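(* Let $b\in\mathbb{R}$ and $c>0$, and let $\mathcal{L}_w$ be the linear operator on the Banach space $L^2(\mathbb{R})\cap C_{\mathrm d}(\mathbb{R})$ defined in the context. Then $\mathcal{L}_w$ is closed on $L^2(\mathbb{R})\cap C_{\mathrm d}(\mathbb{R})$, and its point spectrum consists of the origin $\lambda=0$ and, if $b<2$, of the two bands of $\lambda\in\mathbb{C}$ defined by $0<|\mathrm{Re}(\lambda)|<c(2-b)$. If the eigenfunctions are restricted to lie in the set $A$ defined in the context, then, when $b<1$, the bands of point spectrum are reduced to $0<|\mathrm{Re}(\lambda)|\le c(1-b)$.
   Context: All functions are complex-valued functions of $\xi\in\mathbb{R}$. Let $u_0(\xi)=c\,e^{-|\xi|}$ (the peakon profile of speed $c$), so that $u_0'(\xi)=-c\,\mathrm{sgn}(\xi)e^{-|\xi|}$ for $\xi\neq 0$, and let $\phi(\xi)=e^{-|\xi|}$; $\ast$ denotes convolution on $\mathbb{R}$. $C_{\mathrm d}(\mathbb{R})$ is the set of $v\in L^\infty(\mathbb{R})$ that are bounded and continuous on $\mathbb{R}\setminus\{0\}$ and for which the one-sided limits $v_0^{\pm}=\lim_{\xi\to 0^\pm}v(\xi)$ exist; it carries the $L^\infty$ norm. The space $L^2(\mathbb{R})\cap C_{\mathrm d}(\mathbb{R})$ is a Banach space with norm $\max(\|v\|_{L^2},\|v\|_{L^\infty})$. The operator $\mathcal{L}_w$ is defined for $\xi\neq0$ by $$ \mathcal{L}_w v=\frac{d}{d\xi}\Bigg\{c(3-b)\Bigg(e^{-\xi}\int_{-\infty}^{\min(\xi,0)}e^{2\xi'}v(\xi')\,d\xi'+e^{\xi}\int_{\max(\xi,0)}^{\infty}e^{-2\xi'}v(\xi')\,d\xi'-\frac{e^{-|\xi|}(v_0^++v_0^-)}{2}\Bigg)-\frac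 b2\,\phi\ast(u_0v)+(c-u_0)v\Bigg\}, $$ equivalently $$ \mathcal{L}_w v=c(3-b)\Big(e^{\xi}\int_{\max(\xi,0)}^{\infty}e^{-2\xi'}v(\xi')\,d\xi'-e^{-\xi}\int_{-\infty}^{\min(\xi,0)}e^{2\xi'}v(\xi')\,d\xi'\Big)-\frac b2\,\phi'\ast(u_0v)+c(3-b)\,\mathrm{sgn}(\xi)e^{-|\xi|}\Big(\frac{v_0^++v_0^-}{2}-v\Big)+\big((c-u_0)v\big)'. $$ Its domain is the set of $v\in L^2(\mathbb{R})\cap C_{\mathrm d}(\mathbb{R})$ such that $\mathcal{L}_wv$ (with the derivative $((c-u_0)v)'$ taken in the weak sense on $\mathbb{R}\setminus\{0\}$) belongs to $L^2(\mathbb{R})\cap C_{\mathrm d}(\mathbb{R})$. The point spectrum is the set of $\lambda\in\mathbb{C}$ for which there is a nonzero $v$ in the domain (an eigenfunction) with $\mathcal{L}_wv=\lambda v$. The set $A$ is $$ A=\{u_0'+p_1 \mid p_1\in H^s(\mathbb{R})\ \text{for all } s<3/2\}. $$ *)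

(* Defs.v *)
From mathcomp Require Import all_boot all_order all_algebra.
From mathcomp Require Import complex.
From mathcomp Require Import all_classical all_reals all_analysis.

Set Implicit Arguments.
Unset Strict Implicit.
Unset Printing Implicit Defensive.

Import Order.TTheory GRing.Theory Num.Theory.
Import numFieldNormedType.Exports.

Local Open Scope classical_set_scope.
Local Open Scope ring_scope.
Local Open Scope complex_scope.

(* Functions xi |-> v(xi) are maps [R -> R[i]].  An element of C_d(R) is
   represented by its representative that is continuous off 0; its value at 0
   is irrelevant, and no definition below depends on it.  Since
   [`|z|] has type [R[i]], [cmod z] is the modulus as an element of [R].      *)

Section Complex.
Context {R : realType}.
Notation mu := (@lebesgue_measure R).

Definition cmod (z : R[i]) : R := Normc.normc z.

Definition cintegral (D : set R) (f : R -> R[i]) : R[i] :=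
  (\int[mu]_(x in D) complex.Re (f x)) +i*
  (\int[mu]_(x in D) complex.Im (f x)).

Definition cmeasurable (f : R -> R[i]) : Prop :=
  measurable_fun [set: R] (fun x => complex.Re (f x)) /\
  measurable_fun [set: R] (fun x => complex.Im (f x)).

Definition L2norm (v : R -> R[i]) : \bar R :=
  Lnorm mu 2%:E (fun x => (cmod (v x))%:E).

Definition Linfnorm (v : R -> R[i]) : \bar R :=
  Lnorm mu +oo%E (fun x => (cmod (v x))%:E).

Definition inL2 (v : R -> R[i]) : Prop :=
  cmeasurable v /\ (L2norm v < +oo)%E.

(* [R[i]^o] carries the topology of the complex modulus. *)
Definition inCd (v : R -> R[i]) : Prop :=
  [/\ exists M : R, forall x, x != 0 -> cmod (v x) <= M,
      forall x : R, x != 0 -> {for x, continuous (v : R -> R[i]^o)},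
      cvg ((v x : R[i]^o) @[x --> (0 : R)^'+]) &
      cvg ((v x : R[i]^o) @[x --> (0 : R)^'-])].

Definition limr0 (v : R -> R[i]) : R[i] :=
  lim ((v x : R[i]^o) @[x --> (0 : R)^'+]).
Definition liml0 (v : R -> R[i]) : R[i] :=
  lim ((v x : R[i]^o) @[x --> (0 : R)^'-]).

Definition inX (v : R -> R[i]) : Prop := inL2 v /\ inCd v.

Definition normX (v : R -> R[i]) : \bar R := maxe (L2norm v) (Linfnorm v).

Definition cvgX (v_ : nat -> R -> R[i]) (v : R -> R[i]) : Prop :=
  normX (fun x => v_ n x - v x) @[n --> \oo] --> 0%E.

Definition smooth (psi : R -> R) : Prop :=
  forall n x, derivable (derive1n n psi) x 1.

(* Real-valued test functions suffice here and in [schwartz] below, the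
   identities tested being linear over R[i].                                  *)
Definition test_off0 (psi : R -> R) : Prop :=
  smooth psi /\
  exists a b : R, [/\ 0 < a, a < b &
    forall x, psi x != 0 -> a <= `|x| <= b].

(* [h] is the weak derivative of [g] on R \ {0}, for [g] and [h] locally
   integrable there.                                                          *)
Definition weak_derivative_off0 (g h : R -> R[i]) : Prop :=
  forall psi, test_off0 psi ->
    cintegral setT (fun x => g x * (derive1 psi x)%:C) =
    - cintegral setT (fun x => h x * (psi x)%:C).

Definition convolution (f g : R -> R[i]) (xi : R) : R[i] :=
  cintegral setT (fun y => f (xi - y) * g y).

Definition u0 (c xi : R) : R := c * expR (- `|xi|).
Definition du0 (c xi : R) : R := - c * Num.sg xi * expR (- `|xi|).
Definition dphi (xi : R) : R := - Num.sg xi * expR (- `|xi|).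

(* L_w v without its last term ((c - u_0) v)'. *)
Definition Lw_nonlocal (b c : R) (v : R -> R[i]) (xi : R) : R[i] :=
  (c * (3 - b))%:C *
    ((expR xi)%:C * cintegral `[Num.max xi 0, +oo[
        (fun x => (expR (- 2 * x))%:C * v x)
     - (expR (- xi))%:C * cintegral `]-oo, Num.min xi 0]
        (fun x => (expR (2 * x))%:C * v x))
  - (b / 2)%:C *
    convolution (fun x => (dphi x)%:C) (fun x => (u0 c x)%:C * v x) xi
  + (c * (3 - b) * Num.sg xi * expR (- `|xi|))%:C *
    ((limr0 v + liml0 v) / 2 - v xi).

(* The graph of L_w: v is in the domain and L_w v = f in X.  The last condition
   is ((c - u_0) v)' = f - Lw_nonlocal v, whose right-hand side is bounded.   *)
Definition Lw_graph (b c : R) (v f : R -> R[i]) : Prop :=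
  [/\ inX v, inX f &
      weak_derivative_off0 (fun x => (c - u0 c x)%:C * v x)
                           (fun x => f x - Lw_nonlocal b c v x)].

Definition closed_graph (G : (R -> R[i]) -> (R -> R[i]) -> Prop) : Prop :=
  forall (v_ f_ : nat -> R -> R[i]) (v f : R -> R[i]),
    (forall n, G (v_ n) (f_ n)) -> inX v -> inX f ->
    cvgX v_ v -> cvgX f_ f -> G v f.

Definition Lw_eigenfunction (b c : R) (lambda : R[i]) (v : R -> R[i]) : Prop :=
  Lw_graph b c v (fun x => lambda * v x) /\ ~ {ae mu, forall x, v x = 0}.

Definition Lw_point_spectrum (b c : R) : set R[i] :=
  [set lambda | exists v, Lw_eigenfunction b c lambda v].

Definition schwartz (psi : R -> R) : Prop :=
  smooth psi /\
  forall m n : nat, exists M : R, forall x, `|x| ^+ m * `|derive1n n psi x| <= M.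

Definition fourier (psi : R -> R) (k : R) : R[i] :=
  cintegral setT (fun x => (psi x)%:C * (cos (k * x) -i* sin (k * x))).

(* [g] is the Fourier transform of [p] in the sense of tempered distributions. *)
Definition is_fourier_transform (p g : R -> R[i]) : Prop :=
  forall psi, schwartz psi ->
    cintegral setT (fun x => p x * fourier psi x) =
    cintegral setT (fun k => g k * (psi k)%:C).

(* H^s(R) for s >= 0, where H^s is contained in L^2; for s < 0 this is the
   intersection of H^s with L^2, that is, L^2.                                *)
Definition inHs (s : R) (p : R -> R[i]) : Prop :=
  inL2 p /\
  exists g : R -> R[i], [/\ cmeasurable g,
    is_fourier_transform p g &
    (\int[mu]_k ((1 + k ^+ 2) `^ s * cmod (g k) ^+ 2)%:E < +oo)%E].

Definition setA (c : R) : set (R -> R[i]) :=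
  [set v | exists p1 : R -> R[i],
     (forall s : R, s < 3 / 2 -> inHs s p1) /\
     {ae mu, forall x, v x = (du0 c x)%:C + p1 x}].

Definition Lw_point_spectrum_in_A (b c : R) : set R[i] :=
  [set lambda | exists v, Lw_eigenfunction b c lambda v /\ setA c v].

End Complex.

(* Main.v *)
(* Write [lambda = c la].  On [xi > 0] the eigenvalue equation becomes a first-order equation for [v]
   whose nonlocal terms are integrals of [v] over [xi, oo) and (0, xi) and a constant coming from
   [xi < 0]; the reflection [xi -> - xi] exchanges the half-lines and [la] with [- la].
   Differentiating twice, the momentum [v - v''] satisfies a homogeneous first-order equation, so it
   is a multiple [M] of [(e^xi - 1)^la (1 - e^{-xi})^{-b}].  Decay at infinity forces [M = 0] if
   [Re la >= 0], and boundedness at the origin forces it if [Re la <= b - 2].  When [M] vanishes on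
   both sides, [v] is a multiple of [e^{-|xi|}] on each half-line and the equation at the origin
   gives [v = 0] unless [la = 0].  In the band, one takes [M = 0] on one side, solves
   [v - v'' = M m] on the other, and adjusts the two multiples of [e^{-|xi|}].
   An eigenfunction in [A] is Hölder continuous of every exponent below 1 up to the origin on each
   side (test its Fourier transform with Gaussians), which forces [M = 0] already for
   [Re la < b - 1].  Conversely, if [Re la + b <= 1], the constructed eigenfunction has a jump at the
   origin proportional to a Beta integral, which does not vanish; rescaled to have the jump of [u0'],
   it differs from [u0'] by a continuous function whose second derivative is
   [O(|xi|^(-1 - eta))] for every [eta > 0], so that its Fourier transform is [O(|k|^(-2 + eta))].
   Finally, the graph is closed because convergence in X is uniform off 0, which passes to the limit
   in the weak formulation. *)

Require Import Defs.
From mathcomp Require Import all_boot all_order all_algebra.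
From mathcomp Require Import complex.
From mathcomp Require Import all_classical all_reals all_analysis measurable_realfun.
From mathcomp Require Import ring lra.

Set Implicit Arguments.
Unset Strict Implicit.
Unset Printing Implicit Defensive.

Import Order.TTheory GRing.Theory Num.Theory.
Import numFieldNormedType.Exports.

Local Open Scope classical_set_scope.
Local Open Scope ring_scope.
Local Open Scope complex_scope.

Local Notation Re := complex.Re.
Local Notation Im := complex.Im.

(** * Complex-valued functions of a real variable *)

(** For $\xi>0$ the left half-line enters the operator only through scalars, gathered in the
    constant [k] of [half_ode]. The eigenvalue problem is thus two copies of one half-line problem,
    with parameters [la] and [- la], coupled by two scalar conditions at the origin. Since $c-u_0$
    vanishes at 0, the equation is singular there, and L'Hôpital's rule extracts these conditions
    from the mere existence of the one-sided limits. An eigenfunction is a priori only continuous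
    off 0 and solves its equation weakly: du Bois-Reymond's lemma makes it differentiable, and
    square integrability yields decay through Barbalat's lemma. In the construction all bounds use
    the weights [epow s p], which record at once the decay $e^{-sx}$ at infinity and the power $x^p$
    at the origin. An arbitrarily small loss [eta] is allowed in the power, so that the borderline
    case $\mathrm{Re}\,\lambda+b=1$, where $m$ has size $1/x$ at the origin and a logarithm could
    appear in $v'$, needs no separate treatment; this is why the closed end of the reduced band is
    reached. *)

Arguments cmod : simpl never.
Arguments cintegral : simpl never.

Section ComplexModulus.
Context {R : realType}.
Implicit Types z w : R[i].

Lemma cmodE z : cmod z = Num.sqrt (Re z ^+ 2 + Im z ^+ 2).
Proof. by case: z. Qed.

Lemma cmod_ge0 z : 0 <= cmod z.
Proof. by rewrite cmodE sqrtr_ge0. Qed.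

Lemma cmod_sqr z : cmod z ^+ 2 = Re z ^+ 2 + Im z ^+ 2.
Proof. by rewrite cmodE sqr_sqrtr // addr_ge0 // sqr_ge0. Qed.

Lemma cmodM z w : cmod (z * w) = cmod z * cmod w.
Proof. exact: Normc.normcM. Qed.

Lemma cmodD z w : cmod (z + w) <= cmod z + cmod w.
Proof. exact: le_normcD. Qed.

Lemma cmodN z : cmod (- z) = cmod z.
Proof. exact: normcN. Qed.

Lemma cmodB z w : cmod (z - w) <= cmod z + cmod w.
Proof. by rewrite -(cmodN w) cmodD. Qed.

Lemma cmodV z : cmod z^-1 = (cmod z)^-1.
Proof. exact: Normc.normcV. Qed.

Lemma cmod_real (x : R) : cmod x%:C = `|x|.
Proof. by rewrite cmodE /= expr0n addr0 sqrtr_sqr. Qed.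

Lemma cmod0 : cmod (0 : R[i]) = 0.
Proof. by rewrite -[0]/((0 : R)%:C) cmod_real normr0. Qed.

Lemma cmod_eq0 z : cmod z = 0 -> z = 0.
Proof. exact: Normc.eq0_normc. Qed.

Lemma cmod_gt0 z : z != 0 -> 0 < cmod z.
Proof.
move=> z0; rewrite lt_neqAle cmod_ge0 andbT eq_sym.
by apply: contra z0 => /eqP /cmod_eq0 ->.
Qed.

Lemma Re_le_cmod z : `|Re z| <= cmod z.
Proof. by rewrite cmodE -sqrtr_sqr ler_wsqrtr // lerDl sqr_ge0. Qed.

Lemma Im_le_cmod z : `|Im z| <= cmod z.
Proof. by rewrite cmodE -sqrtr_sqr ler_wsqrtr // lerDr sqr_ge0. Qed.

Lemma cmod_le_ReIm z : cmod z <= `|Re z| + `|Im z|.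
Proof.
rewrite -(ler_pXn2r (n := 2)) ?nnegrE ?cmod_ge0 ?addr_ge0 //.
rewrite cmod_sqr sqrrD !real_normK ?num_real //.
by rewrite lerD2r lerDl mulrn_wge0 // mulr_ge0.
Qed.

Lemma cReD z w : Re (z + w) = Re z + Re w. Proof. by case: z; case: w. Qed.
Lemma cImD z w : Im (z + w) = Im z + Im w. Proof. by case: z; case: w. Qed.
Lemma cReN z : Re (- z) = - Re z. Proof. by case: z. Qed.
Lemma cImN z : Im (- z) = - Im z. Proof. by case: z. Qed.
Lemma cReM z w : Re (z * w) = Re z * Re w - Im z * Im w.
Proof. by case: z; case: w. Qed.
Lemma cImM z w : Im (z * w) = Re z * Im w + Im z * Re w.
Proof. by case: z; case: w. Qed.
Lemma complexP z w : Re z = Re w -> Im z = Im w -> z = w.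
Proof. by case: z => a b; case: w => c d /= -> ->. Qed.

Definition ReImE := (cReD, cImD, cReN, cImN, cReM, cImM).

Lemma realc0 : (0 : R)%:C = 0 :> R[i]. Proof. by []. Qed.

Lemma realcV (x : R) : (x^-1)%:C = (x%:C)^-1 :> R[i].
Proof. exact: fmorphV. Qed.

Definition realcE := (rmorphD (real_complex R), rmorphB (real_complex R),
  rmorphN (real_complex R), rmorphM (real_complex R), rmorph1 (real_complex R),
  rmorph0 (real_complex R), rmorph_nat (real_complex R)).

End ComplexModulus.

(** * Limits of complex-valued functions *)

Section ComplexLimits.
Context {R : realType}.
Implicit Types (f g : R -> R[i]) (l : R[i]).

(** Limits are taken on the two parts so that real-variable results apply to each; [ccvgP]
    identifies this with the topology of the modulus, the one used in [inCd]. *)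
Definition ccvg (T : Type) (F : set_system T) (f : T -> R[i]) (l : R[i]) : Prop :=
  (Re (f x) @[x --> F] --> Re l) /\ (Im (f x) @[x --> F] --> Im l).

Lemma ccvgP (T : Type) (F : set_system T) {FF : Filter F} (f : T -> R[i]) l :
  (f : T -> R[i]^o) @ F --> (l : R[i]^o) <-> ccvg F f l.
Proof.
split.
- move=> /cvgrPdist_lt H.
  have K : forall e : R, 0 < e -> \forall t \near F, cmod (l - f t) < e.
    move=> e e0.
    have e0' : (0 : R[i]) < e%:C by rewrite ltcR.
    move: (H e%:C e0'); apply: filterS => t.
    by rewrite normc_def -cmodE ltcR.
  split; apply/cvgrPdist_lt => e e0; move: (K e e0); apply: filterS => t.
  + by apply: le_lt_trans; rewrite -cReN -cReD Re_le_cmod.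
  + by apply: le_lt_trans; rewrite -cImN -cImD Im_le_cmod.
- move=> [/cvgrPdist_lt H1 /cvgrPdist_lt H2]; apply/cvgrPdist_lt => e e0.
  have [e1 he] : exists e1 : R, e = e1%:C.
    by apply/complex_realP; exact: gtr0_real.
  move: e0; rewrite he ltcR => e10.
  have e20 : 0 < e1 / 2 by rewrite divr_gt0.
  near=> t; rewrite normc_def -cmodE ltcR.
  apply: (le_lt_trans (cmod_le_ReIm _)).
  rewrite (splitr e1) !ReImE ltrD //; near: t; [exact: H1|exact: H2].
Unshelve. all: by end_near.
Qed.

Lemma ccvg_cst (T : Type) (F : set_system T) {FF : Filter F} l :
  ccvg F (fun=> l) l.
Proof. by split; exact: cvg_cst. Qed.

Lemma ccvg_real (T : Type) (F : set_system T) {FF : Filter F} (f : T -> R) (l : R) :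
  f x @[x --> F] --> l -> ccvg F (fun x => (f x)%:C) l%:C.
Proof. by move=> h; split => //=; exact: cvg_cst. Qed.

Lemma ccvgD (T : Type) (F : set_system T) {FF : Filter F} (f g : T -> R[i]) k l :
  ccvg F f k -> ccvg F g l -> ccvg F (fun x => f x + g x) (k + l).
Proof.
move=> [f1 f2] [g1 g2]; split; rewrite !ReImE.
- by under eq_fun do rewrite cReD; exact: cvgD.
- by under eq_fun do rewrite cImD; exact: cvgD.
Qed.

Lemma ccvgN (T : Type) (F : set_system T) {FF : Filter F} (f : T -> R[i]) k :
  ccvg F f k -> ccvg F (fun x => - f x) (- k).
Proof.
move=> [f1 f2]; split; rewrite !ReImE.
- by under eq_fun do rewrite cReN; exact: cvgN.
- by under eq_fun do rewrite cImN; exact: cvgN.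
Qed.

Lemma ccvgB (T : Type) (F : set_system T) {FF : Filter F} (f g : T -> R[i]) k l :
  ccvg F f k -> ccvg F g l -> ccvg F (fun x => f x - g x) (k - l).
Proof. by move=> hf hg; apply: ccvgD => //; exact: ccvgN. Qed.

Lemma ccvgM (T : Type) (F : set_system T) {FF : Filter F} (f g : T -> R[i]) k l :
  ccvg F f k -> ccvg F g l -> ccvg F (fun x => f x * g x) (k * l).
Proof.
move=> [f1 f2] [g1 g2]; split; rewrite !ReImE.
- by under eq_fun do rewrite cReM; apply: cvgB; exact: cvgM.
- by under eq_fun do rewrite cImM; apply: cvgD; exact: cvgM.
Qed.

Lemma ccvg_eq (T : Type) (F : set_system T) (f : T -> R[i]) k l :
  ccvg F f k -> k = l -> ccvg F f l.
Proof. by move=> ? <-. Qed.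

Lemma ccvg_near (T : Type) (F : set_system T) {FF : Filter F} (f g : T -> R[i]) l :
  (\forall x \near F, g x = f x) -> ccvg F f l -> ccvg F g l.
Proof.
move=> h [f1 f2]; split; [apply: cvg_trans f1|apply: cvg_trans f2];
  apply: near_eq_cvg; move: h; apply: filterS => x ->; done.
Qed.

Lemma ccvg_cmodP (T : Type) (F : set_system T) {FF : Filter F} (f : T -> R[i]) l :
  ccvg F f l <-> cmod (f x - l) @[x --> F] --> (0 : R).
Proof.
split.
- move=> [f1 f2].
  have h : `|Re (f x) - Re l| + `|Im (f x) - Im l| @[x --> F] --> (0 : R).
    rewrite -[X in _ --> X]addr0; apply: cvgD; rewrite -(@normr0 _ R);
    apply: cvg_norm; [rewrite -(subrr (Re l))|rewrite -(subrr (Im l))];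
    apply: cvgB => //; exact: cvg_cst.
  apply: squeeze_cvgr h; last exact: (cvg_cst (0 : R)).
  apply: nearW => x; rewrite cmod_ge0 /=.
  by apply: (le_trans (cmod_le_ReIm _)); rewrite !ReImE.
- move=> h.
  split; apply/cvgrPdist_lt => e e0; move/cvgr0Pnorm_lt: h => /(_ e e0);
  apply: filterS => x; rewrite (ger0_norm (cmod_ge0 _)); apply: le_lt_trans.
  + by rewrite distrC -cReN -cReD Re_le_cmod.
  + by rewrite distrC -cImN -cImD Im_le_cmod.
Qed.

Lemma ccvg_cmod (T : Type) (F : set_system T) {FF : Filter F} (f : T -> R[i]) l :
  ccvg F f l -> cmod (f x) @[x --> F] --> cmod l.
Proof.
move=> [f1 f2]; under eq_fun do rewrite cmodE; rewrite cmodE.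
apply: continuous_cvg; first exact: sqrt_continuous.
by apply: cvgD; apply: cvgM.
Qed.

Lemma ccvg0_cmod (T : Type) (F : set_system T) {FF : Filter F} (f : T -> R[i]) :
  ccvg F f 0 -> cmod (f x) @[x --> F] --> (0 : R).
Proof. by move/ccvg_cmod; rewrite cmod0. Qed.

Lemma ccvg_unique (T : Type) (F : set_system T) {FF : ProperFilter F}
  (f : T -> R[i]) k l : ccvg F f k -> ccvg F f l -> k = l.
Proof.
move=> [f1 f2] [g1 g2]; apply: complexP.
- exact: (cvg_unique _ f1 g1).
- exact: (cvg_unique _ f2 g2).
Qed.

Definition ccont f (x : R) := ccvg (nbhs x) f (f x).

End ComplexLimits.

(** * Derivatives with respect to a real variable *)

Section ComplexDerivative.
Context {R : realType}.
Implicit Types (f g : R -> R[i]) (k l : R[i]) (x : R).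

(** The variable is real, so the derivative is taken on the two parts, to which the mean value
    theorem and the fundamental theorem of calculus apply. *)
Definition cderiv f x l : Prop :=
  is_derive x (1 : R) (fun y => Re (f y)) (Re l) /\
  is_derive x (1 : R) (fun y => Im (f y)) (Im l).

Lemma cderiv_eq f x k l : cderiv f x k -> k = l -> cderiv f x l.
Proof. by move=> ? <-. Qed.

Lemma cderiv_cst k x : cderiv (fun=> k) x 0.
Proof. by split; exact: is_derive_cst. Qed.

Lemma cderiv_real (f : R -> R) x (l : R) :
  is_derive x (1 : R) f l -> cderiv (fun y => (f y)%:C) x l%:C.
Proof. by move=> h; split => //=; exact: is_derive_cst. Qed.

Lemma cderivD f g x k l :
  cderiv f x k -> cderiv g x l -> cderiv (fun y => f y + g y) x (k + l).
Proof.
move=> [f1 f2] [g1 g2]; split; rewrite !ReImE.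
- by under eq_fun do rewrite cReD; exact: is_deriveD.
- by under eq_fun do rewrite cImD; exact: is_deriveD.
Qed.

Lemma cderivN f x k : cderiv f x k -> cderiv (fun y => - f y) x (- k).
Proof.
move=> [f1 f2]; split; rewrite !ReImE.
- by under eq_fun do rewrite cReN; exact: is_deriveN.
- by under eq_fun do rewrite cImN; exact: is_deriveN.
Qed.

Lemma cderivB f g x k l :
  cderiv f x k -> cderiv g x l -> cderiv (fun y => f y - g y) x (k - l).
Proof. by move=> hf hg; apply: cderivD => //; exact: cderivN. Qed.

Lemma cderivM f g x k l :
  cderiv f x k -> cderiv g x l ->
  cderiv (fun y => f y * g y) x (k * g x + f x * l).
Proof.
move=> [f1 f2] [g1 g2]; split; rewrite !ReImE.
- under eq_fun do rewrite cReM.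
  apply: is_derive_eq; rewrite /GRing.scale /=; ring.
- under eq_fun do rewrite cImM.
  apply: is_derive_eq; rewrite /GRing.scale /=; ring.
Qed.

Lemma cderivZ k f x l : cderiv f x l -> cderiv (fun y => k * f y) x (k * l).
Proof.
move=> h; apply: cderiv_eq (cderivM (cderiv_cst k x) h) _.
by rewrite mul0r add0r.
Qed.

Lemma cderiv_near f g x l :
  (\forall y \near x, f y = g y) -> cderiv f x l -> cderiv g x l.
Proof.
move=> h [f1 f2]; split.
- apply: near_eq_is_derive f1.
  by move: h; apply: filterS => y ->.
- apply: near_eq_is_derive f2.
  by move: h; apply: filterS => y ->.
Qed.

Lemma cderiv_cont f x l : cderiv f x l -> ccont f x.
Proof.
move=> [[f1 _] [f2 _]]; split.
- by apply: differentiable_continuous; exact/derivable1_diffP.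
- by apply: differentiable_continuous; exact/derivable1_diffP.
Qed.

Lemma cderiv_unique f x k l : cderiv f x k -> cderiv f x l -> k = l.
Proof.
move=> [f1 f2] [g1 g2]; apply: complexP.
- by rewrite -(@derive_val _ _ _ _ _ _ _ f1) -(@derive_val _ _ _ _ _ _ _ g1).
- by rewrite -(@derive_val _ _ _ _ _ _ _ f2) -(@derive_val _ _ _ _ _ _ _ g2).
Qed.

Lemma is_derive_comp_opp (f : R -> R) x (l : R) :
  is_derive (- x) (1 : R) f l -> is_derive x (1 : R) (fun y => f (- y)) (- l).
Proof.
move=> h; have h' : is_derive (- x : R) (1 : R) f l by [].
have := @is_derive1_comp _ f (fun y : R => - y) x l (-1) h'.
rewrite mulrN1; exact.
Qed.

Lemma cderiv_comp_opp f x l :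
  cderiv f (- x) l -> cderiv (fun y => f (- y)) x (- l).
Proof. by move=> [f1 f2]; split; rewrite !ReImE; exact: is_derive_comp_opp. Qed.

Lemma is_derive0_cst_itv (f : R -> R) a b :
  (forall x, a < x < b -> is_derive x (1 : R) f 0) ->
  forall x y, a < x < b -> a < y < b -> f x = f y.
Proof.
move=> h.
suff H x y : a < x < b -> a < y < b -> x < y -> f x = f y.
  move=> x y hx hy; have [xy|xy|->//] := ltgtP x y; first exact: H.
  by symmetry; exact: H.
move=> /andP[ax xb] /andP[ay yb] xy.
have hd z : z \in `]x, y[ -> is_derive z (1 : R) f ((fun=> 0) z).
  by rewrite in_itv /= => /andP[xz zy]; apply: h; apply/andP; split; lra.
have [|c _ ] := @MVT _ f (fun=> 0) x y xy hd.
  apply: derivable_within_continuous => z; rewrite in_itv /= => /andP[xz zy].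
  by have [] : is_derive z (1 : R) f 0 by apply: h; apply/andP; split; lra.
by rewrite mul0r => /eqP; rewrite subr_eq0 => /eqP.
Qed.

Lemma cderiv0_cst f a :
  (forall x, a < x -> cderiv f x 0) -> forall x y, a < x -> a < y -> f x = f y.
Proof.
move=> h x y ax ay.
(* This bound exceeds both points because [x - a] and [y - a] are positive. *)
pose b := x + y - a + 1.
have hx : a < x < b by rewrite /b; apply/andP; split; lra.
have hy : a < y < b by rewrite /b; apply/andP; split; lra.
by apply: complexP;
  [apply: (@is_derive0_cst_itv (fun z => Re (f z)) a b)
  |apply: (@is_derive0_cst_itv (fun z => Im (f z)) a b)] => // z /andP[az _];
  have [] := h _ az.
Qed.

End ComplexDerivative.

(** * Integration of complex-valued functions *)

Section ComplexIntegral.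
Context {R : realType}.
Notation mu := (@lebesgue_measure R).
Implicit Types (f g : R -> R[i]) (D : set R).

Definition cmeas D f : Prop :=
  measurable_fun D (fun x => Re (f x)) /\ measurable_fun D (fun x => Im (f x)).

Definition cintegrable D f : Prop :=
  mu.-integrable D (EFin \o (fun x => Re (f x))) /\
  mu.-integrable D (EFin \o (fun x => Im (f x))).

Lemma cmeasS D E f : measurable E -> D `<=` E -> cmeas E f -> cmeas D f.
Proof. by move=> mE DE [f1 f2]; split; [exact: measurable_funS f1|exact: measurable_funS f2]. Qed.

Lemma cmeas_real D (f : R -> R) : measurable_fun D f -> cmeas D (fun x => (f x)%:C).
Proof. by move=> mf; split => //=; exact: measurable_cst. Qed.

Lemma cmeasM D f g : cmeas D f -> cmeas D g -> cmeas D (fun x => f x * g x).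
Proof.
move=> [f1 f2] [g1 g2]; split.
- under eq_fun do rewrite cReM; apply: measurable_funB; exact: measurable_funM.
- under eq_fun do rewrite cImM; apply: measurable_funD; exact: measurable_funM.
Qed.

Lemma cmeasD D f g : cmeas D f -> cmeas D g -> cmeas D (fun x => f x + g x).
Proof.
move=> [f1 f2] [g1 g2]; split.
- by under eq_fun do rewrite cReD; exact: measurable_funD.
- by under eq_fun do rewrite cImD; exact: measurable_funD.
Qed.

Lemma cmeas_cst D (k : R[i]) : cmeas D (fun=> k).
Proof. by split; exact: measurable_cst. Qed.

Lemma cmeasN D f : cmeas D f -> cmeas D (fun x => - f x).
Proof.
move=> h; have -> : (fun x => - f x) = (fun x => (-1) * f x).
  by apply/funext => x; rewrite mulN1r.
by apply: cmeasM => //; exact: cmeas_cst.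
Qed.

Lemma cmeasB D f g : cmeas D f -> cmeas D g -> cmeas D (fun x => f x - g x).
Proof. by move=> hf hg; apply: cmeasD => //; exact: cmeasN. Qed.

Lemma cmeas_cmod D f : measurable D -> cmeas D f -> measurable_fun D (fun x => cmod (f x)).
Proof.
move=> mD [f1 f2]; under eq_fun do rewrite cmodE.
apply: (@measurableT_comp _ _ _ _ _ _ (@Num.sqrt R)).
  by apply: continuous_measurable_fun; exact: sqrt_continuous.
by apply: measurable_funD; exact: measurable_funX.
Qed.

Lemma ccont_cmeas (D : set R) f : open D -> {in D, forall x, ccont f x} -> cmeas D f.
Proof.
move=> oD h; split; apply: open_continuous_measurable_fun => // x xD; by have [] := h x xD.
Qed.

Lemma cintegrable_cmeas D f : cintegrable D f -> cmeas D f.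
Proof.
by move=> [/integrableP[/measurable_EFinP m1 _] /integrableP[/measurable_EFinP m2 _]].
Qed.

Lemma cintegrable_dom D f (G : R -> R) : measurable D -> cmeas D f ->
  mu.-integrable D (EFin \o G) -> (forall x, D x -> cmod (f x) <= G x) ->
  cintegrable D f.
Proof.
move=> mD [m1 m2] iG h; split.
- apply: le_integrable iG => //; first exact/measurable_EFinP.
  move=> x Dx /=; rewrite lee_fin (le_trans (Re_le_cmod _)) //.
  by rewrite (le_trans (h _ Dx)) // ler_norm.
- apply: le_integrable iG => //; first exact/measurable_EFinP.
  move=> x Dx /=; rewrite lee_fin (le_trans (Im_le_cmod _)) //.
  by rewrite (le_trans (h _ Dx)) // ler_norm.
Qed.

Lemma cintegrable_cmod D f : measurable D -> cintegrable D f ->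
  mu.-integrable D (EFin \o (fun x => cmod (f x))).
Proof.
move=> mD hf; have [h1 h2] := hf; have m := cintegrable_cmeas hf.
have h : mu.-integrable D (EFin \o (fun x => `|Re (f x)| + `|Im (f x)|)).
  have -> : (EFin \o (fun x => `|Re (f x)| + `|Im (f x)|)) =
    (fun x => (abse ((EFin \o (fun x => Re (f x))) x) + abse ((EFin \o (fun x => Im (f x))) x))%E) by [].
  by apply: integrableD => //; exact: integrable_abse.
apply: le_integrable h => //; first by apply/measurable_EFinP; exact: cmeas_cmod.
move=> x Dx /=; rewrite lee_fin ger0_norm ?cmod_ge0 //.
by rewrite ger0_norm ?cmod_le_ReIm // addr_ge0.
Qed.

Lemma cintegrableS D E f : measurable E -> measurable D -> D `<=` E ->
  cintegrable E f -> cintegrable D f.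
Proof. by move=> mE mD DE [h1 h2]; split; [exact: integrableS h1|exact: integrableS h2]. Qed.

Lemma cintegrableD D f g : measurable D -> cintegrable D f -> cintegrable D g ->
  cintegrable D (fun x => f x + g x).
Proof.
move=> mD [f1 f2] [g1 g2]; split.
- have -> : EFin \o (fun x => Re (f x + g x)) =
    (EFin \o (fun x => Re (f x))) \+ (EFin \o (fun x => Re (g x))).
    by apply/funext => x /=; rewrite cReD.
  exact: integrableD.
- have -> : EFin \o (fun x => Im (f x + g x)) =
    (EFin \o (fun x => Im (f x))) \+ (EFin \o (fun x => Im (g x))).
    by apply/funext => x /=; rewrite cImD.
  exact: integrableD.
Qed.

Lemma cintegrableZ D f (k : R[i]) : measurable D -> cintegrable D f ->
  cintegrable D (fun x => k * f x).
Proof.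
move=> mD hf; have m := cintegrable_cmeas hf.
have iG : mu.-integrable D (EFin \o (fun x => cmod k * cmod (f x))).
  have -> : (EFin \o (fun x => cmod k * cmod (f x))) =
    (fun x => ((cmod k)%:E * ((EFin \o (fun x => cmod (f x))) x))%E) by [].
  by apply: integrableZl => //; exact: cintegrable_cmod.
apply: cintegrable_dom iG _ => //; first by apply: cmeasM => //; exact: cmeas_cst.
by move=> x _; rewrite cmodM.
Qed.

Lemma cintegrableN D f : measurable D -> cintegrable D f ->
  cintegrable D (fun x => - f x).
Proof.
move=> mD h; have -> : (fun x => - f x) = (fun x => (-1) * f x).
  by apply/funext => x; rewrite mulN1r.
exact: cintegrableZ.
Qed.

Lemma cintegrableB D f g : measurable D -> cintegrable D f -> cintegrable D g ->
  cintegrable D (fun x => f x - g x).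
Proof. by move=> mD hf hg; apply: cintegrableD => //; exact: cintegrableN. Qed.

Lemma cintegrable_real D (f : R -> R) : mu.-integrable D (EFin \o f) ->
  measurable D -> cintegrable D (fun x => (f x)%:C).
Proof. by move=> h mD; split => //=; exact: integrable0. Qed.

Lemma eq_cintegrable D f g : measurable D -> {in D, f =1 g} ->
  cintegrable D f -> cintegrable D g.
Proof.
move=> mD fg [h1 h2]; split.
- by apply: eq_integrable h1 => // x xD /=; rewrite fg.
- by apply: eq_integrable h2 => // x xD /=; rewrite fg.
Qed.

Lemma eq_cintegral D f g : {in D, f =1 g} -> cintegral D f = cintegral D g.
Proof.
by move=> fg; rewrite /cintegral; congr (_ +i* _); apply: eq_Rintegral => x xD; rewrite fg.
Qed.

Lemma cintegralD D f g : measurable D -> cintegrable D f -> cintegrable D g ->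
  cintegral D (fun x => f x + g x) = cintegral D f + cintegral D g.
Proof.
move=> mD [f1 f2] [g1 g2]; apply: complexP; rewrite !ReImE /=.
- by under eq_Rintegral do rewrite cReD; rewrite RintegralD.
- by under eq_Rintegral do rewrite cImD; rewrite RintegralD.
Qed.

Lemma cintegralZ D f (k : R[i]) : measurable D -> cintegrable D f ->
  cintegral D (fun x => k * f x) = k * cintegral D f.
Proof.
move=> mD [f1 f2]; apply: complexP; rewrite !ReImE /=.
- under eq_Rintegral do rewrite cReM.
  rewrite RintegralB ?RintegralZl //.
  + have -> : (EFin \o (fun x => Re k * Re (f x))) =
     (fun x => ((Re k)%:E * ((EFin \o (fun x => Re (f x))) x))%E) by [].
    exact: integrableZl.
  + have -> : (EFin \o (fun x => Im k * Im (f x))) =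
     (fun x => ((Im k)%:E * ((EFin \o (fun x => Im (f x))) x))%E) by [].
    exact: integrableZl.
- under eq_Rintegral do rewrite cImM.
  rewrite RintegralD ?RintegralZl //.
  + have -> : (EFin \o (fun x => Re k * Im (f x))) =
     (fun x => ((Re k)%:E * ((EFin \o (fun x => Im (f x))) x))%E) by [].
    exact: integrableZl.
  + have -> : (EFin \o (fun x => Im k * Re (f x))) =
     (fun x => ((Im k)%:E * ((EFin \o (fun x => Re (f x))) x))%E) by [].
    exact: integrableZl.
Qed.

Lemma cintegralNf D f : measurable D -> cintegrable D f ->
  cintegral D (fun x => - f x) = - cintegral D f.
Proof.
move=> mD h; have -> : (fun x => - f x) = (fun x => (-1) * f x).
  by apply/funext => x; rewrite mulN1r.
by rewrite cintegralZ // mulN1r.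
Qed.

Lemma cintegralB D f g : measurable D -> cintegrable D f -> cintegrable D g ->
  cintegral D (fun x => f x - g x) = cintegral D f - cintegral D g.
Proof.
by move=> mD hf hg; rewrite cintegralD ?cintegralNf //; exact: cintegrableN.
Qed.

(** The factor 2 comes from estimating the real and imaginary parts separately. *)
Lemma cmod_cintegral_le D f (G : R -> R) : measurable D -> cmeas D f ->
  mu.-integrable D (EFin \o G) -> (forall x, D x -> cmod (f x) <= G x) ->
  cmod (cintegral D f) <= 2 * \int[mu]_(x in D) G x.
Proof.
move=> mD m iG h; have hf := cintegrable_dom mD m iG h.
have [f1 f2] := hf.
apply: (le_trans (cmod_le_ReIm _)); rewrite mulrDl mul1r /=.
apply: lerD.
- apply: (le_trans (le_normr_Rintegral _ _)) => //; apply: le_Rintegral => //.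
  + exact: integrable_norm.
  + by move=> x Dx; rewrite (le_trans (Re_le_cmod _)) // h.
- apply: (le_trans (le_normr_Rintegral _ _)) => //; apply: le_Rintegral => //.
  + exact: integrable_norm.
  + by move=> x Dx; rewrite (le_trans (Im_le_cmod _)) // h.
Qed.

Lemma cintegral_setU D E f : measurable D -> measurable E -> [disjoint D & E] ->
  cintegrable (D `|` E) f ->
  cintegral (D `|` E) f = cintegral D f + cintegral E f.
Proof.
move=> mD mE DE [f1 f2]; apply: complexP; rewrite !ReImE /= Rintegral_setU //.
Qed.

Lemma cintegral_itvB f (a b : itv_bound R) x :
  cintegrable [set` Interval a b] f -> (a <= BRight x)%O -> (BRight x <= b)%O ->
  cintegral [set` Interval a b] f - cintegral [set` Interval a (BRight x)] f =
  cintegral [set` Interval (BRight x) b] f.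
Proof. by move=> [f1 f2] ax xb; apply: complexP; rewrite !ReImE /= Rintegral_itvB. Qed.

Lemma cintegral_obnd_cbnd (r : R) (b : itv_bound R) f :
  cintegrable [set` Interval (BRight r) b] f ->
  cintegral [set` Interval (BRight r) b] f = cintegral [set` Interval (BLeft r) b] f.
Proof. by move=> [f1 f2]; apply: complexP; rewrite /= Rintegral_itv_obnd_cbnd. Qed.

Lemma cintegral_bndo_bndc (a : itv_bound R) (r : R) f :
  cintegrable [set` Interval a (BLeft r)] f ->
  cintegral [set` Interval a (BLeft r)] f = cintegral [set` Interval a (BRight r)] f.
Proof. by move=> [f1 f2]; apply: complexP; rewrite /= Rintegral_itv_bndo_bndc. Qed.

Lemma cderiv_cintegral (a : itv_bound R) (u x : R) f : x < u ->
  cintegrable [set` Interval a (BRight u)] f -> (a < BRight x)%E -> ccont f x ->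
  cderiv (fun y => cintegral [set` Interval a (BRight y)] f) x (f x).
Proof.
move=> xu [f1 f2] ax [c1 c2]; split => /=.
- have [d1 d2] := continuous_FTC1 xu f1 ax c1.
  exact: (DeriveDef d1 (etrans (esym (derive1E _ _)) d2)).
- have [d1 d2] := continuous_FTC1 xu f2 ax c2.
  exact: (DeriveDef d1 (etrans (esym (derive1E _ _)) d2)).
Qed.

Lemma cintegral_tail a x f : a < x -> cintegrable `[a, +oo[ f ->
  cintegral `[x, +oo[ f = cintegral `[a, +oo[ f - cintegral `[a, x] f.
Proof.
move=> ax h; rewrite cintegral_itvB ?bnd_simp ?(ltW ax) // cintegral_obnd_cbnd //.
apply: cintegrableS h => //; apply: subset_itvr; by rewrite bnd_simp ltW.
Qed.

Lemma cderiv_cintegral_tail a x f : a < x -> cintegrable `[a, +oo[ f ->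
  ccont f x -> cderiv (fun y => cintegral `[y, +oo[ f) x (- f x).
Proof.
move=> ax h cf.
have h1 : cderiv (fun y => cintegral `[a, y] f) x (f x).
  apply: (@cderiv_cintegral _ (x + 1)) => //; first by rewrite ltrDl.
  - by apply: cintegrableS h => //; apply: subset_itvl.
apply: (@cderiv_near _ (fun y => cintegral `[a, +oo[ f - cintegral `[a, y] f)).
- have : \forall y \near x, a < y by exact: lt_nbhsr.
  by apply: filterS => y ay; rewrite -cintegral_tail.
- by apply: cderiv_eq (cderivB (cderiv_cst _ _) h1) _; rewrite sub0r.
Qed.

End ComplexIntegral.

(** * The reflection of the line and its action on the function space *)

Section Reflection.
Context {R : realType}.
Notation mu := (@lebesgue_measure R).
Implicit Types (f g v : R -> R[i]) (D : set R).

Let opp : R -> measurableTypeR R := fun x => - x.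

Let mopp : measurable_fun [set: measurableTypeR R] (opp : measurableTypeR R -> measurableTypeR R).
Proof. exact: oppr_measurable. Qed.

(** Lebesgue measure is its own image under the reflection, so this is the change of variables for a
    pushforward measure. *)
Lemma ge0_integral_opp (f : R -> \bar R) : measurable_fun setT f ->
  (forall x, 0 <= f x)%E -> (\int[mu]_x f (- x)%R = \int[mu]_x f x)%E.
Proof.
move=> mf f0.
have := @ge0_integral_pushforward _ _ _ _ _ _ mopp lebesgue_measure setT f measurableT mf (fun y _ => f0 y).
rewrite preimage_setT /= => <-.
by apply: eq_measure_integral => A mA _; exact: lebesgue_measureN.
Qed.

Lemma integrable_opp D (f : R -> R) : measurable D -> measurable_fun setT f ->
  mu.-integrable D (EFin \o f) ->
  mu.-integrable [set x | D (- x)] (EFin \o (fun x => f (- x))).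
Proof.
move=> mD mf hf.
have mD' : measurable [set x : R | D (- x)].
  by rewrite -[X in measurable X]setTI; exact: (@oppr_measurable R setT).
have mf' : measurable_fun setT (EFin \o (fun x => f (- x))).
  by apply/measurable_EFinP; exact: (measurableT_comp mf).
apply/integrableP; split; first exact: measurable_funTS.
have /integrableP[_ ] := hf.
rewrite integral_mkcond [X in _ -> (X < _)%E]integral_mkcond.
rewrite -ge0_integral_opp; first 1 last.
- apply/(measurable_restrictT _ mD); apply: measurableT_comp => //.
  by apply/measurable_EFinP; exact: measurable_funTS.
- by move=> x; rewrite patchE; case: ifP.
by apply: le_lt_trans; rewrite le_eqVlt; apply/orP; left; apply/eqP;
  apply: eq_integral => x _; rewrite !patchE; do 2 case: ifPn => //; rewrite !inE.
Qed.

Lemma Rintegral_opp D (f : R -> R) : measurable D -> measurable_fun setT f ->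
  mu.-integrable D (EFin \o f) ->
  \int[mu]_(x in [set x | D (- x)]) f (- x) = \int[mu]_(x in D) f x.
Proof.
move=> mD mf hf.
have hf' := integrable_opp mD mf hf.
have mf' : measurable_fun setT (EFin \o f) by exact/measurable_EFinP.
rewrite /Rintegral; congr fine.
have := @integral_pushforward _ _ _ _ _ _ mopp lebesgue_measure D (EFin \o f) mf' hf' mD.
move=> /= <-.
by apply: eq_measure_integral => A mA _; exact: lebesgue_measureN.
Qed.

Lemma cmeas_opp f : cmeas setT f -> cmeas setT (fun x => f (- x)).
Proof.
have mopp' : measurable_fun [set: R] (fun x : R => - x) by exact: oppr_measurable.
by move=> [m1 m2]; split; [exact: (measurableT_comp m1)|exact: (measurableT_comp m2)].
Qed.

Lemma cintegrable_opp D f : measurable D -> cmeas setT f -> cintegrable D f ->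
  cintegrable [set x | D (- x)] (fun x => f (- x)).
Proof.
move=> mD [m1 m2] [i1 i2]; split.
- exact: (integrable_opp mD m1 i1).
- exact: (integrable_opp mD m2 i2).
Qed.

Lemma cintegral_opp D f : measurable D -> cmeas setT f -> cintegrable D f ->
  cintegral [set x | D (- x)] (fun x => f (- x)) = cintegral D f.
Proof.
move=> mD [m1 m2] [i1 i2]; apply: complexP => /=.
- exact: (Rintegral_opp mD m1 i1).
- exact: (Rintegral_opp mD m2 i2).
Qed.

Lemma cintegrable_oppy a f : cmeas setT f -> cintegrable `[a, +oo[ f ->
  cintegrable `]-oo, (- a)] (fun x => f (- x)).
Proof.
move=> mf hf.
have E : [set x : R | `[a, +oo[%classic (- x)] = `]-oo, (- a)]%classic.
  by apply/seteqP; split => x /=; rewrite !in_itv /= ?andbT lerNr.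
by have := cintegrable_opp (measurable_itv _) mf hf; rewrite E.
Qed.

Lemma cintegral_oppy a f : cmeas setT f -> cintegrable `[a, +oo[ f ->
  cintegral `]-oo, (- a)] (fun x => f (- x)) = cintegral `[a, +oo[ f.
Proof.
move=> mf hf.
have E : [set x : R | `[a, +oo[%classic (- x)] = `]-oo, (- a)]%classic.
  by apply/seteqP; split => x /=; rewrite !in_itv /= ?andbT lerNr.
by have := cintegral_opp (measurable_itv _) mf hf; rewrite E.
Qed.

Lemma cintegral_oppT f : cmeas setT f -> cintegrable setT f ->
  cintegral setT (fun x => f (- x)) = cintegral setT f.
Proof.
move=> mf hf.
have E : [set x : R | [set: R] (- x)] = setT by apply/seteqP.
by have := cintegral_opp measurableT mf hf; rewrite E.
Qed.

(** The square root in the $L^2$ norm preserves finiteness in both directions, so square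
    integrability can replace the norm from here on. *)
Lemma inL2P v : inL2 v <->
  cmeas setT v /\ mu.-integrable setT (EFin \o (fun x => cmod (v x) ^+ 2)).
Proof.
have E : cmeas setT v -> (\int[mu]_x (`|(cmod (v x))%:E| `^ 2)%E =
   \int[mu]_x (`|(EFin \o (fun x => (cmod (v x) ^+ 2)%R)) x|))%E.
  move=> m; apply: eq_integral => x _ /=.
  by rewrite (ger0_norm (cmod_ge0 _)) powR_mulrn ?cmod_ge0 // ger0_norm // sqr_ge0.
split=> [[m h]|[m /integrableP[_ h]]]; split => //.
- apply/integrableP; split.
    by apply/measurable_EFinP/measurable_funX; exact: cmeas_cmod.
  rewrite -E //; move: h; rewrite /L2norm unlock => h.
  by apply: (@lty_poweRy _ _ 2^-1).
- by rewrite /L2norm unlock E //; exact: poweR_lty.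
Qed.

Lemma inL2_opp v : inL2 v -> inL2 (fun x => v (- x)).
Proof.
move=> /inL2P[m h]; apply/inL2P; split; first exact: cmeas_opp.
have := @integrable_opp setT _ measurableT _ h.
have -> : [set x : R | [set: R] (- x)] = setT by apply/seteqP.
by apply; apply: measurable_funX; exact: cmeas_cmod.
Qed.

Lemma cvg_at_right_opp f l : ccvg (0 : R)^'- f l -> ccvg (0 : R)^'+ (fun x => f (- x)) l.
Proof.
by move=> [h1 h2]; split; apply/cvg_at_rightNP; rewrite oppr0; [move: h1|move: h2];
  apply: cvg_trans; apply: near_eq_cvg; apply: nearW => x; rewrite /= opprK.
Qed.

Lemma cvg_at_left_opp f l : ccvg (0 : R)^'+ f l -> ccvg (0 : R)^'- (fun x => f (- x)) l.
Proof.
by move=> [h1 h2]; split; apply/cvg_at_leftNP; rewrite oppr0; [move: h1|move: h2];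
  apply: cvg_trans; apply: near_eq_cvg; apply: nearW => x; rewrite /= opprK.
Qed.

Lemma inCdP v : inCd v -> [/\ exists M : R, forall x, x != 0 -> cmod (v x) <= M,
  forall x, x != 0 -> ccont v x, ccvg (0 : R)^'+ v (limr0 v) & ccvg (0 : R)^'- v (liml0 v)].
Proof.
move=> [h1 h2 h3 h4]; split => //.
- by move=> x x0; have /ccvgP := h2 x x0; apply.
- by apply/ccvgP; exact: h3.
- by apply/ccvgP; exact: h4.
Qed.

Lemma inCdI v k l : (exists M : R, forall x, x != 0 -> cmod (v x) <= M) ->
  (forall x, x != 0 -> ccont v x) -> ccvg (0 : R)^'+ v k -> ccvg (0 : R)^'- v l ->
  [/\ inCd v, limr0 v = k & liml0 v = l].
Proof.
move=> h1 h2 h3 h4.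
have h3' : (v x : R[i]^o) @[x --> (0 : R)^'+] --> (k : R[i]^o) by apply/ccvgP.
have h4' : (v x : R[i]^o) @[x --> (0 : R)^'-] --> (l : R[i]^o) by apply/ccvgP.
split; last 2 first.
- by apply: cvg_lim h3'; exact: norm_hausdorff.
- by apply: cvg_lim h4'; exact: norm_hausdorff.
split.
- exact: h1.
- by move=> x x0; apply/ccvgP; exact: h2.
- exact: (cvgP _ h3').
- exact: (cvgP _ h4').
Qed.

Lemma ccont_opp v x : ccont v (- x) -> ccont (fun y => v (- y)) x.
Proof.
move=> [h1 h2]; have o : (- y : R) @[y --> x] --> - x by apply: cvgN.
by split; [exact: (cvg_comp (fun y : R => - y) _ o h1)|exact: (cvg_comp (fun y : R => - y) _ o h2)].
Qed.

Lemma inX_opp v : inX v -> [/\ inX (fun x => v (- x)),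
  limr0 (fun x => v (- x)) = liml0 v & liml0 (fun x => v (- x)) = limr0 v].
Proof.
move=> [hL hC]; have [[M hM] h2 h3 h4] := inCdP hC.
have [||||c1 c2 c3] := @inCdI (fun x => v (- x)) (liml0 v) (limr0 v).
- by exists M => x x0; apply: hM; rewrite oppr_eq0.
- by move=> x x0; apply: ccont_opp; apply: h2; rewrite oppr_eq0.
- exact: cvg_at_right_opp.
- exact: cvg_at_left_opp.
by split => //; split => //; exact: inL2_opp.
Qed.

End Reflection.

(** * Exponential weights on half-lines *)

Section ExponentialTails.
Context {R : realType}.
Notation mu := (@lebesgue_measure R).

Lemma is_derive_expM (k x : R) : is_derive x (1 : R) (fun y => expR (k * y)) (k * expR (k * x)).
Proof.
have := @is_derive1_comp _ expR (fun y : R => k * y) x (expR (k * x)) k (is_derive_expR _).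
rewrite mulrC; apply.
have := @is_deriveZ _ _ _ id k x 1 1 (is_derive_id _ _).
by rewrite /GRing.scale /= mulr1.
Qed.

Lemma continuous_expM (k x : R) : {for x, continuous (fun y => expR (k * y))}.
Proof.
by apply: differentiable_continuous; apply/derivable1_diffP; have [] := is_derive_expM k x.
Qed.

Lemma cvg_expM (k : R) : 0 < k -> expR (- k * x) @[x --> +oo] --> (0 : R).
Proof.
move=> k0.
have h : (k * x : R) @[x --> +oo] --> +oo by apply: gt0_cvgMry => //; exact: cvg_id.
under eq_fun do rewrite mulNr.
exact: (cvg_comp (fun x => k * x) _ h (@cvgr_expR R)).
Qed.

Lemma tail_expM (k a : R) : 0 < k ->
  (\int[mu]_(x in `[a, +oo[) (expR (- k * x))%:E = (expR (- k * a) / k)%:E)%E.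
Proof.
move=> k0.
rewrite (@ge0_continuous_FTC2y _ _ (fun x => - expR (- k * x) / k) _ 0).
- by rewrite -EFinB sub0r mulNr opprK.
- by move=> x _; exact: expR_ge0.
- by apply: continuous_subspaceT => x; exact: continuous_expM.
- rewrite -(mul0r k^-1) -oppr0; apply: cvgMl; apply: cvgN; exact: cvg_expM.
- by move=> x _; apply: derivableM => //; apply: derivableN; have [] := is_derive_expM (- k) x.
- apply: cvg_at_right_filter; apply: cvgMl; apply: cvgN; exact: continuous_expM.
- move=> x _; rewrite derive1E.
  have := @is_deriveM _ _ (fun x => - expR (- k * x)) (cst k^-1) x 1 _ _
    (is_deriveN (is_derive_expM (- k) x)) (is_derive_cst _ _ _).
  move=> h; rewrite (@derive_val _ _ _ _ _ _ _ h) /GRing.scale /=.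
  by rewrite mulr0 add0r mulNr opprK mulrA mulVf ?mul1r // gt_eqF.
Qed.

Lemma integrable_tail_expM (k a : R) : 0 < k ->
  mu.-integrable `[a, +oo[ (EFin \o (fun x => expR (- k * x))).
Proof.
move=> k0; apply/integrableP; split.
  apply/measurable_EFinP; apply: measurable_funTS; apply: continuous_measurable_fun => x.
  exact: continuous_expM.
under eq_integral do rewrite /= ger0_norm ?expR_ge0 //.
by rewrite tail_expM // ltry.
Qed.

Lemma Rintegral_tail_expM (k a : R) : 0 < k ->
  \int[mu]_(x in `[a, +oo[) expR (- k * x) = expR (- k * a) / k.
Proof. by move=> k0; rewrite /Rintegral tail_expM. Qed.

End ExponentialTails.

(** * The nonlocal part of the operator *)

Section Nonlocal.
Context {R : realType}.
Notation mu := (@lebesgue_measure R).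
Implicit Types (v f : R -> R[i]).

Lemma cmeas_expM (k : R) (D : set R) : cmeas D (fun x => (expR (k * x))%:C).
Proof.
apply: cmeas_real; apply: measurable_funTS; apply: continuous_measurable_fun => x.
exact: continuous_expM.
Qed.

Lemma integrable_cst_itv (a b K : R) : mu.-integrable `[a, b] (EFin \o (fun=> K)).
Proof.
apply: (@continuous_compact_integrable _ (fun=> K)); first exact: segment_compact.
by apply: continuous_subspaceT => x; exact: cst_continuous.
Qed.

Lemma Rintegral_cst_itv (a b K : R) : a <= b ->
  \int[mu]_(x in `[a, b]) K = K * (b - a).
Proof.
move=> ab; rewrite Rintegral_cst //= -/mu lebesgue_measure_itv /= lte_fin.
by move: ab; rewrite le_eqVlt => /predU1P[->|->//]; rewrite ltxx subrr.
Qed.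

(** The sets may overlap, so the restriction to the union is dominated by the sum of the absolute
    values of the two restrictions. *)
Lemma integrable_setU (A B : set R) (f : R -> R) : measurable A -> measurable B ->
  mu.-integrable A (EFin \o f) -> mu.-integrable B (EFin \o f) ->
  mu.-integrable (A `|` B) (EFin \o f).
Proof.
move=> mA mB hA hB.
have mAf : measurable_fun (A `|` B) (EFin \o f).
  by apply/measurable_funU => //; split; [case/integrableP: hA|case/integrableP: hB].
have hA' := hA; have hB' := hB.
move/(integrable_mkcond (mu := mu) _ mA).1/integrable_abse : hA' => hA'.
move/(integrable_mkcond (mu := mu) _ mB).1/integrable_abse : hB' => hB'.
have hS := integrableD measurableT hA' hB'.
apply/(integrable_mkcond (mu := mu) _ (measurableU _ _ mA mB)).
apply: le_integrable hS => //.
  by apply/(measurable_restrictT _ (measurableU _ _ mA mB)).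
move=> x _ /=; rewrite !patchE in_setU.
have -> : point = 0%E :> \bar R by [].
rewrite [leRHS]gee0_abs; last by apply: adde_ge0; exact: abse_ge0.
case: (x \in A) => /=; first by apply: leeDl; exact: abse_ge0.
by rewrite /= normr0 add0e.
Qed.

Lemma measurable_sg : measurable_fun setT (Num.sg : R -> R).
Proof.
have -> : (Num.sg : R -> R) = (fun x => \1_(`]0, +oo[%classic) x - \1_(`]-oo, 0[%classic) x).
  apply/funext => x; rewrite !indicE !mem_setE !in_itv /= andbT.
  by have [x0|x0|->] := ltgtP x 0; rewrite ?sgr0 ?(gtr0_sg x0) ?(ltr0_sg x0) ?subr0 ?sub0r.
by apply: measurable_funB; exact: measurable_indic.
Qed.

Lemma integrable_exp_abs (k : R) : 0 < k ->
  mu.-integrable setT (EFin \o (fun x => expR (- k * `|x|))).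
Proof.
move=> k0.
have mf : measurable_fun setT (fun x : R => expR (- k * `|x|)).
  apply: (@measurableT_comp _ _ _ _ _ _ (fun y => expR (- k * y))) => //.
  by apply: continuous_measurable_fun => x; exact: continuous_expM.
have i1 : mu.-integrable `[0, +oo[ (EFin \o (fun x => expR (- k * `|x|))).
  apply: eq_integrable (integrable_tail_expM 0 k0) => // x.
  by rewrite inE /= in_itv /= andbT => x0; rewrite ger0_norm.
have i2 := integrable_opp (measurable_itv _) mf i1.
have -> : [set: R] = `[0, +oo[ `|` [set x | `[0, +oo[%classic (- x)].
  apply/seteqP; split => // x _ /=; rewrite !in_itv /= !andbT oppr_ge0.
  by case: (leP 0 x) => [|/ltW]; [left|right].
apply: integrable_setU => //.
  have -> : [set x : R | `[0, +oo[%classic (- x)] = `]-oo, 0]%classic.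
    by apply/seteqP; split => x /=; rewrite !in_itv /= ?andbT oppr_ge0.
  exact: measurable_itv.
apply: eq_integrable i2 => //; last by move=> x _ /=; rewrite normrN.
have -> : [set x : R | `[0, +oo[%classic (- x)] = `]-oo, 0]%classic.
  by apply/seteqP; split => x /=; rewrite !in_itv /= ?andbT oppr_ge0.
exact: measurable_itv.
Qed.

(** [Jh] is the weighted tail present in the operator. [Kh] is what the convolution leaves on
    [[0, x]], where the product $e^{-(x-y)}e^{-y}=e^{-x}$ does not depend on [y]. *)
Definition Jh v (x : R) : R[i] := cintegral `[x, +oo[ (fun y => (expR (- 2 * y))%:C * v y).
Definition Kh v (x : R) : R[i] := cintegral `[0, x] v.

Lemma cintegrable_tail v (B k a : R) : cmeas setT v -> (forall x, a <= x -> cmod (v x) <= B) ->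
  0 < k -> cintegrable `[a, +oo[ (fun y => (expR (- k * y))%:C * v y).
Proof.
move=> mv hB k0.
have hi : mu.-integrable `[a, +oo[ (EFin \o (fun x => B * expR (- k * x))).
  have -> : (EFin \o (fun x => B * expR (- k * x))) =
    (fun x => (B%:E * (EFin \o (fun x => expR (- k * x))) x)%E) by [].
  by apply: integrableZl => //; exact: integrable_tail_expM.
apply: cintegrable_dom hi _ => //.
- apply: cmeasM; first exact: cmeas_expM.
  by apply: cmeasS mv.
- move=> x /=; rewrite in_itv /= andbT => ax.
  by rewrite cmodM cmod_real ger0_norm ?expR_ge0 // mulrC ler_wpM2r ?expR_ge0 // hB.
Qed.

Lemma cmod_tail_le v (B k a : R) : cmeas setT v -> (forall x, a <= x -> cmod (v x) <= B) ->
  0 < k -> cmod (cintegral `[a, +oo[ (fun y => (expR (- k * y))%:C * v y)) <=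
           2 * (B * (expR (- k * a) / k)).
Proof.
move=> mv hB k0.
have hi : mu.-integrable `[a, +oo[ (EFin \o (fun x => B * expR (- k * x))).
  have -> : (EFin \o (fun x => B * expR (- k * x))) =
    (fun x => (B%:E * (EFin \o (fun x => expR (- k * x))) x)%E) by [].
  by apply: integrableZl => //; exact: integrable_tail_expM.
rewrite -Rintegral_tail_expM // -RintegralZl //; last exact: integrable_tail_expM.
apply: cmod_cintegral_le => //.
- apply: cmeasM; first exact: cmeas_expM.
  by apply: cmeasS mv.
- move=> x /=; rewrite in_itv /= andbT => ax.
  by rewrite cmodM cmod_real ger0_norm ?expR_ge0 // mulrC ler_wpM2r ?expR_ge0 // hB.
Qed.

Lemma cintegrable_Kh v (B x : R) : cmeas setT v -> (forall x, cmod (v x) <= B) ->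
  cintegrable `[0, x] v.
Proof.
move=> mv hB; apply: cintegrable_dom (integrable_cst_itv 0 x B) _ => //.
by apply: cmeasS mv.
Qed.

Lemma cmod_Kh_le v (B x : R) : cmeas setT v -> (forall x, 0 <= x -> cmod (v x) <= B) ->
  0 <= x -> cmod (Kh v x) <= 2 * (B * x).
Proof.
move=> mv hB x0.
have -> : B * x = \int[mu]_(x in `[0, x]) B by rewrite Rintegral_cst_itv ?subr0.
apply: cmod_cintegral_le => //; first by apply: cmeasS mv.
- exact: integrable_cst_itv.
- by move=> y /=; rewrite in_itv /= => /andP[y0 _]; exact: hB.
Qed.

Lemma inX_bound v : inX v -> exists2 B : R, 0 <= B & forall x, cmod (v x) <= B.
Proof.
move=> [_ [[M hM] _ _ _]]; exists (Num.max M (cmod (v 0))).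
  by rewrite le_max cmod_ge0 orbT.
move=> x; have [->|x0] := eqVneq x 0; first by rewrite le_max lexx orbT.
by rewrite le_max hM.
Qed.

Lemma inX_cmeas v : inX v -> cmeas setT v.
Proof. by move=> [[h _] _]. Qed.

Lemma dphi_opp (x : R) : dphi (- x) = - dphi x.
Proof. by rewrite /dphi normrN sgrN; ring. Qed.

Lemma measurable_dphi (xi : R) : measurable_fun setT (fun y : R => dphi (xi - y)).
Proof.
have mB : measurable_fun setT (fun y : R => xi - y) by exact: measurable_funB.
have m1 : measurable_fun setT (fun y : R => dphi y).
  rewrite /dphi; apply: measurable_funM.
    by apply: measurable_funN; exact: measurable_sg.
  apply: (@measurableT_comp _ _ _ _ _ _ expR); first exact: measurable_expR.
  by apply: measurable_funN; exact: normr_measurable.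
exact: (measurableT_comp m1 mB).
Qed.

Lemma dphi_le1 (x : R) : `|dphi x| <= 1.
Proof.
rewrite /dphi normrM normrN normr_sg (ger0_norm (expR_ge0 _)).
have h : expR (- `|x|) <= 1 by rewrite -expR0 ler_expR oppr_le0.
by case: (x != 0); rewrite ?mul1r ?mul0r.
Qed.

Lemma cintegrable_conv (c : R) v (xi : R) : 0 < c -> inX v ->
  cintegrable setT (fun y => (dphi (xi - y))%:C * ((u0 c y)%:C * v y)).
Proof.
move=> c0 hv; have [B B0 hB] := inX_bound hv; have mv := inX_cmeas hv.
have hi : mu.-integrable setT (EFin \o (fun x => (c * B) * expR (- 1 * `|x|))).
  have -> : (EFin \o (fun x => (c * B) * expR (- 1 * `|x|))) =
    (fun x => ((c * B)%:E * (EFin \o (fun x => expR (- 1 * `|x|))) x)%E) by [].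
  by apply: integrableZl => //; exact: integrable_exp_abs.
apply: cintegrable_dom hi _ => //.
- apply: cmeasM; first by apply: cmeas_real; exact: measurable_dphi.
  apply: cmeasM => //; apply: cmeas_real; rewrite /u0.
  apply: measurable_funM => //.
  apply: (@measurableT_comp _ _ _ _ _ _ expR); first exact: measurable_expR.
  by apply: measurable_funN; exact: normr_measurable.
- move=> y _; rewrite !cmodM !cmod_real /u0 [`|c * _|]normrM (gtr0_norm c0) (ger0_norm (expR_ge0 _)).
  rewrite mulN1r -[leRHS]mul1r; apply: ler_pM => //; first by rewrite !mulr_ge0 ?expR_ge0 ?cmod_ge0 // ltW.
    exact: dphi_le1.
  rewrite -!mulrA ler_wpM2l ?(ltW c0) // mulrC ler_wpM2r ?expR_ge0 //.
Qed.

(** Among the integrals of the operator at points [xi > 0], the left half-line contributes only this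
    number. *)
Lemma Jh_reflect v : inX v ->
  cintegral `]-oo, 0] (fun x => (expR (2 * x))%:C * v x) = Jh (fun x => v (- x)) 0.
Proof.
move=> hv; have [B B0 hB] := inX_bound hv; have mv := inX_cmeas hv.
have mvr := cmeas_opp mv.
have mg : cmeas setT (fun y => (expR (- 2 * y))%:C * v (- y)).
  by apply: cmeasM => //; exact: cmeas_expM.
have ig : cintegrable `[0, +oo[ (fun y => (expR (- 2 * y))%:C * v (- y)).
  exact: (@cintegrable_tail _ B).
rewrite /Jh -(cintegral_oppy mg ig) oppr0.
by apply: eq_cintegral => x _; rewrite opprK; congr (_%:C * _); congr expR; ring.
Qed.

(** The convolution is cut at 0 and [xi]: up to the factor [c], the pieces are $-e^{-\xi}$ times the
    reflected [Jh] at 0, $-e^{-\xi}$ times [Kh], and $e^{\xi}$ times [Jh]. The first and last merge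
    with the explicit integrals of the operator, which produces the coefficient
    $(3-b)-b/2=3-3b/2$. *)
Lemma Lw_nonlocal_pos (b c : R) v (xi : R) : 0 < c -> inX v -> 0 < xi ->
  Lw_nonlocal b c v xi = c%:C *
   ((3 - 3 * b / 2)%:C * (expR xi)%:C * Jh v xi
    - (3 - 3 * b / 2)%:C * (expR (- xi))%:C * Jh (fun x => v (- x)) 0
    + (b / 2)%:C * (expR (- xi))%:C * Kh v xi
    + (3 - b)%:C * (expR (- xi))%:C * ((limr0 v + liml0 v) / 2 - v xi)).
Proof.
move=> c0 hv x0; have [B B0 hB] := inX_bound hv; have mv := inX_cmeas hv.
rewrite /Lw_nonlocal (max_idPl (ltW x0)) (min_idPr (ltW x0)) Jh_reflect //.
rewrite -/(Jh v xi) gtr0_sg // gtr0_norm //.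
rewrite /convolution.
have ic := cintegrable_conv xi c0 hv.
set F := (fun y => _) in ic *.
have E1 : [set: R] = `]-oo, 0] `|` (`]0, xi] `|` `]xi, +oo[).
  apply/seteqP; split => // y _ /=; rewrite !in_itv /= !andbT.
  case: (leP y 0) => y0; [by left|right].
  by case: (leP y xi) => yx; [left|right].
have iS D : measurable D -> cintegrable D F by move=> mD; apply: cintegrableS ic.
have i1 : cintegrable `[0, xi] v by exact: (@cintegrable_Kh _ B).
have i2 : cintegrable `]0, xi] v by apply: cintegrableS i1 => //; apply: subset_itv; rewrite bnd_simp.
have i3 : cintegrable `]0, xi[ v by apply: cintegrableS i1 => //; apply: subset_itv; rewrite bnd_simp.
have iJ : cintegrable `[xi, +oo[ (fun y => (expR (- 2 * y))%:C * v y).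
  by apply: (@cintegrable_tail _ B).
have iJr : cintegrable `]-oo, 0] (fun x => (expR (2 * x))%:C * v x).
  have mg : cmeas setT (fun y => (expR (- 2 * y))%:C * v (- y)).
    by apply: cmeasM; [exact: cmeas_expM|exact: cmeas_opp].
  have h : cintegrable `[0, +oo[ (fun y => (expR (- 2 * y))%:C * v (- y)).
    by apply: (@cintegrable_tail (fun y => v (- y)) B) => //; exact: cmeas_opp.
  have := cintegrable_oppy mg h; rewrite oppr0; apply: eq_cintegrable => // y _.
  by rewrite opprK; congr (_%:C * _); congr expR; ring.
rewrite E1 cintegral_setU //; first 1 last.
- exact: measurableU.
- apply/disj_set2P/seteqP; split => // y /=; rewrite !in_itv /= !andbT.
  by move=> [y0 [/andP[y1 _]|y1]]; lra.
- by rewrite -E1.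
rewrite cintegral_setU //; first 1 last.
- apply/disj_set2P/seteqP; split => // y /=; rewrite !in_itv /= !andbT.
  by move=> [/andP[_ y0] y1]; lra.
- by apply: iS; exact: measurableU.
have -> : cintegral `]-oo, 0] F = - (c * expR (- xi))%:C * Jh (fun x => v (- x)) 0.
  rewrite -Jh_reflect // -cintegralZ //.
  apply: eq_cintegral => y; rewrite inE /= in_itv /= => y0.
  have y1 : 0 < xi - y by lra.
  rewrite /F /dphi /u0 (gtr0_sg y1) (gtr0_norm y1) (ler0_norm y0).
  have E : - 1 * expR (- (xi - y)) * (c * expR (- - y)) = - (c * expR (- xi)) * expR (2 * y).
    have -> : expR (- (xi - y)) = expR (- xi) * expR y by rewrite -expRD; congr expR; ring.
    have -> : expR (2 * y) = expR y * expR y by rewrite -expRD; congr expR; ring.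
    by rewrite opprK; ring.
  by rewrite mulrA -rmorphM E rmorphM rmorphN -mulrA.
have -> : cintegral `]0, xi] F = - (c * expR (- xi))%:C * Kh v xi.
  (* The endpoint [y = xi], at which the sign in [dphi] vanishes, is discarded. *)
  rewrite -cintegral_bndo_bndc; last exact: iS.
  rewrite /Kh -cintegral_obnd_cbnd // -cintegral_bndo_bndc // -cintegralZ //.
  apply: eq_cintegral => y; rewrite inE /= in_itv /= => /andP[y0 y1].
  have y2 : 0 < xi - y by lra.
  rewrite /F /dphi /u0 (gtr0_sg y2) (gtr0_norm y2) (gtr0_norm y0).
  have E : - 1 * expR (- (xi - y)) * (c * expR (- y)) = - (c * expR (- xi)).
    have -> : expR (- (xi - y)) = expR (- xi) * expR y by rewrite -expRD; congr expR; ring.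
    have h : expR y * expR (- y) = 1 by rewrite -expRD subrr expR0.
    transitivity (- c * expR (- xi) * (expR y * expR (- y))); first ring.
    by rewrite h; ring.
  by rewrite mulrA -rmorphM E rmorphN.
have -> : cintegral `]xi, +oo[ F = (c * expR xi)%:C * Jh v xi.
  have iJo : cintegrable `]xi, +oo[ (fun y => (expR (- 2 * y))%:C * v y).
    by apply: cintegrableS iJ => //; apply: subset_itvr; rewrite bnd_simp.
  rewrite /Jh -(cintegral_obnd_cbnd iJo) -(cintegralZ _ (measurable_itv _) iJo).
  apply: eq_cintegral => y; rewrite inE /= in_itv /= andbT => y1.
  have y2 : xi - y < 0 by lra.
  have y3 : 0 < y by lra.
  rewrite /F /dphi /u0 (ltr0_sg y2) (ltr0_norm y2) (gtr0_norm y3).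
  have E : - -1 * expR (- - (xi - y)) * (c * expR (- y)) = c * expR xi * expR (- 2 * y).
    have -> : expR (- - (xi - y)) = expR xi * expR (- y) by rewrite -expRD; congr expR; ring.
    have -> : expR (- 2 * y) = expR (- y) * expR (- y) by rewrite -expRD; congr expR; ring.
    ring.
  by rewrite mulrA -rmorphM E rmorphM -mulrA.
by rewrite !realcE !mulr1; field.
Qed.

(** The two one-sided integrals trade places with opposite signs, and [dphi] and the sign are odd.
    Hence the equation on the left half-line is the equation on the right for the reflected function
    and the opposite eigenvalue. *)
Lemma Lw_nonlocal_opp (b c : R) v (xi : R) : 0 < c -> inX v -> xi != 0 ->
  Lw_nonlocal b c v (- xi) = - Lw_nonlocal b c (fun x => v (- x)) xi.
Proof.
move=> c0 hv x0; have [B B0 hB] := inX_bound hv; have mv := inX_cmeas hv.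
have [hr hr1 hr2] := inX_opp hv.
rewrite /Lw_nonlocal hr1 hr2.
have mvr := inX_cmeas hr.
have T1 a g : cmeas setT g -> (forall x, cmod (g x) <= B) ->
    cintegral `]-oo, (- a)] (fun x => (expR (2 * x))%:C * g x) =
    cintegral `[a, +oo[ (fun x => (expR (- 2 * x))%:C * g (- x)).
  move=> mg gB.
  have mg1 : cmeas setT (fun x => (expR (- 2 * x))%:C * g (- x)).
    by apply: cmeasM; [exact: cmeas_expM|exact: cmeas_opp].
  have ig : cintegrable `[a, +oo[ (fun x => (expR (- 2 * x))%:C * g (- x)).
    by apply: (@cintegrable_tail (fun y => g (- y)) B) => //; exact: cmeas_opp.
  rewrite -(cintegral_oppy mg1 ig).
  by apply: eq_cintegral => x _; rewrite opprK; congr (_%:C * _); congr expR; ring.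
have -> : cintegral `[Num.max (- xi) 0, +oo[ (fun x => (expR (- 2 * x))%:C * v x) =
    cintegral `]-oo, Num.min xi 0] (fun x => (expR (2 * x))%:C * v (- x)).
  have -> : Num.min xi 0 = - Num.max (- xi) 0 by rewrite oppr_max opprK oppr0.
  rewrite (T1 _ (fun x => v (- x))) //; apply: eq_cintegral => x _; by rewrite opprK.
have -> : cintegral `]-oo, Num.min (- xi) 0] (fun x => (expR (2 * x))%:C * v x) =
    cintegral `[Num.max xi 0, +oo[ (fun x => (expR (- 2 * x))%:C * v (- x)).
  have -> : Num.min (- xi) 0 = - Num.max xi 0 by rewrite oppr_max oppr0.
  by rewrite T1.
have -> : convolution (fun x => (dphi x)%:C) (fun x => (u0 c x)%:C * v x) (- xi) =
  - convolution (fun x => (dphi x)%:C) (fun x => (u0 c x)%:C * v (- x)) xi.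
  rewrite /convolution; have ic := cintegrable_conv xi c0 hr.
  have ic' := cintegrableN measurableT ic.
  rewrite -cintegralNf // -(cintegral_oppT (cintegrable_cmeas ic') ic').
  apply: eq_cintegral => y _; rewrite opprK /u0 normrN -mulNr -rmorphN -dphi_opp.
  by congr ((dphi _)%:C * _); ring.
rewrite sgrN normrN !opprK !realcE.
move: (cintegral _ _) (cintegral _ _) (convolution _ _ _) => I1 I2 I3; ring.
Qed.

End Nonlocal.

(** * The eigenvalue equation on a half-line *)

Section ComplexExponential.
Context {R : realType}.
Implicit Types (z w : R[i]) (f : R -> R[i]).

Definition cexp z : R[i] := (expR (Re z) * cos (Im z)) +i* (expR (Re z) * sin (Im z)).

Lemma cmod_cexp z : cmod (cexp z) = expR (Re z).
Proof.
by rewrite cmodE /= !exprMn -mulrDr cos2Dsin2 mulr1 sqrtr_sqr ger0_norm ?expR_ge0 //.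
Qed.

Lemma cexpD z w : cexp (z + w) = cexp z * cexp w.
Proof.
apply: complexP; rewrite /cexp !ReImE /= ?cReD ?cImD expRD.
- rewrite cosD; ring.
- rewrite sinD; ring.
Qed.

Lemma cexp0 : cexp 0 = 1.
Proof. by apply: complexP; rewrite /= expR0 ?cos0 ?sin0 mul1r. Qed.

Lemma cexpN z : cexp (- z) * cexp z = 1.
Proof. by rewrite -cexpD addNr cexp0. Qed.

Lemma cderiv_cexp f x l : cderiv f x l -> cderiv (fun y => cexp (f y)) x (l * cexp (f x)).
Proof.
move=> [f1 f2].
have he := @is_derive1_comp _ expR (fun y => Re (f y)) x _ _ (is_derive_expR _) f1.
have hc := @is_derive1_comp _ cos (fun y => Im (f y)) x _ _ (is_derive_cos _) f2.
have hs := @is_derive1_comp _ sin (fun y => Im (f y)) x _ _ (is_derive_sin _) f2.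
split; rewrite !ReImE /=.
- apply: is_derive_eq (is_deriveM he hc) _; rewrite /GRing.scale /=; ring.
- apply: is_derive_eq (is_deriveM he hs) _; rewrite /GRing.scale /=; ring.
Qed.

End ComplexExponential.

(** * The first-order equation on a half-line and its momentum *)

Section HalfLine.
Context {R : realType}.
Notation mu := (@lebesgue_measure R).
Implicit Types (v : R -> R[i]) (la k : R[i]) (b x : R).

Lemma onem_exp_gt0 x : 0 < x -> 0 < 1 - expR (- x).
Proof. by move=> x0; rewrite subr_gt0 -expR0 ltr_expR oppr_lt0. Qed.

Lemma is_derive_exp x : is_derive x (1 : R) (fun y => expR y) (expR x).
Proof. exact: is_derive_expR. Qed.

Lemma is_derive_expN x : is_derive x (1 : R) (fun y => expR (- y)) (- expR (- x)).
Proof. exact: is_derive_comp_opp (is_derive_expR _). Qed.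

Lemma is_derive_onem_exp x : is_derive x (1 : R) (fun y => 1 - expR (- y)) (expR (- x)).
Proof.
apply: is_derive_eq (is_deriveB (is_derive_cst _ _ _) (is_derive_expN x)) _.
by rewrite sub0r opprK.
Qed.

Lemma is_derive_onem_expV x : 0 < x ->
  is_derive x (1 : R) (fun y => (1 - expR (- y))^-1) (- expR (- x) / (1 - expR (- x)) ^+ 2).
Proof.
move=> x0; have h := onem_exp_gt0 x0.
have := @is_deriveV R (fun y : R => 1 - expR (- y)) x _ 1 _ (is_derive_onem_exp x).
rewrite gt_eqF // => /(_ isT) h'; apply: is_derive_eq h' _.
by rewrite /GRing.scale /= !mulNr mulrC.
Qed.

Lemma is_derive_ln_onem_exp x : 0 < x ->
  is_derive x (1 : R) (fun y => ln (1 - expR (- y))) (expR (- x) / (1 - expR (- x))).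
Proof.
move=> x0; have h := onem_exp_gt0 x0.
have := @is_derive1_comp _ (@ln R) (fun y => 1 - expR (- y)) x _ _ (is_derive1_ln h) (is_derive_onem_exp x).
by rewrite mulrC.
Qed.

(** The eigenvalue equation on $x>0$ divided by $c$: since $c-u_0=c(1-e^{-x})$, it prescribes the
    derivative of $(1-e^{-x})v$. Everything that depends on the left half-line sits in [k]. *)
Definition hrhs b la k v x : R[i] :=
  (la + ((3 - b) * expR (- x))%:C) * v x
  - (3 - 3 * b / 2)%:C * ((expR x)%:C * Jh v x)
  - (b / 2)%:C * ((expR (- x))%:C * Kh v x)
  - k * (expR (- x))%:C.

Definition half_ode b la k v := forall x, 0 < x ->
  cderiv (fun y => (1 - expR (- y))%:C * v y) x (hrhs b la k v x).

(** The derivative of a solution: expanding $((1-e^{-x})v)'$ moves one $e^{-x}v$ to the right-hand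
    side, so the coefficient $3-b$ becomes $2-b$. *)
Definition hv1 b la k v x : R[i] := ((1 - expR (- x))^-1)%:C *
  ((la + ((2 - b) * expR (- x))%:C) * v x
  - (3 - 3 * b / 2)%:C * ((expR x)%:C * Jh v x)
  - (b / 2)%:C * ((expR (- x))%:C * Kh v x)
  - k * (expR (- x))%:C).

(** The second derivative of a solution. One more $e^{-x}v'$ crosses over, and the terms in
    $e^{-x}v$ collect to $-(2-b)+(3-3b/2)-b/2=1-b$, the last two being released by [Jh] and [Kh]. *)
Definition hv2 b la k v x : R[i] := ((1 - expR (- x))^-1)%:C *
  ((la + ((1 - b) * expR (- x))%:C) * hv1 b la k v x
  + ((1 - b) * expR (- x))%:C * v x
  - (3 - 3 * b / 2)%:C * ((expR x)%:C * Jh v x)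
  + (b / 2)%:C * ((expR (- x))%:C * Kh v x)
  + k * (expR (- x))%:C).

(* [(e^x - 1)^la (1 - e^{-x})^{-b}] *)
Definition mexp b la x : R[i] :=
  cexp (la * x%:C + (la - b%:C) * (ln (1 - expR (- x)))%:C).

(** With $t=e^{-x}$ and $\lambda$ for [la], the logarithmic derivative is
    $\lambda+(\lambda-b)t/(1-t)=(\lambda-bt)/(1-t)$. *)
Lemma cderiv_mexp b la x : 0 < x -> cderiv (mexp b la) x
  (((1 - expR (- x))^-1)%:C * (la - (b * expR (- x))%:C) * mexp b la x).
Proof.
move=> x0; have h := onem_exp_gt0 x0.
apply: cderiv_eq (cderiv_cexp (cderivD (cderivZ la (cderiv_real (is_derive_id _ _)))
  (cderivZ (la - b%:C) (cderiv_real (is_derive_ln_onem_exp x0))))) _.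
congr (_ * _); have h' : ((1 - expR (- x))%:C : R[i]) != 0.
  by rewrite -realc0 (inj_eq (@complexI _)) gt_eqF.
rewrite !realcE !realcV; move: h'; rewrite !realcE => h'; field.
exact: h'.
Qed.

Lemma cmod_mexp b la x : cmod (mexp b la x) =
  expR (Re la * x + (Re la - b) * ln (1 - expR (- x))).
Proof. by rewrite cmod_cexp !ReImE /= !mulr0 !subr0. Qed.

Section HalfOde.
Variables (b : R) (la k : R[i]) (v : R -> R[i]) (B : R).
Hypothesis mv : cmeas setT v.
Hypothesis vB : forall x, cmod (v x) <= B.
Hypothesis cv : forall x, 0 < x -> ccont v x.

Lemma cderiv_Jh x : 0 < x -> cderiv (Jh v) x (- ((expR (- 2 * x))%:C * v x)).
Proof.
move=> x0; apply: (@cderiv_cintegral_tail _ 0) => //.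
- by apply: (@cintegrable_tail _ _ B).
- apply: ccvgM; last exact: cv.
  by apply: ccvg_real; exact: continuous_expM.
Qed.

Lemma cderiv_Kh x : 0 < x -> cderiv (Kh v) x (v x).
Proof.
move=> x0; apply: (@cderiv_cintegral _ (BLeft 0) (x + 1)) => //.
- by rewrite ltrDl.
- exact: (@cintegrable_Kh _ _ B).
- exact: cv.
Qed.

(** Up to a multiple of $e^{-x}v$, the function $e^xJ$ is its own derivative, and $e^{-x}K$ is minus
    its own (next lemma). Both are therefore reproduced by two differentiations, which is what makes
    $v-v''$ free of nonlocal terms. *)
Lemma cderiv_eJh x : 0 < x -> cderiv (fun y => (expR y)%:C * Jh v y) x
  ((expR x)%:C * Jh v x - (expR (- x))%:C * v x).
Proof.
move=> x0; apply: cderiv_eq (cderivM (cderiv_real (is_derive_exp x)) (cderiv_Jh x0)) _.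
congr (_ + _); rewrite mulrN; congr (- _); rewrite mulrA; congr (_ * _).
by rewrite -rmorphM -expRD; congr (expR _)%:C; ring.
Qed.

Lemma cderiv_eKh x : 0 < x -> cderiv (fun y => (expR (- y))%:C * Kh v y) x
  (- ((expR (- x))%:C * Kh v x) + (expR (- x))%:C * v x).
Proof.
move=> x0; apply: cderiv_eq (cderivM (cderiv_real (is_derive_expN x)) (cderiv_Kh x0)) _.
by rewrite rmorphN mulNr.
Qed.

(* Both sides of this identity are computed for an arbitrary smooth function:
   it gives the equation for [v - v''] when the residual vanishes, and
   conversely the residual equation when that equation holds. *)
Lemma cderiv_hrhs x w l : 0 < x -> cderiv v x l ->
  cderiv (fun y => (la + ((2 - b) * expR (- y))%:C) * v y
  - (3 - 3 * b / 2)%:C * ((expR y)%:C * Jh v y)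
  - (b / 2)%:C * ((expR (- y))%:C * Kh v y)
  - w * (expR (- y))%:C) x
  ((la + ((2 - b) * expR (- x))%:C) * l - ((2 - b) * expR (- x))%:C * v x
  - (3 - 3 * b / 2)%:C * ((expR x)%:C * Jh v x - (expR (- x))%:C * v x)
  - (b / 2)%:C * (- ((expR (- x))%:C * Kh v x) + (expR (- x))%:C * v x)
  + w * (expR (- x))%:C).
Proof.
move=> x0 dv.
have d1 : cderiv (fun y => la + ((2 - b) * expR (- y))%:C) x (- ((2 - b) * expR (- x)))%:C.
  apply: cderiv_eq (cderivD (cderiv_cst _ _) (cderiv_real (is_deriveM (is_derive_cst (2 - b) x 1) (is_derive_expN x)))) _.
  by rewrite add0r /GRing.scale /= mulr0 addr0 mulrN.
apply: cderiv_eq (cderivB (cderivB (cderivB (cderivM d1 dv) (cderivZ _ (cderiv_eJh x0)))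
  (cderivZ _ (cderiv_eKh x0))) (cderivZ _ (cderiv_real (is_derive_expN x)))) _.
rewrite !rmorphN; ring.
Qed.

Let onem_neq0 x : 0 < x -> (1 - (expR (- x))%:C : R[i]) != 0.
Proof.
move=> x0; rewrite -(rmorph1 (real_complex R)) -rmorphB.
by rewrite -realc0 (inj_eq (@complexI _)) gt_eqF // onem_exp_gt0.
Qed.

Lemma cderiv_onem_expV x : 0 < x -> cderiv (fun y => ((1 - expR (- y))^-1)%:C) x
  (- (expR (- x))%:C * ((1 - expR (- x))^-1)%:C ^+ 2).
Proof.
move=> x0; apply: cderiv_eq (cderiv_real (is_derive_onem_expV x0)) _.
have -> : - expR (- x) / (1 - expR (- x)) ^+ 2 =
  - expR (- x) * ((1 - expR (- x))^-1 * (1 - expR (- x))^-1) by rewrite -invfM expr2.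
by rewrite expr2 !realcE.
Qed.

Lemma cderiv_hv1 x : 0 < x -> cderiv v x (hv1 b la k v x) ->
  cderiv (hv1 b la k v) x (hv2 b la k v x).
Proof.
move=> x0 dv.
apply: cderiv_eq (cderivM (cderiv_onem_expV x0) (cderiv_hrhs k x0 dv)) _.
rewrite /hv2 /hv1; move: (onem_neq0 x0); rewrite !realcE !realcV !realcE.
set t := (expR (- x))%:C; set e := (expR x)%:C; set J := Jh v x; set K := Kh v x.
by move=> ht; field.
Qed.

Lemma half_ode_derive x : half_ode b la k v -> 0 < x -> cderiv v x (hv1 b la k v x).
Proof.
move=> h x0.
apply: (@cderiv_near _ (fun y => ((1 - expR (- y))^-1)%:C * ((1 - expR (- y))%:C * v y))).
  have : \forall y \near x, 0 < y by exact: lt_nbhsr.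
  apply: filterS => y y0.
  by rewrite mulrA -rmorphM mulVf ?gt_eqF ?onem_exp_gt0 // mul1r.
apply: cderiv_eq (cderivM (cderiv_onem_expV x0) (h x x0)) _.
rewrite /hrhs /hv1; move: (onem_neq0 x0); rewrite !realcE !realcV !realcE.
set t := (expR (- x))%:C; set e := (expR x)%:C; set J := Jh v x; set K := Kh v x.
by move=> ht; field.
Qed.

Lemma derive_half_ode : (forall x, 0 < x -> cderiv v x (hv1 b la k v x)) ->
  half_ode b la k v.
Proof.
move=> h x x0.
apply: cderiv_eq (cderivM (cderiv_real (is_derive_onem_exp x)) (h x x0)) _.
rewrite /hrhs /hv1; move: (onem_neq0 x0); rewrite !realcE !realcV !realcE.
set t := (expR (- x))%:C; set e := (expR x)%:C; set J := Jh v x; set K := Kh v x.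
by move=> ht; field.
Qed.

(** Once [hv1] and [hv2] are unfolded, this is a rational identity in $t=e^{-x}$ in which [J], [K],
    [k] and [v x] are independent unknowns. *)
Lemma cderiv_momentum x : half_ode b la k v -> 0 < x ->
  cderiv (fun y => v y - hv2 b la k v y) x
  (((1 - expR (- x))^-1)%:C * (la - (b * expR (- x))%:C) * (v x - hv2 b la k v x)).
Proof.
move=> h x0; have dv := half_ode_derive h x0; have dv1 := cderiv_hv1 x0 dv.
have dt1 : cderiv (fun y => la + ((1 - b) * expR (- y))%:C) x (- ((1 - b) * expR (- x)))%:C.
  apply: cderiv_eq (cderivD (cderiv_cst _ _) (cderiv_real (is_deriveM (is_derive_cst (1 - b) x 1) (is_derive_expN x)))) _.
  by rewrite add0r /GRing.scale /= mulr0 addr0 mulrN.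
have dt2 : cderiv (fun y => ((1 - b) * expR (- y))%:C) x (- ((1 - b) * expR (- x)))%:C.
  apply: cderiv_eq (cderiv_real (is_deriveM (is_derive_cst (1 - b) x 1) (is_derive_expN x))) _.
  by rewrite /GRing.scale /= mulr0 addr0 mulrN.
have D := cderivM (cderiv_onem_expV x0) (cderivD (cderivD (cderivB (cderivD (cderivM dt1 dv1)
  (cderivM dt2 dv)) (cderivZ (3 - 3 * b / 2)%:C (cderiv_eJh x0))) (cderivZ (b / 2)%:C (cderiv_eKh x0)))
  (cderivZ k (cderiv_real (is_derive_expN x)))).
apply: cderiv_eq (cderivB dv D) _.
rewrite /hv2 /hv1; move: (onem_neq0 x0); rewrite !realcE !realcV !realcE.
set t := (expR (- x))%:C; set e := (expR x)%:C; set J := Jh v x; set K := Kh v x.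
by move=> ht; field.
Qed.

Lemma momentum_mexp : half_ode b la k v ->
  exists M : R[i], forall x, 0 < x -> v x - hv2 b la k v x = M * mexp b la x.
Proof.
move=> h.
(* The integrating factor [cexp (phi x)] is the inverse of [mexp b la x]. *)
pose phi x := - (la * x%:C + (la - b%:C) * (ln (1 - expR (- x)))%:C).
have dE x : 0 < x -> cderiv (fun y => cexp (phi y)) x
    (- (((1 - expR (- x))^-1)%:C * (la - (b * expR (- x))%:C)) * cexp (phi x)).
  move=> x0; have h' := onem_neq0 x0.
  apply: cderiv_eq (cderiv_cexp (cderivN (cderivD (cderivZ la (cderiv_real (is_derive_id _ _)))
    (cderivZ (la - b%:C) (cderiv_real (is_derive_ln_onem_exp x0)))))) _.
  by congr (_ * _); rewrite !realcE !realcV !realcE; field.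
have d0 x : 0 < x -> cderiv (fun y => (v y - hv2 b la k v y) * cexp (phi y)) x 0.
  move=> x0; apply: cderiv_eq (cderivM (cderiv_momentum h x0) (dE x x0)) _.
  ring.
exists ((v 1 - hv2 b la k v 1) * cexp (phi 1)) => x x0.
rewrite -(cderiv0_cst d0 x0 ltr01) -mulrA.
by rewrite /phi /mexp cexpN mulr1.
Qed.

Lemma eJh_le x : 0 <= x -> cmod ((expR x)%:C * Jh v x) <= B * expR (- x).
Proof.
move=> x0; rewrite cmodM cmod_real (ger0_norm (expR_ge0 _)).
have h := @cmod_tail_le _ _ B 2 x mv (fun y _ => vB y) (ltr0Sn _ _).
apply: (le_trans (ler_wpM2l (expR_ge0 x) h)).
rewrite le_eqVlt; apply/orP; left; apply/eqP.
have -> : expR (- 2 * x) = expR (- x) * expR (- x) by rewrite -expRD; congr expR; ring.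
have e : expR x * expR (- x) = 1 by rewrite -expRD subrr expR0.
transitivity ((expR x * expR (- x)) * (B * expR (- x))); first by field.
by rewrite e mul1r.
Qed.

Lemma eKh_le x : 0 <= x -> cmod ((expR (- x))%:C * Kh v x) <= 2 * B * (x * expR (- x)).
Proof.
move=> x0; rewrite cmodM cmod_real (ger0_norm (expR_ge0 _)).
have h := @cmod_Kh_le _ v B x mv (fun y _ => vB y) x0.
apply: (le_trans (ler_wpM2l (expR_ge0 _) h)); rewrite le_eqVlt; apply/orP; left.
by apply/eqP; ring.
Qed.

End HalfOde.

End HalfLine.

(** * Decay from integrability and a bounded derivative *)

Section Asymptotics.
Context {R : realType}.
Notation mu := (@lebesgue_measure R).

Lemma cvg_expN_pinfty : expR (- x) @[x --> +oo] --> (0 : R).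
Proof. exact: cvgr_expR. Qed.

Lemma cvg_id_expN_pinfty : x * expR (- x) @[x --> +oo] --> (0 : R).
Proof.
have h : 2 * expR (- (1 / 2) * x) @[x --> +oo] --> (0 : R).
  rewrite -(mulr0 2); apply: cvgMr; apply: cvg_expM; lra.
apply: squeeze_cvgr h; last exact: (cvg_cst (0 : R)).
near=> x.
have x0 : 0 <= x by near: x; exact: nbhs_pinfty_ge.
rewrite mulr_ge0 ?expR_ge0 //=.
have -> : expR (- x) = expR (- (1 / 2) * x) * expR (- (1 / 2) * x).
  by rewrite -expRD; congr expR; field.
rewrite mulrA ler_wpM2r ?expR_ge0 //.
have h1 : 1 + x / 2 <= expR (x / 2) by exact: expR_ge1Dx.
have h2 : expR (x / 2) * expR (- (1 / 2) * x) = 1.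
  by rewrite -expRD -[RHS]expR0; congr expR; field.
have h3 := expR_ge0 (- (1 / 2) * x).
nra.
Unshelve. all: by end_near. Qed.

(** Barbalat's lemma. If [q x >= e], the bound on the derivative keeps [q] above [e / 2] on an
    interval of fixed length after [x]. The primitive [G], bounded and nondecreasing, then gains a
    fixed amount, which is impossible once it is closer than that to its supremum. *)
Lemma barbalat (q dq : R -> R) (L : R) : 0 < L ->
  (forall x : R, 1 <= x -> is_derive x (1 : R) q (dq x)) ->
  (forall x, 1 <= x -> `|dq x| <= L) -> (forall x, 0 <= q x) ->
  mu.-integrable `[1, +oo[ (EFin \o q) -> q x @[x --> +oo] --> (0 : R).
Proof.
move=> L0 hd hL q0 iq.
have iqS a b : 1 <= a -> mu.-integrable `[a, b] (EFin \o q).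
  by move=> a1; apply: integrableS iq => //; apply: subset_itv; rewrite bnd_simp.
pose G y := \int[mu]_(x in `[1, y]) q x.
have GB y : 1 <= y -> G y <= \int[mu]_(x in `[1, +oo[) q x.
  move=> y1; have := @Rintegral_itvB _ q (BLeft 1) +oo%O y iq.
  rewrite !bnd_simp => /(_ y1 isT).
  move=> E; rewrite -subr_ge0 /G E; apply: Rintegral_ge0 => ? _; exact: q0.
have GD x y : 1 <= x -> x < y -> G y - G x = \int[mu]_(z in `[x, y]) q z.
  move=> x1 xy; rewrite /G Rintegral_itvB ?bnd_simp ?(ltW xy) //; last exact: iqS.
  rewrite Rintegral_itv_obnd_cbnd //.
  by apply: integrableS (iqS x y x1) => //; apply: subset_itv; rewrite bnd_simp.
pose S := sup [set G y | y in [set y | 1 <= y]].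
have hS : has_sup [set G y | y in [set y | 1 <= y]].
  split; first by exists (G 1); exists 1 => //=.
  by exists (\int[mu]_(x in `[1, +oo[) q x) => _ [y y1 <-]; exact: GB.
apply/cvgr0Pnorm_lt => e e0.
(* Over this length [q] can lose at most [L * h = e / 2]. *)
pose h := e / (2 * L).
have h0 : 0 < h by rewrite divr_gt0 // mulr_gt0.
have d0 : 0 < e / 2 * h by rewrite mulr_gt0 // divr_gt0.
have [_ [X X1 <-] hX] := sup_adherent d0 hS.
near=> x.
have xX : X < x by near: x; apply: nbhs_pinfty_gt; exact: num_real.
have x1 : 1 <= x by apply: le_trans (ltW xX).
rewrite ger0_norm // ltNge; apply/negP => ex.
have xh : x < x + h by rewrite ltrDl.
have lowq z : x <= z <= x + h -> e / 2 <= q z.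
  move=> /andP[xz zh]; have [->|xz'] := eqVneq z x; first by lra.
  have xlz : x < z by rewrite lt_neqAle eq_sym xz' xz.
  have [||c] := @MVT _ q dq x z xlz.
  - by move=> t; rewrite in_itv /= => /andP[t1 _]; apply: hd; lra.
  - apply: derivable_within_continuous => t; rewrite in_itv /= => /andP[t1 _].
    by have [] : is_derive t (1 : R) q (dq t) by apply: hd; lra.
  rewrite in_itv /= => /andP[c1 c2] E.
  have hc : `|dq c| <= L by apply: hL; lra.
  have hz : `|dq c * (z - x)| <= L * h.
    rewrite normrM; apply: ler_pM => //.
    by rewrite ger0_norm; lra.
  have hLh : L * h = e / 2 by rewrite /h; field; rewrite gt_eqF.
  rewrite hLh in hz; move: hz; rewrite ler_norml -E => /andP[hz _]; lra.
have : e / 2 * h <= \int[mu]_(z in `[x, x + h]) q z.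
  have -> : e / 2 * h = \int[mu]_(z in `[x, x + h]) (e / 2).
    by rewrite Rintegral_cst_itv; [congr (_ * _); ring|lra].
  apply: le_Rintegral => //; first exact: integrable_cst_itv.
  - exact: iqS.
rewrite -GD //.
have : G (x + h) <= S.
  by apply: sup_upper_bound => //; exists (x + h) => //=; lra.
have : G X <= G x.
  rewrite -subr_ge0 GD //; apply: Rintegral_ge0 => ? _; exact: q0.
move: hX; rewrite -/S; lra.
Unshelve. all: by end_near. Qed.

End Asymptotics.

(** * Behaviour of a solution at the origin and at infinity *)

Section HalfLineConclusion.
Context {R : realType}.
Notation mu := (@lebesgue_measure R).
Variables (b : R) (la k : R[i]) (v : R -> R[i]) (B : R) (v0 : R[i]).
Hypothesis mv : cmeas setT v.
Hypothesis vB : forall x, cmod (v x) <= B.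
Hypothesis cv : forall x, 0 < x -> ccont v x.
Hypothesis lv : ccvg (0 : R)^'+ v v0.

Let B0 : 0 <= B.
Proof. by apply: le_trans (vB 0); exact: cmod_ge0. Qed.

Lemma cvg_exp0 (a : R) : expR (a * x) @[x --> (0 : R)^'+] --> (1 : R).
Proof.
apply: cvg_at_right_filter.
by have := @continuous_expM R a 0; rewrite /prop_for /continuous_at mulr0 expR0.
Qed.

Lemma cvg_expN0 : expR (- x) @[x --> (0 : R)^'+] --> (1 : R).
Proof. by have := cvg_exp0 (-1); under eq_fun do rewrite mulN1r. Qed.

Lemma cvg_onem0 : 1 - expR (- x) @[x --> (0 : R)^'+] --> (0 : R).
Proof. by rewrite -[X in _ --> X](subrr (1 : R)); apply: cvgB; [exact: cvg_cst|exact: cvg_expN0]. Qed.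

Lemma Jh_lim0 : ccvg (0 : R)^'+ (Jh v) (Jh v 0).
Proof.
apply/ccvg_cmodP.
have h : 2 * (B * x) @[x --> (0 : R)^'+] --> (0 : R).
  have E : (0 : R) = 2 * (B * 0) by rewrite !mulr0.
  by rewrite [X in _ --> X]E; apply: cvgMr; apply: cvgMr; apply: cvg_at_right_filter; exact: cvg_id.
apply: squeeze_cvgr h; last exact: (cvg_cst (0 : R)).
near=> x.
have x0 : 0 < x by near: x; exact: nbhs_right_gt.
rewrite cmod_ge0 /=.
have ij : cintegrable `[0, +oo[ (fun y => (expR (- 2 * y))%:C * v y).
  by apply: (@cintegrable_tail _ _ B).
rewrite /Jh (cintegral_tail x0 ij) addrAC subrr add0r cmodN.
have -> : B * x = \int[mu]_(y in `[0, x]) B by rewrite Rintegral_cst_itv ?subr0 // ltW.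
apply: cmod_cintegral_le => //.
- apply: cmeasM; first exact: cmeas_expM.
  by apply: cmeasS mv.
- exact: integrable_cst_itv.
- move=> y /=; rewrite in_itv /= => /andP[y0 _].
  rewrite cmodM cmod_real ger0_norm ?expR_ge0 // -[leRHS]mul1r.
  apply: ler_pM => //; rewrite ?expR_ge0 ?cmod_ge0 //.
  by rewrite expR_le1; lra.
Unshelve. all: by end_near. Qed.

Lemma eJh_lim0 : ccvg (0 : R)^'+ (fun x => (expR x)%:C * Jh v x) (Jh v 0).
Proof.
have c1 : expR x @[x --> (0 : R)^'+] --> (1 : R).
  by have := cvg_exp0 1; under eq_fun do rewrite mul1r.
by apply: ccvg_eq (ccvgM (ccvg_real c1) Jh_lim0) (mul1r _).
Qed.

Lemma eKh_lim0 : ccvg (0 : R)^'+ (fun x => (expR (- x))%:C * Kh v x) 0.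
Proof.
apply/ccvg_cmodP.
have h : 2 * B * (x * expR (- x)) @[x --> (0 : R)^'+] --> (0 : R).
  have E : (0 : R) = 2 * B * (0 * 1) by rewrite mul0r !mulr0.
  rewrite [X in _ --> X]E; apply: cvgMr; apply: cvgM; last exact: cvg_expN0.
  by apply: cvg_at_right_filter; exact: cvg_id.
apply: squeeze_cvgr h; last exact: (cvg_cst (0 : R)).
near=> x.
have x0 : 0 < x by near: x; exact: nbhs_right_gt.
by rewrite cmod_ge0 subr0 (eKh_le mv vB (ltW x0)).
Unshelve. all: by end_near. Qed.

Lemma hv1_num_lim0 : ccvg (0 : R)^'+ (fun x => (1 - expR (- x))%:C * hv1 b la k v x)
  ((la + (2 - b)%:C) * v0 - (3 - 3 * b / 2)%:C * Jh v 0 - k).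
Proof.
apply: (@ccvg_near _ _ _ _ (fun x => (la + ((2 - b) * expR (- x))%:C) * v x
  - (3 - 3 * b / 2)%:C * ((expR x)%:C * Jh v x)
  - (b / 2)%:C * ((expR (- x))%:C * Kh v x)
  - k * (expR (- x))%:C)).
  near=> x; have x0 : 0 < x by near: x; exact: nbhs_right_gt.
  by rewrite /hv1 mulrA -rmorphM mulfV ?gt_eqF ?onem_exp_gt0 // mul1r.
have c1 : (2 - b) * expR (- x) @[x --> (0 : R)^'+] --> 2 - b.
  by rewrite -[X in _ --> X]mulr1; apply: cvgMr; exact: cvg_expN0.
apply: ccvg_eq (ccvgB (ccvgB (ccvgB (ccvgM (ccvgD (ccvg_cst la) (ccvg_real c1)) lv)
  (ccvgM (ccvg_cst _) eJh_lim0)) (ccvgM (ccvg_cst _) eKh_lim0))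
  (ccvgM (ccvg_cst k) (ccvg_real cvg_expN0))) _.
by rewrite mulr0 subr0 mulr1.
Unshelve. all: by end_near. Qed.

Hypothesis ode : half_ode b la k v.

(** The matching condition at the origin. L'Hôpital's rule applied to $v=((1-e^{-x})v)/(1-e^{-x})$
    gives as limit that of $e^x$ times [hrhs], namely [E + v0]; but [v] tends to [v0]. *)
Lemma half_ode_at0 :
  (la + (2 - b)%:C) * v0 - (3 - 3 * b / 2)%:C * Jh v 0 - k = 0.
Proof.
set E := LHS.
have hl : ccvg (0 : R)^'+ (hrhs b la k v) (E + v0).
  apply: (@ccvg_near _ _ _ _ (fun x => (1 - expR (- x))%:C * hv1 b la k v x + (expR (- x))%:C * v x)).
    near=> x; have x0 : 0 < x by near: x; exact: nbhs_right_gt.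
    rewrite /hv1 mulrA -rmorphM mulfV ?gt_eqF ?onem_exp_gt0 // mul1r /hrhs !realcE; ring.
  apply: ccvgD; first exact: hv1_num_lim0.
  by apply: ccvg_eq (ccvgM (ccvg_real cvg_expN0) lv) (mul1r _).
have g0 : ccvg (0 : R)^'+ (fun y => (1 - expR (- y))%:C * v y) 0.
  by apply: ccvg_eq (ccvgM (ccvg_real cvg_onem0) lv) (mul0r _).
have hq : ccvg (0 : R)^'+ (fun y => hrhs b la k v y * ((expR (- y))^-1)%:C) (E + v0).
  have c1 : (expR (- x))^-1 @[x --> (0 : R)^'+] --> (1 : R).
    by rewrite -[X in _ --> X]invr1; apply: cvgV; [exact: oner_neq0|exact: cvg_expN0].
  by apply: ccvg_eq (ccvgM hl (ccvg_real c1)) _; rewrite mulr1.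
suff : v0 = E + v0.
  by move=> /eqP; rewrite eq_sym -subr_eq0 addrK => /eqP.
apply: (ccvg_unique lv).
have Lop (f df : R -> R) (l : R) : (forall x : R, 0 < x -> is_derive x (1 : R) f (df x)) ->
   f x @[x --> (0 : R)^'+] --> (0 : R) -> df x * (expR (- x))^-1 @[x --> (0 : R)^'+] --> l ->
   f x / (1 - expR (- x)) @[x --> (0 : R)^'+] --> l.
  move=> fd f0 fl.
  apply: (@lhopital_at_right _ f df (fun x => 1 - expR (- x)) (fun x => expR (- x)) 0 1 l) => //.
  - by move=> x; rewrite in_itv /= => /andP[x0 _]; exact: fd.
  - by move=> x _; exact: is_derive_onem_exp.
  - exact: cvg_onem0.
  - by move=> x _; rewrite gt_eqF // expR_gt0.
apply: (@ccvg_near _ _ _ _ (fun x => ((1 - expR (- x))%:C * v x) * ((1 - expR (- x))^-1)%:C)).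
  near=> x; have x0 : 0 < x by near: x; exact: nbhs_right_gt.
  by rewrite mulrAC -rmorphM mulfV ?gt_eqF ?onem_exp_gt0 // mul1r.
case: g0 => g1 g2; case: hq => q1 q2; split.
- under eq_fun do rewrite cReM /= mulr0 subr0.
  apply: (Lop _ (fun x => Re (hrhs b la k v x))) => //.
  + by move=> x x0; have [] := ode x0.
  + by move: q1; under eq_fun do rewrite cReM /= mulr0 subr0.
- under eq_fun do rewrite cImM /= mulr0 add0r.
  apply: (Lop _ (fun x => Im (hrhs b la k v x))) => //.
  + by move=> x x0; have [] := ode x0.
  + by move: q2; under eq_fun do rewrite cImM /= mulr0 add0r.
Unshelve. all: by end_near. Qed.

Lemma hv1_lim0 : ccvg (0 : R)^'+ (fun x => (1 - expR (- x))%:C * hv1 b la k v x) 0.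
Proof. by rewrite -half_ode_at0; exact: hv1_num_lim0. Qed.

Lemma hv2_lim0 : ccvg (0 : R)^'+ (fun x => ((1 - expR (- x)) ^+ 2)%:C * hv2 b la k v x) 0.
Proof.
apply: (@ccvg_near _ _ _ _ (fun x => (la + ((1 - b) * expR (- x))%:C) * ((1 - expR (- x))%:C * hv1 b la k v x)
  + (1 - expR (- x))%:C * (((1 - b) * expR (- x))%:C * v x
  - (3 - 3 * b / 2)%:C * ((expR x)%:C * Jh v x)
  + (b / 2)%:C * ((expR (- x))%:C * Kh v x)
  + k * (expR (- x))%:C))).
  near=> x; have x0 : 0 < x by near: x; exact: nbhs_right_gt.
  rewrite /hv2 mulrA -rmorphM expr2 mulfK ?gt_eqF ?onem_exp_gt0 // !mulrDr mulrCA.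
  by rewrite !addrA.
have c1 : (1 - b) * expR (- x) @[x --> (0 : R)^'+] --> 1 - b.
  by rewrite -[X in _ --> X]mulr1; apply: cvgMr; exact: cvg_expN0.
apply: ccvg_eq (ccvgD (ccvgM (ccvgD (ccvg_cst la) (ccvg_real c1)) hv1_lim0)
  (ccvgM (ccvg_real cvg_onem0) (ccvgD (ccvgD (ccvgB (ccvgM (ccvg_real c1) lv)
    (ccvgM (ccvg_cst _) eJh_lim0)) (ccvgM (ccvg_cst _) eKh_lim0))
  (ccvgM (ccvg_cst k) (ccvg_real cvg_expN0))))) _.
by rewrite mulr0 mul0r addr0.
Unshelve. all: by end_near. Qed.

(** By the matching condition, $(1-e^{-x})^2(v-v'')$ tends to 0. On the other hand $(1-e^{-x})^2$
    times the modulus of [mexp] is at least $e^{-|\mathrm{Re}\,\lambda|}$ for $0<x<1$, because its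
    logarithm contains a negative number with the nonpositive coefficient [2 + Re la - b]. *)
Lemma momentum_eq0_at0 (M : R[i]) : 2 + Re la - b <= 0 ->
  (forall x, 0 < x -> v x - hv2 b la k v x = M * mexp b la x) -> M = 0.
Proof.
move=> hla hM.
have l1 : ccvg (0 : R)^'+ (fun x => ((1 - expR (- x)) ^+ 2)%:C * (M * mexp b la x)) 0.
  apply: (@ccvg_near _ _ _ _ (fun x => ((1 - expR (- x)) ^+ 2)%:C * v x -
    ((1 - expR (- x)) ^+ 2)%:C * hv2 b la k v x)).
    near=> x; have x0 : 0 < x by near: x; exact: nbhs_right_gt.
    by rewrite -hM // mulrBr.
  have c2 : (1 - expR (- x)) ^+ 2 @[x --> (0 : R)^'+] --> (0 : R).
    have c3 : (1 - expR (- x)) * (1 - expR (- x)) @[x --> (0 : R)^'+] --> (0 * 0 : R).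
      by apply: cvgM; exact: cvg_onem0.
    rewrite mulr0 in c3.
    by apply: cvg_trans c3; apply: near_eq_cvg; apply: nearW => x; rewrite expr2.
  by apply: ccvg_eq (ccvgB (ccvgM (ccvg_real c2) lv) hv2_lim0) _; rewrite mul0r subr0.
apply: cmod_eq0; apply/eqP; rewrite eq_le cmod_ge0 andbT leNgt; apply/negP => M0.
have e0 : 0 < cmod M * expR (- `|Re la|) by rewrite mulr_gt0 // expR_gt0.
have hn : \forall x \near (0 : R)^'+,
    `|cmod (((1 - expR (- x)) ^+ 2)%:C * (M * mexp b la x))| < cmod M * expR (- `|Re la|).
  have /cvgr0Pnorm_lt h : cmod (((1 - expR (- x)) ^+ 2)%:C * (M * mexp b la x)) @[x --> (0 : R)^'+] --> (0 : R).
    by apply: ccvg0_cmod; exact: l1.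
  exact: h.
near (0 : R)^'+ => x.
have x0 : 0 < x by near: x; exact: nbhs_right_gt.
have x1 : x < 1 by near: x; exact: nbhs_right_lt.
have : `|cmod (((1 - expR (- x)) ^+ 2)%:C * (M * mexp b la x))| < cmod M * expR (- `|Re la|).
  by near: x.
rewrite ger0_norm ?cmod_ge0 // !cmodM cmod_real cmod_mexp ger0_norm ?sqr_ge0 //.
rewrite mulrCA ltr_pM2l // ltNge => /negP; apply.
have h := onem_exp_gt0 x0.
have -> : (1 - expR (- x)) ^+ 2 = expR (2 * ln (1 - expR (- x))).
  by rewrite mulrC expRM_natr lnK.
rewrite -expRD ler_expR.
have hln : ln (1 - expR (- x)) <= 0.
  rewrite -ln1 ler_ln ?posrE //; have := expR_ge0 (- x); lra.
have hx : - `|Re la| <= Re la * x.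
  have : `|Re la * x| <= `|Re la|.
    by rewrite normrM -[leRHS]mulr1 ler_wpM2l // ger0_norm; lra.
  by rewrite ler_norml => /andP[].
nra.
Unshelve. all: by end_near. Qed.

Lemma hv1_bounded : exists2 L : R, 0 < L & forall x, 1 <= x -> cmod (hv1 b la k v x) <= L.
Proof.
pose t1 := (1 - expR (- 1 : R))^-1.
have t10 : 0 < t1 by rewrite invr_gt0 onem_exp_gt0.
pose L := t1 * ((cmod la + `|2 - b|) * B + `|3 - 3 * b / 2| * B + `|b / 2| * (2 * B) + cmod k) + 1.
have LN : 0 <= (cmod la + `|2 - b|) * B + `|3 - 3 * b / 2| * B + `|b / 2| * (2 * B) + cmod k.
  by rewrite !addr_ge0 ?mulr_ge0 ?addr_ge0 ?cmod_ge0.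
exists L; first by rewrite ltr_pwDr // mulr_ge0 // ltW.
move=> x x1; have x0 : 0 < x by lra.
have ex1 : expR (- x) <= 1 by rewrite -expR0 ler_expR; lra.
have ex0 := expR_ge0 (- x).
rewrite /hv1 cmodM cmod_real ger0_norm ?invr_ge0 ?subr_ge0 //.
apply: (@le_trans _ _ (t1 * ((cmod la + `|2 - b|) * B + `|3 - 3 * b / 2| * B + `|b / 2| * (2 * B) + cmod k)));
  last by rewrite /L lerDl.
apply: ler_pM; rewrite ?invr_ge0 ?subr_ge0 ?cmod_ge0 //.
  rewrite lef_pV2 ?posrE ?onem_exp_gt0 // lerD2l lerN2 ler_expR; lra.
apply: (le_trans (cmodB _ _)); apply: lerD; last first.
  by rewrite cmodM cmod_real ger0_norm // ler_piMr ?cmod_ge0.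
apply: (le_trans (cmodB _ _)); apply: lerD; last first.
  rewrite cmodM cmod_real ler_wpM2l //; apply: (le_trans (eKh_le mv vB (ltW x0))).
  have h : x * expR (- x) <= 1.
    have h1 : 1 + x <= expR x := expR_ge1Dx x.
    have h2 : expR x * expR (- x) = 1 by rewrite -expRD subrr expR0.
    nra.
  by rewrite ler_piMr ?mulr_ge0.
apply: (le_trans (cmodB _ _)); apply: lerD; last first.
  rewrite cmodM cmod_real ler_wpM2l //; apply: (le_trans (eJh_le mv vB (ltW x0))).
  by rewrite ler_piMr.
rewrite cmodM; apply: ler_pM; rewrite ?cmod_ge0 //.
apply: (le_trans (cmodD _ _)); rewrite lerD2l cmod_real normrM (ger0_norm ex0).
by rewrite ler_piMr.
Qed.

Hypothesis iv : mu.-integrable `[1, +oo[ (EFin \o (fun x => cmod (v x) ^+ 2)).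

(** Square integrability alone gives no limit. The equation bounds $v'$ on $[1,\infty)$, hence the
    derivative of $|v|^2$, and Barbalat's lemma applies. *)
Lemma half_ode_decay : ccvg (+oo : set_system R) v 0.
Proof.
apply/ccvg_cmodP; under eq_fun do rewrite subr0.
suff h : cmod (v x) ^+ 2 @[x --> +oo] --> (0 : R).
  have -> : (fun x => cmod (v x)) = (fun x => Num.sqrt (cmod (v x) ^+ 2)).
    by apply/funext => x; rewrite sqrtr_sqr ger0_norm ?cmod_ge0.
  rewrite -(sqrtr0 R); apply: continuous_cvg => //; exact: sqrt_continuous.
have [L L0 hL] := hv1_bounded.
pose dq x := 2 * (Re (v x) * Re (hv1 b la k v x) + Im (v x) * Im (hv1 b la k v x)).
apply: (@barbalat _ _ dq (4 * B * L + 1)) => //.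
- by rewrite ltr_pwDr // !mulr_ge0 // ltW.
- move=> x x1; have x0 : 0 < x by lra.
  have [d1 d2] := half_ode_derive ode x0.
  have -> : (fun x => cmod (v x) ^+ 2) = (fun x => Re (v x) * Re (v x) + Im (v x) * Im (v x)).
    by apply/funext => y; rewrite cmod_sqr !expr2.
  apply: is_derive_eq (is_deriveD (is_deriveM d1 d1) (is_deriveM d2 d2)) _.
  rewrite /GRing.scale /= /dq; ring.
- move=> x x1; have := hL x x1; set w := hv1 b la k v x => hw.
  have a1 : `|Re (v x)| <= B by apply: le_trans (Re_le_cmod _) (vB x).
  have a2 : `|Im (v x)| <= B by apply: le_trans (Im_le_cmod _) (vB x).
  have a3 : `|Re w| <= L by apply: le_trans (Re_le_cmod _) hw.
  have a4 : `|Im w| <= L by apply: le_trans (Im_le_cmod _) hw.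
  have a5 : `|Re (v x) * Re w| <= B * L by rewrite normrM ler_pM.
  have a6 : `|Im (v x) * Im w| <= B * L by rewrite normrM ler_pM.
  rewrite /dq -/w normrM ger0_norm //.
  have := ler_normD (Re (v x) * Re w) (Im (v x) * Im w); lra.
- by move=> x; exact: sqr_ge0.
Qed.

Lemma cvg_onemV_pinfty : (1 - expR (- x))^-1 @[x --> +oo] --> (1 : R).
Proof.
have h : 1 - expR (- x) @[x --> +oo] --> (1 : R).
  by rewrite -[X in _ --> X]subr0; apply: cvgB; [exact: cvg_cst|exact: cvg_expN_pinfty].
by rewrite -[X in _ --> X]invr1; apply: cvgV h; exact: oner_neq0.
Qed.

Lemma eJh_lim_pinfty : ccvg (+oo : set_system R) (fun x => (expR x)%:C * Jh v x) 0.
Proof.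
apply/ccvg_cmodP.
have h : B * expR (- x) @[x --> +oo] --> (0 : R).
  by rewrite -[X in _ --> X](mulr0 B); apply: cvgMr; exact: cvg_expN_pinfty.
apply: squeeze_cvgr h; last exact: (cvg_cst (0 : R)).
near=> x; have x0 : 0 <= x by near: x; exact: nbhs_pinfty_ge.
by rewrite cmod_ge0 subr0 (eJh_le mv vB x0).
Unshelve. all: by end_near. Qed.

Lemma eKh_lim_pinfty : ccvg (+oo : set_system R) (fun x => (expR (- x))%:C * Kh v x) 0.
Proof.
apply/ccvg_cmodP.
have h : 2 * B * (x * expR (- x)) @[x --> +oo] --> (0 : R).
  by rewrite -[X in _ --> X](mulr0 (2 * B)); apply: cvgMr; exact: cvg_id_expN_pinfty.
apply: squeeze_cvgr h; last exact: (cvg_cst (0 : R)).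
near=> x; have x0 : 0 <= x by near: x; exact: nbhs_pinfty_ge.
by rewrite cmod_ge0 subr0 (eKh_le mv vB x0).
Unshelve. all: by end_near. Qed.

Lemma hv1_lim_pinfty : ccvg (+oo : set_system R) (hv1 b la k v) 0.
Proof.
have c1 : (2 - b) * expR (- x) @[x --> +oo] --> (0 : R).
  by rewrite -[X in _ --> X](mulr0 (2 - b)); apply: cvgMr; exact: cvg_expN_pinfty.
apply: ccvg_eq (ccvgM (ccvg_real cvg_onemV_pinfty) (ccvgB (ccvgB (ccvgB
  (ccvgM (ccvgD (ccvg_cst la) (ccvg_real c1)) half_ode_decay)
  (ccvgM (ccvg_cst _) eJh_lim_pinfty)) (ccvgM (ccvg_cst _) eKh_lim_pinfty))
  (ccvgM (ccvg_cst k) (ccvg_real cvg_expN_pinfty)))) _.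
by rewrite !mulr0 !subr0 mulr0.
Qed.

Lemma hv2_lim_pinfty : ccvg (+oo : set_system R) (hv2 b la k v) 0.
Proof.
have c1 : (1 - b) * expR (- x) @[x --> +oo] --> (0 : R).
  by rewrite -[X in _ --> X](mulr0 (1 - b)); apply: cvgMr; exact: cvg_expN_pinfty.
apply: ccvg_eq (ccvgM (ccvg_real cvg_onemV_pinfty) (ccvgD (ccvgD (ccvgB (ccvgD
  (ccvgM (ccvgD (ccvg_cst la) (ccvg_real c1)) hv1_lim_pinfty)
  (ccvgM (ccvg_real c1) half_ode_decay))
  (ccvgM (ccvg_cst _) eJh_lim_pinfty)) (ccvgM (ccvg_cst _) eKh_lim_pinfty))
  (ccvgM (ccvg_cst k) (ccvg_real cvg_expN_pinfty)))) _.
by rewrite !mulr0 !subr0 !addr0 mulr0.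
Qed.

(** Both $v$ and $v''$ tend to 0, whereas the modulus of [mexp] is eventually at least $e^{-1}$: the
    power of $1-e^{-x}$ tends to 1 and the exponential does not decay when [0 <= Re la]. *)
Lemma momentum_eq0_pinfty (M : R[i]) : 0 <= Re la ->
  (forall x, 0 < x -> v x - hv2 b la k v x = M * mexp b la x) -> M = 0.
Proof.
move=> la0 hM.
have l1 : ccvg (+oo : set_system R) (fun x => M * mexp b la x) 0.
  apply: (@ccvg_near _ _ _ _ (fun x => v x - hv2 b la k v x)).
    near=> x; have x0 : 0 < x by near: x; apply: nbhs_pinfty_gt; exact: num_real.
    by rewrite hM.
  by apply: ccvg_eq (ccvgB half_ode_decay hv2_lim_pinfty) _; rewrite subr0.
apply: cmod_eq0; apply/eqP; rewrite eq_le cmod_ge0 andbT leNgt; apply/negP => M0.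
have e0 : 0 < cmod M * expR (- 1) by rewrite mulr_gt0 // expR_gt0.
have hn : \forall x \near +oo, `|cmod (M * mexp b la x)| < cmod M * expR (- 1).
  have /cvgr0Pnorm_lt h : cmod (M * mexp b la x) @[x --> +oo] --> (0 : R).
    by apply: ccvg0_cmod; exact: l1.
  exact: h.
have hl : (Re la - b) * ln (1 - expR (- x)) @[x --> +oo] --> (0 : R).
  rewrite -[X in _ --> X](mulr0 (Re la - b)); apply: cvgMr.
  rewrite -(ln1 R); apply: continuous_cvg; first exact: continuous_ln.
  by rewrite -[X in _ --> X]subr0; apply: cvgB; [exact: cvg_cst|exact: cvg_expN_pinfty].
move/cvgr0Pnorm_lt: hl => /(_ _ ltr01) hl.
near (+oo : set_system R) => x.
have x0 : 0 < x by near: x; apply: nbhs_pinfty_gt; exact: num_real.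
have : `|cmod (M * mexp b la x)| < cmod M * expR (- 1) by near: x.
rewrite ger0_norm ?cmod_ge0 // cmodM cmod_mexp ltr_pM2l // ltr_expR.
have : `|(Re la - b) * ln (1 - expR (- x))| < 1 by near: x.
have : 0 <= Re la * x by rewrite mulr_ge0 // ltW.
rewrite ltr_norml => h1 /andP[h2 _]; lra.
Unshelve. all: by end_near. Qed.

End HalfLineConclusion.

(** * Solutions without momentum *)

Section ZeroMomentum.
Context {R : realType}.

(** The functions $(v'+v)e^{-x}$ and $(v'-v)e^{x}$ are constant, and boundedness excludes the
    growing exponential. *)
Lemma second_order_decay (v v1 : R -> R[i]) (B : R) :
  (forall x, 0 < x -> cderiv v x (v1 x)) -> (forall x, 0 < x -> cderiv v1 x (v x)) ->
  (forall x, 0 < x -> cmod (v x) <= B) ->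
  exists A : R[i], forall x, 0 < x -> v x = A * (expR (- x))%:C.
Proof.
move=> d1 d2 vB.
have e1 x : (expR x)%:C * (expR (- x))%:C = 1 :> R[i].
  by rewrite -rmorphM -expRD subrr expR0.
have c1 x : 0 < x -> cderiv (fun y => (v1 y + v y) * (expR (- y))%:C) x 0.
  move=> x0; apply: cderiv_eq (cderivM (cderivD (d2 x x0) (d1 x x0)) (cderiv_real (is_derive_expN x))) _.
  by rewrite rmorphN; ring.
have c2 x : 0 < x -> cderiv (fun y => (v1 y - v y) * (expR y)%:C) x 0.
  move=> x0; apply: cderiv_eq (cderivM (cderivB (d2 x x0) (d1 x x0)) (cderiv_real (is_derive_exp x))) _.
  ring.
pose C := (v1 1 + v 1) * (expR (- 1))%:C; pose D := (v1 1 - v 1) * (expR 1)%:C.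
have E x : 0 < x -> v x = (C * (expR x)%:C - D * (expR (- x))%:C) / 2.
  move=> x0; rewrite /C /D -(cderiv0_cst c1 x0 ltr01) -(cderiv0_cst c2 x0 ltr01).
  rewrite -!mulrA [(expR (- x))%:C * _]mulrC e1 !mulr1 -/(e1 x).
  by field.
suff C0 : C = 0.
  by exists (- D / 2) => x x0; rewrite E // C0; field.
apply: cmod_eq0; apply/eqP; rewrite eq_le cmod_ge0 andbT leNgt; apply/negP => M0.
(* At this point $|C|e^x\ge|C|(1+x)>2B+|D|$, against the bound on $|C|e^x$ proved below. *)
pose x := (2 * B + cmod D + 1) / cmod C.
have B0 : 0 <= B by apply: le_trans (vB 1 ltr01); exact: cmod_ge0.
have x0 : 0 < x by rewrite divr_gt0 // ltr_pwDr // addr_ge0 ?mulr_ge0 ?cmod_ge0.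
have : cmod (C * (expR x)%:C) <= 2 * B + cmod D.
  have -> : C * (expR x)%:C = 2 * v x + D * (expR (- x))%:C by rewrite E //; field.
  apply: (le_trans (cmodD _ _)); rewrite (cmodM 2) (cmodM D); apply: lerD.
    have -> : (2 : R[i]) = (2 : R)%:C by rewrite rmorph_nat.
    by rewrite cmod_real ger0_norm // ler_wpM2l // vB.
  rewrite cmod_real ger0_norm ?expR_ge0 // ler_piMr ?cmod_ge0 //.
  by rewrite expR_le1; lra.
rewrite (cmodM C) cmod_real ger0_norm ?expR_ge0 //.
have h1 : 1 + x <= expR x := expR_ge1Dx x.
have h2 : cmod C * x = 2 * B + cmod D + 1 by rewrite mulrC divfK // gt_eqF.
nra.
Qed.

Lemma Jh_exp (v : R -> R[i]) (A : R[i]) :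
  (forall x, 0 < x -> v x = A * (expR (- x))%:C) -> cmeas setT v ->
  forall x, 0 <= x -> Jh v x = A / 3 * (expR (- 3 * x))%:C.
Proof.
move=> vE mv x x0.
have i3 : (@lebesgue_measure R).-integrable `[x, +oo[ (EFin \o (fun y => expR (- 3 * y))).
  exact: integrable_tail_expM.
have i3o : (@lebesgue_measure R).-integrable `]x, +oo[ (EFin \o (fun y => expR (- 3 * y))).
  by apply: integrableS i3 => //; apply: subset_itvr; rewrite bnd_simp.
have ic : cintegrable `]x, +oo[ (fun y => A * (expR (- 3 * y))%:C).
  by apply: cintegrableZ => //; exact: cintegrable_real.
have eq : {in `]x, +oo[%classic, (fun y => A * (expR (- 3 * y))%:C) =1 (fun y => (expR (- 2 * y))%:C * v y)}.
  move=> y; rewrite inE /= in_itv /= andbT => xy.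
  rewrite vE; last exact: le_lt_trans xy.
  rewrite mulrCA -rmorphM -expRD; congr (_ * (expR _)%:C); ring.
rewrite /Jh -cintegral_obnd_cbnd; last exact: eq_cintegrable ic.
rewrite -(eq_cintegral eq) cintegralZ //; last exact: cintegrable_real.
have -> : cintegral `]x, +oo[ (fun y => (expR (- 3 * y))%:C) = (expR (- 3 * x) / 3)%:C :> R[i].
  apply: complexP => /=; last by rewrite /Rintegral integral0.
  by rewrite Rintegral_itv_obnd_cbnd // Rintegral_tail_expM.
by rewrite rmorphM fmorphV rmorph_nat mulrAC mulrA.
Qed.

End ZeroMomentum.

(** * Test functions and weak derivatives *)

Section RealCalculus.
Context {R : realType}.
Notation mu := (@lebesgue_measure R).

(* A definition, as [is_derive] being a class would otherwise make [rewrite]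
   try to infer the hypothesis. *)
Definition derive_on (F f : R -> R) (a b : R) : Prop :=
  forall x : R, a <= x <= b -> is_derive x (1 : R) F (f x).

Lemma FTC2_closed (F f : R -> R) (a b : R) : a < b -> derive_on F f a b ->
  (forall x : R, a <= x <= b -> {for x, continuous f}) ->
  \int[mu]_(x in `[a, b]) f x = F b - F a.
Proof.
move=> ab dF cf.
have cF x : a <= x <= b -> {for x, continuous F}.
  move=> h; apply: differentiable_continuous; apply/derivable1_diffP.
  by have [] := dF x h.
rewrite /Rintegral (@continuous_FTC2 _ f F a b) //.
- apply/continuous_within_itvP => //; split.
  + by move=> x; rewrite in_itv /= => /andP[h1 h2]; apply: cf; rewrite !ltW.
  + by apply: cvg_at_right_filter; apply: cf; rewrite lexx ltW.
  + by apply: cvg_at_left_filter; apply: cf; rewrite lexx andbT ltW.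
- split.
  + by move=> x; rewrite in_itv /= => /andP[h1 h2]; have [] : is_derive x (1 : R) F (f x) by apply: dF; rewrite !ltW.
  + by apply: cvg_at_right_filter; apply: cF; rewrite lexx ltW.
  + by apply: cvg_at_left_filter; apply: cF; rewrite lexx andbT ltW.
- move=> x; rewrite in_itv /= => /andP[h1 h2]; rewrite derive1E.
  have h : is_derive x (1 : R) F (f x) by apply: dF; rewrite !ltW.
  by rewrite (@derive_val _ _ _ _ _ _ _ h).
Qed.

Lemma integrable_continuous_itv (f : R -> R) (a b : R) :
  (forall x : R, a <= x <= b -> {for x, continuous f}) ->
  mu.-integrable `[a, b] (EFin \o f).
Proof.
move=> cf; apply: continuous_compact_integrable; first exact: segment_compact.
apply: continuous_in_subspaceT => x; rewrite inE /= in_itv /=; exact: cf.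
Qed.

Lemma Rintegral_support (f : R -> R) (D : set R) : (forall x, ~ D x -> f x = 0) ->
  \int[mu]_x f x = \int[mu]_(x in D) f x.
Proof.
move=> h; rewrite [RHS]Rintegral_mkcond; apply: eq_Rintegral => x _.
by rewrite patchE; case: ifPn => //; rewrite notin_setE => /h.
Qed.

(** Each power is controlled by one term of the exponential series, $y^i\le i!\,e^y$. *)
Lemma horner_exp_bound (P : {poly R}) :
  exists2 C : R, 0 <= C & forall y, 0 <= y -> `|P.[y]| * expR (- y) <= C.
Proof.
exists (\sum_(i < size P) `|P`_i| * (i`!)%:R).
  by apply: sumr_ge0 => i _; rewrite mulr_ge0.
move=> y y0.
have hi i : y ^+ i <= (i`!)%:R * expR y.
  have f0 : 0 < (i`!)%:R :> R by rewrite ltr0n fact_gt0.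
  case: i f0 => [|i] f0.
    by rewrite expr0 fact0 mul1r; have := expR_ge1Dx y; lra.
  have h := expR_ge1Dxn i y0.
  have : y ^+ i.+1 / (i.+1)`!%:R <= expR y by lra.
  by rewrite ler_pdivrMr // mulrC.
rewrite expRN ler_pdivrMr ?expR_gt0 // horner_coef.
apply: (le_trans (ler_norm_sum _ _ _)); rewrite mulr_suml; apply: ler_sum => i _.
by rewrite normrM -mulrA ler_wpM2l // ger0_norm ?exprn_ge0.
Qed.

End RealCalculus.

(** * Smooth functions and a compactly supported bump *)

Section Smooth.
Context {R : realType}.
Notation mu := (@lebesgue_measure R).

Lemma smooth_seq (d : nat -> R -> R) :
  (forall n (x : R), is_derive x (1 : R) (d n) (d n.+1 x)) ->
  (forall n, derive1n n (d 0%N) = d n) /\ smooth (d 0%N).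
Proof.
move=> h.
have E n : derive1n n (d 0%N) = d n.
  elim: n => [//|n IH]; rewrite /derive1n iterS -/(derive1n n _) IH.
  by apply/funext => x; rewrite derive1E; have hx := h n x; rewrite derive_val.
by split => // n x; rewrite E; have [] := h n x.
Qed.

Lemma smooth_is_derive (f : R -> R) n (x : R) : smooth f ->
  is_derive x (1 : R) (derive1n n f) (derive1n n.+1 f x).
Proof. by move=> h; apply: DeriveDef; [exact: h|rewrite /derive1n iterS derive1E]. Qed.

Lemma smooth_cont (f : R -> R) n (x : R) : smooth f -> {for x, continuous (derive1n n f)}.
Proof.
by move=> h; apply: differentiable_continuous; apply/derivable1_diffP; exact: h.
Qed.

(** Serves for the bump, whose successive derivatives are easier to confine to a class stable under
    differentiation than to write down. *)
Lemma smooth_closed (S : set (R -> R)) :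
  (forall g, S g -> exists2 g', S g' & forall x : R, is_derive x (1 : R) g (g' x)) ->
  forall f, S f -> smooth f.
Proof.
move=> hS f Sf.
have H n : S (derive1n n f).
  elim: n => [//|n IH]; have [g' Sg' dg] := hS _ IH.
  suff -> : derive1n n.+1 f = g' by [].
  rewrite /derive1n iterS -/(derive1n n f).
  by apply/funext => x; rewrite derive1E; have hx := dg x; rewrite derive_val.
move=> n x; have [g' _ dg] := hS _ (H n).
by have [] := dg x.
Qed.

Lemma smooth_affine (f : R -> R) (p q : R) : smooth f -> smooth (fun x => f (p * x + q)).
Proof.
move=> sf.
pose d n x := p ^+ n * derive1n n f (p * x + q).
have -> : (fun x => f (p * x + q)) = d 0%N.
  by apply/funext => x; rewrite /d expr0 mul1r.
apply: (smooth_seq _).2 => n x.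
have da : is_derive x (1 : R) (fun y => p * y + q) p.
  apply: is_derive_eq (is_deriveD (is_deriveM (is_derive_cst p x 1) (is_derive_id x 1)) (is_derive_cst q x 1)) _.
  by rewrite /GRing.scale /= mulr0 !addr0 mulr1.
have dc := @is_derive1_comp _ (derive1n n f) (fun y => p * y + q) x _ _ (smooth_is_derive n _ sf) da.
apply: is_derive_eq (is_deriveM (is_derive_cst (p ^+ n) x 1) dc) _.
by rewrite /GRing.scale /= mulr0 addr0 /d exprSr mulrA mulrAC.
Qed.

Lemma smoothB (f g : R -> R) : smooth f -> smooth g -> smooth (fun x => f x - g x).
Proof.
move=> sf sg; pose d n x := derive1n n f x - derive1n n g x.
apply: (@smooth_seq d _).2 => n x.
by apply: is_deriveB; exact: smooth_is_derive.
Qed.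

Lemma smoothZ (f : R -> R) (p : R) : smooth f -> smooth (fun x => p * f x).
Proof.
move=> sf; pose d n x := p * derive1n n f x.
apply: (@smooth_seq d _).2 => n x.
apply: is_derive_eq (is_deriveM (is_derive_cst p x 1) (smooth_is_derive n x sf)) _.
by rewrite /GRing.scale /= mulr0 addr0.
Qed.

Lemma smooth_primitive (f F : R -> R) : smooth f ->
  (forall x : R, is_derive x (1 : R) F (f x)) -> smooth F.
Proof.
move=> sf dF; pose d n := if n is m.+1 then derive1n m f else F.
by apply: (@smooth_seq d _).2 => -[|n] x; [exact: dF|exact: smooth_is_derive].
Qed.

(** The standard flat function with a polynomial factor in $1/x$: the family is stable under
    differentiation, which replaces $P$ by $X^2(P-P')$. *)
Definition flat (P : {poly R}) (x : R) : R :=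
  if 0 < x then P.[x^-1] * expR (- x^-1) else 0.

Lemma flat_le (P : {poly R}) :
  exists2 C : R, 0 <= C & forall x, `|flat P x| <= C * `|x|.
Proof.
have [C C0 hC] := horner_exp_bound (P * 'X).
exists C => // x; rewrite /flat; case: ifPn => [x0|_]; last first.
  by rewrite normr0 mulr_ge0.
have := hC x^-1; rewrite invr_ge0 => /(_ (ltW x0)).
rewrite hornerM hornerX !normrM (ger0_norm (expR_ge0 _)) (gtr0_norm x0).
rewrite normfV (gtr0_norm x0) mulrAC => h.
by rewrite -ler_pdivrMr.
Qed.

Lemma is_derive_flat (P : {poly R}) (x : R) :
  is_derive x (1 : R) (flat P) (flat ('X^2 * (P - P^`())) x).
Proof.
have [x0|x0|->] := ltgtP x 0.
- apply: (@near_eq_is_derive _ _ _ (fun=> 0)).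
    have : \forall y \near x, y < 0 by exact: lt_nbhsl.
    by apply: filterS => y y0; rewrite /flat ltNge ltW.
  by rewrite /flat ltNge (ltW x0); exact: is_derive_cst.
- apply: (@near_eq_is_derive _ _ _ (fun y : R => P.[y^-1] * expR (- y^-1))).
    have : \forall y \near x, 0 < y by exact: lt_nbhsr.
    by apply: filterS => y y0; rewrite /flat y0.
  have xn0 : x != 0 by rewrite gt_eqF.
  have di : is_derive x (1 : R) (fun y => y^-1) (- x ^- 2).
    apply: is_derive_eq (@is_deriveV _ id x 1 1 xn0 (is_derive_id x 1)) _.
    by rewrite /GRing.scale /= mulr1.
  have dp := @is_derive1_comp _ (horner P) (fun y => y^-1) x _ _ (is_derive_poly P _) di.
  have de := @is_derive1_comp _ expR (fun y => - y^-1) x _ _ (is_derive_expR _) (is_deriveN di).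
  apply: is_derive_eq (is_deriveM dp de) _.
  rewrite /flat x0 /GRing.scale /= !hornerE /= exprVn; ring.
- have -> : flat ('X^2 * (P - P^`())) 0 = 0 by rewrite /flat ltxx.
  (* Carathéodory's slope function: dividing by [x] multiplies the polynomial in $1/x$ by its
     variable. Its continuity at 0 is [flat_le]. *)
  apply/is_derive1_caratheodory; exists (flat (P * 'X)); split.
  + move=> z; rewrite subr0 {2}/flat ltxx subr0 /flat; case: ifPn => z0.
      by rewrite hornerMX; field; rewrite gt_eqF.
    by rewrite mul0r.
  + have [C C0 hC] := flat_le (P * 'X).
    have f0 : flat (P * 'X) 0 = 0 by rewrite /flat ltxx.
    apply/cvgrPdist_lt => e e0.
    have e1 : 0 < e / (C + 1) by rewrite divr_gt0 // ltr_pwDr.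
    near=> z; rewrite f0 sub0r normrN; apply: (le_lt_trans (hC z)).
    have hz : `|z| < e / (C + 1).
      near: z; rewrite nearE /=; apply/nbhs_ballP; exists (e / (C + 1)) => //= z.
      by rewrite /ball /= sub0r normrN.
    rewrite ltr_pdivlMr in hz; last by rewrite ltr_pwDr.
    by apply: le_lt_trans hz; rewrite mulrC ler_wpM2l // lerDl.
  + by rewrite /flat ltxx.
Unshelve. all: by end_near. Qed.

Definition bumpf (x : R) : R := flat 1 (1 + x) * flat 1 (1 - x).

(** The derivative of a product of two flat factors is a sum of two such products, so the stable
    class consists of finite sums, indexed by lists of pairs of polynomials. *)
Lemma smooth_bump : smooth bumpf.
Proof.
pose S : set (R -> R) := [set g | exists l : seq ({poly R} * {poly R}),
  g = fun x => \sum_(pq <- l) flat pq.1 (1 + x) * flat pq.2 (1 - x)].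
pose D (P : {poly R}) := 'X^2 * (P - P^`()).
apply: (@smooth_closed S); last first.
  by exists [:: (1, 1)]; apply/funext => x; rewrite big_seq1.
move=> g [l ->].
exists (fun x => \sum_(pq <- flatten [seq [:: (D pq.1, pq.2); (pq.1, - D pq.2)] | pq <- l])
   flat pq.1 (1 + x) * flat pq.2 (1 - x)).
  by exists (flatten [seq [:: (D pq.1, pq.2); (pq.1, - D pq.2)] | pq <- l]).
move=> x; elim: l => [|[P Q] l IH].
  rewrite big_nil; under eq_fun do rewrite big_nil.
  exact: is_derive_cst.
rewrite /= !big_cons /= addrA.
under eq_fun do rewrite big_cons.
apply: is_deriveD IH.
have d1 : is_derive x (1 : R) (fun y : R => 1 + y) 1.
  by apply: is_derive_eq (is_deriveD (is_derive_cst (1 : R) x (1 : R)) (is_derive_id x (1 : R))) _; rewrite add0r.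
have d2 : is_derive x (1 : R) (fun y : R => 1 - y) (-1).
  by apply: is_derive_eq (is_deriveB (is_derive_cst (1 : R) x (1 : R)) (is_derive_id x (1 : R))) _; rewrite sub0r.
have e1 := @is_derive1_comp _ (flat P) (fun y => 1 + y) x _ _ (is_derive_flat P _) d1.
have e2 := @is_derive1_comp _ (flat Q) (fun y => 1 - y) x _ _ (is_derive_flat Q _) d2.
apply: is_derive_eq (is_deriveM e1 e2) _.
have -> : flat (- D Q) (1 - x) = - flat (D Q) (1 - x).
  by rewrite /flat; case: ifP => _; rewrite ?oppr0 // hornerN mulNr.
rewrite /GRing.scale /= -/(D P) -/(D Q); ring.
Qed.

Lemma bump_ge0 x : 0 <= bumpf x.
Proof.
by rewrite mulr_ge0 // /flat; case: ifP => _ //; rewrite hornerC mul1r expR_ge0.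
Qed.

Lemma bump_gt0 x : `|x| < 1 -> 0 < bumpf x.
Proof.
rewrite ltr_norml => /andP[h1 h2]; rewrite /bumpf /flat.
have -> : 0 < 1 + x by lra.
have -> : 0 < 1 - x by lra.
by rewrite !hornerC !mul1r mulr_gt0 // expR_gt0.
Qed.

Lemma bump_eq0 x : 1 <= `|x| -> bumpf x = 0.
Proof.
rewrite ler_normr /bumpf /flat => /orP[h|h].
  have -> : (0 < 1 - x) = false by apply/negbTE; rewrite -leNgt; lra.
  by rewrite mulr0.
have -> : (0 < 1 + x) = false by apply/negbTE; rewrite -leNgt; lra.
by rewrite mul0r.
Qed.

Lemma bump_cont (x : R) : {for x, continuous bumpf}.
Proof. exact: (@smooth_cont bumpf 0%N x smooth_bump). Qed.

Lemma bump_primitive : exists E : R -> R, [/\ forall x : R, is_derive x (1 : R) E (bumpf x),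
  forall x, x <= -1 -> E x = 0 & forall x, 1 <= x -> E x = E 1].
Proof.
have ib : mu.-integrable setT (EFin \o bumpf).
  have i1 : mu.-integrable `[-1, 1] (EFin \o bumpf).
    by apply: integrable_continuous_itv => x _; exact: bump_cont.
  move/(integrable_mkcond (mu := mu) _ (measurable_itv _)).1 : i1.
  apply: eq_integrable => // x _; rewrite patchE; case: ifPn => //.
  rewrite notin_setE /= in_itv /= => h; rewrite bump_eq0 //.
  by rewrite leNgt; apply/negP => /ltW; rewrite ler_norml.
pose E x := \int[mu]_(t in `]-oo, x]) bumpf t.
have dE (x : R) : is_derive x (1 : R) E (bumpf x).
  have [||||d1 d2] := @continuous_FTC1 _ bumpf -oo%O x (x + 1).
  - by rewrite ltrDl.
  - by apply: integrableS ib.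
  - by rewrite ltNyr.
  - exact: bump_cont.
  exact: (DeriveDef d1 (etrans (esym (derive1E _ _)) d2)).
exists E; split => //.
- move=> x x1; rewrite /E; under eq_Rintegral.
    move=> t; rewrite inE /= in_itv /= => tx; rewrite bump_eq0; last first.
      by rewrite ler_normr; apply/orP; right; lra.
    over.
  by rewrite /Rintegral integral0.
- move=> x; rewrite le_eqVlt => /predU1P[->//|x1].
  have := @FTC2_closed _ E bumpf 1 x x1 (fun y _ => dE y) (fun y _ => bump_cont (x := y)).
  rewrite (_ : \int[mu]_(x0 in `[1, x]) bumpf x0 = 0).
    by move/esym/eqP; rewrite subr_eq0 => /eqP.
  under eq_Rintegral.
    move=> t; rewrite inE /= in_itv /= => /andP[t1 _]; rewrite bump_eq0; last first.
      by rewrite ler_normr t1.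
    over.
  by rewrite /Rintegral integral0.
Qed.

End Smooth.

(** * Weak derivatives of continuous functions on a half-line *)

Section DuBoisReymond.
Context {R : realType}.
Notation mu := (@lebesgue_measure R).

Lemma continuous_mul (f g : R -> R) (x : R) : {for x, continuous f} ->
  {for x, continuous g} -> {for x, continuous (fun y => f y * g y)}.
Proof. by move=> cf cg; exact: continuousM. Qed.

Lemma is_derive_primitive (f : R -> R) (a x u : R) : a < x -> x < u ->
  mu.-integrable `[a, u] (EFin \o f) -> {for x, continuous f} ->
  is_derive x (1 : R) (fun y => \int[mu]_(t in `[a, y]) f t) (f x).
Proof.
move=> ax xu fi cf; have [d1 d2] := continuous_FTC1_closed xu fi ax cf.
exact: (DeriveDef d1 (etrans (esym (derive1E _ _)) d2)).
Qed.

Lemma smooth_itv_eq0 (psi : R -> R) (a b : R) : smooth psi -> a < b ->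
  (forall x, psi x != 0 -> a < x < b) -> forall x, ~ `[a, b]%classic x ->
  psi x = 0 /\ derive1 psi x = 0.
Proof.
move=> sp ab hp x; rewrite /= in_itv /= => hx.
have N y : ~ (a < y < b) -> psi y = 0.
  by move=> h; apply/eqP; apply/negPn/negP => /hp.
split; first by apply: N => /andP[h1 h2]; apply: hx; rewrite !ltW.
have h : \forall y \near x, psi y = 0.
  have [xa|ax] := ltP x a.
    have : \forall y \near x, y < a by exact: lt_nbhsl.
    by apply: filterS => y ya; apply: N => /andP[]; lra.
  have [bx|xb] := ltP b x; last by exfalso; apply: hx; rewrite ax xb.
  have : \forall y \near x, b < y by exact: lt_nbhsr.
  by apply: filterS => y ya; apply: N => /andP[]; lra.
have h' : is_derive x (1 : R) psi 0.
  apply: (@near_eq_is_derive _ _ _ (fun _ : R => 0 : R)).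
  by move: h; apply: filterS => y ->.
by rewrite derive1E derive_val.
Qed.

Lemma bump_affine_cont (d r x : R) :
  {for x, continuous (fun y : R => bumpf (d * (y - r)))}.
Proof.
have -> : (fun y : R => bumpf (d * (y - r))) = (fun y : R => bumpf (d * y + - (d * r))).
  by apply/funext => y; rewrite mulrBr.
have sb := @smooth_affine _ _ d (- (d * r)) (@smooth_bump R).
by have := @smooth_cont _ _ 0%N x sb; rewrite /derive1n.
Qed.

Lemma is_derive_cont (f : R -> R) (x l : R) : is_derive x (1 : R) f l -> {for x, continuous f}.
Proof. by case=> d _; apply: differentiable_continuous; apply/derivable1_diffP. Qed.

Lemma is_derive_MVT (f f' : R -> R) (a x y : R) :
  (forall x, a < x -> is_derive x (1 : R) f (f' x)) -> a < x -> x < y ->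
  exists2 z, x < z < y & f y - f x = f' z * (y - x).
Proof.
move=> df ax xy.
have hd z : z \in `]x, y[ -> is_derive z (1 : R) f (f' z).
  by rewrite in_itv /= => /andP[xz _]; apply: df; exact: lt_trans xz.
have [|z ] := @MVT _ f f' x y xy hd.
  apply: derivable_within_continuous => z; rewrite in_itv /= => /andP[xz _].
  by have [] : is_derive z (1 : R) f (f' z) by apply: df; exact: lt_le_trans xz.
by rewrite in_itv /= => zxy E; exists z.
Qed.

Lemma is_derive_nondecreasing (f f' : R -> R) (a x y : R) :
  (forall x, a < x -> is_derive x (1 : R) f (f' x)) -> (forall x, a < x -> 0 <= f' x) ->
  a < x -> x <= y -> f x <= f y.
Proof.
move=> df f0 ax; rewrite le_eqVlt => /predU1P[->//|xy].
have [z /andP[xz zy] E] := is_derive_MVT df ax xy.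
by rewrite -subr_ge0 E mulr_ge0 ?f0 ?(lt_trans ax) // subr_ge0 ltW.
Qed.

Lemma exists_primitive_pos (h : R -> R) : (forall x : R, 0 < x -> {for x, continuous h}) ->
  exists H : R -> R, forall x : R, 0 < x -> is_derive x (1 : R) H (h x).
Proof.
move=> ch.
have ih (a u : R) : 0 < a -> mu.-integrable `[a, u] (EFin \o h).
  by move=> a0; apply: integrable_continuous_itv => y /andP[ay _]; apply: ch; exact: lt_le_trans ay.
pose H x := if x < 1 then - \int[mu]_(t in `[x, 1]) h t else \int[mu]_(t in `[1, x]) h t.
exists H => x x0.
pose a := Num.min x 1 / 2.
have a0 : 0 < a by rewrite divr_gt0 // lt_min x0 ltr01.
have [m1 m2] : Num.min x 1 <= x /\ Num.min x 1 <= 1 by rewrite !ge_min !lexx orbT.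
have [ax a1] : a < x /\ a < 1 by rewrite /a; split; lra.
have add u w : a < u -> u <= w ->
    \int[mu]_(t in `[a, w]) h t - \int[mu]_(t in `[a, u]) h t = \int[mu]_(t in `[u, w]) h t.
  move=> au uw; rewrite Rintegral_itvB ?bnd_simp ?(ltW au) //; last exact: ih.
  rewrite Rintegral_itv_obnd_cbnd //.
  apply: integrableS (ih u w (lt_trans a0 au)) => // y /=; rewrite !in_itv /=.
  by move=> /andP[/ltW -> ->].
have HE y : a < y -> H y = \int[mu]_(t in `[a, y]) h t - \int[mu]_(t in `[a, 1]) h t.
  move=> ay; rewrite /H; case: ltP => y1; last by rewrite add.
  by rewrite -(add _ _ ay (ltW y1)) opprB.
have x1 : x < x + 1 by rewrite ltrDl.
have d := is_derive_primitive ax x1 (ih a (x + 1) a0) (ch x x0).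
apply: (@near_eq_is_derive _ _ _ (fun y => \int[mu]_(t in `[a, y]) h t - \int[mu]_(t in `[a, 1]) h t)).
  have : \forall y \near x, a < y by exact: lt_nbhsr.
  by apply: filterS => y ay; rewrite HE.
by apply: is_derive_eq (is_deriveB d (is_derive_cst _ _ _)) _; rewrite subr0.
Qed.

Lemma bump_mass_gt0 (E : R -> R) : (forall x : R, is_derive x (1 : R) E (bumpf x)) ->
  E (-1) < E 1.
Proof.
move=> dE; have dE' a (x : R) : a < x -> is_derive x (1 : R) E (bumpf x) by [].
have [z /andP[z1 z2] Ez] := @is_derive_MVT E bumpf (-1) (- 2^-1) 2^-1 (dE' _) ltac:(lra) ltac:(lra).
have h1 : E (- 1) <= E (- 2^-1).
  by apply: (is_derive_nondecreasing (dE' (-2)) (fun x _ => bump_ge0 x)); lra.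
have h2 : E 2^-1 <= E 1.
  by apply: (is_derive_nondecreasing (dE' (-2)) (fun x _ => bump_ge0 x)); lra.
have h3 : 0 < bumpf z by apply: bump_gt0; rewrite ltr_norml; apply/andP; split; lra.
have h4 : E 2^-1 - E (- 2^-1) = bumpf z by rewrite Ez; lra.
lra.
Qed.

Lemma is_derive_scaled_bump (E : R -> R) (d r x : R) :
  (forall x : R, is_derive x (1 : R) E (bumpf x)) -> 0 < d ->
  is_derive x (1 : R) (fun y => d * E (d^-1 * y + - (d^-1 * r))) (bumpf (d^-1 * (x - r))).
Proof.
move=> dE d0.
have da : is_derive x (1 : R) (fun y => d^-1 * y + - (d^-1 * r)) d^-1.
  apply: is_derive_eq (is_deriveD (is_deriveM (is_derive_cst d^-1 x 1) (is_derive_id x 1)) (is_derive_cst (- (d^-1 * r)) x 1)) _.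
  by rewrite /GRing.scale /= mulr0 !addr0 mulr1.
have dc := @is_derive1_comp _ E (fun y => d^-1 * y + - (d^-1 * r)) x _ _ (dE _) da.
apply: is_derive_eq (is_deriveM (is_derive_cst d x 1) dc) _.
by rewrite /GRing.scale /= mulr0 addr0 mulrCA mulfV ?gt_eqF // mulr1 mulrBr.
Qed.

Lemma scaled_bump_eq0 (d r x : R) : 0 < d -> ~ `[r - d, r + d]%classic x ->
  bumpf (d^-1 * (x - r)) = 0.
Proof.
move=> d0; rewrite /= in_itv /= => hx.
apply: bump_eq0; rewrite normrM normfV (gtr0_norm d0) mulrC ler_pdivlMr // mul1r leNgt.
apply/negP; rewrite ltr_norml => /andP[h1 h2]; apply: hx; apply/andP; split; lra.
Qed.

Lemma Rintegral_scaled_bump (f : R -> R) (d r : R) : 0 < d ->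
  \int[mu]_x (f x * bumpf (d^-1 * (x - r))) =
  \int[mu]_(x in `[r - d, r + d]) (f x * bumpf (d^-1 * (x - r))).
Proof.
by move=> d0; apply: Rintegral_support => x hx; rewrite scaled_bump_eq0 // mulr0.
Qed.

(** The rescaled bump has mass [d * (E 1 - E (-1))] and lives within [d] of [r], where [k] is within
    [e] of [k r]. *)
Lemma bump_average (E k : R -> R) (r e : R) :
  (forall x : R, is_derive x (1 : R) E (bumpf x)) -> 0 < e -> 0 < r ->
  (forall x : R, 0 < x -> {for x, continuous k}) ->
  exists2 d0 : R, 0 < d0 & forall d, 0 < d -> d < d0 ->
    mu.-integrable setT (EFin \o (fun x => k x * bumpf (d^-1 * (x - r)))) /\
    `|\int[mu]_x (k x * bumpf (d^-1 * (x - r))) - k r * (d * (E 1 - E (-1)))| <=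
      e * (d * (E 1 - E (-1))).
Proof.
move=> dE e0 r0 ck.
have /cvgrPdist_le/(_ e e0)[d1 /= d10 hd1] := ck r r0.
exists (Num.min d1 r); first by rewrite lt_min d10.
move=> d d0; rewrite lt_min => /andP[dd1 dr].
have cb x : {for x, continuous (fun x => bumpf (d^-1 * (x - r)))} by exact: bump_affine_cont.
have sub : r - d < r + d by lra.
have ik : mu.-integrable `[r - d, r + d] (EFin \o (fun x => k x * bumpf (d^-1 * (x - r)))).
  apply: integrable_continuous_itv => x /andP[h1 h2].
  by apply: continuous_mul => //; apply: ck; lra.
split.
  rewrite (integrable_mkcond (mu := mu)) // in ik.
  apply: eq_integrable ik => // x _; rewrite /= patchE; case: ifPn => //.
  by rewrite notin_setE => /(scaled_bump_eq0 d0) ->; rewrite mulr0.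
have icb (c : R) : mu.-integrable `[r - d, r + d] (EFin \o (fun x => c * bumpf (d^-1 * (x - r)))).
  by apply: integrable_continuous_itv => x _; apply: continuous_mul => //; exact: cst_continuous.
have I1 (c : R) : \int[mu]_(x in `[r - d, r + d]) (c * bumpf (d^-1 * (x - r))) = c * (d * (E 1 - E (-1))).
  rewrite RintegralZl //; last by apply: integrable_continuous_itv => x _.
  congr (_ * _).
  rewrite (@FTC2_closed _ (fun y => d * E (d^-1 * y + - (d^-1 * r)))) //; last first.
    by move=> x _; exact: is_derive_scaled_bump.
  rewrite -!mulrBr.
  have -> : d^-1 * (r + d - r) = 1 by rewrite addrAC subrr add0r mulVf // gt_eqF.
  by have -> : d^-1 * (r - d - r) = -1 by rewrite addrAC subrr sub0r mulrN mulVf // gt_eqF.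
have ii : mu.-integrable `[r - d, r + d] (EFin \o (fun x => k x * bumpf (d^-1 * (x - r)) - k r * bumpf (d^-1 * (x - r)))).
  apply: integrable_continuous_itv => x /andP[h1 h2].
  apply: continuousB; apply: continuous_mul => //; [by apply: ck; lra|exact: cst_continuous].
rewrite (Rintegral_scaled_bump k r d0) -(I1 (k r)) -RintegralB // -(I1 e).
apply: (le_trans (le_normr_Rintegral _ _)) => //.
apply: le_Rintegral => //; first exact: integrable_norm.
move=> x /=; rewrite in_itv /= => /andP[h1 h2].
rewrite -mulrBl normrM (ger0_norm (bump_ge0 _)) ler_wpM2r ?bump_ge0 // distrC.
apply: hd1; rewrite /ball /= ltr_norml; apply/andP; split; lra.
Qed.

(* Test against the difference of two translates of the same bump. *)
Lemma weak_constant (k : R -> R) : (forall x : R, 0 < x -> {for x, continuous k}) ->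
  (forall psi, smooth psi -> (exists a b : R, [/\ 0 < a, a < b &
    forall x, psi x != 0 -> a <= x <= b]) -> \int[mu]_x (k x * derive1 psi x) = 0) ->
  forall p q, 0 < p -> p < q -> k p = k q.
Proof.
move=> ck hw p q p0 pq; have q0 := lt_trans p0 pq.
have [E [dE E0 E1]] := @bump_primitive R.
have mE := bump_mass_gt0 dE.
apply/eqP; rewrite -subr_eq0 -normr_le0 leNgt; apply/negP => kpq.
(* A third of the gap: the two averaging errors together use only two thirds of it. *)
have e0 : 0 < `|k p - k q| / 3 by rewrite divr_gt0.
have [d1 d10 hd1] := bump_average dE e0 p0 ck.
have [d2 d20 hd2] := bump_average dE e0 q0 ck.
pose d := Num.min (Num.min d1 d2) (p / 2) / 2.
have p2 : 0 < p / 2 by rewrite divr_gt0.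
have d0 : 0 < d by rewrite divr_gt0 // !lt_min d10 d20.
have [c1 c2 c3] : [/\ d < d1, d < d2 & d < p].
  have h m : Num.min (Num.min d1 d2) (p / 2) <= m -> 0 < m -> d < m.
    by move=> h1 m0; rewrite /d; lra.
  by split; apply: h => //; rewrite !ge_min ?lexx ?orbT //; apply/orP; right; lra.
clearbody d.
(* A primitive of the difference of the two bumps. The bumps have equal mass, so it vanishes on the
   right as well as on the left and is an admissible test function. *)
pose psi x := d * E (d^-1 * x + - (d^-1 * p)) - d * E (d^-1 * x + - (d^-1 * q)).
have dpsi (x : R) : is_derive x (1 : R) psi (bumpf (d^-1 * (x - p)) - bumpf (d^-1 * (x - q))).
  by apply: is_deriveB; exact: is_derive_scaled_bump.
have spsi : smooth psi.
  have sPhi r : smooth (fun x => d * E (d^-1 * x + - (d^-1 * r))).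
    apply: smoothZ; apply: (@smooth_affine _ E d^-1 (- (d^-1 * r))).
    exact: (smooth_primitive smooth_bump dE).
  by apply: smoothB; exact: sPhi.
have psiN x : psi x != 0 -> p - d <= x <= q + d.
  apply: contra_neqT; rewrite negb_and -!ltNge => /orP[h1|h1].
    by rewrite /psi !E0 ?mulr0 ?subr0 // -mulrBr mulrC ler_pdivrMr //; lra.
  rewrite /psi [E (_ * x + - (_ * p))]E1; last by rewrite -mulrBr mulrC ler_pdivlMr //; lra.
  by rewrite E1 ?subrr // -mulrBr mulrC ler_pdivlMr //; lra.
have W : \int[mu]_x (k x * derive1 psi x) = 0.
  by apply: hw => //; exists (p - d), (q + d); split => //; lra.
have [i1 b1] := hd1 d d0 c1; have [i2 b2] := hd2 d d0 c2.
have W' : \int[mu]_x (k x * bumpf (d^-1 * (x - p))) = \int[mu]_x (k x * bumpf (d^-1 * (x - q))).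
  apply/eqP; rewrite -subr_eq0 -RintegralB // -[X in _ == X]W; apply/eqP; apply: eq_Rintegral => x _.
  by rewrite -mulrBr derive1E; have hx := dpsi x; rewrite derive_val.
rewrite W' in b1; move: b1 b2; set I := Rintegral _ _ _; set D := d * _ => b1 b2.
have M0 : 0 < D by apply: mulr_gt0; [exact: d0|rewrite subr_gt0; exact: mE].
clear - M0 b1 b2 kpq.
have : `|(k p - k q) * D| <= 2 * (`|k p - k q| / 3 * D).
  have -> : (k p - k q) * D = (I - k q * D) - (I - k p * D) by ring.
  by apply: (le_trans (ler_normB _ _)); lra.
by rewrite normrM (gtr0_norm M0); nra.
Qed.

(* With a primitive [H] of [h], the function [g - H] has weak derivative 0. *)
Lemma du_bois_reymond (g h : R -> R) :
  (forall x : R, 0 < x -> {for x, continuous g}) ->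
  (forall x : R, 0 < x -> {for x, continuous h}) ->
  (forall psi, smooth psi -> (exists a b : R, [/\ 0 < a, a < b &
    forall x, psi x != 0 -> a <= x <= b]) ->
    \int[mu]_x (g x * derive1 psi x) = - \int[mu]_x (h x * psi x)) ->
  forall x : R, 0 < x -> is_derive x (1 : R) g (h x).
Proof.
move=> cg ch hw; have [H dH] := exists_primitive_pos ch.
have cH (x : R) : 0 < x -> {for x, continuous H} by move=> x0; exact: is_derive_cont (dH x x0).
have ck (x : R) : 0 < x -> {for x, continuous (fun y => g y - H y)}.
  by move=> x0; apply: continuousB; [exact: cg|exact: cH].
have K p q : 0 < p -> p < q -> g p - H p = g q - H q.
  apply: (weak_constant ck) => psi sp [a [b [a0 ab hp]]].
  pose a' := a / 2; pose b' := b + 1.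
  have a'0 : 0 < a' by rewrite divr_gt0.
  have [a'a bb' ab'] : [/\ a' < a, b < b' & a' < b'] by rewrite /a' /b'; split; lra.
  have hp' x : psi x != 0 -> a' < x < b'.
    by move=> /hp /andP[h1 h2]; rewrite (lt_le_trans a'a h1) (le_lt_trans h2).
  have Z := smooth_itv_eq0 sp ab' hp'.
  have [cp cdp] : (forall x : R, {for x, continuous psi}) /\ (forall x : R, {for x, continuous (derive1 psi)}).
    by split=> x; [exact: (@smooth_cont _ psi 0%N x sp)|exact: (@smooth_cont _ psi 1%N x sp)].
  have pos x : a' <= x -> 0 < x by exact: lt_le_trans.
  have R0 (f : R -> R) : \int[mu]_x (f x * derive1 psi x) = \int[mu]_(x in `[a', b']) (f x * derive1 psi x).
    by apply: Rintegral_support => x /Z[_ ->]; rewrite mulr0.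
  have R1 : \int[mu]_x (h x * psi x) = \int[mu]_(x in `[a', b']) (h x * psi x).
    by apply: Rintegral_support => x /Z[-> _]; rewrite mulr0.
  have i1 (f : R -> R) : (forall x : R, 0 < x -> {for x, continuous f}) ->
      mu.-integrable `[a', b'] (EFin \o (fun x => f x * derive1 psi x)).
    move=> cf; apply: integrable_continuous_itv => x /andP[h1 _].
    by apply: continuous_mul => //; apply: cf; exact: pos.
  have i2 : mu.-integrable `[a', b'] (EFin \o (fun x => h x * psi x)).
    apply: integrable_continuous_itv => x /andP[h1 _].
    by apply: continuous_mul => //; apply: ch; exact: pos.
  have p0 x : ~ (a' < x < b') -> psi x = 0 by move=> hx; apply/eqP/negPn/negP => /hp'.
  have parts : \int[mu]_(x in `[a', b']) (h x * psi x + H x * derive1 psi x) = 0.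
    rewrite (@FTC2_closed _ (fun x => H x * psi x)) //.
    - by rewrite !p0 ?mulr0 ?subrr // ltxx ?andbF.
    - move=> x /andP[h1 _].
      apply: is_derive_eq (is_deriveM (dH x (pos x h1)) (@smooth_is_derive _ psi 0%N x sp)) _.
      by rewrite /GRing.scale /= addrC [psi x * _]mulrC.
    - move=> x /andP[h1 _]; apply: continuousD; apply: continuous_mul => //.
        by apply: ch; exact: pos.
      by apply: cH; exact: pos.
  rewrite RintegralD // in parts; last exact: i1.
  have := hw psi sp (ex_intro _ a (ex_intro _ b (And3 a0 ab hp))).
  rewrite !R0 R1 => hw'.
  under eq_Rintegral do rewrite mulrBl.
  by rewrite RintegralB // ?hw'; [lra|exact: i1|exact: i1].
move=> x x0.
apply: (@near_eq_is_derive _ _ _ (fun y => (g x - H x) + H y)).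
  have : \forall y \near x, 0 < y by exact: lt_nbhsr.
  apply: filterS => y y0.
  have -> : g x - H x = g y - H y.
    by have [xy|yx|->//] := ltgtP x y; [exact: K|symmetry; exact: K].
  by rewrite subrK.
by apply: is_derive_eq (is_deriveD (is_derive_cst _ _ _) (dH x x0)) _; rewrite add0r.
Qed.

End DuBoisReymond.

(** * Test functions supported away from the origin *)

Section TestFunctions.
Context {R : realType}.
Notation mu := (@lebesgue_measure R).
Implicit Types (g h v f : R -> R[i]) (r psi : R -> R).

Lemma near_norm_lt (a x : R) : `|x| < a -> \forall y \near x, `|y| < a.
Proof.
have cn : (fun y : R => `|y|) @ x --> `|x| by apply: norm_continuous.
by move=> h; exact: (cvgr_lt `|x| cn a h).
Qed.

Lemma near_norm_gt (a x : R) : a < `|x| -> \forall y \near x, a < `|y|.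
Proof.
have cn : (fun y : R => `|y|) @ x --> `|x| by apply: norm_continuous.
by move=> h; exact: (cvgr_gt `|x| cn a h).
Qed.

Definition off0_support r := exists a b : R, [/\ 0 < a, a < b &
    forall x, r x != 0 -> a <= `|x| <= b].

Lemma test_off0_derive1 psi : test_off0 psi -> off0_support (derive1 psi).
Proof.
move=> [sp [a [b [a0 ab h]]]]; exists a, b; split => // x; apply: contra_neqT => hx.
have N : \forall y \near x, psi y = 0.
  move: hx; rewrite negb_and -!ltNge => /orP[hx|hx].
    have : \forall y \near x, `|y| < a by exact: near_norm_lt.
    by apply: filterS => y ya; apply/eqP/negPn/negP => /h; rewrite leNgt ya.
  have : \forall y \near x, b < `|y| by exact: near_norm_gt.
  by apply: filterS => y ya; apply/eqP/negPn/negP => /h; rewrite [_ <= b]leNgt ya andbF.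
have h' : is_derive x (1 : R) psi 0.
  apply: (@near_eq_is_derive _ _ _ (fun _ : R => 0 : R)).
  by move: N; apply: filterS => y ->.
by rewrite derive1E derive_val.
Qed.

Lemma ccontM g h x : ccont g x -> ccont h x -> ccont (fun y => g y * h y) x.
Proof. by move=> cg ch; apply: ccvgM. Qed.

Lemma ccontD g h x : ccont g x -> ccont h x -> ccont (fun y => g y + h y) x.
Proof. by move=> cg ch; apply: ccvgD. Qed.

Lemma ccontB g h x : ccont g x -> ccont h x -> ccont (fun y => g y - h y) x.
Proof. by move=> cg ch; apply: ccvgB. Qed.

Lemma ccont_cst (k : R[i]) (x : R) : ccont (fun=> k) x.
Proof. exact: ccvg_cst. Qed.

Lemma ccont_real r x : {for x, continuous r} -> ccont (fun y => (r y)%:C) x.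
Proof. exact: ccvg_real. Qed.

Lemma ccont_near g h x : (\forall y \near x, g y = h y) -> ccont h x -> ccont g x.
Proof.
move=> E ch; rewrite /ccont; have := nbhs_singleton E => ->.
exact: ccvg_near E ch.
Qed.

(** At the origin, where nothing is known of [g], the product vanishes in a whole neighbourhood. *)
Lemma test_mul_cont g r x : (forall x, x != 0 -> ccont g x) ->
  (forall x : R, {for x, continuous r}) -> off0_support r ->
  ccont (fun y => g y * (r y)%:C) x.
Proof.
move=> cg cr [a [b [a0 ab h]]]; have [->|x0] := eqVneq x 0; last first.
  by apply: ccontM; [exact: cg|exact: ccont_real].
apply: (@ccont_near _ (fun=> 0)); last exact: ccont_cst.
have : \forall y \near (0 : R), `|y| < a by apply: near_norm_lt; rewrite normr0.
apply: filterS => y ya; suff -> : r y = 0 by rewrite mulr0.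
by apply/eqP/negPn/negP => /h; rewrite leNgt ya.
Qed.

Lemma cintegrable_compact g (M : R) : (forall x, ccont g x) ->
  (forall x, M < `|x| -> g x = 0) -> cintegrable setT g.
Proof.
move=> cg g0.
have K (f : R -> R) : (forall x : R, {for x, continuous f}) ->
    (forall x, M < `|x| -> f x = 0) -> mu.-integrable setT (EFin \o f).
  move=> cf f0.
  have i1 : mu.-integrable `[- M, M] (EFin \o f).
    by apply: integrable_continuous_itv => x _; exact: cf.
  move/(integrable_mkcond (mu := mu) _ (measurable_itv _)).1 : i1.
  apply: eq_integrable => // x _; rewrite patchE; case: ifPn => //.
  rewrite notin_setE /= in_itv /= => hx; rewrite f0 // ltNge; apply/negP.
  by rewrite ler_norml.
split; apply: K => x; [by have [] := cg x|by move/g0 ->|by have [] := cg x|by move/g0 ->].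
Qed.

Lemma test_mul_integrable g r : (forall x, x != 0 -> ccont g x) ->
  (forall x : R, {for x, continuous r}) -> off0_support r ->
  cintegrable setT (fun y => g y * (r y)%:C).
Proof.
move=> cg cr hr; have [a [b [a0 ab h]]] := hr.
apply: (@cintegrable_compact _ b) => x; first exact: test_mul_cont.
move=> bx; suff -> : r x = 0 by rewrite mulr0.
by apply/eqP/negPn/negP => /h; rewrite [_ <= b]leNgt bx andbF.
Qed.

Lemma test_cont psi (x : R) : test_off0 psi -> {for x, continuous psi}.
Proof. by move=> [sp _]; exact: (@smooth_cont _ psi 0%N x sp). Qed.

Lemma test_cont1 psi (x : R) : test_off0 psi -> {for x, continuous (derive1 psi)}.
Proof. by move=> [sp _]; exact: (@smooth_cont _ psi 1%N x sp). Qed.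

(** Integration by parts: the product of [g] and the test function is differentiable on the whole
    line, since it vanishes near 0, and has compact support. *)
Lemma derive_weak_derivative g h : (forall x, x != 0 -> cderiv g x (h x)) ->
  (forall x, x != 0 -> ccont h x) -> weak_derivative_off0 g h.
Proof.
move=> dg ch psi tp; have [sp [a [b [a0 ab hp]]]] := tp.
have hs : off0_support psi by exists a, b.
have hs1 := test_off0_derive1 tp.
have cg x : x != 0 -> ccont g x by move=> x0; exact: (cderiv_cont (dg x x0)).
have i1 := test_mul_integrable cg (fun x => @test_cont1 psi x tp) hs1.
have i2 := test_mul_integrable ch (fun x => @test_cont psi x tp) hs.
apply/eqP; rewrite -addr_eq0 -cintegralD //; apply/eqP.
pose F x := g x * (psi x)%:C.
have dpsi x := @smooth_is_derive _ psi 0%N x sp.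
have dF x : cderiv F x (g x * (derive1 psi x)%:C + h x * (psi x)%:C).
  have [->|x0] := eqVneq x 0; last first.
    by apply: cderiv_eq (cderivM (dg x x0) (cderiv_real (dpsi x))) _; rewrite addrC.
  have p0 : psi 0 = 0 by apply/eqP/negPn/negP => /hp; rewrite normr0 leNgt a0.
  have p1 : derive1 psi 0 = 0.
    have [a' [b' [a'0 _ h']]] := hs1.
    by apply/eqP/negPn/negP => /h'; rewrite normr0 leNgt a'0.
  rewrite p0 p1 !mulr0 addr0; apply: (@cderiv_near _ (fun=> 0)); last exact: cderiv_cst.
    have : \forall y \near (0 : R), `|y| < a by apply: near_norm_lt; rewrite normr0.
  apply: filterS => y ya; rewrite /F; suff -> : psi y = 0 by rewrite mulr0.
  by apply/eqP/negPn/negP => /hp; rewrite leNgt ya.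
have cF x : ccont (fun x => g x * (derive1 psi x)%:C + h x * (psi x)%:C) x.
  apply: ccontD; first exact: (test_mul_cont _ cg (fun x => @test_cont1 psi x tp) hs1).
  exact: (test_mul_cont _ ch (fun x => @test_cont psi x tp) hs).
have [a' [b' [a'0 ab' hp']]] := hs1.
pose M := b + b'.
have Mx x : M <= `|x| -> psi x = 0 /\ derive1 psi x = 0.
  move=> hx; split; apply/eqP/negPn/negP; first by move/hp => /andP[_]; rewrite /M in hx *; lra.
  by move/hp' => /andP[_]; rewrite /M in hx *; lra.
have M0 : 0 < M by rewrite /M; lra.
have NM : - M < M by lra.
have key (F' F1 : R -> R) : (forall x : R, is_derive x (1 : R) F' (F1 x)) ->
   (forall x : R, {for x, continuous F1}) -> (forall x, M <= `|x| -> F' x = 0) ->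
   (forall x, M <= `|x| -> F1 x = 0) -> \int[mu]_x F1 x = 0.
  move=> d1 c1 z1 z2.
  rewrite (@Rintegral_support _ F1 `[- M, M]); last first.
    move=> x /=; rewrite in_itv /= -ler_norml => /negP; rewrite -ltNge => /ltW; exact: z2.
  rewrite (@FTC2_closed _ F' F1 _ _ NM); [|by move=> x _; exact: d1|by move=> x _; exact: c1].
  by rewrite !z1 ?subrr // ?normrN ger0_norm // ltW.
apply: complexP => /=.
- apply: (key (fun x => Re (F x))).
  + by move=> x; have [] := dF x.
  + by move=> x; have [] := cF x.
  + by move=> x /Mx[p0 _]; rewrite /F p0 mulr0.
  + by move=> x /Mx[p0 p1]; rewrite p0 p1 !mulr0 addr0.
- apply: (key (fun x => Im (F x))).
  + by move=> x; have [] := dF x.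
  + by move=> x; have [] := cF x.
  + by move=> x /Mx[p0 _]; rewrite /F p0 mulr0.
  + by move=> x /Mx[p0 p1]; rewrite p0 p1 !mulr0 addr0.
Qed.

(** Weak solutions with a continuous right-hand side are classical. Only the right half-line is
    treated; the left one is reached by reflection. *)
Lemma weak_derivative_derive g h h' : weak_derivative_off0 g h ->
  (forall x, 0 < x -> ccont g x) -> (forall x, 0 < x -> h x = h' x) ->
  (forall x, 0 < x -> ccont h' x) -> forall x, 0 < x -> cderiv g x (h' x).
Proof.
move=> wd cg hh ch x x0.
have T psi : smooth psi -> (exists a b : R, [/\ 0 < a, a < b &
    forall x, psi x != 0 -> a <= x <= b]) ->
    cintegral setT (fun x => g x * (derive1 psi x)%:C) = - cintegral setT (fun x => h' x * (psi x)%:C).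
  move=> sp [a [b [a0 ab hp]]]; have tp : test_off0 psi.
    split => //; exists a, b; split => // y /hp /andP[ay yb].
    by rewrite ger0_norm ?ay ?yb // ltW // (lt_le_trans a0).
  rewrite (wd psi tp); congr (- _); apply: eq_cintegral => y _.
  have [->|py] := eqVneq (psi y) 0; first by rewrite !mulr0.
  by rewrite hh //; have /andP[ay _] := hp y py; exact: lt_le_trans ay.
split.
- apply: (@du_bois_reymond _ (fun y => Re (g y)) (fun y => Re (h' y))) => //.
  + by move=> y y0; have [] := cg y y0.
  + by move=> y y0; have [] := ch y y0.
  + move=> psi sp hp; have /(congr1 (fun z => Re z)) := T psi sp hp.
    rewrite cReN /=; under eq_Rintegral do rewrite cReM /= mulr0 subr0.
    by move=> ->; congr (- _); apply: eq_Rintegral => y _; rewrite cReM /= mulr0 subr0.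
- apply: (@du_bois_reymond _ (fun y => Im (g y)) (fun y => Im (h' y))) => //.
  + by move=> y y0; have [] := cg y y0.
  + by move=> y y0; have [] := ch y y0.
  + move=> psi sp hp; have /(congr1 (fun z => Im z)) := T psi sp hp.
    rewrite cImN /=; under eq_Rintegral do rewrite cImM /= mulr0 add0r.
    by move=> ->; congr (- _); apply: eq_Rintegral => y _; rewrite cImM /= mulr0 add0r.
Qed.

End TestFunctions.

(** * The operator as a pair of half-line equations *)

Section Graph.
Context {R : realType}.
Notation mu := (@lebesgue_measure R).
Implicit Types (g h v f : R -> R[i]) (b c : R).

(* The constant [k] of [hrhs] that the equation imposes on [xi > 0]. *)
Definition coupling b v : R[i] :=
  (3 - b)%:C * ((limr0 v + liml0 v) / 2) - (3 - 3 * b / 2)%:C * Jh (fun x => v (- x)) 0.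

Lemma inX_cont v x : inX v -> x != 0 -> ccont v x.
Proof. by move=> [_ /inCdP[_ h _ _]]; exact: h. Qed.

Lemma hrhs_cont b la k v x : inX v -> 0 < x -> ccont (hrhs b la k v) x.
Proof.
move=> hv x0; have [B B0 hB] := inX_bound hv; have mv := inX_cmeas hv.
have cv y : 0 < y -> ccont v y by move=> y0; apply: inX_cont => //; rewrite gt_eqF.
have ce : {for x, continuous (fun y : R => expR (- y))}.
  by apply: differentiable_continuous; apply/derivable1_diffP; have [] := is_derive_expN x.
apply: ccontB; [apply: ccontB; [apply: ccontB|]|].
- apply: ccontM; last exact: cv.
  apply: ccontD; first exact: ccont_cst.
  by apply: ccont_real; apply: continuous_mul => //; exact: cst_continuous.
- apply: ccontM; first exact: ccont_cst.
  exact: (cderiv_cont (cderiv_eJh mv hB cv x0)).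
- apply: ccontM; first exact: ccont_cst.
  exact: (cderiv_cont (cderiv_eKh mv hB cv x0)).
- by apply: ccontM; [exact: ccont_cst|exact: ccont_real].
Qed.

Lemma Lw_nonlocal_hrhs b c la v x : 0 < c -> inX v -> 0 < x ->
  c%:C * la * v x - Lw_nonlocal b c v x = c%:C * hrhs b la (coupling b v) v x.
Proof.
move=> c0 hv x0; rewrite Lw_nonlocal_pos // /hrhs /coupling !realcE.
by move: (Jh _ _) (Jh _ _) (Kh _ _) => J1 J2 K; field.
Qed.

Lemma Lw_nonlocal_cont b c v x : 0 < c -> inX v -> x != 0 -> ccont (Lw_nonlocal b c v) x.
Proof.
move=> c0.
suff H u y : inX u -> 0 < y -> ccont (Lw_nonlocal b c u) y.
  move=> hv x0; have [x0'|x0'|E] := ltgtP x 0; last by rewrite E eqxx in x0.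
  - have [hr _ _] := inX_opp hv.
    have hc : ccont (Lw_nonlocal b c (fun x => v (- x))) (- x) by apply: H => //; rewrite oppr_gt0.
    apply: (@ccont_near _ _ (fun y => - Lw_nonlocal b c (fun x => v (- x)) (- y))).
      have : \forall y \near x, y < 0 by exact: lt_nbhsl.
      apply: filterS => y y0; rewrite -Lw_nonlocal_opp ?opprK // oppr_eq0 lt_eqF //.
    by apply: ccvgN; exact: (@ccont_opp _ _ x hc).
  - exact: H.
move=> hu y0; apply: (@ccont_near _ _ (fun y => c%:C * 0 * u y - c%:C * hrhs b 0 (coupling b u) u y)).
  have : \forall z \near y, 0 < z by exact: lt_nbhsr.
  apply: filterS => z z0; rewrite -Lw_nonlocal_hrhs //; ring.
have yn0 : y != 0 by rewrite gt_eqF.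
have c1 := inX_cont hu yn0; have c2 := hrhs_cont b 0 (coupling b u) hu y0.
exact: (ccontB (ccontM (ccont_cst _ y) c1) (ccontM (ccont_cst _ y) c2)).
Qed.

(** The nonlocal part of an element of X is continuous off 0, so the weak equation has a continuous
    right-hand side and the eigenfunction is differentiable there. *)
Lemma Lw_graph_half_ode b c (lambda : R[i]) v : 0 < c ->
  Lw_graph b c v (fun x => lambda * v x) -> half_ode b (lambda / c%:C) (coupling b v) v.
Proof.
move=> c0 [hv hf wd] x x0.
have cC : (c%:C : R[i]) != 0 by rewrite -realc0 (inj_eq (@complexI _)) gt_eqF.
have lc : c%:C * (lambda / c%:C) = lambda by rewrite mulrC divfK.
have cv y : 0 < y -> ccont v y by move=> y0; apply: inX_cont => //; rewrite gt_eqF.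
have K := @weak_derivative_derive _ _ _
  (fun y => c%:C * hrhs b (lambda / c%:C) (coupling b v) v y) wd _ _ _ x x0.
have D : cderiv (fun x0 : R => (c - u0 c x0)%:C * v x0) x (c%:C * hrhs b (lambda / c%:C) (coupling b v) v x).
  apply: K.
  - move=> y y0; apply: ccontM; last exact: cv.
    apply: ccont_real; rewrite /u0; apply: continuousB; first exact: cst_continuous.
    apply: continuous_mul; first exact: cst_continuous.
    apply: (@continuous_comp _ _ _ (fun y : R => - `|y|) expR); last exact: continuous_expR.
    by apply: continuousN; exact: norm_continuous.
  - by move=> y y0; rewrite -Lw_nonlocal_hrhs // lc.
  - by move=> y y0; apply: ccontM; [exact: ccont_cst|exact: hrhs_cont].
apply: (@cderiv_near _ (fun y => c%:C^-1 * ((c - u0 c y)%:C * v y))).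
  have : \forall y \near x, 0 < y by exact: lt_nbhsr.
  apply: filterS => y y0; rewrite mulrA; congr (_ * _).
  rewrite /u0 gtr0_norm //; have -> : c - c * expR (- y) = c * (1 - expR (- y)) by ring.
  by rewrite rmorphM mulrA mulVf // mul1r.
by apply: cderiv_eq (cderivZ _ D) _; rewrite mulrA mulVf // mul1r.
Qed.

Lemma half_ode_Lw_graph b c (lambda : R[i]) v : 0 < c -> inX v -> inX (fun x => lambda * v x) ->
  half_ode b (lambda / c%:C) (coupling b v) v ->
  half_ode b (- (lambda / c%:C)) (coupling b (fun x => v (- x))) (fun x => v (- x)) ->
  Lw_graph b c v (fun x => lambda * v x).
Proof.
move=> c0 hv hf o1 o2; split => //.
have cC : (c%:C : R[i]) != 0 by rewrite -realc0 (inj_eq (@complexI _)) gt_eqF.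
have lc : c%:C * (lambda / c%:C) = lambda by rewrite mulrC divfK.
have [hr _ _] := inX_opp hv.
have cE (y : R) : 0 < y -> c - c * expR (- y) = c * (1 - expR (- y)) by move=> _; ring.
apply: derive_weak_derivative => x x0; last first.
  apply: ccontB; first by apply: ccontM; [exact: ccont_cst|exact: inX_cont].
  exact: Lw_nonlocal_cont.
have [x0'|x0'|E] := ltgtP x 0; last by rewrite E eqxx in x0.
- have nx0 : 0 < - x by rewrite oppr_gt0.
  have D := cderiv_comp_opp (cderivZ c%:C (o2 (- x) nx0)).
  apply: (@cderiv_near _ (fun y => c%:C * ((1 - expR (- - y))%:C * v (- - y)))).
    have : \forall y \near x, y < 0 by exact: lt_nbhsl.
    apply: filterS => y y0; rewrite !opprK mulrA; congr (_ * _).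
    by rewrite /u0 ltr0_norm // opprK -rmorphM; congr (_%:C); ring.
  have nx : - x != 0 by rewrite oppr_eq0.
  have E := Lw_nonlocal_opp b c0 hv nx; rewrite opprK in E.
  by apply: cderiv_eq D _; rewrite -Lw_nonlocal_hrhs // opprK mulrN lc E; ring.
- apply: (@cderiv_near _ (fun y => c%:C * ((1 - expR (- y))%:C * v y))).
    have : \forall y \near x, 0 < y by exact: lt_nbhsr.
    apply: filterS => y y0; rewrite mulrA; congr (_ * _).
    by rewrite /u0 gtr0_norm // -rmorphM; congr (_%:C); ring.
  by apply: cderiv_eq (cderivZ c%:C (o1 x x0')) _; rewrite -Lw_nonlocal_hrhs // lc.
Qed.

(** Testing with the reflected function: the derivative of the test function and [Lw_nonlocal] both
    change sign, which turns [lambda] into [- lambda]. *)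
Lemma Lw_graph_opp b c (lambda : R[i]) v : 0 < c ->
  Lw_graph b c v (fun x => lambda * v x) ->
  Lw_graph b c (fun x => v (- x)) (fun x => - lambda * v (- x)).
Proof.
move=> c0 [hv hf wd].
have [hr _ _] := inX_opp hv; have [hfr _ _] := inX_opp hf.
have hX g : inX g -> inX (fun x => - g x).
  move=> [[m n] /inCdP[[M hM] h2 h3 h4]]; split.
    apply/inL2P; split; first exact: cmeasN.
    have /inL2P[_] : inL2 g by [].
    by apply: eq_integrable => // x _ /=; rewrite cmodN.
  have [] := @inCdI _ (fun x => - g x) (- limr0 g) (- liml0 g) => //.
  - by exists M => x /hM; rewrite cmodN.
  - by move=> x /h2; exact: ccvgN.
  - exact: ccvgN.
  - exact: ccvgN.
have hfX : inX (fun x => - lambda * v (- x)).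
  have -> : (fun x => - lambda * v (- x)) = (fun x => - (lambda * v (- x))) by apply/funext => x; rewrite mulNr.
  exact: hX.
split; [exact: hr|exact: hfX|move=> psi tp].
have [sp [a [b' [a0 ab hp]]]] := tp.
pose psi' x := psi (- x).
have sp' : smooth psi'.
  have := @smooth_affine _ psi (-1) 0 sp.
  by have -> : (fun x => psi (-1 * x + 0)) = psi' by apply/funext => x; rewrite addr0 mulN1r.
have tp' : test_off0 psi'.
  by split => //; exists a, b'; split => // x /hp; rewrite normrN.
have dE x : derive1 psi' x = - derive1 psi (- x).
  have d := @is_derive_comp_opp _ psi x _ (@smooth_is_derive _ psi 0%N (- x) sp).
  by rewrite derive1E derive_val.
have hs : off0_support psi' by exists a, b'; split => // x /hp; rewrite normrN.
have hs1 := test_off0_derive1 tp'.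
have cg x : x != 0 -> ccont (fun x => (c - u0 c x)%:C * v x) x.
  move=> x0; apply: ccontM; last exact: inX_cont.
  apply: ccont_real; rewrite /u0; apply: continuousB; first exact: cst_continuous.
  apply: continuous_mul; first exact: cst_continuous.
  apply: (@continuous_comp _ _ _ (fun y : R => - `|y|) expR); last exact: continuous_expR.
  by apply: continuousN; exact: norm_continuous.
have ch x : x != 0 -> ccont (fun x => lambda * v x - Lw_nonlocal b c v x) x.
  move=> x0; apply: ccontB; first by apply: ccontM; [exact: ccont_cst|exact: inX_cont].
  exact: Lw_nonlocal_cont.
have i1 := test_mul_integrable cg (fun x => @test_cont1 _ psi' x tp') hs1.
have i2 := test_mul_integrable ch (fun x => @test_cont _ psi' x tp') hs.
have W := wd psi' tp'.
rewrite -(cintegral_oppT (cintegrable_cmeas i1) i1) -(cintegral_oppT (cintegrable_cmeas i2) i2) in W.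
have i1' : cintegrable setT (fun x => (c - u0 c (- x))%:C * v (- x) * (derive1 psi' (- x))%:C).
  have := cintegrable_opp measurableT (cintegrable_cmeas i1) i1.
  by have -> : [set x : R | [set: R] (- x)] = setT by apply/seteqP.
have -> : cintegral setT (fun x => (c - u0 c x)%:C * v (- x) * (derive1 psi x)%:C) =
  - cintegral setT (fun x => (c - u0 c (- x))%:C * v (- x) * (derive1 psi' (- x))%:C).
  rewrite -cintegralNf //; apply: eq_cintegral => x _.
  by rewrite dE opprK /u0 normrN rmorphN mulrN opprK.
rewrite W opprK -[LHS]opprK; congr (- _).
have i2' : cintegrable setT (fun x => (lambda * v (- x) - Lw_nonlocal b c v (- x)) * (psi' (- x))%:C).
  have := cintegrable_opp measurableT (cintegrable_cmeas i2) i2.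
  by have -> : [set x : R | [set: R] (- x)] = setT by apply/seteqP.
rewrite -cintegralNf //; apply: eq_cintegral => x _; rewrite /psi' opprK.
have [->|x0] := eqVneq x 0.
  have p0 : (psi 0)%:C = 0 :> R[i].
    congr (_%:C); by apply/eqP/negPn/negP => /hp; rewrite normr0 leNgt a0.
  have Z (X Y : R[i]) : - (X * (psi 0)%:C) = Y * (psi 0)%:C by rewrite p0 !mulr0 oppr0.
  exact: Z.
by rewrite Lw_nonlocal_opp // -mulNr; congr (_ * _); ring.
Qed.

End Graph.

(** * The point spectrum lies in the bands *)

Section Spectrum.
Context {R : realType}.
Notation mu := (@lebesgue_measure R).
Implicit Types (v : R -> R[i]) (b c : R).

Lemma inX_sqr_integrable v : inX v ->
  mu.-integrable `[1, +oo[ (EFin \o (fun x => cmod (v x) ^+ 2)).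
Proof. by move=> [/inL2P[_ h] _]; apply: integrableS h. Qed.

Lemma inX_limr0 v : inX v -> ccvg (0 : R)^'+ v (limr0 v).
Proof. by move=> [_ /inCdP[]]. Qed.

Lemma inX_liml0 v : inX v -> ccvg (0 : R)^'- v (liml0 v).
Proof. by move=> [_ /inCdP[]]. Qed.

Lemma inX_cont_pos v x : inX v -> 0 < x -> ccont v x.
Proof. by move=> hv x0; apply: inX_cont => //; rewrite gt_eqF. Qed.

(* [hv2 b la k v] is the second derivative of a solution [v], so this is the vanishing of the
   momentum density [v - v'']. *)
Definition no_momentum b la k v := forall x, 0 < x -> hv2 b la k v x = v x.

Lemma half_ode_no_momentum b la k v : inX v -> half_ode b la k v ->
  (0 <= Re la \/ 2 + Re la - b <= 0) -> no_momentum b la k v.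
Proof.
move=> hv ode hla x x0; have [B B0 hB] := inX_bound hv; have mv := inX_cmeas hv.
have cv y : 0 < y -> ccont v y by exact: inX_cont_pos.
have [M hM] := momentum_mexp mv hB cv ode.
have M0 : M = 0.
  case: hla => hla.
  - exact: (momentum_eq0_pinfty mv hB ode (inX_sqr_integrable hv) hla hM).
  - exact: (momentum_eq0_at0 mv hB (inX_limr0 hv) ode hla hM).
by have /eqP := hM x x0; rewrite M0 mul0r subr_eq0 => /eqP.
Qed.

Lemma no_momentum_exp b la k v : inX v -> half_ode b la k v -> no_momentum b la k v ->
  (forall x, 0 < x -> v x = limr0 v * (expR (- x))%:C) /\ Jh v 0 = limr0 v / 3.
Proof.
move=> hv ode E2; have [B B0 hB] := inX_bound hv; have mv := inX_cmeas hv.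
have cv x : 0 < x -> ccont v x by exact: inX_cont_pos.
have lv := inX_limr0 hv.
have d1 x : 0 < x -> cderiv v x (hv1 b la k v x) by exact: half_ode_derive.
have d2 x : 0 < x -> cderiv (hv1 b la k v) x (v x).
  by move=> x0; exact: cderiv_eq (cderiv_hv1 mv hB cv x0 (d1 x x0)) (E2 x x0).
have [A hA] := second_order_decay d1 d2 (fun x _ => hB x).
have AE : A = limr0 v.
  apply: (ccvg_unique _ lv).
  apply: (@ccvg_near _ _ _ _ (fun x => A * (expR (- x))%:C)).
    by near=> x; apply: hA; near: x; exact: nbhs_right_gt.
  by apply: ccvg_eq (ccvgM (ccvg_cst A) (ccvg_real cvg_expN0)) _; rewrite mulr1.
split; first by rewrite -AE.
by rewrite (Jh_exp hA mv) // AE mulr0 expR0 mulr1.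
Unshelve. all: by end_near. Qed.

Lemma Re_divc (z : R[i]) c : Re (z / c%:C) = Re z / c.
Proof. by rewrite -fmorphV cReM /= mulr0 subr0. Qed.

Lemma eigenfunction_halves b c (lambda : R[i]) v : 0 < c ->
  Lw_graph b c v (fun x => lambda * v x) ->
  [/\ inX v, inX (fun x => v (- x)),
      half_ode b (lambda / c%:C) (coupling b v) v &
      half_ode b (- (lambda / c%:C)) (coupling b (fun x => v (- x))) (fun x => v (- x))].
Proof.
move=> c0 hG; have [hv _ _] := hG; have [hr _ _] := inX_opp hv.
split; [exact: hv|exact: hr|exact: (Lw_graph_half_ode c0 hG)|].
by have := Lw_graph_half_ode c0 (Lw_graph_opp c0 hG); rewrite mulNr.
Qed.

Lemma coupling_opp b v : inX v -> coupling b (fun x => v (- x)) =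
  (3 - b)%:C * ((limr0 v + liml0 v) / 2) - (3 - 3 * b / 2)%:C * Jh v 0.
Proof.
move=> hv; have [_ r1 r2] := inX_opp hv; rewrite /coupling r1 r2 [liml0 v + _]addrC.
have -> // : (fun x => v (- - x)) = v by apply/funext => x; rewrite opprK.
Qed.

Lemma ae_eq0_off0 v : (forall x, x != 0 -> v x = 0) -> {ae mu, forall x, v x = 0}.
Proof.
move=> h; exists [set 0]; split => //; first exact: lebesgue_measure_set1.
move=> x /= hx; apply/eqP; apply/negPn/negP => /h; exact: hx.
Qed.

(** Let $A$ and $C$ be the one-sided limits at 0. With pure exponentials on both sides the two
    matching conditions become $\lambda A=(A+C)/2=-\lambda C$, with $\lambda$ for [la]. Hence
    $\lambda(A+C)=0$, and a nonzero $\lambda$ forces $A+C=0$, then $A=C=0$. *)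
Lemma no_momentum_eigenvalue b c (lambda : R[i]) v : 0 < c -> Lw_eigenfunction b c lambda v ->
  no_momentum b (lambda / c%:C) (coupling b v) v ->
  no_momentum b (- (lambda / c%:C)) (coupling b (fun x => v (- x))) (fun x => v (- x)) -> lambda = 0.
Proof.
move=> c0 [hG hn]; have [hv hr o1 o2] := eigenfunction_halves c0 hG.
have [->//|l0] := eqVneq lambda 0; set la := lambda / c%:C in o1 o2 * => n1 n2; exfalso.
have la0 : la != 0.
  rewrite mulf_neq0 // invr_eq0 -realc0 (inj_eq (@complexI _)) gt_eqF //.
have [v1 J1] := no_momentum_exp hv o1 n1.
have [v2 J2] := no_momentum_exp hr o2 n2.
have [_ r1 r2] := inX_opp hv.
have [B B0 hB] := inX_bound hv; have mv := inX_cmeas hv; have mr := inX_cmeas hr.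
have hBr x : cmod (v (- x)) <= B by [].
have e1 := half_ode_at0 mv hB (inX_limr0 hv) o1.
have e2 := half_ode_at0 mr hBr (inX_limr0 hr) o2.
rewrite coupling_opp // in e2; rewrite /coupling in e1.
rewrite J1 J2 in e1; rewrite J1 J2 in e2.
rewrite r1 in e1 e2 v2 *; rewrite ?r1 in v2.
set A := limr0 v in e1 e2 v1 v2 J1 J2; set C := liml0 v in e1 e2 v1 v2 J1 J2.
rewrite !realcE in e1 e2.
have f1 : la * A = (A + C) / 2.
  apply/eqP; rewrite -subr_eq0; apply/eqP; rewrite -[RHS]e1; by field.
have f2 : - la * C = (A + C) / 2.
  apply/eqP; rewrite -subr_eq0; apply/eqP; rewrite -[RHS]e2; by field.
have f3 : A + C = 0.
  have : la * (A + C) = 0 by rewrite mulrDr f1 -[la * C]opprK -mulNr f2 subrr.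
  by move/eqP; rewrite mulf_eq0 (negbTE la0) => /eqP.
have A0 : A = 0.
  by move: f1; rewrite f3 mul0r => /eqP; rewrite mulf_eq0 (negbTE la0) => /eqP.
have C0 : C = 0 by move: f3; rewrite A0 add0r.
apply: hn; apply: ae_eq0_off0 => x x0.
have [x0'|x0'|E] := ltgtP x 0; last by rewrite E eqxx in x0.
- have nx : 0 < - x by rewrite oppr_gt0.
  by have := v2 _ nx; rewrite opprK C0 mul0r.
- by rewrite v1 // A0 mul0r.
Qed.

(** Each half-line whose parameter has nonnegative real part has no momentum because of decay. A
    remaining one has parameter of real part [- |Re la|], and boundedness at the origin disposes of
    it as soon as [|Re la| >= 2 - b]. *)
Lemma eigenvalue_band b c (lambda : R[i]) v : 0 < c -> Lw_eigenfunction b c lambda v ->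
  lambda = 0 \/ (b < 2 /\ 0 < `|Re lambda| < c * (2 - b)).
Proof.
move=> c0 he; have [hv hr o1 o2] := eigenfunction_halves c0 he.1.
have [->|l0] := eqVneq lambda 0; [by left|right].
set la := lambda / c%:C in o1 o2.
have Rl : Re lambda = c * Re la by rewrite /la Re_divc mulrC divfK // gt_eqF.
apply: contrapT => hb.
have hb' : ~ (0 < `|Re la| < 2 - b).
  move=> /andP[h1 h2]; apply: hb; split; first by have := normr_ge0 (Re la); lra.
  by rewrite Rl normrM (gtr0_norm c0) mulr_gt0 //= ltr_pM2l.
have c1 : 0 <= Re la \/ 2 + Re la - b <= 0.
  have [h|h] := leP 0 (Re la); [by left|right].
  rewrite leNgt; apply/negP => h2; apply: hb'; rewrite ltr0_norm //; apply/andP; split; lra.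
have c2 : 0 <= Re (- la) \/ 2 + Re (- la) - b <= 0.
  rewrite cReN; have [h|h] := leP (Re la) 0; [by left; lra|right].
  rewrite leNgt; apply/negP => h2; apply: hb'; rewrite gtr0_norm //; apply/andP; split; lra.
move/eqP: l0; apply; apply: (no_momentum_eigenvalue c0 he).
- exact: half_ode_no_momentum.
- exact: half_ode_no_momentum.
Qed.

End Spectrum.

(** * Closedness of the graph *)

Section Closedness.
Context {R : realType}.
Notation mu := (@lebesgue_measure R).
Implicit Types (v w f d : R -> R[i]) (b c : R).

Lemma inXB v w : inX v -> inX w -> [/\ inX (fun x => v x - w x),
  limr0 (fun x => v x - w x) = limr0 v - limr0 w &
  liml0 (fun x => v x - w x) = liml0 v - liml0 w].
Proof.
move=> [/inL2P[mv iv] /inCdP[[M hM] v1 v2 v3]] [/inL2P[mw iw] /inCdP[[N hN] w1 w2 w3]].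
have [h1 h2 h3] : [/\ inCd (fun x => v x - w x),
  limr0 (fun x => v x - w x) = limr0 v - limr0 w &
  liml0 (fun x => v x - w x) = liml0 v - liml0 w].
  apply: inCdI.
  - exists (M + N) => x x0; apply: le_trans (cmodB _ _) _.
    by apply: lerD; [exact: hM|exact: hN].
  - by move=> x x0; apply: ccontB; [exact: v1|exact: w1].
  - exact: ccvgB.
  - exact: ccvgB.
split; [split; [|exact: h1]|exact: h2|exact: h3].
apply/inL2P; split; first exact: cmeasB.
have ii : mu.-integrable setT (EFin \o (fun x => 2 * (cmod (v x) ^+ 2) + 2 * (cmod (w x) ^+ 2))).
  have -> : (EFin \o (fun x => 2 * (cmod (v x) ^+ 2) + 2 * (cmod (w x) ^+ 2))) =
    ((fun x => (2%:E * (EFin \o (fun x => cmod (v x) ^+ 2)%R) x)%E) \+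
     (fun x => (2%:E * (EFin \o (fun x => cmod (w x) ^+ 2)%R) x)%E))%E by [].
  by apply: integrableD => //; apply: integrableZl.
apply: le_integrable ii => //.
  apply/measurable_EFinP; apply: measurable_funX.
  by apply: cmeas_cmod => //; exact: cmeasB.
move=> x _ /=; rewrite lee_fin !ger0_norm ?exprn_ge0 ?cmod_ge0 //; last first.
  by rewrite addr_ge0 // mulr_ge0 // exprn_ge0 // cmod_ge0.
have h : cmod (v x - w x) ^+ 2 <= (cmod (v x) + cmod (w x)) ^+ 2.
  by rewrite ler_pXn2r ?nnegrE ?addr_ge0 ?cmod_ge0 // cmodB.
apply: le_trans h _; have := sqr_ge0 (cmod (v x) - cmod (w x)); nra.
Qed.

Lemma JhB v w x : inX v -> inX w -> Jh (fun y => v y - w y) x = Jh v x - Jh w x.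
Proof.
move=> hv hw; have [B B0 hB] := inX_bound hv; have [N N0 hN] := inX_bound hw.
rewrite /Jh -cintegralB //.
- by apply: eq_cintegral => y _; rewrite mulrBr.
- exact: (@cintegrable_tail _ _ B _ _ (inX_cmeas hv)).
- exact: (@cintegrable_tail _ _ N _ _ (inX_cmeas hw)).
Qed.

Lemma KhB v w x : inX v -> inX w -> Kh (fun y => v y - w y) x = Kh v x - Kh w x.
Proof.
move=> hv hw; have [B B0 hB] := inX_bound hv; have [N N0 hN] := inX_bound hw.
rewrite /Kh -cintegralB //.
- exact: (@cintegrable_Kh _ _ B _ (inX_cmeas hv)).
- exact: (@cintegrable_Kh _ _ N _ (inX_cmeas hw)).
Qed.

Lemma Lw_nonlocalB b c v w x : 0 < c -> inX v -> inX w -> x != 0 ->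
  Lw_nonlocal b c (fun y => v y - w y) x = Lw_nonlocal b c v x - Lw_nonlocal b c w x.
Proof.
move=> c0.
suff H u z y : inX u -> inX z -> 0 < y ->
    Lw_nonlocal b c (fun y => u y - z y) y = Lw_nonlocal b c u y - Lw_nonlocal b c z y.
  move=> hv hw x0; have [x0'|x0'|E] := ltgtP x 0; last by rewrite E eqxx in x0.
  - have nx : 0 < - x by rewrite oppr_gt0.
    have nx0 : - x != 0 by rewrite oppr_eq0.
    have [hb _ _] := inXB hv hw; have [rv _ _] := inX_opp hv; have [rw _ _] := inX_opp hw.
    have EE u : inX u -> Lw_nonlocal b c u x = - Lw_nonlocal b c (fun x => u (- x)) (- x).
      by move=> hu; rewrite -{1}[x]opprK (Lw_nonlocal_opp b c0 hu nx0).
    rewrite (EE _ hb) (EE _ hv) (EE _ hw) (H _ _ _ rv rw nx); ring.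
  - exact: H.
move=> hu hz y0; have [hb r1 r2] := inXB hu hz.
have [ru _ _] := inX_opp hu; have [rz _ _] := inX_opp hz.
rewrite !Lw_nonlocal_pos // JhB // (JhB _ ru rz) KhB // r1 r2.
rewrite !realcE; move: (Jh _ _) (Jh _ _) (Kh _ _) (Jh _ _) (Jh _ _) (Kh _ _).
move=> J1 J2 K1 J3 J4 K2; by field.
Qed.

Lemma cmod_lim_le (F : set_system R) {FF : ProperFilter F} v l (e : R) :
  ccvg F v l -> (\forall x \near F, cmod (v x) <= e) -> cmod l <= e.
Proof.
move=> /ccvg_cmod h hn; have hc : cvg (cmod (v x) @[x --> F]) by apply/cvg_ex; exists (cmod l).
by rewrite -(cvg_lim _ h) //; exact: limr_le.
Qed.

(** The bound on [d] is assumed off 0 only, so the case [x = 0] is obtained as a limit from the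
    right. *)
Lemma cmod_Jh_off0_le d (e : R) x : inX d -> (forall x, x != 0 -> cmod (d x) <= e) ->
  0 <= x -> cmod ((expR x)%:C * Jh d x) <= e.
Proof.
move=> hd he x0; have [B B0 hB] := inX_bound hd; have md := inX_cmeas hd.
have pos y : 0 < y -> cmod ((expR y)%:C * Jh d y) <= e.
  move=> y0; have e0 : 0 <= e by apply: le_trans (he 1 _); rewrite ?cmod_ge0 ?oner_neq0.
  have h : cmod (Jh d y) <= 2 * (e * (expR (- 2 * y) / 2)).
    apply: cmod_tail_le => // z yz; apply: he; rewrite gt_eqF //; exact: lt_le_trans yz.
  rewrite cmodM cmod_real gtr0_norm ?expR_gt0 //.
  apply: (@le_trans _ _ (expR y * (2 * (e * (expR (- 2 * y) / 2))))).
    by rewrite ler_wpM2l ?expR_ge0.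
  have -> : expR y * (2 * (e * (expR (- 2 * y) / 2))) = e * expR (- y).
    have -> : expR (- y) = expR y * expR (- 2 * y) by rewrite -expRD; congr expR; ring.
    by field.
  rewrite -[leRHS]mulr1 ler_wpM2l // -expR0 ler_expR; lra.
move: x0; rewrite le_eqVlt => /predU1P[<-|]; last exact: pos.
rewrite expR0 mul1r; have hj := eJh_lim0 md hB.
by apply: (cmod_lim_le hj); near=> y; apply: pos; near: y; exact: nbhs_right_gt.
Unshelve. all: by end_near. Qed.

Lemma cmod_Kh_off0_le d (e : R) x : inX d -> (forall x, x != 0 -> cmod (d x) <= e) ->
  0 < x -> cmod ((expR (- x))%:C * Kh d x) <= 2 * e.
Proof.
move=> hd he x0; have [B B0 hB] := inX_bound hd; have md := inX_cmeas hd.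
have e0 : 0 <= e by apply: le_trans (he 1 _); rewrite ?cmod_ge0 ?oner_neq0.
have ic : mu.-integrable `]0, x] (EFin \o (fun=> e)).
  apply: integrableS (integrable_cst_itv 0 x e) => // y /=; rewrite !in_itv /=.
  by move=> /andP[/ltW -> ->].
have h : cmod (Kh d x) <= 2 * \int[mu]_(y in `]0, x]) e.
  rewrite /Kh -cintegral_obnd_cbnd; last first.
    apply: cintegrableS (cintegrable_Kh x md hB) => // y /=; rewrite !in_itv /=.
    by move=> /andP[/ltW -> ->].
  apply: cmod_cintegral_le => //.
  - exact: cmeasS md.
  - by move=> y /=; rewrite in_itv /= => /andP[y0 _]; apply: he; rewrite gt_eqF.
have E : \int[mu]_(y in `]0, x]) e = e * x.
  rewrite Rintegral_itv_obnd_cbnd; first by rewrite Rintegral_cst_itv ?subr0 // ltW.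
  exact: ic.
rewrite E in h; rewrite cmodM cmod_real gtr0_norm ?expR_gt0 //.
have hx : x * expR (- x) <= 1.
  rewrite expRN ler_pdivrMr ?expR_gt0 // mul1r.
  by have := expR_ge1Dx x; lra.
apply: le_trans (ler_wpM2l (expR_ge0 _) h) _.
have -> : expR (- x) * (2 * (e * x)) = 2 * e * (x * expR (- x)) by ring.
by rewrite -[leRHS]mulr1 ler_wpM2l // mulr_ge0.
Qed.

(** The nonlocal part is bounded for the supremum norm; the unbounded part of the operator is the
    derivative, which the weak formulation moves to the test function. *)
Lemma cmod_Lw_nonlocal_le b c d (e : R) x : 0 < c -> inX d ->
  (forall x, x != 0 -> cmod (d x) <= e) -> x != 0 ->
  cmod (Lw_nonlocal b c d x) <= c * (2 * `|3 - 3 * b / 2| + `|b| + 2 * `|3 - b|) * e.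
Proof.
move=> c0.
suff H u y : inX u -> (forall x, x != 0 -> cmod (u x) <= e) -> 0 < y ->
  cmod (Lw_nonlocal b c u y) <= c * (2 * `|3 - 3 * b / 2| + `|b| + 2 * `|3 - b|) * e.
  move=> hd he x0; have [x0'|x0'|E] := ltgtP x 0; last by rewrite E eqxx in x0.
  - have nx : 0 < - x by rewrite oppr_gt0.
    have nx0 : - x != 0 by rewrite oppr_eq0.
    have [rd _ _] := inX_opp hd.
    by rewrite -[x]opprK Lw_nonlocal_opp // cmodN; apply: H => // y y0; rewrite he // oppr_eq0.
  - exact: H.
move=> hu he y0; have [ru _ _] := inX_opp hu.
have e0 : 0 <= e by apply: le_trans (he 1 _); rewrite ?cmod_ge0 ?oner_neq0.
rewrite Lw_nonlocal_pos // cmodM cmod_real (gtr0_norm c0) -[leRHS]mulrA (ler_pM2l c0).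
have ey : `|expR (- y)| <= 1 by rewrite ger0_norm ?expR_ge0 // -expR0 ler_expR; lra.
have h1 := cmod_Jh_off0_le hu he (ltW y0).
have hr z : z != 0 -> cmod (u (- z)) <= e by move=> z0; rewrite he // oppr_eq0.
have := cmod_Jh_off0_le ru hr (lexx (0 : R)); rewrite expR0 mul1r => h2.
have h3 := cmod_Kh_off0_le hu he y0.
have h4 : cmod (limr0 u) <= e.
  apply: (cmod_lim_le (inX_limr0 hu)); near=> z; apply: he.
  by rewrite gt_eqF //; near: z; exact: nbhs_right_gt.
have h5 : cmod (liml0 u) <= e.
  apply: (cmod_lim_le (inX_liml0 hu)); near=> z; apply: he.
  by rewrite lt_eqF //; near: z; exact: nbhs_left_lt.
have h6 : cmod ((limr0 u + liml0 u) / 2 - u y) <= 2 * e.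
  apply: le_trans (cmodB _ _) _.
  have -> : 2 * e = e + e by ring.
  apply: lerD; last by apply: he; rewrite gt_eqF.
  rewrite cmodM cmodV.
  have -> : cmod (2 : R[i]) = 2 by rewrite -[2 in LHS](rmorph_nat (real_complex R)) cmod_real ger0_norm.
  by rewrite ler_pdivrMr // mulr_natr mulr2n (le_trans (cmodD _ _)) // lerD.
have T1 : cmod ((3 - 3 * b / 2)%:C * (expR y)%:C * Jh u y) <= `|3 - 3 * b / 2| * e.
  by rewrite -mulrA cmodM cmod_real ler_wpM2l.
have T2 : cmod ((3 - 3 * b / 2)%:C * (expR (- y))%:C * Jh (fun x => u (- x)) 0) <= `|3 - 3 * b / 2| * e.
  rewrite -mulrA cmodM cmod_real ler_wpM2l // cmodM cmod_real -[leRHS]mul1r.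
  by apply: ler_pM => //; exact: cmod_ge0.
have T3 : cmod ((b / 2)%:C * (expR (- y))%:C * Kh u y) <= `|b| * e.
  rewrite -mulrA cmodM cmod_real; apply: le_trans (ler_wpM2l (normr_ge0 _) h3) _.
  by rewrite normrM (@ger0_norm _ 2^-1) //; lra.
have T4 : cmod ((3 - b)%:C * (expR (- y))%:C * ((limr0 u + liml0 u) / 2 - u y)) <= `|3 - b| * (2 * e).
  rewrite -mulrA cmodM cmod_real ler_wpM2l // cmodM cmod_real -[leRHS]mul1r.
  by apply: ler_pM => //; exact: cmod_ge0.
apply: le_trans (cmodD _ _) _.
apply: le_trans (lerD (cmodD _ _) (lexx _)) _.
apply: le_trans (lerD (lerD (cmodB _ _) (lexx _)) (lexx _)) _.
apply: le_trans (lerD (lerD (lerD T1 T2) T3) T4) _.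
by rewrite le_eqVlt; apply/orP; left; apply/eqP; ring.
Unshelve. all: by end_near. Qed.

(** If the bound failed at a point of continuity it would fail on an interval, which has positive
    measure. *)
Lemma le_ae_le d (e : R) x : ccont d x -> {ae mu, forall y, cmod (d y) <= e} -> cmod (d x) <= e.
Proof.
move=> cd [N [mN N0 hN]]; rewrite leNgt; apply/negP => ex.
have /nbhs_ballP[r /= r0 hr] : \forall y \near x, e < cmod (d y).
  exact: (cvgr_gt _ (ccvg_cmod cd) _ ex).
have sub : `]x - r, x + r[%classic `<=` N.
  move=> y /=; rewrite in_itv /= => /andP[y1 y2]; apply: hN => /=; apply/negP; rewrite -ltNge.
  by apply: hr; rewrite /ball /= ltr_norml; apply/andP; split; lra.
have hle : (mu `](x - r)%R, (x + r)%R[%classic <= 0)%E.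
  by rewrite -[leRHS]N0; apply: le_measure => //; rewrite inE //; exact: measurable_itv.
move: hle; rewrite lebesgue_measure_itv /= lte_fin ifT; last by lra.
by rewrite -EFinD lee_fin leNgt => /negP; apply; lra.
Qed.

Lemma normX_small d (e : R) : inX d -> (normX d < e%:E)%E -> forall x, x != 0 -> cmod (d x) <= e.
Proof.
move=> hd; rewrite /normX gt_max => /andP[_]; rewrite /Linfnorm unlock /=.
(* The norm of exponent infinity takes a default value when the whole space is null; the interval
   [[0, 1]] excludes this case. *)
case: ifPn => [_ h|/negP[]]; last first.
  apply: (@lt_le_trans _ _ (mu `[0, 1]%classic)).
    by rewrite lebesgue_measure_itv /= lte_fin ltr01 oppr0 adde0 lte_fin.
  by apply: le_measure => //; rewrite inE.
have /ess_sup_inf.ess_supP hae := ltW h; move=> x x0; apply: (le_ae_le (inX_cont hd x0)).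
by move: hae; apply: filterS => y /=; rewrite lee_fin ger0_norm // cmod_ge0.
Qed.

Lemma cvgX_near (v_ : nat -> R -> R[i]) v (e : R) : (forall n, inX (v_ n)) -> inX v -> cvgX v_ v -> 0 < e ->
  \forall n \near \oo, forall x, x != 0 -> cmod (v_ n x - v x) <= e.
Proof.
move=> hn hv cv e0.
have : \forall n \near \oo, (normX (fun x => (v_ n x - v x)%R) < e%:E)%E.
  have : nbhs (0%E : \bar R) [set y | (y < e%:E)%E].
    by apply: open_nbhs_nbhs; split; [exact: open_ereal_lt_ereal|rewrite /= lte_fin].
  exact: cv.
apply: filterS => n; apply: normX_small.
by have [] := inXB (hn n) hv.
Qed.

Lemma closed_graph_Lw b c : 0 < c -> closed_graph (Lw_graph b c).
Proof.
move=> c0 v_ f_ v f hG hv hf cv cf; split; [exact: hv|exact: hf|move=> psi tp].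
have hs : off0_support psi by have [_ ?] := tp.
have hs1 := test_off0_derive1 tp.
have cu (x : R) : {for x, continuous (fun x => c - u0 c x)}.
  rewrite /u0; apply: continuousB; first exact: cst_continuous.
  apply: continuous_mul; first exact: cst_continuous.
  apply: (@continuous_comp _ _ _ (fun y : R => - `|y|) expR); last exact: continuous_expR.
  by apply: continuousN; exact: norm_continuous.
have cg u x : inX u -> x != 0 -> ccont (fun x => (c - u0 c x)%:C * u x) x.
  by move=> hu x0; apply: ccontM; [apply: ccont_real; exact: cu|exact: inX_cont].
have ch u g x : inX u -> inX g -> x != 0 -> ccont (fun x => g x - Lw_nonlocal b c u x) x.
  by move=> hu hg x0; apply: ccontB; [exact: inX_cont|exact: Lw_nonlocal_cont].
have ig u : inX u -> cintegrable setT (fun x => (c - u0 c x)%:C * u x * (derive1 psi x)%:C).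
  by move=> hu; apply: test_mul_integrable hs1 => // x; [exact: cg|exact: test_cont1].
have ih u g : inX u -> inX g -> cintegrable setT (fun x => (g x - Lw_nonlocal b c u x) * (psi x)%:C).
  by move=> hu hg; apply: test_mul_integrable hs => // x; [exact: ch|exact: test_cont].
have i1 : mu.-integrable setT (EFin \o (fun x => `|derive1 psi x|)).
  have c1 x : x != 0 -> ccont (fun=> 1 : R[i]) x by move=> _; exact: ccont_cst.
  have := cintegrable_cmod measurableT (test_mul_integrable c1 (fun x => @test_cont1 _ psi x tp) hs1).
  by apply: eq_integrable => // x _ /=; rewrite mul1r cmod_real.
have i2 : mu.-integrable setT (EFin \o (fun x => `|psi x|)).
  have c1 x : x != 0 -> ccont (fun=> 1 : R[i]) x by move=> _; exact: ccont_cst.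
  have := cintegrable_cmod measurableT (test_mul_integrable c1 (fun x => @test_cont _ psi x tp) hs).
  by apply: eq_integrable => // x _ /=; rewrite mul1r cmod_real.
pose I1 := \int[mu]_x `|derive1 psi x|; pose I2 := \int[mu]_x `|psi x|.
pose K := c * (2 * `|3 - 3 * b / 2| + `|b| + 2 * `|3 - b|).
set L := LHS; set Q := RHS.
(* The defect [L - Q] of the weak identity is linear in [(v, f)] and vanishes at every
   [(v_ n, f_ n)], so up to sign it is the defect of the differences, at most [e] times a constant
   depending on the test function. *)
suff key (e : R) : 0 < e -> cmod (L - Q) <= e * (2 * (c * I1) + 2 * ((1 + K) * I2)).
  have I10 : 0 <= I1 by apply: Rintegral_ge0 => // x _; exact: normr_ge0.
  have I20 : 0 <= I2 by apply: Rintegral_ge0 => // x _; exact: normr_ge0.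
  have K0 : 0 <= K by rewrite /K mulr_ge0 ?(ltW c0) // !addr_ge0 ?mulr_ge0.
  pose Z := 2 * (c * I1) + 2 * ((1 + K) * I2).
  have Z0 : 0 <= Z by rewrite /Z addr_ge0 // mulr_ge0 // mulr_ge0 // ?(ltW c0) // addr_ge0.
  apply/eqP; rewrite -subr_eq0; apply/eqP; apply: cmod_eq0; apply/eqP.
  rewrite eq_le cmod_ge0 andbT; apply/ler_addgt0Pr => e e0; rewrite add0r.
  have Z1 : 0 < Z + 1 by lra.
  have := key (e / (Z + 1)) (divr_gt0 e0 Z1); rewrite -/Z => /le_trans; apply.
  by rewrite mulrAC ler_pdivrMr // ler_pM2l //; lra.
move=> e0.
have hv_ n : inX (v_ n) by have [] := hG n.
have hf_ n : inX (f_ n) by have [_ ] := hG n.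
have [n [h1 h2]] : exists n, (forall x, x != 0 -> cmod (v_ n x - v x) <= e) /\
    (forall x, x != 0 -> cmod (f_ n x - f x) <= e).
  have N1 := cvgX_near hv_ hv cv e0; have N2 := cvgX_near hf_ hf cf e0.
  have [N _ hN] := filterI N1 N2.
  by exists N; have [] := hN N (leqnn N).
have [hd _ _] := inXB (hv_ n) hv; have [_ _ wd] := hG n; have W := wd psi tp.
have E1 : cintegral setT (fun x => (c - u0 c x)%:C * (v_ n x - v x) * (derive1 psi x)%:C) =
   cintegral setT (fun x => (c - u0 c x)%:C * v_ n x * (derive1 psi x)%:C) - L.
  rewrite /L -(cintegralB measurableT (ig _ (hv_ n)) (ig _ hv)).
  by apply: eq_cintegral => x _; ring.
have E2 : cintegral setT (fun x => (f_ n x - f x - Lw_nonlocal b c (fun y => v_ n y - v y) x) * (psi x)%:C) =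
   cintegral setT (fun x => (f_ n x - Lw_nonlocal b c (v_ n) x) * (psi x)%:C) + Q.
  rewrite /Q -(cintegralB measurableT (ih _ _ (hv_ n) (hf_ n)) (ih _ _ hv hf)).
  apply: eq_cintegral => x _.
  have [->|x0] := eqVneq x 0.
    have p0 : (psi 0)%:C = 0 :> R[i].
      have [a [b' [a0 _ hp]]] := hs.
      congr (_%:C); by apply/eqP/negPn/negP => /hp; rewrite normr0 leNgt a0.
    by rewrite p0 !mulr0 subrr.
  rewrite (Lw_nonlocalB b c0 (hv_ n) hv x0).
  by move: (Lw_nonlocal _ _ _ _) (Lw_nonlocal _ _ _ _) => X Y; ring.
have -> : L - Q = - (cintegral setT (fun x => (c - u0 c x)%:C * (v_ n x - v x) * (derive1 psi x)%:C)
   + cintegral setT (fun x => (f_ n x - f x - Lw_nonlocal b c (fun y => v_ n y - v y) x) * (psi x)%:C)).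
  by rewrite E1 E2 W; ring.
rewrite cmodN; apply: le_trans (cmodD _ _) _.
rewrite mulrDr; apply: lerD.
- have -> : e * (2 * (c * I1)) = 2 * \int[mu]_x (e * c * `|derive1 psi x|).
    by rewrite RintegralZl // -/I1; ring.
  apply: cmod_cintegral_le => //.
  + by have /cintegrable_cmeas := ig _ hd.
  + by apply: (integrableZl (mu := mu) measurableT (e * c)) i1.
  + move=> x _; rewrite !cmodM !cmod_real ler_wpM2r // mulrC.
    have [->|x0] := eqVneq x 0.
      by rewrite /u0 normr0 oppr0 expR0 mulr1 subrr normr0 mulr0 mulr_ge0 ?ltW.
    apply: ler_pM; rewrite ?cmod_ge0 ?normr_ge0 ?h1 // /u0.
    have : expR (- `|x|) <= 1 by rewrite -expR0 ler_expR oppr_le0.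
    have := expR_gt0 (- `|x|) => a1 a2; rewrite ger0_norm; nra.
- have -> : e * (2 * ((1 + K) * I2)) = 2 * \int[mu]_x (e * (1 + K) * `|psi x|).
    by rewrite RintegralZl // -/I2; ring.
  have [hfd _ _] := inXB (hf_ n) hf.
  apply: cmod_cintegral_le => //.
  + by have /cintegrable_cmeas := ih _ _ hd hfd.
  + by apply: (integrableZl (mu := mu) measurableT (e * (1 + K))) i2.
  + move=> x _; rewrite cmodM cmod_real.
    have [->|x0] := eqVneq x 0.
      have -> : psi 0 = 0.
        have [a [b' [a0 _ hp]]] := hs.
        by apply/eqP/negPn/negP => /hp; rewrite normr0 leNgt a0.
      by rewrite normr0 !mulr0.
    rewrite ler_wpM2r //; apply: le_trans (cmodB _ _) _.
    have -> : e * (1 + K) = e + K * e by ring.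
    by apply: lerD; [exact: h2|exact: cmod_Lw_nonlocal_le].
Qed.

End Closedness.

(** * Eigenfunctions in the bands *)

Section BoundedPrimitives.
Context {R : realType}.

(** Replaces an improper integral from the end of the half-line towards which [G] decreases. With
    [P] any primitive, a constant [z] gives $|P-z|\le G$ when it separates the values of [P - G]
    from those of [P + G]; the monotonicity of $G\pm P$ ensures that every value of the first is
    below every value of the second. *)
Lemma bounded_primitive (g G G' : R -> R) :
  (forall x : R, 0 < x -> {for x, continuous g}) ->
  (forall x : R, 0 < x -> is_derive x (1 : R) G (G' x)) -> (forall x, 0 < x -> 0 <= G x) ->
  (forall x, 0 < x -> `|g x| <= G' x) \/ (forall x, 0 < x -> `|g x| <= - G' x) ->
  exists f : R -> R, forall x : R, 0 < x -> is_derive x (1 : R) f (g x) /\ `|f x| <= G x.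
Proof.
move=> cg dG G0 gG; have [P dP] := exists_primitive_pos cg.
have key x y : 0 < x -> 0 < y -> P y - G y <= P x + G x.
  move=> x0 y0; have Gx := G0 x x0; have Gy := G0 y y0; case: gG => gG.
  - have dD (z : R) : 0 < z -> is_derive z (1 : R) (fun y => P y + G y) (g z + G' z).
      by move=> z0; apply: is_deriveD; [exact: dP|exact: dG].
    have dB (z : R) : 0 < z -> is_derive z (1 : R) (fun y => G y - P y) (G' z - g z).
      by move=> z0; apply: is_deriveB; [exact: dG|exact: dP].
    have [xy|/ltW yx] := leP x y.
      have := is_derive_nondecreasing dB _ x0 xy; last first.
        move=> /(_ _) h; have /h : forall z, 0 < z -> 0 <= G' z - g z; last lra.
        by move=> z /gG; rewrite ler_norml => /andP[]; lra.
    have := is_derive_nondecreasing dD _ y0 yx.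
    move=> /(_ _) h; have /h : forall z, 0 < z -> 0 <= g z + G' z; last lra.
    by move=> z /gG; rewrite ler_norml => /andP[]; lra.
  - have dD (z : R) : 0 < z -> is_derive z (1 : R) (fun y => - (P y + G y)) (- (g z + G' z)).
      by move=> z0; apply: is_deriveN; apply: is_deriveD; [exact: dP|exact: dG].
    have dB (z : R) : 0 < z -> is_derive z (1 : R) (fun y => P y - G y) (g z - G' z).
      by move=> z0; apply: is_deriveB; [exact: dP|exact: dG].
    have [xy|/ltW yx] := leP x y.
      have := is_derive_nondecreasing dD _ x0 xy.
      move=> /(_ _) h; have /h : forall z, 0 < z -> 0 <= - (g z + G' z); last lra.
      by move=> z /gG; rewrite ler_norml => /andP[]; lra.
    have := is_derive_nondecreasing dB _ y0 yx.
    move=> /(_ _) h; have /h : forall z, 0 < z -> 0 <= g z - G' z; last lra.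
    by move=> z /gG; rewrite ler_norml => /andP[]; lra.
pose S := [set z | exists2 y, 0 < y & z = P y - G y].
have uS x : 0 < x -> ubound S (P x + G x) by move=> x0 _ [y y0 ->]; exact: key.
have S0 : S !=set0 by exists (P 1 - G 1); exists 1.
exists (fun x => P x - sup S) => x x0; split.
  by apply: is_derive_eq (is_deriveB (dP x x0) (is_derive_cst _ _ _)) _; rewrite subr0.
have h1 : sup S <= P x + G x by apply: ge_sup => //; exact: uS.
have h2 : P x - G x <= sup S by apply: ub_le_sup; [exists (P 1 + G 1); exact: uS|exists x].
rewrite ler_norml; apply/andP; split; lra.
Qed.

Lemma bounded_cprimitive (g : R -> R[i]) (G G' : R -> R) :
  (forall x, 0 < x -> ccont g x) ->
  (forall x : R, 0 < x -> is_derive x (1 : R) G (G' x)) -> (forall x, 0 < x -> 0 <= G x) ->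
  (forall x, 0 < x -> cmod (g x) <= G' x) \/ (forall x, 0 < x -> cmod (g x) <= - G' x) ->
  exists f : R -> R[i], forall x : R, 0 < x -> cderiv f x (g x) /\ cmod (f x) <= 2 * G x.
Proof.
move=> cg dG G0 gG.
have [|f1 h1] := @bounded_primitive (fun x => Re (g x)) G G' (fun x x0 => (cg x x0).1) dG G0.
  by case: gG => gG; [left|right] => x x0; apply: le_trans (gG x x0); exact: Re_le_cmod.
have [|f2 h2] := @bounded_primitive (fun x => Im (g x)) G G' (fun x x0 => (cg x x0).2) dG G0.
  by case: gG => gG; [left|right] => x x0; apply: le_trans (gG x x0); exact: Im_le_cmod.
exists (fun x => f1 x +i* f2 x) => x x0; have [d1 b1] := h1 x x0; have [d2 b2] := h2 x x0.
split; first by split.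
by apply: le_trans (cmod_le_ReIm _) _ => /=; lra.
Qed.

(** Two primitives differ by a constant, and this constant is seen along the filter [F], which will
    be either end of the half-line. *)
Lemma cprimitive_unique (F : set_system R) {FF : ProperFilter F} (f1 f2 g : R -> R[i]) :
  (forall x, 0 < x -> cderiv f1 x (g x)) -> (forall x, 0 < x -> cderiv f2 x (g x)) ->
  (\forall x \near F, 0 < x) -> ccvg F f1 0 -> ccvg F f2 0 -> forall x, 0 < x -> f1 x = f2 x.
Proof.
move=> d1 d2 F0 l1 l2 x x0.
have d0 z : 0 < z -> cderiv (fun y => f1 y - f2 y) z 0.
  by move=> z0; apply: cderiv_eq (cderivB (d1 z z0) (d2 z z0)) _; rewrite subrr.
apply/eqP; rewrite -subr_eq0; apply/eqP.
have : ccvg F (fun y => f1 y - f2 y) (0 - 0) by exact: ccvgB.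
rewrite subrr; apply: ccvg_unique; apply: ccvg_near (ccvg_cst _).
by near=> y; apply: (cderiv0_cst d0) => //; near: y.
Unshelve. all: by end_near. Qed.

Lemma ccvg0_le (F : set_system R) {FF : Filter F} (f : R -> R[i]) (G : R -> R) :
  (\forall x \near F, cmod (f x) <= G x) -> G x @[x --> F] --> (0 : R) -> ccvg F f 0.
Proof.
move=> h lG; apply/ccvg_cmodP; under eq_fun do rewrite subr0.
apply: (@squeeze_cvgr _ _ _ _ (fun=> 0) G) => //; last exact: cvg_cst.
by apply: filterS h => x hx; rewrite cmod_ge0.
Qed.

End BoundedPrimitives.

(** * Weights for the behaviour at the origin and at infinity *)

Section Weights.
Context {R : realType}.
Implicit Types (s p q x : R).

(* [e^{-s x} (1 - e^{-x})^p] *)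
Definition epow s p x : R := expR (p * ln (1 - expR (- x)) - s * x).

Lemma epow_gt0 s p x : 0 < epow s p x. Proof. exact: expR_gt0. Qed.
Lemma epow_ge0 s p x : 0 <= epow s p x. Proof. exact: expR_ge0. Qed.

Lemma epowM s p r q x : epow s p x * epow r q x = epow (s + r) (p + q) x.
Proof. by rewrite /epow -expRD; congr expR; ring. Qed.

Lemma epow10 x : epow 1 0 x = expR (- x).
Proof. by rewrite /epow; congr expR; ring. Qed.

Lemma epow01 x : 0 < x -> epow 0 1 x = 1 - expR (- x).
Proof. by move=> x0; rewrite /epow mul1r mul0r subr0 lnK // posrE onem_exp_gt0. Qed.

Lemma epow00 x : epow 0 0 x = 1.
Proof. by rewrite /epow !mul0r subr0 expR0. Qed.

Lemma ln_onem_exp_le0 x : 0 < x -> ln (1 - expR (- x)) <= 0.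
Proof. by move=> x0; apply: ln_le0; have := expR_gt0 (- x); lra. Qed.

Lemma epowE s p x : epow s p x = expR (p * ln (1 - expR (- x))) * expR (- s * x).
Proof. by rewrite /epow -expRD mulNr. Qed.

Lemma expN_epow s r p x : r = s + 1 -> expR (- x) * epow s p x = epow r p x.
Proof. by move=> ->; rewrite -epow10 epowM add0r addrC. Qed.

Lemma exp_epow s r p x : r = s - 1 -> expR x * epow s p x = epow r p x.
Proof. by move=> ->; rewrite /epow -expRD; congr expR; ring. Qed.

Lemma epow_onem s p q x : 0 < x -> q = p + 1 -> epow s p x * (1 - expR (- x)) = epow s q x.
Proof. by move=> x0 ->; rewrite -epow01 // epowM addr0. Qed.

Lemma epow_le s p r q x : 0 < x -> r <= s -> q <= p -> epow s p x <= epow r q x.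
Proof.
move=> x0 rs qp; rewrite /epow ler_expR; have := ln_onem_exp_le0 x0; nra.
Qed.

Lemma is_derive_epow s p x : 0 < x -> is_derive x (1 : R) (epow s p)
  (epow s p x * (p * (expR (- x) / (1 - expR (- x))) - s)).
Proof.
move=> x0.
have d : is_derive x (1 : R) (fun y => p * ln (1 - expR (- y)) - s * y)
    (p * (expR (- x) / (1 - expR (- x))) - s).
  have d1 := is_deriveM (is_derive_cst p x 1) (is_derive_ln_onem_exp x0).
  have d2 := is_deriveM (is_derive_cst s x 1) (is_derive_id x (1 : R)).
  apply: is_derive_eq (is_deriveB d1 d2) _.
  by rewrite /GRing.scale /= !mulr0 !addr0 mulr1.
by have := @is_derive1_comp _ expR (fun y => p * ln (1 - expR (- y)) - s * y) x _ _ (is_derive_expR _) d.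
Qed.

Lemma cmod_mexp_epow b (la : R[i]) x : cmod (mexp b la x) = epow (- Re la) (Re la - b) x.
Proof. by rewrite cmod_mexp /epow; congr expR; ring. Qed.

Lemma cvg_epow_at0 s p : 0 < p -> epow s p x @[x --> (0 : R)^'+] --> (0 : R).
Proof.
move=> p0.
have h1 : expR (p * ln (1 - expR (- x))) @[x --> (0 : R)^'+] --> (0 : R).
  apply/cvgrPdist_lt => e e0; have e1 : 0 < expR (ln e / p) by exact: expR_gt0.
  near=> x.
  have x0 : 0 < x by near: x; exact: nbhs_right_gt.
  rewrite sub0r normrN gtr0_norm ?expR_gt0 //.
  have : 1 - expR (- x) < expR (ln e / p).
    by near: x; exact: (cvgr_lt _ (@cvg_onem0 R) _ e1).
  move=> h; have := h; rewrite -ltr_ln ?posrE ?onem_exp_gt0 // expRK => h2.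
  rewrite -[ltRHS](@lnK _ e) ?posrE // ltr_expR mulrC -ltr_pdivlMr //.
have h2 : expR (- s * x) @[x --> (0 : R)^'+] --> (1 : R) by exact: cvg_exp0.
rewrite (_ : epow s p = (fun x => expR (p * ln (1 - expR (- x))) * expR (- s * x))); last first.
  by apply/funext => x; exact: epowE.
by rewrite -[X in _ --> X](mul0r (1 : R)); exact: cvgM.
Unshelve. all: by end_near. Qed.

Lemma cvg_epow_pinfty s p : 0 < s -> epow s p x @[x --> +oo] --> (0 : R).
Proof.
move=> s0.
have h0 : 1 - expR (- x) @[x --> +oo] --> (1 : R).
  by rewrite -[X in _ --> X](subr0 (1 : R)); apply: cvgB; [exact: cvg_cst|exact: cvg_expN_pinfty].
have h1 : expR (p * ln (1 - expR (- x))) @[x --> +oo] --> (1 : R).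
  rewrite -[X in _ --> X]expR0 -(mulr0 p) -(@ln1 R).
  apply: continuous_cvg; first exact: continuous_expR.
  apply: cvgMr; apply: continuous_cvg => //; exact: continuous_ln.
have h2 : expR (- s * x) @[x --> +oo] --> (0 : R) by exact: cvg_expM.
rewrite (_ : epow s p = (fun x => expR (p * ln (1 - expR (- x))) * expR (- s * x))); last first.
  by apply/funext => x; exact: epowE.
by rewrite -[X in _ --> X](mulr0 (1 : R)); exact: cvgM.
Qed.

End Weights.

(** * Variation of constants for the momentum equation *)

Section Particular.
Context {R : realType}.
Variables (m : R -> R[i]) (s : R).
Hypothesis cm : forall x, 0 < x -> ccont m x.
Hypothesis s01 : 0 < s < 1.

Let bound eta := forall x, 0 < x -> cmod (m x) <= epow s (- 1 - eta) x.

Let C1 (eta : R) := 2 / eta.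
Let C2 (eta : R) := 2 * (C1 eta / ((1 - eta) * (1 - s))).

Let first_primitive eta : 0 < eta < 1 -> bound eta -> exists Z : R -> R[i],
  forall x, 0 < x -> cderiv Z x (- ((expR (- x))%:C * m x)) /\
    cmod (Z x) <= C1 eta * epow (s + 1) (- eta) x.
Proof.
move=> /andP[e0 e1] hb; have [s0 s1] := andP s01.
(* The subtraction gains a factor $e^{-x}$ at infinity: with $t=e^{-x}$, one has $(1-t)^{-\eta}-1\le
   t(1-t)^{-\eta}$, because $(1-t)^\eta\ge1-t$. *)
pose G x := (epow s (- eta) x - epow s 0 x) / eta.
pose G' x := - (epow (s + 1) (- 1 - eta) x + s / eta * (epow s (- eta) x - epow s 0 x)).
have G0 x : 0 < x -> 0 <= epow s (- eta) x - epow s 0 x.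
  by move=> x0; rewrite subr_ge0; apply: epow_le => //; lra.
have dG (x : R) : 0 < x -> is_derive x (1 : R) G (G' x).
  move=> x0; have t0 := onem_exp_gt0 x0.
  have d := is_deriveM (is_deriveB (is_derive_epow s (- eta) x0) (is_derive_epow s 0 x0)) (is_derive_cst (eta^-1) x 1).
  apply: is_derive_eq d _; rewrite /GRing.scale /= mulr0 add0r /G'.
  have -> : epow (s + 1) (- 1 - eta) x = epow s (- eta) x * expR (- x) / (1 - expR (- x)).
    rewrite [_ * expR (- x)]mulrC (@expN_epow _ s (s + 1)) //.
    by apply: (canRL (mulfK _)); [rewrite gt_eqF|apply: epow_onem => //; ring].
  have h1 : 1 - expR (- x) != 0 by rewrite gt_eqF.
  have h2 : eta != 0 by rewrite gt_eqF.
  by field; rewrite h1 h2.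
have [|||f hf] := @bounded_cprimitive _ (fun x => - ((expR (- x))%:C * m x)) G G' _ dG.
- move=> x x0; apply: ccvgN; apply: ccontM; last exact: cm.
  by apply: ccont_real; exact: is_derive_cont (is_derive_expN x).
- by move=> x x0; rewrite divr_ge0 ?G0 // ltW.
- right => x x0; rewrite cmodN cmodM cmod_real gtr0_norm ?expR_gt0 // /G' opprK.
  have h1 : expR (- x) * cmod (m x) <= epow (s + 1) (- 1 - eta) x.
    rewrite -(@expN_epow _ s (s + 1)) //.
    by rewrite ler_pM2l ?expR_gt0 // hb.
  apply: le_trans h1 _; by rewrite lerDl mulr_ge0 ?G0 ?divr_ge0 ?(ltW s0) ?(ltW e0).
exists f => x x0; have [d hb'] := hf x x0; split => //.
apply: le_trans hb' _; rewrite /C1 /G -(@expN_epow _ s (s + 1)) //.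
have -> : 2 / eta * (expR (- x) * epow s (- eta) x) = 2 * (epow s (- eta) x * expR (- x) / eta) by ring.
rewrite ler_pM2l // ler_pM2r ?invr_gt0 //.
have -> : epow s 0 x = epow s (- eta) x * epow 0 eta x by rewrite epowM addr0 addNr.
have h : epow 0 1 x <= epow 0 eta x by apply: epow_le => //; lra.
rewrite epow01 // in h; have := epow_gt0 s (- eta) x; nra.
Qed.

(** The second step, integrated from 0: the exponent $1-\eta$ is positive, so the bound vanishes
    there, while [s < 1] makes it grow at infinity. *)
Let second_primitive eta (Z : R -> R[i]) : 0 < eta < 1 ->
  (forall x, 0 < x -> ccont Z x) ->
  (forall x, 0 < x -> cmod (Z x) <= C1 eta * epow (s + 1) (- eta) x) -> exists Y : R -> R[i],
  forall x, 0 < x -> cderiv Y x ((expR (2 * x))%:C * Z x) /\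
    cmod (Y x) <= C2 eta * epow (s - 1) (1 - eta) x.
Proof.
move=> /andP[e0 e1] cZ hZ; have [s0 s1] := andP s01.
(* Differentiating the weight produces the factor $(1-\eta)t+(1-s)(1-t)$ with $t=e^{-x}$, which is
   at least $(1-\eta)(1-s)$. *)
pose K := C1 eta / ((1 - eta) * (1 - s)).
have K0 : 0 <= K by rewrite /K /C1 divr_ge0 ?divr_ge0 ?mulr_ge0; lra.
pose G x := K * epow (s - 1) (1 - eta) x.
pose G' x := K * (epow (s - 1) (1 - eta) x * ((1 - eta) * (expR (- x) / (1 - expR (- x))) - (s - 1))).
have dG (x : R) : 0 < x -> is_derive x (1 : R) G (G' x).
  move=> x0; have d := is_deriveM (is_derive_cst K x 1) (is_derive_epow (s - 1) (1 - eta) x0).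
  by apply: is_derive_eq d _; rewrite /GRing.scale /= mulr0 addr0.
have [|||f hf] := @bounded_cprimitive _ (fun x => (expR (2 * x))%:C * Z x) G G' _ dG.
- move=> x x0; apply: ccontM; last exact: cZ.
  by apply: ccont_real; exact: continuous_expM.
- by move=> x x0; rewrite mulr_ge0 // epow_ge0.
- left => x x0; rewrite cmodM cmod_real gtr0_norm ?expR_gt0 //.
  have t0 := onem_exp_gt0 x0.
  have -> : G' x = K * epow (s - 1) (- eta) x * ((1 - eta) * expR (- x) + (1 - s) * (1 - expR (- x))).
    have -> : epow (s - 1) (- eta) x = epow (s - 1) (1 - eta) x / (1 - expR (- x)).
      by apply: (canRL (mulfK _)); [rewrite gt_eqF|apply: epow_onem => //; ring].
    have h1 : 1 - expR (- x) != 0 by rewrite gt_eqF.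
    by rewrite /G'; field.
  have h1 : expR (2 * x) * cmod (Z x) <= C1 eta * epow (s - 1) (- eta) x.
    have -> : C1 eta * epow (s - 1) (- eta) x = expR (2 * x) * (C1 eta * epow (s + 1) (- eta) x).
      rewrite mulrCA; congr (_ * _).
      have -> : 2 * x = x + x by ring.
      by rewrite expRD -mulrA (@exp_epow _ (s + 1) s) ?addrK // (@exp_epow _ s (s - 1)).
    by rewrite ler_pM2l ?expR_gt0 // hZ.
  apply: le_trans h1 _; rewrite /K.
  have -> : C1 eta * epow (s - 1) (- eta) x = C1 eta / ((1 - eta) * (1 - s)) * epow (s - 1) (- eta) x * ((1 - eta) * (1 - s)).
    by field; apply/andP; split; rewrite gt_eqF //; lra.
  rewrite ler_wpM2l //; first by rewrite -/K mulr_ge0 ?epow_ge0.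
  have a1 : 0 <= expR (- x) * (1 - eta) * s by rewrite !mulr_ge0 ?expR_ge0 ?(ltW s0) //; lra.
  have a2 : 0 <= (1 - expR (- x)) * (1 - s) * eta by rewrite !mulr_ge0 ?(ltW t0) ?(ltW e0) //; lra.
  lra.
exists f => x x0; have [d hb'] := hf x x0; split => //.
by rewrite /C2 -mulrA; exact: hb'.
Qed.

(** One solution, built for [eta0], has to satisfy the bounds for every admissible [eta]. Whatever
    the exponent, [Z] tends to 0 at infinity and [Y] at the origin, so the primitives built for
    different exponents coincide. *)
Lemma particular_solution (eta0 : R) : 0 < eta0 < 1 ->
  (forall x, 0 < x -> cmod (m x) <= epow s (- 1 - eta0) x) -> exists y y1 : R -> R[i],
  [/\ forall x, 0 < x -> cderiv y x (y1 x), forall x, 0 < x -> cderiv y1 x (y x - m x) &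
   forall eta, 0 < eta < 1 -> (forall x, 0 < x -> cmod (m x) <= epow s (- 1 - eta) x) ->
   exists2 C : R, 0 <= C & forall x, 0 < x ->
     cmod (y x) <= C * epow s (1 - eta) x /\ cmod (y1 x) <= C * epow s (- eta) x].
Proof.
move=> h0 b0; have [s0 s1] := andP s01.
have [Z hZ] := first_primitive h0 b0.
have cZ x : 0 < x -> ccont Z x by move=> /hZ[d _]; exact: cderiv_cont d.
have [Y hY] := second_primitive h0 cZ (fun x x0 => (hZ x x0).2).
have Z0 eta (W : R -> R[i]) : 0 < eta < 1 ->
    (forall x, 0 < x -> cmod (W x) <= C1 eta * epow (s + 1) (- eta) x) -> ccvg (+oo : set_system R) W 0.
  move=> /andP[e0 e1] hW; apply: (@ccvg0_le _ _ _ _ (fun x => C1 eta * epow (s + 1) (- eta) x)).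
    by near=> x; apply: hW; near: x; apply: nbhs_pinfty_gt; exact: num_real.
  rewrite -[X in _ --> X](mulr0 (C1 eta)); apply: cvgMr; apply: cvg_epow_pinfty; lra.
have Y0 eta (W : R -> R[i]) : 0 < eta < 1 ->
    (forall x, 0 < x -> cmod (W x) <= C2 eta * epow (s - 1) (1 - eta) x) -> ccvg (0 : R)^'+ W 0.
  move=> /andP[e0 e1] hW; apply: (@ccvg0_le _ _ _ _ (fun x => C2 eta * epow (s - 1) (1 - eta) x)).
    by near=> x; apply: hW; near: x; exact: nbhs_right_gt.
  rewrite -[X in _ --> X](mulr0 (C2 eta)); apply: cvgMr; apply: cvg_epow_at0; lra.
pose y x := (expR (- x))%:C * Y x; pose y1 x := (expR x)%:C * Z x - y x.
have dy x : 0 < x -> cderiv y x (y1 x).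
  move=> x0; apply: cderiv_eq (cderivM (cderiv_real (is_derive_expN x)) (hY x x0).1) _.
  rewrite /y1 /y mulrA -rmorphM -expRD; have -> : - x + 2 * x = x by ring.
  by rewrite rmorphN; ring.
have dy1 x : 0 < x -> cderiv y1 x (y x - m x).
  move=> x0; apply: cderiv_eq (cderivB (cderivM (cderiv_real (is_derive_exp x)) (hZ x x0).1) (dy x x0)) _.
  rewrite /y1 mulrN mulrA -rmorphM -expRD subrr expR0 mul1r; ring.
exists y, y1; split => // eta he hb; have [e0 e1] := andP he.
have [Z' hZ'] := first_primitive he hb.
have EZ x : 0 < x -> Z x = Z' x.
  apply: (@cprimitive_unique _ (+oo : set_system R)) => //.
  - by move=> z z0; exact: (hZ z z0).1.
  - by move=> z z0; exact: (hZ' z z0).1.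
  - by apply: nbhs_pinfty_gt; exact: num_real.
  - by apply: (Z0 eta0) => // z z0; exact: (hZ z z0).2.
  - by apply: (Z0 eta) => // z z0; exact: (hZ' z z0).2.
have [|Y' hY'] := second_primitive he cZ.
  by move=> x x0; rewrite EZ //; exact: (hZ' x x0).2.
have EY x : 0 < x -> Y x = Y' x.
  apply: (@cprimitive_unique _ (0 : R)^'+) => //.
  - by move=> z z0; exact: (hY z z0).1.
  - by move=> z z0; exact: (hY' z z0).1.
  - exact: nbhs_right_gt.
  - by apply: (Y0 eta0) => // z z0; exact: (hY z z0).2.
  - by apply: (Y0 eta) => // z z0; exact: (hY' z z0).2.
have C20 : 0 <= C2 eta by rewrite /C2 /C1 mulr_ge0 // divr_ge0 ?divr_ge0 ?mulr_ge0; lra.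
have C10 : 0 <= C1 eta by rewrite /C1 divr_ge0 //; lra.
have by_ x : 0 < x -> cmod (y x) <= C2 eta * epow s (1 - eta) x.
  move=> x0; rewrite /y cmodM cmod_real gtr0_norm ?expR_gt0 // EY //.
  rewrite -(@expN_epow _ (s - 1) s) ?subrK //.
  by rewrite mulrCA ler_pM2l ?expR_gt0 //; exact: (hY' x x0).2.
exists (C1 eta + C2 eta); first by rewrite addr_ge0.
move=> x x0; split.
  by apply: le_trans (by_ x x0) _; rewrite ler_wpM2r ?epow_ge0 // lerDr.
rewrite /y1; apply: le_trans (cmodB _ _) _; rewrite mulrDl; apply: lerD.
- rewrite cmodM cmod_real gtr0_norm ?expR_gt0 // EZ //.
  rewrite -(@exp_epow _ (s + 1) s) ?addrK //.
  by rewrite mulrCA ler_pM2l ?expR_gt0 //; exact: (hZ' x x0).2.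
- apply: le_trans (by_ x x0) _; rewrite ler_wpM2l //; apply: epow_le => //; lra.
Unshelve. all: by end_near. Qed.

End Particular.

(** * From the momentum equation back to the eigenvalue equation *)

Section Converse.
Context {R : realType}.
Variables (b : R) (la k M : R[i]) (v v1 : R -> R[i]) (B L : R) (v0 : R[i]).
Hypothesis mv : cmeas setT v.
Hypothesis vB : forall x, cmod (v x) <= B.
Hypothesis d1 : forall x, 0 < x -> cderiv v x (v1 x).
Hypothesis d2 : forall x, 0 < x -> cderiv v1 x (v x - M * mexp b la x).
Hypothesis v1L : forall x, 0 < x -> cmod ((1 - expR (- x))%:C * v1 x) <= L.
Hypothesis l1 : ccvg (0 : R)^'+ (fun x => (1 - expR (- x))%:C * v1 x) 0.
Hypothesis lv : ccvg (0 : R)^'+ v v0.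

(* The residual [F] of the equation satisfies [F'' = F], is bounded and vanishes at 0. *)
Lemma half_ode_of_momentum :
  (la + (2 - b)%:C) * v0 - (3 - 3 * b / 2)%:C * Jh v 0 - k = 0 -> half_ode b la k v.
Proof.
move=> hE; have cv x : 0 < x -> ccont v x by move=> x0; exact: cderiv_cont (d1 x0).
pose F x := (1 - expR (- x))%:C * v1 x - ((la + ((2 - b) * expR (- x))%:C) * v x
  - (3 - 3 * b / 2)%:C * ((expR x)%:C * Jh v x)
  - (b / 2)%:C * ((expR (- x))%:C * Kh v x) - k * (expR (- x))%:C).
pose F1 x := ((expR (- x))%:C * v1 x + (1 - expR (- x))%:C * (v x - M * mexp b la x)) -
  ((la + ((2 - b) * expR (- x))%:C) * v1 x - ((2 - b) * expR (- x))%:C * v x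
  - (3 - 3 * b / 2)%:C * ((expR x)%:C * Jh v x - (expR (- x))%:C * v x)
  - (b / 2)%:C * (- ((expR (- x))%:C * Kh v x) + (expR (- x))%:C * v x)
  + k * (expR (- x))%:C).
have dF x : 0 < x -> cderiv F x (F1 x).
  move=> x0; apply: cderivB.
    exact: (cderivM (cderiv_real (is_derive_onem_exp x)) (d2 x0)).
  exact: (cderiv_hrhs b la mv vB cv k x0 (d1 x0)).
have dF1 x : 0 < x -> cderiv F1 x (F x).
  move=> x0.
  have dt : cderiv (fun y => (expR (- y))%:C) x (- (expR (- x))%:C).
    by apply: cderiv_eq (cderiv_real (is_derive_expN x)) _; rewrite rmorphN.
  have da (a : R) : cderiv (fun y => (a * expR (- y))%:C) x (- (a * expR (- x))%:C).
    apply: (@cderiv_near _ (fun y => a%:C * (expR (- y))%:C)).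
      by near=> y; rewrite rmorphM.
    by apply: cderiv_eq (cderivZ a%:C dt) _; rewrite rmorphM mulrN.
  have dm := cderivZ M (cderiv_mexp b la x0).
  have D1 := cderivD (cderivM dt (d2 x0)) (cderivM (cderiv_real (is_derive_onem_exp x)) (cderivB (d1 x0) dm)).
  have D2 := cderivM (cderivD (cderiv_cst la x) (da (2 - b))) (d2 x0).
  have D3 := cderivM (da (2 - b)) (d1 x0).
  have D4 := cderivZ (3 - 3 * b / 2)%:C (cderivB (cderiv_eJh mv vB cv x0) (cderivM dt (d1 x0))).
  have D5 := cderivZ (b / 2)%:C (cderivD (cderivN (cderiv_eKh mv vB cv x0)) (cderivM dt (d1 x0))).
  have D6 := cderivZ k dt.
  apply: cderiv_eq (cderivB D1 (cderivD (cderivB (cderivB (cderivB D2 D3) D4) D5) D6)) _.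
  have t0 : ((1 - expR (- x))%:C : R[i]) != 0.
    by rewrite -realc0 (inj_eq (@complexI _)) gt_eqF // onem_exp_gt0.
  move: t0; rewrite /F !realcE !realcV !realcE !(fmorphV (real_complex R)) !realcE.
  set t := (expR (- x))%:C; set e := (expR x)%:C; set J := Jh v x; set K := Kh v x; set m := mexp _ _ _.
  by move=> ht; field.
have B0 : 0 <= B by apply: le_trans (vB 0); exact: cmod_ge0.
have FB x : 0 < x -> cmod (F x) <= L + ((cmod la + `|2 - b|) * B + `|3 - 3 * b / 2| * B
    + `|b / 2| * (2 * B) + cmod k).
  move=> x0; have e1 : expR (- x) <= 1 by rewrite expR_le1; lra.
  have te : `|expR (- x)| <= 1 by rewrite ger0_norm ?expR_ge0.
  have T1 : cmod ((la + ((2 - b) * expR (- x))%:C) * v x) <= (cmod la + `|2 - b|) * B.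
    rewrite cmodM; apply: ler_pM; rewrite ?cmod_ge0 //.
    apply: le_trans (cmodD _ _) _; rewrite lerD2l cmod_real normrM.
    by rewrite ler_piMr.
  have T2 : cmod ((3 - 3 * b / 2)%:C * ((expR x)%:C * Jh v x)) <= `|3 - 3 * b / 2| * B.
    rewrite (cmodM (_%:C)) cmod_real ler_wpM2l //.
    apply: le_trans (eJh_le mv vB (ltW x0)) _; by rewrite ler_piMr.
  have T3 : cmod ((b / 2)%:C * ((expR (- x))%:C * Kh v x)) <= `|b / 2| * (2 * B).
    rewrite (cmodM (_%:C)) cmod_real ler_wpM2l //.
    apply: le_trans (eKh_le mv vB (ltW x0)) _.
    rewrite ler_piMr ?mulr_ge0 // expRN ler_pdivrMr ?expR_gt0 // mul1r.
    by have := expR_ge1Dx x; lra.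
  have T4 : cmod (k * (expR (- x))%:C) <= cmod k.
    by rewrite cmodM cmod_real ler_piMr ?cmod_ge0.
  apply: le_trans (cmodB _ _) _; apply: lerD; first exact: v1L.
  apply: le_trans (cmodB _ _) _; apply: lerD => //.
  apply: le_trans (cmodB _ _) _; apply: lerD => //.
  apply: le_trans (cmodB _ _) _; exact: lerD.
have [A hA] := second_order_decay dF dF1 FB.
have F0 : ccvg (0 : R)^'+ F 0.
  have := hv1_num_lim0 b la k mv vB lv; rewrite hE => h.
  have h2 : ccvg (0 : R)^'+ (fun x => (1 - expR (- x))%:C * v1 x - (1 - expR (- x))%:C * hv1 b la k v x) (0 - 0).
    exact: ccvgB.
  rewrite subrr in h2.
  apply: ccvg_near _ h2; near=> x.
  have x0 : 0 < x by near: x; exact: nbhs_right_gt.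
  rewrite /F; congr (_ - _); rewrite /hv1 [RHS]mulrA -[in RHS]rmorphM mulfV ?mul1r // gt_eqF //; exact: onem_exp_gt0.
have A0 : A = 0.
  apply: ccvg_unique F0; apply: (@ccvg_near _ _ _ _ (fun x => A * (expR (- x))%:C)).
    by near=> x; apply: hA; near: x; exact: nbhs_right_gt.
  by apply: ccvg_eq (ccvgM (ccvg_cst A) (ccvg_real (@cvg_expN0 R))) _; rewrite mulr1.
apply: derive_half_ode => x x0; apply: cderiv_eq (d1 x0) _.
have := hA x x0; rewrite A0 mul0r /F /hv1 => /eqP; rewrite subr_eq0 => /eqP <-.
by rewrite mulrA -rmorphM mulVf ?mul1r // gt_eqF // onem_exp_gt0.
Unshelve. all: by end_near. Qed.

End Converse.

(** * Gluing two half-lines *)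

Section Glue.
Context {R : realType}.
Notation mu := (@lebesgue_measure R).
Implicit Types f g v : R -> R[i].

Definition glue_halves f g (x : R) : R[i] := if 0 < x then f x else if x < 0 then g (- x) else 0.

Lemma glue_pos f g x : 0 < x -> glue_halves f g x = f x.
Proof. by rewrite /glue_halves => ->. Qed.

Lemma glue_neg f g x : 0 < x -> glue_halves f g (- x) = g x.
Proof. by move=> x0; rewrite /glue_halves oppr_gt0 oppr_lt0 x0 ltNge ltW //= opprK. Qed.

Lemma glue_opp f g : (fun x => glue_halves f g (- x)) = glue_halves g f.
Proof.
apply/funext => x; rewrite /glue_halves oppr_gt0 oppr_lt0 opprK.
by case: ltgtP.
Qed.

Lemma glue_cont f g x : (forall x, 0 < x -> ccont f x) -> (forall x, 0 < x -> ccont g x) ->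
  x != 0 -> ccont (glue_halves f g) x.
Proof.
move=> cf cg x0; have [x0'|x0'|E] := ltgtP x 0; last by rewrite E eqxx in x0.
- have nx : 0 < - x by rewrite oppr_gt0.
  apply: (@ccont_near _ _ (fun y => g (- y))); last by apply: ccont_opp; exact: cg.
  have : \forall y \near x, y < 0 by exact: lt_nbhsl.
  by apply: filterS => y y0; rewrite -{1}[y]opprK glue_neg // oppr_gt0.
- apply: (@ccont_near _ _ f); last exact: cf.
  have : \forall y \near x, 0 < y by exact: lt_nbhsr.
  by apply: filterS => y y0; rewrite glue_pos.
Qed.

Lemma cont_off0_cmeas f : (forall x, x != 0 -> ccont f x) -> cmeas setT f.
Proof.
move=> cf; have [h1 h2] : cmeas (~` [set 0]) f.
  apply: ccont_cmeas; first by rewrite openC; exact: closed_eq.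
  by move=> x; rewrite inE /= => /eqP; exact: cf.
have U : [set: R] = ~` [set 0] `|` [set 0] by rewrite setUC setUv.
have ms : measurable (~` [set (0 : R)]) by exact: measurableC.
by split; rewrite U; apply/measurable_funU => //; split => //; exact: measurable_fun_set1.
Qed.

Lemma inX_glue f g (s C : R) (lf lg : R[i]) : 0 < s ->
  (forall x, 0 < x -> cmod (f x) <= C * expR (- s * x)) ->
  (forall x, 0 < x -> cmod (g x) <= C * expR (- s * x)) ->
  (forall x, 0 < x -> ccont f x) -> (forall x, 0 < x -> ccont g x) ->
  ccvg (0 : R)^'+ f lf -> ccvg (0 : R)^'+ g lg ->
  [/\ inX (glue_halves f g), limr0 (glue_halves f g) = lf & liml0 (glue_halves f g) = lg].
Proof.
move=> s0 hf hg cf cg lf0 lg0.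
have C0 : 0 <= C.
  have := le_trans (cmod_ge0 _) (hf 1 ltr01); rewrite pmulr_lge0 //; exact: expR_gt0.
have hb x : cmod (glue_halves f g x) <= C * expR (- s * `|x|).
  have [x0|x0|->] := ltgtP x 0.
  - by rewrite -{1}[x]opprK glue_neg ?oppr_gt0 // ltr0_norm // hg // oppr_gt0.
  - by rewrite glue_pos // gtr0_norm // hf.
  - by rewrite /glue_halves ltxx cmod0 mulr_ge0 // expR_ge0.
have cc x : x != 0 -> ccont (glue_halves f g) x by exact: glue_cont.
have mm := cont_off0_cmeas cc.
have [h1 h2 h3] : [/\ inCd (glue_halves f g), limr0 (glue_halves f g) = lf & liml0 (glue_halves f g) = lg].
  apply: inCdI.
  - exists C => x _; apply: le_trans (hb x) _; rewrite ler_piMr // expR_le1.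
    by rewrite mulNr oppr_le0 mulr_ge0 // ltW.
  - exact: cc.
  - apply: ccvg_near lf0; near=> x; apply: glue_pos; near: x; exact: nbhs_right_gt.
  - have -> : glue_halves f g = (fun x => glue_halves g f (- x)) by rewrite glue_opp.
    apply: cvg_at_left_opp; apply: ccvg_near lg0; near=> x; apply: glue_pos; near: x.
    exact: nbhs_right_gt.
split; [split; [|exact: h1]|exact: h2|exact: h3].
apply/inL2P; split; first exact: mm.
have i2 : mu.-integrable setT (EFin \o (fun x => C ^+ 2 * expR (- (2 * s) * `|x|))).
  have s2 : 0 < 2 * s by rewrite mulr_gt0.
  exact: (integrableZl (mu := mu) measurableT (C ^+ 2) (integrable_exp_abs s2)).
apply: le_integrable i2 => //.
  by apply/measurable_EFinP; apply: measurable_funX; exact: cmeas_cmod.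
move=> x _ /=; rewrite lee_fin (ger0_norm (sqr_ge0 (cmod _))).
rewrite [leRHS]ger0_norm ?mulr_ge0 ?sqr_ge0 ?expR_ge0 //.
have -> : C ^+ 2 * expR (- (2 * s) * `|x|) = (C * expR (- s * `|x|)) ^+ 2.
  by rewrite exprMn [expR _ ^+ 2]expr2 -expRD; congr (_ * expR _); ring.
by rewrite ler_pXn2r ?nnegrE ?cmod_ge0 ?mulr_ge0 ?expR_ge0.
Unshelve. all: by end_near. Qed.

End Glue.

(** * Construction of eigenfunctions *)

Section Existence.
Context {R : realType}.
Notation mu := (@lebesgue_measure R).

Lemma cderiv_cexpN (A : R[i]) (x : R) :
  cderiv (fun y => A * (expR (- y))%:C) x (- (A * (expR (- x))%:C)).
Proof.
by apply: cderiv_eq (cderivZ A (cderiv_real (is_derive_expN x))) _; rewrite rmorphN mulrN.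
Qed.

Lemma ccvg_cexpN (A : R[i]) : ccvg (0 : R)^'+ (fun y => A * (expR (- y))%:C) A.
Proof.
by apply: ccvg_eq (ccvgM (ccvg_cst A) (ccvg_real (@cvg_expN0 R))) _; rewrite mulr1.
Qed.

Lemma cmod_cexpN (A : R[i]) (s x : R) : s <= 1 -> 0 < x ->
  cmod (A * (expR (- x))%:C) <= cmod A * expR (- s * x).
Proof.
move=> s1 x0; rewrite cmodM cmod_real gtr0_norm ?expR_gt0 // ler_wpM2l ?cmod_ge0 //.
rewrite ler_expR; nra.
Qed.

(** No momentum on the right, momentum [M] times [mexp] on the left. The two scalar hypotheses are
    the matching conditions of [half_ode_at0]: the first is the one on the right, with $J=A/3$ for
    the pure exponential; the second is the sum of both, in which the integrals cancel. *)
Lemma Lw_graph_glue (b c : R) (la A M B : R[i]) (w w1 : R -> R[i]) (s C L : R) : 0 < c ->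
  0 < s <= 1 ->
  (forall x, 0 < x -> cderiv w x (w1 x)) ->
  (forall x, 0 < x -> cderiv w1 x (w x - M * mexp b (- la) x)) ->
  (forall x, 0 < x -> cmod (w x) <= C * expR (- s * x)) ->
  (forall x, 0 < x -> cmod ((1 - expR (- x))%:C * w1 x) <= L) ->
  ccvg (0 : R)^'+ (fun x => (1 - expR (- x))%:C * w1 x) 0 -> ccvg (0 : R)^'+ w B ->
  let v := glue_halves (fun x => A * (expR (- x))%:C) w in
  let I := Jh (glue_halves w (fun=> 0)) 0 in
  (la - 1 / 2) * A - (3 - b)%:C / 2 * B + (3 - 3 * b / 2)%:C * I = 0 ->
  la * (A - B) = A + B ->
  [/\ Lw_graph b c v (fun x => c%:C * la * v x), limr0 v = A & liml0 v = B].
Proof.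
move=> c0 /andP[s0 s1] dw dw1 hw hL l1 lw v I e1 e2.
pose f := fun x : R => A * (expR (- x))%:C.
have C0 : 0 <= C.
  have := le_trans (cmod_ge0 _) (hw 1 ltr01); rewrite pmulr_lge0 //; exact: expR_gt0.
have cw x : 0 < x -> ccont w x by move=> x0; exact: cderiv_cont (dw x x0).
have cf x : 0 < x -> ccont f x by move=> _; exact: cderiv_cont (cderiv_cexpN A x).
have lf := ccvg_cexpN A.
have [hv rv lv] : [/\ inX v, limr0 v = A & liml0 v = B].
  apply: (@inX_glue _ _ _ s (cmod A + C)) => //.
  - move=> x x0; apply: le_trans (cmod_cexpN A s1 x0) _.
    by rewrite ler_wpM2r ?expR_ge0 // lerDl.
  - move=> x x0; apply: le_trans (hw x x0) _.
    by rewrite ler_wpM2r ?expR_ge0 // lerDr cmod_ge0.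
split; [|exact: rv|exact: lv].
have [hr rr lr] := inX_opp hv; rewrite rv lv in rr lr.
have mv := inX_cmeas hv; have mr := inX_cmeas hr.
have [K K0 vK] := inX_bound hv.
have rK x : cmod (v (- x)) <= K by [].
have vE x : 0 < x -> v x = f x by exact: glue_pos.
have rE x : 0 < x -> v (- x) = w x by exact: glue_neg.
have Jv : Jh v 0 = A / 3 by rewrite (Jh_exp vE mv) // mulr0 expR0 mulr1.
have Jr : Jh (fun x => v (- x)) 0 = I.
  apply: eq_cintegral => x; rewrite inE /= in_itv /= andbT => x0.
  by rewrite /v /glue_halves oppr_gt0 oppr_lt0 opprK; case: ltgtP x0.
have sm : inX (fun x => c%:C * la * v x).
  have fE g h : glue_halves (fun x => c%:C * la * g x) (fun x => c%:C * la * h x) = (fun x => c%:C * la * glue_halves g h x).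
    by apply/funext => x; rewrite /glue_halves; case: ifP => // _; case: ifP => // _; rewrite mulr0.
  have := @inX_glue _ (fun x => c%:C * la * f x) (fun x => c%:C * la * w x) s
    (cmod (c%:C * la) * (cmod A + C)) (c%:C * la * A) (c%:C * la * B) s0.
  rewrite fE -/v => h; have [|||| | |//] := h.
  - move=> x x0; rewrite cmodM -mulrA ler_wpM2l ?cmod_ge0 //.
    apply: le_trans (cmod_cexpN A s1 x0) _.
    by rewrite ler_wpM2r ?expR_ge0 // lerDl.
  - move=> x x0; rewrite cmodM -mulrA ler_wpM2l ?cmod_ge0 //.
    apply: le_trans (hw x x0) _.
    by rewrite ler_wpM2r ?expR_ge0 // lerDr cmod_ge0.
  - by move=> x x0; apply: ccontM; [exact: ccont_cst|exact: cf].
  - by move=> x x0; apply: ccontM; [exact: ccont_cst|exact: cw].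
  - by apply: ccvgM; [exact: ccvg_cst|exact: lf].
  - by apply: ccvgM; [exact: ccvg_cst|exact: lw].
have nearp (g h : R -> R[i]) (x : R) : 0 < x -> (forall y, 0 < y -> g y = h y) ->
    \forall y \near x, h y = g y.
  move=> x0 gh; have : \forall y \near x, 0 < y by exact: lt_nbhsr.
  by apply: filterS => y y0; rewrite gh.
have cC : (c%:C : R[i]) != 0 by rewrite -realc0 (inj_eq (@complexI _)) gt_eqF.
have lac : c%:C * la / c%:C = la by rewrite mulrAC mulfV // mul1r.
apply: half_ode_Lw_graph => //; rewrite lac.
- have l0 : ccvg (0 : R)^'+ (fun x => (1 - expR (- x))%:C * - f x) 0.
    apply: ccvg_eq (ccvgM (ccvg_real (@cvg_onem0 R)) (ccvgN lf)) _.
    by rewrite realc0 mul0r.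
  apply: (@half_ode_of_momentum _ b la (coupling b v) 0 v (fun x => - f x) K (cmod A) A) => //.
  + move=> x x0; apply: cderiv_near (nearp _ _ x x0 vE) _; exact: cderiv_cexpN.
  + move=> x x0; rewrite mul0r subr0 vE //.
    by apply: cderiv_eq (cderivN (cderiv_cexpN A x)) _; rewrite opprK.
  + move=> x x0; rewrite cmodM cmodN cmod_real /f cmodM cmod_real mulrCA ler_piMr ?cmod_ge0 //.
    have t0 := expR_gt0 (- x); have t1 := onem_exp_gt0 x0.
    by rewrite !gtr0_norm //; nra.
  + by rewrite -rv; exact: inX_limr0.
  + rewrite Jv /coupling rv lv Jr -[RHS]e1 !realcE.
    by field.
- apply: (@half_ode_of_momentum _ b (- la) _ M (fun x => v (- x)) w1 K L B) => //.
  + by move=> x x0; apply: cderiv_near (nearp _ _ x x0 rE) _; exact: dw.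
  + by move=> x x0; rewrite rE //; exact: dw1.
  + by rewrite -rr; exact: inX_limr0.
  + rewrite coupling_opp // rv lv Jr Jv.
    have -> : 0 = (la * (A - B) - (A + B)) - ((la - 1 / 2) * A - (3 - b)%:C / 2 * B + (3 - 3 * b / 2)%:C * I).
      by rewrite e1 e2 subrr subr0.
    by rewrite !realcE; field.
Qed.

Lemma ae_eq0_inX (v : R -> R[i]) x : inX v -> {ae mu, forall x, v x = 0} -> x != 0 -> v x = 0.
Proof.
move=> hv h x0; apply: cmod_eq0; apply/eqP; rewrite eq_le cmod_ge0 andbT.
apply: (le_ae_le (inX_cont hv x0)); have [N [mN N0 hN]] := h; exists N; split => // y hy.
by apply: hN => vy; apply: hy; rewrite /= vy cmod0.
Qed.

(** The left half-line has parameter [- la]. There [mexp] decays at infinity and is less singular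
    than $x^{-2}$ at the origin, which is exactly the band, so momentum is put on that side with
    coefficient 1. The solution [y] and its bounds are kept in the statement for the study of
    regularity. *)
Lemma eigenfunction_exists_pos (b c : R) (la : R[i]) : 0 < c -> 0 < Re la < 2 - b ->
  let s := Num.min (Re la) (1 / 2) in
  exists (kap : R[i]) (y y1 v : R -> R[i]),
  [/\ [/\ forall x, 0 < x -> cderiv y x (y1 x),
      forall x, 0 < x -> cderiv y1 x (y x - mexp b (- la) x) &
      forall eta, 0 < eta < 1 -> Re la + b <= 1 + eta ->
        exists2 C : R, 0 <= C & forall x, 0 < x ->
        cmod (y x) <= C * epow s (1 - eta) x /\ cmod (y1 x) <= C * epow s (- eta) x],
    kap * la ^+ 2 = - (3 - 3 * b / 2)%:C * Jh (glue_halves y (fun=> 0)) 0,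
    forall x, 0 < x -> v x = kap * (la + 1) * (expR (- x))%:C,
    forall x, 0 < x -> v (- x) = kap * (la - 1) * (expR (- x))%:C + y x &
    Lw_eigenfunction b c (c%:C * la) v].
Proof.
move=> c0 /andP[l0 lb] s.
(* [s] is the decay rate of the momentum, capped below 1 to stay clear of resonance with the
   homogeneous solution $e^{-x}$. *)
have s0 : 0 < s by rewrite lt_min l0 divr_gt0.
have s2 : s <= 1 / 2 by rewrite ge_min lexx orbT.
have sl : s <= Re la by rewrite ge_min lexx.
have s01 : 0 < s < 1 by rewrite s0; lra.
have cm x : 0 < x -> ccont (mexp b (- la)) x by move=> x0; exact: cderiv_cont (cderiv_mexp _ _ x0).
have bm eta : Re la + b <= 1 + eta -> forall x, 0 < x -> cmod (mexp b (- la) x) <= epow s (- 1 - eta) x.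
  by move=> h x x0; rewrite cmod_mexp_epow cReN opprK; apply: epow_le => //; lra.
(* Some exponent in $(0,1)$ with $\mathrm{Re}\,\lambda+b\le1+\eta_0$; it exists because
   $\mathrm{Re}\,\lambda<2-b$. *)
pose eta0 : R := Num.max (1 / 2) (Re la + b - 1).
have e0 : 0 < eta0 < 1 by rewrite lt_max gt_max divr_gt0 //=; lra.
have he0 : Re la + b <= 1 + eta0.
  by rewrite -lerBlDl le_max lexx orbT.
have [y [y1 [dy dy1 hy]]] := particular_solution cm s01 e0 (bm _ he0).
have [C C0 hC] := hy _ e0 (bm _ he0).
have ey (p x : R) : 0 <= p -> 0 < x -> epow s p x <= expR (- s * x).
  move=> p0 x0; apply: (@le_trans _ _ (epow s 0 x)); first exact: epow_le.
  by rewrite /epow mul0r sub0r mulNr.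
have yB x : 0 < x -> cmod (y x) <= C * expR (- s * x).
  move=> x0; apply: le_trans (hC x x0).1 _; rewrite ler_wpM2l // ey //.
  by have /andP[_] := e0; lra.
have cy x : 0 < x -> ccont y x by move=> x0; exact: cderiv_cont (dy x x0).
have y1L x : 0 < x -> cmod ((1 - expR (- x))%:C * y1 x) <= C * epow s (1 - eta0) x.
  move=> x0; rewrite cmodM cmod_real gtr0_norm ?onem_exp_gt0 //.
  rewrite -(@epow_onem _ s (- eta0)) //; last by rewrite addrC.
  rewrite [C * _]mulrA [leRHS]mulrC ler_pM2l ?onem_exp_gt0 //.
  exact: (hC x x0).2.
have lG : C * epow s (1 - eta0) x @[x --> (0 : R)^'+] --> (0 : R).
  rewrite -[X in _ --> X](mulr0 C); apply: cvgMr; apply: cvg_epow_at0.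
  by have /andP[_] := e0; lra.
have ly : ccvg (0 : R)^'+ y 0.
  apply: ccvg0_le lG; near=> x; apply: (hC x _).1; near: x; exact: nbhs_right_gt.
have ly1 : ccvg (0 : R)^'+ (fun x => (1 - expR (- x))%:C * y1 x) 0.
  apply: ccvg0_le lG; near=> x; apply: y1L; near: x; exact: nbhs_right_gt.
have la0 : la != 0 by apply/eqP => E; rewrite E ltxx in l0.
(* Taking $A-B=2\kappa$ and $A+B=2\kappa\lambda$ solves the second matching condition; the first one
   then collapses to $\kappa\lambda^2=-qJ$. *)
pose q := (3 - 3 * b / 2)%:C : R[i]; pose J := Jh (glue_halves y (fun=> 0)) 0.
pose kap := - q * J / la ^+ 2.
have hk : kap * la ^+ 2 = - q * J by rewrite /kap divfK // expf_neq0.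
pose A := kap * (la + 1); pose B := kap * (la - 1).
pose w x := B * (expR (- x))%:C + y x; pose w1 x := - (B * (expR (- x))%:C) + y1 x.
have dw x : 0 < x -> cderiv w x (w1 x).
  by move=> x0; apply: cderivD; [exact: cderiv_cexpN|exact: dy].
have dw1 x : 0 < x -> cderiv w1 x (w x - 1 * mexp b (- la) x).
  move=> x0; apply: cderiv_eq (cderivD (cderivN (cderiv_cexpN B x)) (dy1 x x0)) _.
  by rewrite /w opprK mul1r addrA.
have s1 : s <= 1 by lra.
have hw x : 0 < x -> cmod (w x) <= (cmod B + C) * expR (- s * x).
  move=> x0; apply: le_trans (cmodD _ _) _; rewrite mulrDl; apply: lerD; last exact: yB.
  exact: cmod_cexpN.
have hL x : 0 < x -> cmod ((1 - expR (- x))%:C * w1 x) <= cmod B + C.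
  move=> x0; rewrite /w1 mulrDr; apply: le_trans (cmodD _ _) _; apply: lerD.
    rewrite cmodM cmodN cmodM !cmod_real mulrCA ler_piMr ?cmod_ge0 //.
    have t0 := expR_gt0 (- x); have t1 := onem_exp_gt0 x0.
    by rewrite !gtr0_norm //; nra.
  apply: le_trans (y1L x x0) _; rewrite ler_piMr //; apply: le_trans (ey _ _ _ x0) _.
    by have /andP[_] := e0; lra.
  by rewrite expR_le1; nra.
have lw1 : ccvg (0 : R)^'+ (fun x => (1 - expR (- x))%:C * w1 x) 0.
  have h1 : ccvg (0 : R)^'+ (fun x => (1 - expR (- x))%:C * - (B * (expR (- x))%:C)) (0%:C * - B).
    exact: ccvgM (ccvg_real (@cvg_onem0 R)) (ccvgN (ccvg_cexpN B)).
  apply: (@ccvg_near _ _ _ _ (fun x => (1 - expR (- x))%:C * - (B * (expR (- x))%:C) + (1 - expR (- x))%:C * y1 x)).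
    by near=> x; rewrite /w1 mulrDr.
  by apply: ccvg_eq (ccvgD h1 ly1) _; rewrite realc0 mul0r addr0.
have lw : ccvg (0 : R)^'+ w B.
  by apply: ccvg_eq (ccvgD (ccvg_cexpN B) ly) _; rewrite addr0.
have JE : Jh (glue_halves w (fun=> 0)) 0 = B / 3 + J.
  pose e := fun x : R => B * (expR (- x))%:C.
  have z0 : ccvg (0 : R)^'+ (fun=> 0 : R[i]) 0 by exact: ccvg_cst.
  have zc x : 0 < x -> ccont (fun=> 0 : R[i]) x by move=> _; exact: ccont_cst.
  have [he _ _] : [/\ inX (glue_halves e (fun=> 0)), limr0 (glue_halves e (fun=> 0)) = B & liml0 (glue_halves e (fun=> 0)) = 0].
    apply: (@inX_glue _ _ _ s (cmod B)) => //.
    - by move=> x x0; exact: cmod_cexpN.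
    - by move=> x x0; rewrite cmod0 mulr_ge0 ?cmod_ge0 ?expR_ge0.
    - by move=> x x0; exact: cderiv_cont (cderiv_cexpN B x).
    - exact: ccvg_cexpN.
  have [hyX _ _] : [/\ inX (glue_halves y (fun=> 0)), limr0 (glue_halves y (fun=> 0)) = 0 & liml0 (glue_halves y (fun=> 0)) = 0].
    apply: (@inX_glue _ _ _ s C) => //.
    by move=> x x0; rewrite cmod0 mulr_ge0 ?expR_ge0.
  have [Be _ hBe] := inX_bound he; have [By _ hBy] := inX_bound hyX.
  have me := inX_cmeas he; have my := inX_cmeas hyX.
  have eE x : 0 < x -> glue_halves e (fun=> 0) x = B * (expR (- x))%:C by exact: glue_pos.
  have <- : Jh (glue_halves e (fun=> 0)) 0 = B / 3 by rewrite (Jh_exp eE me) // mulr0 expR0 mulr1.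
  rewrite /J /Jh -cintegralD //.
  - apply: eq_cintegral => x _; rewrite -mulrDr; congr (_ * _); rewrite /glue_halves.
    by case: ifP => // _; case: ifP => // _; rewrite addr0.
  - exact: (@cintegrable_tail _ _ Be _ _ me).
  - exact: (@cintegrable_tail _ _ By _ _ my).
have ss : 0 < s <= 1 by rewrite s0.
have [||hG hA hB] := @Lw_graph_glue b c la A 1 B w w1 s _ _ c0 ss dw dw1 hw hL lw1 lw.
- rewrite JE mulrDr -/q.
  have -> : q * J = - (kap * la ^+ 2) by rewrite hk mulNr opprK.
  by rewrite /A /B /q !realcE; field.
- by rewrite /A /B; ring.
set v := glue_halves _ w in hG hA hB.
exists kap, y, y1, v; split.
- split; [exact: dy|exact: dy1|move=> eta he hb; exact: (hy eta he (bm _ hb))].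
- exact: hk.
- by move=> x x0; rewrite /v glue_pos.
- by move=> x x0; rewrite /v glue_neg.
- split; first exact: hG.
  move=> hae; have [hv _ _] := hG.
  (* If the function vanished almost everywhere, so would [w] and its derivatives, and with them the
     momentum [mexp], whose modulus is positive. *)
  have w0 x : 0 < x -> w x = 0.
    move=> x0; rewrite -(@glue_neg _ (fun x => A * (expR (- x))%:C) w x x0).
    by apply: (ae_eq0_inX hv hae); rewrite oppr_eq0 gt_eqF.
  have near0 (g : R -> R[i]) (x : R) : 0 < x -> (forall y, 0 < y -> g y = 0) -> cderiv g x 0.
    move=> x0 h; apply: cderiv_near (cderiv_cst 0 x).
    have : \forall y \near x, 0 < y by exact: lt_nbhsr.
    by apply: filterS => z z0; rewrite h.
  have w10 x : 0 < x -> w1 x = 0.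
    by move=> x0; exact: cderiv_unique (dw x x0) (near0 _ _ x0 w0).
  have := cderiv_unique (dw1 1 ltr01) (near0 _ _ ltr01 w10).
  rewrite w0 // mul1r sub0r => /(congr1 cmod); rewrite cmodN cmod0 cmod_mexp => /eqP.
  by rewrite gt_eqF // expR_gt0.
Unshelve. all: by end_near. Qed.

(** The translation mode: there is no momentum on either side, and the one-sided limits $-c$ and $c$
    at the origin are opposite. *)
Lemma eigenfunction_du0 (b c : R) : 0 < c -> Lw_eigenfunction b c 0 (fun x => (du0 c x)%:C).
Proof.
move=> c0; have lt1 := @ltr01 R.
pose w := fun x : R => c%:C * (expR (- x))%:C : R[i].
pose w1 := fun x : R => - (c%:C * (expR (- x))%:C) : R[i].
have dE : (fun x => (du0 c x)%:C) = glue_halves (fun x => (- c%:C) * (expR (- x))%:C) w.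
  apply/funext => x; rewrite /du0 /glue_halves; have [x0|x0|->] := ltgtP x 0.
  - by rewrite ltr0_sg // ltr0_norm // opprK mulrN1 opprK rmorphM /w opprK.
  - by rewrite gtr0_sg // gtr0_norm // mulr1 rmorphM rmorphN.
  - by rewrite sgr0 mulr0 mul0r.
have dw x : 0 < x -> cderiv w x (w1 x) by move=> _; exact: cderiv_cexpN.
have dw1 x : 0 < x -> cderiv w1 x (w x - 0 * mexp b (- 0) x).
  move=> _; apply: cderiv_eq (cderivN (cderiv_cexpN c%:C x)) _.
  by rewrite opprK mul0r subr0.
have hw x : 0 < x -> cmod (w x) <= cmod (c%:C : R[i]) * expR (- 1 * x) by exact: cmod_cexpN.
have hL x : 0 < x -> cmod ((1 - expR (- x))%:C * w1 x) <= cmod (c%:C : R[i]).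
  move=> x0; rewrite /w1 cmodM cmodN cmodM !cmod_real mulrCA ler_piMr ?normr_ge0 //.
  have t0 := expR_gt0 (- x); have t1 := onem_exp_gt0 x0.
  by rewrite !gtr0_norm //; nra.
have lw1 : ccvg (0 : R)^'+ (fun x => (1 - expR (- x))%:C * w1 x) 0.
  apply: ccvg_eq (ccvgM (ccvg_real (@cvg_onem0 R)) (ccvgN (ccvg_cexpN c%:C))) _.
  by rewrite realc0 mul0r.
have lw := ccvg_cexpN (c%:C : R[i]).
have s1 : 0 < (1 : R) <= 1 by rewrite ltr01 /=.
have mw : cmeas setT (glue_halves w (fun=> 0)).
  apply: cont_off0_cmeas => x; apply: glue_cont.
  - by move=> z _; exact: cderiv_cont (cderiv_cexpN c%:C z).
  - by move=> z _; exact: ccont_cst.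
have J0 : Jh (glue_halves w (fun=> 0)) 0 = c%:C / 3.
  by rewrite (@Jh_exp _ _ c%:C _ mw) ?mulr0 ?expR0 ?mulr1 // => x x0; rewrite glue_pos.
have [||hG _ _] := @Lw_graph_glue b c 0 (- c%:C) 0 c%:C w w1 1 _ _ c0 s1 dw dw1 hw hL lw1 lw.
- by rewrite J0 !realcE; field.
- by rewrite mul0r addNr.
rewrite -dE in hG; split.
  have -> : (fun x => 0 * (du0 c x)%:C) = (fun x => c%:C * 0 * (du0 c x)%:C).
    by apply/funext => x; rewrite mulr0 !mul0r.
  exact: hG.
have [hv _ _] := hG.
move=> hae; have := @ae_eq0_inX _ 1 hv hae (oner_neq0 _).
rewrite /du0 gtr0_sg // gtr0_norm // => /(congr1 cmod).
rewrite cmod_real cmod0 normrM mulr1 normrN => /eqP.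
by rewrite mulf_eq0 !normr_eq0 gt_eqF //= gt_eqF // expR_gt0.
Qed.

Lemma Lw_eigenfunction_opp (b c : R) (lambda : R[i]) v : 0 < c ->
  Lw_eigenfunction b c lambda v -> Lw_eigenfunction b c (- lambda) (fun x => v (- x)).
Proof.
move=> c0 [hG hn]; split; first exact: Lw_graph_opp.
move=> hae; apply: hn; have [hv _ _] := hG; have [hr _ _] := inX_opp hv.
apply: ae_eq0_off0 => x x0; rewrite -[x]opprK; apply: (ae_eq0_inX hr hae).
by rewrite oppr_eq0.
Qed.

Lemma Lw_point_spectrumE (b c : R) : 0 < c -> Lw_point_spectrum b c =
  [set lambda : R[i] | lambda = 0 \/ (b < 2 /\ 0 < `|Re lambda| < c * (2 - b))].
Proof.
move=> c0; apply/seteqP; split => lambda /=; first by move=> [v]; exact: eigenvalue_band.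
case=> [->|[b2 hl]]; first by exists (fun x => (du0 c x)%:C); exact: eigenfunction_du0.
have pos (mu : R[i]) : 0 < Re mu < c * (2 - b) -> exists v, Lw_eigenfunction b c mu v.
  move=> /andP[m0 m1]; have cC : (c%:C : R[i]) != 0 by rewrite -realc0 (inj_eq (@complexI _)) gt_eqF.
  have [|kap [y [y1 [v [_ _ _ _ hv]]]]] := @eigenfunction_exists_pos b c (mu / c%:C) c0.
    by rewrite Re_divc divr_gt0 //= ltr_pdivrMr // mulrC.
  by exists v; rewrite mulrC divfK in hv.
have [l0|l0] := leP 0 (Re lambda); first by apply: pos; rewrite ger0_norm in hl.
have [|v hv] := pos (- lambda); first by rewrite cReN; rewrite ltr0_norm in hl.
by exists (fun x => v (- x)); rewrite -[lambda]opprK; exact: Lw_eigenfunction_opp.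
Qed.

End Existence.

(** * Fourier transform and Hölder continuity *)

Section ImproperIntegrals.
Context {R : realType}.
Notation mu := (@lebesgue_measure R).

Lemma cvg_Rintegral_expanding (D : set R) (A : nat -> set R) (f : R -> R) :
  measurable D -> (forall n, measurable (A n)) -> (forall n, A n `<=` D) ->
  (forall x, D x -> \forall n \near \oo, A n x) -> mu.-integrable D (EFin \o f) ->
  \int[mu]_(x in A n) f x @[n --> \oo] --> \int[mu]_(x in D) f x.
Proof.
move=> mD mA AD cA fi.
have mf : measurable_fun D (EFin \o f) by case/integrableP: fi.
have AE n : (\int[mu]_(x in A n) (f x)%:E = \int[mu]_(x in D) (((EFin \o f) \_ (A n)) x))%E.
  by rewrite -integral_mkcondr setIidr.
have h : (\int[mu]_(x in A n) (f x)%:E @[n --> \oo] --> \int[mu]_(x in D) (f x)%:E)%E.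
  under eq_fun do rewrite AE.
  apply: (@dominated_cvg _ _ _ mu D mD _ _ (fun x => `|(f x)%:E|%E)) => //.
  - move=> n; apply/(measurable_restrict _ (mA n) mD).
    by apply: measurable_funS mf => //; exact: subIsetl.
  - move=> x Dx; apply: cvg_near_cst.
    by move: (cA x Dx); apply: filterS => n Anx; rewrite patchE mem_set.
  - by apply: integrable_abse.
  - move=> n x Dx; rewrite patchE; case: ifPn => // _.
    by rewrite abse0.
apply: (fine_cvg (f := fun n => (\int[mu]_(x in A n) (f x)%:E)%E)).
by rewrite fineK //; exact: integrable_fin_num.
Qed.

Lemma Rintegral_derivative (G g : R -> R) : (forall x : R, is_derive x (1 : R) G (g x)) ->
  (forall x : R, {for x, continuous g}) -> mu.-integrable setT (EFin \o g) ->
  G x @[x --> +oo] --> (0 : R) -> G (- x) @[x --> +oo] --> (0 : R) -> \int[mu]_x g x = 0.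
Proof.
move=> dG cg ig G1 G2.
pose A n := `[- n.+1%:R, n.+1%:R]%classic : set R.
have h1 : \int[mu]_(x in A n) g x @[n --> \oo] --> \int[mu]_x g x.
  have mA n : measurable (A n) by exact: measurable_itv.
  have AT n : A n `<=` setT by [].
  apply: (cvg_Rintegral_expanding measurableT mA AT _ ig) => x _; near=> n.
  rewrite /A /= in_itv /= -ler_norml; apply: (@le_trans _ _ n%:R); last by rewrite ler_nat.
  by near: n; exact: nbhs_infty_ger.
have cn : (n.+1%:R : R) @[n --> \oo] --> +oo.
  by rewrite (cvg_shiftS (fun n => n%:R : R)); exact: cvgr_idn.
have h2 : \int[mu]_(x in A n) g x @[n --> \oo] --> (0 : R).
  have E n : \int[mu]_(x in A n) g x = G n.+1%:R - G (- n.+1%:R).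
    have nn : - n.+1%:R < n.+1%:R :> R by apply: (@lt_trans _ _ 0); rewrite ?oppr_lt0 ltr0n.
    by rewrite (@FTC2_closed _ G g _ _ nn) // => x _.
  have -> : (fun n => \int[mu]_(x in A n) g x) = (fun n => G n.+1%:R - G (- n.+1%:R)) by apply/funext.
  rewrite -[X in _ --> X](subrr (0 : R)); apply: cvgB.
  - exact: cvg_comp cn G1.
  - exact: cvg_comp cn G2.
exact: (cvg_unique _ h1 h2).
Unshelve. all: by end_near. Qed.

Lemma Rintegral_odd (f : R -> R) : measurable_fun setT f -> mu.-integrable setT (EFin \o f) ->
  (forall x, f (- x) = - f x) -> \int[mu]_x f x = 0.
Proof.
move=> mf fi fo; have := Rintegral_opp measurableT mf fi.
have -> : [set x : R | [set: R] (- x)] = setT by apply/seteqP.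
have -> : \int[mu]_x f (- x) = - \int[mu]_x f x.
  under eq_Rintegral do rewrite fo -mulN1r.
  by rewrite RintegralZl // mulN1r.
lra.
Qed.

End ImproperIntegrals.

(** * The Gaussian and its Fourier transform *)

Section Gaussian.
Context {R : realType}.
Notation mu := (@lebesgue_measure R).
Implicit Types (a x k : R).

Definition gaussian a k : R := expR (- a * k ^+ 2).

Lemma gaussian_gt0 a k : 0 < gaussian a k. Proof. exact: expR_gt0. Qed.

Lemma gaussianN a k : gaussian a (- k) = gaussian a k.
Proof. by rewrite /gaussian sqrrN. Qed.

(** Completing the square: $a|k|^2-2|k|+1/a=(a|k|-1)^2/a\ge0$. *)
Lemma gaussian_le a k : 0 < a -> gaussian a k <= expR a^-1 * expR (- 2 * `|k|).
Proof.
move=> a0; rewrite /gaussian -expRD ler_expR -[k ^+ 2]real_normK ?num_real //.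
have h : a * a^-1 = 1 by rewrite mulfV // gt_eqF.
have := sqr_ge0 (a * `|k| - 1); have : 0 < a^-1 by rewrite invr_gt0.
move: (a^-1) h (`|k|) => i h y i0 hy.
have E : i * (a * y - 1) ^+ 2 = a * i * (a * y ^+ 2) - 2 * (a * i) * y + i by ring.
have := mulr_ge0 (ltW i0) hy; rewrite E h; lra.
Qed.

Lemma is_derive_gaussian a k : is_derive k (1 : R) (gaussian a) (- 2 * a * k * gaussian a k).
Proof.
have d : is_derive k (1 : R) (fun y : R => - a * y ^+ 2) (- 2 * a * k).
  have -> : (fun y => - a * y ^+ 2) = (fun y : R => - a * (y * y)) by apply/funext => y; rewrite expr2.
  apply: is_derive_eq (is_deriveM (is_derive_cst (- a) k 1) (is_deriveM (is_derive_id k (1 : R)) (is_derive_id k (1 : R)))) _.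
  by rewrite /GRing.scale /= mulr0 addr0; ring.
apply: is_derive_eq (@is_derive1_comp _ expR (fun y => - a * y ^+ 2) k _ _ (is_derive_expR _) d) _.
by rewrite /gaussian mulrC.
Qed.

Lemma gaussian_cont a k : {for k, continuous (gaussian a)}.
Proof. exact: is_derive_cont (is_derive_gaussian a k). Qed.

Lemma is_derive_cosM x k : is_derive k (1 : R) (fun y => cos (x * y)) (- x * sin (x * k)).
Proof.
have d : is_derive k (1 : R) (fun y => x * y) x.
  by apply: is_derive_eq (is_deriveM (is_derive_cst x k 1) (is_derive_id k (1 : R))) _; rewrite /GRing.scale /= mulr0 addr0 mulr1.
apply: is_derive_eq (@is_derive1_comp _ cos (fun y => x * y) k _ _ (is_derive_cos _) d) _.
by ring.
Qed.

Lemma is_derive_sinM x k : is_derive k (1 : R) (fun y => sin (x * y)) (x * cos (x * k)).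
Proof.
have d : is_derive k (1 : R) (fun y => x * y) x.
  by apply: is_derive_eq (is_deriveM (is_derive_cst x k 1) (is_derive_id k (1 : R))) _; rewrite /GRing.scale /= mulr0 addr0 mulr1.
apply: is_derive_eq (@is_derive1_comp _ sin (fun y => x * y) k _ _ (is_derive_sin _) d) _.
by rewrite mulrC.
Qed.

Lemma cosM_cont x k : {for k, continuous (fun y => cos (x * y))}.
Proof. exact: is_derive_cont (is_derive_cosM x k). Qed.

Lemma sinM_cont x k : {for k, continuous (fun y => sin (x * y))}.
Proof. exact: is_derive_cont (is_derive_sinM x k). Qed.

Lemma norm_cos_le1 x : `|cos x| <= 1.
Proof. by rewrite ler_norml cos_geN1 cos_le1. Qed.

Lemma norm_sin_le1 x : `|sin x| <= 1.
Proof. by rewrite ler_norml sin_geN1 sin_le1. Qed.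

Lemma integrable_dominated (f : R -> R) (C : R) : (forall x : R, {for x, continuous f}) ->
  (forall x, `|f x| <= C * expR (- 1 * `|x|)) -> mu.-integrable setT (EFin \o f).
Proof.
move=> cf hf; have i1 := integrableZl (mu := mu) measurableT C (@integrable_exp_abs R 1 ltr01).
apply: le_integrable i1 => //.
  by apply/measurable_EFinP; exact: continuous_measurable_fun.
by move=> x _ /=; rewrite lee_fin; apply: le_trans (hf x) (ler_norm _).
Qed.

Lemma gaussian_le1 a k : 0 < a -> gaussian a k <= expR a^-1 * expR (- 1 * `|k|).
Proof.
move=> a0; apply: le_trans (gaussian_le k a0) _; rewrite ler_wpM2l ?expR_ge0 // ler_expR.
by have := normr_ge0 k; lra.
Qed.

Lemma gaussian_leX a k : 0 < a -> `|k| * gaussian a k <= expR a^-1 * expR (- 1 * `|k|).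
Proof.
move=> a0; apply: (@le_trans _ _ (expR `|k| * (expR a^-1 * expR (- 2 * `|k|)))).
  apply: ler_pM => //; [exact: expR_ge0| |exact: gaussian_le].
  by have := expR_ge1Dx `|k|; lra.
by rewrite [leLHS]mulrCA -(expRD `|k|) ler_wpM2l ?expR_ge0 // ler_expR; lra.
Qed.

Lemma integrable_gaussianM a (f : R -> R) : 0 < a -> (forall x : R, {for x, continuous f}) ->
  (forall x, `|f x| <= 1) -> mu.-integrable setT (EFin \o (fun k => gaussian a k * f k)).
Proof.
move=> a0 cf f1; apply: (@integrable_dominated _ (expR a^-1)).
  by move=> x; apply: continuous_mul => //; exact: gaussian_cont.
move=> x; rewrite normrM gtr0_norm ?gaussian_gt0 //.
by apply: le_trans (gaussian_le1 x a0); rewrite ler_piMr // ltW // gaussian_gt0.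
Qed.

Lemma integrable_id_gaussianM a (f : R -> R) : 0 < a -> (forall x : R, {for x, continuous f}) ->
  (forall x, `|f x| <= 1) -> mu.-integrable setT (EFin \o (fun k => k * gaussian a k * f k)).
Proof.
move=> a0 cf f1; apply: (@integrable_dominated _ (expR a^-1)).
  move=> x; apply: continuous_mul => //; apply: continuous_mul; [exact: cvg_id|exact: gaussian_cont].
move=> x; rewrite !normrM (gtr0_norm (gaussian_gt0 _ _)).
by apply: le_trans (gaussian_leX x a0); rewrite ler_piMr // mulr_ge0 // ltW // gaussian_gt0.
Qed.

Lemma cvg_exp_abs (C : R) : C * expR (- 1 * `|x|) @[x --> +oo] --> (0 : R).
Proof.
rewrite -[X in _ --> X](mulr0 C); apply: cvgMr.
apply: cvg_trans (@cvg_expM R 1 ltr01); apply: near_eq_cvg; near=> x.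
by rewrite gtr0_norm //; near: x; apply: nbhs_pinfty_gt; exact: num_real.
Unshelve. all: by end_near. Qed.

Definition gaussian_cos a x : R := \int[mu]_k (gaussian a k * cos (x * k)).

(* Integrating [d/dk (e^{-a k^2} sin (x k))]. *)
Lemma gaussian_cos_parts a x : 0 < a ->
  \int[mu]_k (k * gaussian a k * sin (x * k)) = x / (2 * a) * gaussian_cos a x.
Proof.
move=> a0.
have i1 := integrable_id_gaussianM a0 (@sinM_cont x) (fun k => norm_sin_le1 (x * k)).
have i2 := integrable_gaussianM a0 (@cosM_cont x) (fun k => norm_cos_le1 (x * k)).
have i1' := integrableZl (mu := mu) measurableT (- 2 * a) i1.
have i2' := integrableZl (mu := mu) measurableT x i2.
pose g k := - 2 * a * (k * gaussian a k * sin (x * k)) + x * (gaussian a k * cos (x * k)).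
have ig : mu.-integrable setT (EFin \o g) by have := integrableD measurableT i1' i2'.
have dG (k : R) : is_derive k (1 : R) (fun k => gaussian a k * sin (x * k)) (g k).
  apply: is_derive_eq (is_deriveM (is_derive_gaussian a k) (is_derive_sinM x k)) _.
  by rewrite /GRing.scale /= /g; ring.
have bG k : `|gaussian a k * sin (x * k)| <= expR a^-1 * expR (- 1 * `|k|).
  rewrite normrM gtr0_norm ?gaussian_gt0 //; apply: le_trans (gaussian_le1 k a0).
  by rewrite ler_piMr ?norm_sin_le1 // ltW // gaussian_gt0.
have c0 (f : R -> R) : (forall k, `|f k| <= expR a^-1 * expR (- 1 * `|k|)) -> f k @[k --> +oo] --> (0 : R).
  move=> hf; apply/norm_cvg0P; apply: (@squeeze_cvgr _ _ _ _ (fun=> 0) (fun k => expR a^-1 * expR (- 1 * `|k|))).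
  - by near=> k; rewrite normr_ge0 hf.
  - exact: cvg_cst.
  - exact: cvg_exp_abs.
have : \int[mu]_k g k = 0.
  apply: (@Rintegral_derivative _ (fun k => gaussian a k * sin (x * k)) g) => //.
  - move=> k; apply: continuousD.
      apply: continuous_mul; first exact: cst_continuous.
      apply: continuous_mul; last exact: sinM_cont.
      by apply: continuous_mul; [exact: cvg_id|exact: gaussian_cont].
    apply: continuous_mul; first exact: cst_continuous.
    by apply: continuous_mul; [exact: gaussian_cont|exact: cosM_cont].
  - exact: c0.
  - by apply: c0 => k; have := bG (- k); rewrite normrN.
rewrite /g RintegralD //.
rewrite RintegralZl // RintegralZl // -/(gaussian_cos a x) => h.
have a20 : 2 * a != 0 by rewrite mulf_neq0 // gt_eqF.
apply: (mulfI a20).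
have -> : 2 * a * (x / (2 * a) * gaussian_cos a x) = x * gaussian_cos a x.
  have a1 : a != 0 by rewrite gt_eqF.
  by field.
lra.
Unshelve. all: by end_near. Qed.

(** Differentiation under the integral followed by [gaussian_cos_parts] gives a linear first-order
    equation in [x]; solving it is the next lemma. *)
Lemma is_derive_gaussian_cos a x : 0 < a ->
  is_derive x (1 : R) (gaussian_cos a) (- (x / (2 * a) * gaussian_cos a x)).
Proof.
move=> a0.
pose f (z k : R) := gaussian a k * cos (z * k).
have df (z k : R) : is_derive z (1 : R) (f ^~ k) (- (k * gaussian a k * sin (z * k))).
  have E : (fun z => cos (z * k)) = (fun z => cos (k * z)) by apply/funext => y; rewrite mulrC.
  have d := is_derive_cosM k z; rewrite -E in d.
  apply: is_derive_eq (is_deriveM (is_derive_cst (gaussian a k) z 1) d) _.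
  by rewrite /GRing.scale /= mulr0 addr0 [k * z]mulrC; ring.
have dE z k : partial1of2 f z k = - (k * gaussian a k * sin (z * k)).
  by rewrite partial1of2E; have h := df z k; rewrite derive_val.
have Ix : `]x - 1, x + 1[%classic x by rewrite /= in_itv /=; apply/andP; split; lra.
have intf z : `]x - 1, x + 1[%classic z -> mu.-integrable setT (EFin \o f z).
  by move=> _; apply: integrable_gaussianM => // k; [exact: cosM_cont|exact: norm_cos_le1].
have dd z k : `]x - 1, x + 1[%classic z -> [set: R] k -> derivable (f ^~ k) z 1.
  by move=> _ _; have [] := df z k.
have G0 k : 0 <= expR a^-1 * expR (- 1 * `|k|) by rewrite mulr_ge0 ?expR_ge0.
have iG := integrableZl (mu := mu) measurableT (expR a^-1) (@integrable_exp_abs R 1 ltr01).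
have Gub z k : `]x - 1, x + 1[%classic z -> [set: R] k ->
    `|partial1of2 f z k| <= expR a^-1 * expR (- 1 * `|k|).
  move=> _ _; rewrite dE normrN !normrM (gtr0_norm (gaussian_gt0 _ _)).
  apply: le_trans (gaussian_leX k a0); rewrite ler_piMr ?norm_sin_le1 //.
  by rewrite mulr_ge0 // ltW // gaussian_gt0.
have d1 := derivable_under_integral measurableT Ix intf dd G0 iG Gub.
have d2 := differentiation_under_integral measurableT Ix intf dd G0 iG Gub.
have E : \int[mu]_k partial1of2 f x k = - (x / (2 * a) * gaussian_cos a x).
  rewrite -gaussian_cos_parts // -mulN1r -RintegralZl //; last first.
    apply: integrable_id_gaussianM => // k; [exact: sinM_cont|exact: norm_sin_le1].
  by apply: eq_Rintegral => k _; rewrite dE mulN1r.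
by split; [exact: d1|rewrite -derive1E d2 E].
Qed.

Lemma gaussian_cosE a x : 0 < a -> gaussian_cos a x = gaussian_cos a 0 * gaussian (4 * a)^-1 x.
Proof.
move=> a0.
have d (z : R) : is_derive z (1 : R) (fun z => gaussian_cos a z * gaussian (- (4 * a)^-1) z) 0.
  apply: is_derive_eq (is_deriveM (is_derive_gaussian_cos z a0) (is_derive_gaussian (- (4 * a)^-1) z)) _.
  rewrite /GRing.scale /=; have h : a != 0 by rewrite gt_eqF.
  by field.
have := @is_derive0_cst_itv _ _ (- `|x| - 1) (`|x| + 1) (fun z _ => d z) x 0.
have x1 := ler_norm x; have x2 := ler_norm (- x); rewrite normrN in x2.
move=> /(_ ltac:(apply/andP; split; lra) ltac:(apply/andP; split; have := normr_ge0 x; lra)).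
have -> : gaussian (- (4 * a)^-1) 0 = 1 by rewrite /gaussian expr0n /= mulr0 expR0.
rewrite mulr1 => <-.
by rewrite -mulrA /gaussian -expRD opprK mulNr addrN expR0 mulr1.
Qed.

End Gaussian.

(** * Modulated Gaussians as Schwartz functions *)

Section GaussianSchwartz.
Context {R : realType}.
Notation mu := (@lebesgue_measure R).
Implicit Types (a x k : R).

(** Differentiation of $e^{-ak^2}(P\cos xk+Q\sin xk)$ expressed on the pair $(P,Q)$: the class is
    stable, so all derivatives keep the Gaussian factor. *)
Let D a x (PQ : {poly R} * {poly R}) : {poly R} * {poly R} :=
  (PQ.1^`() - (2 * a) *: ('X * PQ.1) + x *: PQ.2, PQ.2^`() - (2 * a) *: ('X * PQ.2) - x *: PQ.1).

Let E a x (PQ : {poly R} * {poly R}) k : R :=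
  gaussian a k * (PQ.1.[k] * cos (x * k) + PQ.2.[k] * sin (x * k)).

Let is_derive_E a x PQ k : is_derive k (1 : R) (E a x PQ) (E a x (D a x PQ) k).
Proof.
have dP (P : {poly R}) : is_derive k (1 : R) (fun y => P.[y]) P^`().[k].
  by have := is_derive_poly P k.
have d1 : is_derive k (1 : R) (fun y : R => PQ.1.[y] * cos (x * y))
    (PQ.1.[k] * (- x * sin (x * k)) + PQ.1^`().[k] * cos (x * k)).
  by apply: is_derive_eq (is_deriveM (dP PQ.1) (is_derive_cosM x k)) _; rewrite /GRing.scale /=; ring.
have d2 : is_derive k (1 : R) (fun y : R => PQ.2.[y] * sin (x * y))
    (PQ.2.[k] * (x * cos (x * k)) + PQ.2^`().[k] * sin (x * k)).
  by apply: is_derive_eq (is_deriveM (dP PQ.2) (is_derive_sinM x k)) _; rewrite /GRing.scale /=; ring.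
have d3 : is_derive k (1 : R) (fun y : R => PQ.1.[y] * cos (x * y) + PQ.2.[y] * sin (x * y)) _ := is_deriveD d1 d2.
apply: is_derive_eq (is_deriveM (is_derive_gaussian a k) d3) _.
by rewrite /E /D /GRing.scale /= !(hornerD, hornerN, hornerZ, hornerM, hornerX); ring.
Qed.

Let E_bound a x PQ m : 0 < a -> exists M : R, forall k, `|k| ^+ m * `|E a x PQ k| <= M.
Proof.
move=> a0.
have pb (P : {poly R}) : exists M : R, forall k, `|k| ^+ m * `|P.[k]| * expR (- `|k|) <= M.
  have [C C0 hC] := horner_exp_bound ('X^m * P).
  have [C' C'0 hC'] := horner_exp_bound ('X^m * (P \Po (- 'X))).
  exists (C + C') => k; have [k0|k0] := leP 0 k.
    have := hC k k0; rewrite hornerM hornerXn normrM normrX ger0_norm // => h; lra.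
  have nk : 0 <= - k by lra.
  have := hC' (- k) nk; rewrite hornerM hornerXn horner_comp hornerN hornerX opprK.
  rewrite normrM normrX normrN (ltr0_norm k0) opprK => h; lra.
have [M1 h1] := pb PQ.1; have [M2 h2] := pb PQ.2.
exists (expR a^-1 * (M1 + M2)) => k; rewrite /E normrM gtr0_norm ?gaussian_gt0 //.
have hg := gaussian_le1 k a0; rewrite mulN1r in hg.
have hs : `|PQ.1.[k] * cos (x * k) + PQ.2.[k] * sin (x * k)| <= `|PQ.1.[k]| + `|PQ.2.[k]|.
  apply: le_trans (ler_normD _ _) _; rewrite !normrM; apply: lerD; rewrite ler_piMr //.
    exact: norm_cos_le1.
  exact: norm_sin_le1.
apply: (@le_trans _ _ (`|k| ^+ m * ((expR a^-1 * expR (- `|k|)) * (`|PQ.1.[k]| + `|PQ.2.[k]|)))).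
  by rewrite ler_wpM2l ?exprn_ge0 // ler_pM // ltW // gaussian_gt0.
have -> : `|k| ^+ m * (expR a^-1 * expR (- `|k|) * (`|PQ.1.[k]| + `|PQ.2.[k]|)) =
  expR a^-1 * (`|k| ^+ m * `|PQ.1.[k]| * expR (- `|k|) + `|k| ^+ m * `|PQ.2.[k]| * expR (- `|k|)) by ring.
by rewrite ler_wpM2l ?expR_ge0 // lerD.
Qed.

Let schwartz_E a x PQ : 0 < a -> schwartz (E a x PQ).
Proof.
move=> a0; pose d n := E a x (iter n (D a x) PQ).
have [h1 h2] := @smooth_seq _ d (fun n k => is_derive_E a x (iter n (D a x) PQ) k).
split; first exact: h2.
move=> m n; have [M hM] := E_bound x (iter n (D a x) PQ) m a0; exists M => k.
by have := h1 n; rewrite /d /= => ->.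
Qed.

Lemma schwartz_gaussian_cos a x : 0 < a -> schwartz (fun k => gaussian a k * cos (x * k)).
Proof.
move=> a0; have := @schwartz_E a x (1, 0) a0.
by have -> : E a x (1, 0) = (fun k => gaussian a k * cos (x * k)) by
  apply/funext => k; rewrite /E /= hornerC horner0 mul1r mul0r addr0.
Qed.

Lemma schwartz_gaussian_sin a x : 0 < a -> schwartz (fun k => gaussian a k * sin (x * k)).
Proof.
move=> a0; have := @schwartz_E a x (0, 1) a0.
by have -> : E a x (0, 1) = (fun k => gaussian a k * sin (x * k)) by
  apply/funext => k; rewrite /E /= horner0 hornerC mul1r mul0r add0r.
Qed.

Let sub_cos x y k : cos (x * k) * cos (y * k) = 2^-1 * (cos ((y - x) * k) + cos ((y + x) * k)).
Proof. by rewrite mulrBl mulrDl cosB cosD; field. Qed.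

Let sub_sin x y k : sin (x * k) * sin (y * k) = 2^-1 * (cos ((y - x) * k) - cos ((y + x) * k)).
Proof. by rewrite mulrBl mulrDl cosB cosD; field. Qed.

(** Product-to-sum formulas give two translated Gaussians for the real part; the imaginary part
    integrates an odd function. *)
Lemma fourier_gaussian_cos a x y : 0 < a ->
  fourier (fun k => gaussian a k * cos (x * k)) y =
  (2^-1 * (gaussian_cos a (y - x) + gaussian_cos a (y + x)))%:C.
Proof.
move=> a0; have iG z := integrable_gaussianM a0 (@cosM_cont _ z) (fun k => norm_cos_le1 (z * k)).
apply: complexP; rewrite /fourier /=.
- under eq_Rintegral do rewrite mul0r subr0 -mulrA sub_cos mulrCA.
  rewrite RintegralZl //; last first.
    have := integrableD measurableT (iG (y - x)) (iG (y + x)).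
    by apply: eq_integrable => // k _; rewrite /= -EFinD -mulrDr.
  under eq_Rintegral do rewrite mulrDr.
  by rewrite RintegralD.
- have cc (k : R) : {for k, continuous (fun k : R => - (cos (x * k) * sin (y * k)))}.
    by apply: continuousN; apply: continuous_mul; [exact: cosM_cont|exact: sinM_cont].
  have c1 k : `|- (cos (x * k) * sin (y * k))| <= 1.
    by rewrite normrN normrM mulr_ile1 ?norm_cos_le1 ?norm_sin_le1.
  under eq_Rintegral do rewrite mul0r addr0 -mulrA mulrN.
  apply: Rintegral_odd => [||k].
  + by apply: continuous_measurable_fun => k; apply: continuous_mul; [exact: gaussian_cont|exact: cc].
  + exact: integrable_gaussianM a0 cc c1.
  + by rewrite gaussianN !mulrN cosN sinN !mulrN.
Qed.

Lemma fourier_gaussian_sin a x y : 0 < a ->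
  fourier (fun k => gaussian a k * sin (x * k)) y =
  - 'i * (2^-1 * (gaussian_cos a (y - x) - gaussian_cos a (y + x)))%:C.
Proof.
move=> a0; have iG z := integrable_gaussianM a0 (@cosM_cont _ z) (fun k => norm_cos_le1 (z * k)).
apply: complexP; rewrite /fourier /= ?mulr0 ?mul0r ?mulr1 ?subr0 ?add0r ?oppr0 ?mul0r ?subr0.
- under eq_Rintegral do rewrite mul0r subr0 -mulrA.
  apply: Rintegral_odd => [||k].
  + apply: continuous_measurable_fun => k; apply: continuous_mul; first exact: gaussian_cont.
    by apply: continuous_mul; [exact: sinM_cont|exact: cosM_cont].
  + have cc (k : R) : {for k, continuous (fun k : R => (sin (x * k) * cos (y * k)))}.
      by apply: continuous_mul; [exact: sinM_cont|exact: cosM_cont].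
    have c1 k : `|(sin (x * k) * cos (y * k))| <= 1.
      by rewrite normrM mulr_ile1 ?norm_cos_le1 ?norm_sin_le1.
    exact: integrable_gaussianM a0 cc c1.
  + by rewrite gaussianN !mulrN cosN sinN !mulNr mulrN.
- under eq_Rintegral do rewrite mul0r addr0 mulrN -mulrA sub_sin mulrCA -mulrN.
  rewrite RintegralZl //; last first.
    have := integrableB measurableT (iG (y + x)) (iG (y - x)).
    by apply: eq_integrable => // k _; rewrite /= -EFinB -mulrBr -mulrN opprB.
  under eq_Rintegral do rewrite -mulrN opprB mulrBr.
  by rewrite RintegralB // mulN1r -mulrN opprB.
Qed.

End GaussianSchwartz.

(** * Integrability of power weights *)

Section PowerTails.
Context {R : realType}.
Notation mu := (@lebesgue_measure R).
Implicit Types (p q x : R).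

Lemma cvg_pow_pinfty p : p < 0 -> expR (p * ln (1 + x)) @[x --> +oo] --> (0 : R).
Proof.
move=> p0; apply/cvgrPdist_lt => e e0; near=> x.
rewrite sub0r normrN gtr0_norm ?expR_gt0 //.
have x0 : 0 < 1 + x.
  by rewrite addr_gt0 //; near: x; apply: nbhs_pinfty_gt; exact: num_real.
have : expR (ln e / p) < 1 + x.
  have : expR (ln e / p) < x by near: x; apply: nbhs_pinfty_gt; exact: num_real.
  lra.
rewrite -ltr_ln ?posrE ?expR_gt0 // expRK => h.
have -> : e = expR (ln e) by rewrite lnK ?posrE.
by rewrite ltr_expR mulrC -ltr_ndivrMr.
Unshelve. all: by end_near. Qed.

Lemma is_derive_pow p x : 0 < 1 + x ->
  is_derive x (1 : R) (fun y => expR (p * ln (1 + y))) (p * expR ((p - 1) * ln (1 + x))).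
Proof.
move=> x0.
have d1 : is_derive x (1 : R) (fun y : R => 1 + y) 1.
  apply: is_derive_eq (is_deriveD (is_derive_cst (1 : R) x (1 : R)) (is_derive_id x (1 : R))) _.
  by rewrite add0r.
have d2 := @is_derive1_comp _ (@ln R) (fun y => 1 + y) x _ _ (is_derive1_ln x0) d1.
have d3 : is_derive x (1 : R) (fun y => p * ln (1 + y)) (p / (1 + x)).
  by apply: is_derive_eq (is_deriveM (is_derive_cst p x 1) d2) _; rewrite /GRing.scale /= mulr0 addr0 mulr1.
apply: is_derive_eq (@is_derive1_comp _ expR (fun y => p * ln (1 + y)) x _ _ (is_derive_expR _) d3) _.
rewrite mulrBl mul1r expRD expRN lnK ?posrE //; ring.
Qed.

Lemma integrable_pow_abs q : 1 < q ->
  mu.-integrable setT (EFin \o (fun x => expR (- q * ln (1 + `|x|)))).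
Proof.
move=> q1; have q0 : q - 1 != 0 by rewrite subr_eq0 gt_eqF.
have d (x : R) : 0 <= x -> is_derive x (1 : R) (fun y => expR ((1 - q) * ln (1 + y)) / (1 - q))
    (expR (- q * ln (1 + x))).
  move=> x0; have x1 : 0 < 1 + x by lra.
  apply: is_derive_eq (is_deriveM (is_derive_pow (1 - q) x1) (is_derive_cst (1 - q)^-1 x 1)) _.
  have -> : 1 - q - 1 = - q by ring.
  by rewrite /GRing.scale /= mulr0 add0r mulrA mulVf ?mul1r // -opprB oppr_eq0.
have cf (x : R) : 0 <= x -> {for x, continuous (fun y : R => expR (- q * ln (1 + y)))}.
  by move=> x0; apply: is_derive_cont (is_derive_pow (- q) _); lra.
have E : (\int[mu]_(x in `[0%R, +oo[) (expR (- q * ln (1 + x)))%:E = (0 - expR ((1 - q) * ln (1 + 0)) / (1 - q))%:E)%E.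
  rewrite EFinB; apply: (@ge0_continuous_FTC2y _ _ (fun y => expR ((1 - q) * ln (1 + y)) / (1 - q)) _ 0).
  - by move=> x _; exact: expR_ge0.
  - by apply: continuous_in_subspaceT => x; rewrite inE /= in_itv /= andbT; exact: cf.
  - rewrite -(mul0r (1 - q)^-1); apply: cvgMl; apply: cvg_pow_pinfty; lra.
  - by move=> x x0; have [] := d x (ltW x0).
  - by apply: cvg_at_right_filter; exact: is_derive_cont (d 0 (lexx _)).
  - move=> x; rewrite in_itv /= andbT => x0; rewrite derive1E.
    by have h := d x (ltW x0); rewrite derive_val.
have mf : measurable_fun setT (fun x : R => expR (- q * ln (1 + `|x|))).
  apply: (@measurableT_comp _ _ _ _ _ _ expR); first exact: measurable_expR.
  apply: measurable_funM => //; apply: (@measurableT_comp _ _ _ _ _ _ (@ln R)); first exact: measurable_ln.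
  by apply: measurable_funD => //; exact: normr_measurable.
have i1 : mu.-integrable `[0, +oo[ (EFin \o (fun x => expR (- q * ln (1 + `|x|)))).
  apply/integrableP; split; first by apply/measurable_EFinP; exact: measurable_funTS.
  rewrite [X in (X < _)%E](_ : _ = (0 - expR ((1 - q) * ln (1 + 0)) / (1 - q))%:E)%E ?ltry // -E.
  by apply: eq_integral => x; rewrite inE /= in_itv /= andbT => x0; rewrite !ger0_norm ?expR_ge0.
have i2 := integrable_opp (measurable_itv _) mf i1.
have SE : [set x : R | `[0, +oo[%classic (- x)] = `]-oo, 0]%classic.
  by apply/seteqP; split => x /=; rewrite !in_itv /= ?andbT oppr_ge0.
rewrite SE in i2.
have -> : [set: R] = `[0, +oo[ `|` `]-oo, 0].
  apply/seteqP; split => // x _ /=; rewrite !in_itv /= !andbT.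
  by case: (leP 0 x) => [|/ltW]; [left|right].
apply: integrable_setU => //.
by apply: eq_integrable i2 => // x _ /=; rewrite normrN.
Qed.

(** The inequality $(1+|k|)^2\le2(1+k^2)$ reduces this to the exponent $2e>1$ of the preceding
    lemma. *)
Lemma integrable_japanese (e : R) : 1 / 2 < e ->
  mu.-integrable setT (EFin \o (fun k => (1 + k ^+ 2) `^ (- e))).
Proof.
move=> e0; have q1 : 1 < 2 * e by lra.
have i := integrableZl (mu := mu) measurableT (expR (e * ln 2)) (integrable_pow_abs q1).
have p1 (k : R) : 0 < 1 + k ^+ 2 by have := sqr_ge0 k; lra.
apply: le_integrable i => //.
  apply/measurable_EFinP; apply: (@measurableT_comp _ _ _ _ _ _ (fun y => y `^ (- e))).
    exact: measurable_powR.
  by apply: measurable_funD => //; exact: measurable_funX.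
move=> k _ /=; rewrite lee_fin ger0_norm ?powR_ge0 //; apply: le_trans (ler_norm _).
rewrite /powR gt_eqF // -expRD ler_expR.
have k1 : 0 < 1 + `|k| by have := normr_ge0 k; lra.
have h : ln ((1 + `|k|) ^+ 2) <= ln (2 * (1 + k ^+ 2)).
  rewrite ler_ln ?posrE ?exprn_gt0 ?mulr_gt0 // -[k ^+ 2]real_normK ?num_real //.
  have := sqr_ge0 (`|k| - 1); nra.
have -> : e * ln 2 + - (2 * e) * ln (1 + `|k|) = - e * (2 * ln (1 + `|k|) - ln 2) by ring.
have h2 : 2 * ln (1 + `|k|) - ln 2 <= ln (1 + k ^+ 2).
  by move: h; rewrite lnXn // lnM ?posrE // -mulr_natl; lra.
have e1 : 0 <= e by lra.
by have := ler_wpM2l e1 h2; lra.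
Qed.

End PowerTails.

(** * A Gaussian approximate identity *)

Section GaussianMass.
Context {R : realType}.
Notation mu := (@lebesgue_measure R).
Implicit Types (a x : R).

(** A multiple of the normal density of mean [m] and variance $1/(2a)$. *)
Lemma gaussian_mass a (m : R) : 0 < a ->
  mu.-integrable setT (EFin \o (fun x => gaussian a (x - m))) /\
  \int[mu]_x gaussian a (x - m) = Num.sqrt (pi / a).
Proof.
move=> a0; pose s := Num.sqrt ((2 * a)^-1).
have a2 : 0 < (2 * a)^-1 by rewrite invr_gt0 mulr_gt0.
have s0 : s != 0 by rewrite gt_eqF // sqrtr_gt0.
have ss : s ^+ 2 = (2 * a)^-1 by rewrite sqr_sqrtr // ltW.
have an : a != 0 by rewrite gt_eqF.
have nE x : normal_pdf m s x = (Num.sqrt (pi / a))^-1 * gaussian a (x - m).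
  rewrite normal_pdfE //; congr (_^-1 * expR _).
    by rewrite ss mulr2n; congr Num.sqrt; field.
  by rewrite ss mulr2n; field.
have P0 : 0 < Num.sqrt (pi / a) :> R by rewrite sqrtr_gt0 divr_gt0 // pi_gt0.
have in1 := @integrable_normal_pdf R m s; have mass := @integral_normal_pdf R m s.
have ig : mu.-integrable setT (EFin \o (fun x => gaussian a (x - m))).
  have := integrableZl (mu := mu) measurableT (Num.sqrt (pi / a)) in1.
  apply: eq_integrable => // x _; rewrite /= nE -EFinM mulrA mulfV ?mul1r // gt_eqF //.
split => //.
have : \int[mu]_x normal_pdf m s x = 1 by rewrite /Rintegral mass.
under eq_Rintegral do rewrite nE.
rewrite RintegralZl // => /(congr1 (fun z => Num.sqrt (pi / a) * z)).
by rewrite mulr1 mulrA mulfV ?mul1r // gt_eqF.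
Qed.

Lemma gaussian_cos0 a : 0 < a -> gaussian_cos a 0 = Num.sqrt (pi / a).
Proof.
move=> a0; have [_] := gaussian_mass 0 a0; rewrite /gaussian_cos => <-.
by apply: eq_Rintegral => k _; rewrite mul0r cos0 mulr1 subr0.
Qed.

Lemma gaussian_cos_ge0 a x : 0 < a -> 0 <= gaussian_cos a x.
Proof. by move=> a0; rewrite gaussian_cosE // gaussian_cos0 // mulr_ge0 // ltW // gaussian_gt0. Qed.

Lemma integrable_gaussian_cos a (m : R) : 0 < a ->
  mu.-integrable setT (EFin \o (fun x => gaussian_cos a (x - m))).
Proof.
move=> a0; have b0 : 0 < (4 * a)^-1 by rewrite invr_gt0 mulr_gt0.
have [i _] := gaussian_mass m b0.
have := integrableZl (mu := mu) measurableT (gaussian_cos a 0) i.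
by apply: eq_integrable => // x _; rewrite /= [in RHS]gaussian_cosE.
Qed.

(** The mass does not depend on [a], and the width shrinks with [a] since the exponent is
    $-x^2/(4a)$: as [a] tends to 0 this is $2\pi$ times an approximate identity. *)
Lemma gaussian_cos_mass a (m : R) : 0 < a -> \int[mu]_x gaussian_cos a (x - m) = 2 * pi.
Proof.
move=> a0; have b0 : 0 < (4 * a)^-1 by rewrite invr_gt0 mulr_gt0.
have [i E] := gaussian_mass m b0.
under eq_Rintegral do rewrite gaussian_cosE //.
rewrite RintegralZl // E gaussian_cos0 // -sqrtrM ?divr_ge0 ?pi_ge0 ?(ltW a0) //.
have -> : pi / a * (pi / (4 * a)^-1) = (2 * pi) ^+ 2 :> R.
  have an : a != 0 by rewrite gt_eqF.
  by field.
by rewrite sqrtr_sqr ger0_norm // mulr_ge0 // pi_ge0.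
Qed.

(** Half of the exponent absorbs the quadratic factor, $z^2e^{-z^2/(4a)}\le8a\,e^{-z^2/(8a)}$, by
    $w\le e^w$ with $w=z^2/(8a)$. *)
Lemma gaussian_cos_moment a (m : R) : 0 < a ->
  mu.-integrable setT (EFin \o (fun x => (x - m) ^+ 2 * gaussian_cos a (x - m))) /\
  \int[mu]_x ((x - m) ^+ 2 * gaussian_cos a (x - m)) <= 32 * pi * a.
Proof.
move=> a0; have b0 : 0 < (8 * a)^-1 by rewrite invr_gt0 mulr_gt0.
have an : a != 0 by rewrite gt_eqF.
have [i E] := gaussian_mass m b0.
have pw x : 0 <= (x - m) ^+ 2 * gaussian_cos a (x - m) <= (8 * a * gaussian_cos a 0) * gaussian (8 * a)^-1 (x - m).
  rewrite mulr_ge0 ?sqr_ge0 ?gaussian_cos_ge0 //= gaussian_cosE // mulrCA -mulrA [leRHS]mulrCA.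
  rewrite ler_wpM2l ?gaussian_cos0 //.
  have -> : gaussian (4 * a)^-1 (x - m) = gaussian (8 * a)^-1 (x - m) * gaussian (8 * a)^-1 (x - m).
    by rewrite /gaussian -expRD; congr expR; field.
  rewrite mulrA ler_pM2r ?gaussian_gt0 // /gaussian mulNr expRN ler_pdivrMr ?expR_gt0 //.
  have a8 : 0 < 8 * a by rewrite mulr_gt0.
  have := expR_ge1Dx ((8 * a)^-1 * (x - m) ^+ 2); set z := _^-1 * _ => h.
  have -> : (x - m) ^+ 2 = 8 * a * z by rewrite /z; field.
  by rewrite ler_pM2l //; lra.
have i2 := integrableZl (mu := mu) measurableT (8 * a * gaussian_cos a 0) i.
have i3 : mu.-integrable setT (EFin \o (fun x => (x - m) ^+ 2 * gaussian_cos a (x - m))).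
  apply: le_integrable i2 => //.
    apply/measurable_EFinP; apply: measurable_funM.
      by apply: measurable_funX; exact: measurable_funB.
    by have /integrableP[/measurable_EFinP] := integrable_gaussian_cos m a0.
  move=> x _ /=; rewrite lee_fin; have /andP[h1 h2] := pw x.
  by rewrite ger0_norm //; apply: le_trans h2 (ler_norm _).
split => //.
apply: (@le_trans _ _ (\int[mu]_x ((8 * a * gaussian_cos a 0) * gaussian (8 * a)^-1 (x - m)))).
  by apply: le_Rintegral => // x _; have /andP[] := pw x.
rewrite RintegralZl // E gaussian_cos0 // -mulrA -sqrtrM ?divr_ge0 ?pi_ge0 ?(ltW a0) //.
have -> : 32 * pi * a = 8 * a * (4 * pi) :> R by ring.
rewrite ler_pM2l ?mulr_gt0 //.
have p0 := @pi_ge0 R.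
rewrite -[leRHS]ger0_norm ?mulr_ge0 // -sqrtr_sqr ler_sqrt ?sqr_ge0 //.
have -> : pi / a * (pi / (8 * a)^-1) = 8 * pi ^+ 2 :> R by field.
by have := sqr_ge0 (pi : R); nra.
Qed.

(** Continuity near [x0] and boundedness elsewhere combine into $|p(x)-p(x_0)|\le e_1+K(x-x_0)^2$
    with $K=2B/r^2$, so the mass and the second moment suffice. *)
Lemma gaussian_approx (p : R -> R[i]) (B x0 e : R) : cmeas setT p -> (forall x, cmod (p x) <= B) ->
  ccont p x0 -> 0 < e -> exists2 d : R, 0 < d & forall a, 0 < a < d ->
  cmod (cintegral setT (fun x => p x * (gaussian_cos a (x - x0))%:C) - (2 * pi)%:C * p x0) <= e.
Proof.
move=> mp pB cp e0.
have B0 : 0 <= B by apply: le_trans (pB 0); exact: cmod_ge0.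
have pi0 := @pi_gt0 R.
pose e1 := e / (8 * pi); have e10 : 0 < e1 by rewrite divr_gt0 // mulr_gt0.
have [r r0 hr] : exists2 r, 0 < r & forall x, `|x - x0| < r -> cmod (p x - p x0) <= e1.
  have /ccvg_cmodP h := cp.
  have /nbhs_ballP[r /= r0 hr] : \forall x \near x0, cmod (p x - p x0) < e1 by exact: (cvgr_lt _ h _ e10).
  by exists r => // x xr; apply: ltW; apply: hr; rewrite /ball /= distrC.
have r20 : 0 < r ^+ 2 by rewrite exprn_gt0.
pose K := 2 * B / r ^+ 2; have K0 : 0 <= K by rewrite divr_ge0 ?mulr_ge0 // ltW.
have pw x : cmod (p x - p x0) <= e1 + K * (x - x0) ^+ 2.
  have [h|h] := ltP `|x - x0| r.
    by apply: le_trans (hr x h) _; rewrite lerDl mulr_ge0 // sqr_ge0.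
  apply: (@le_trans _ _ (2 * B)).
    by apply: le_trans (cmodB _ _) _; have := pB x; have := pB x0; lra.
  apply: (@le_trans _ _ (K * (x - x0) ^+ 2)); last by rewrite lerDr ltW.
  rewrite /K mulrAC ler_pdivlMr // ler_wpM2l ?mulr_ge0 //.
  by rewrite -[(x - x0) ^+ 2]real_normK ?num_real // ler_pXn2r ?nnegrE // ltW.
(* With this bound on [a], the moment term $K\cdot32\pi a$ is at most [e / 4], as is $e_1\cdot2\pi$;
   the factor 2 of [cmod_cintegral_le] makes the total [e]. *)
exists (e / (128 * pi * (K + 1))); first by rewrite divr_gt0 // !mulr_gt0 // ltr_wpDl.
move=> a /andP[a0 ad].
have iN := integrable_gaussian_cos x0 a0; have [iM M] := gaussian_cos_moment x0 a0.
have mN : measurable_fun setT (fun x => gaussian_cos a (x - x0)).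
  by have /integrableP[/measurable_EFinP] := iN.
have ip : cintegrable setT (fun x => p x * (gaussian_cos a (x - x0))%:C).
  have iB := integrableZl (mu := mu) measurableT B iN.
  apply: cintegrable_dom iB _ => //; first by apply: cmeasM => //; exact: cmeas_real.
  by move=> x _; rewrite cmodM cmod_real ger0_norm ?gaussian_cos_ge0 // ler_wpM2r ?gaussian_cos_ge0.
have ic : cintegrable setT (fun x => p x0 * (gaussian_cos a (x - x0))%:C).
  by apply: cintegrableZ => //; exact: cintegrable_real.
have -> : (2 * pi)%:C * p x0 = cintegral setT (fun x => p x0 * (gaussian_cos a (x - x0))%:C).
  rewrite cintegralZ //; last exact: cintegrable_real.
  rewrite mulrC; congr (_ * _); apply: complexP => /=; first by rewrite gaussian_cos_mass.
  by rewrite /Rintegral integral0.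
rewrite -cintegralB //.
have iG := integrableD measurableT (integrableZl (mu := mu) measurableT e1 iN) (integrableZl (mu := mu) measurableT K iM).
apply: (@le_trans _ _ (2 * \int[mu]_x (e1 * gaussian_cos a (x - x0) + K * ((x - x0) ^+ 2 * gaussian_cos a (x - x0))))).
  apply: cmod_cintegral_le => //.
  - by have /cintegrable_cmeas := cintegrableB measurableT ip ic.
  - move=> x _; rewrite -mulrBl cmodM cmod_real ger0_norm ?gaussian_cos_ge0 //.
    by rewrite mulrA -mulrDl ler_wpM2r ?gaussian_cos_ge0.
rewrite RintegralD //; last 2 first.
- exact: (integrableZl (mu := mu) measurableT e1 iN).
- exact: (integrableZl (mu := mu) measurableT K iM).
rewrite RintegralZl // RintegralZl // gaussian_cos_mass //.
have h1 : e1 * (2 * pi) = e / 4.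
  have pn : 2 * pi != 0 :> R by rewrite gt_eqF // mulr_gt0.
  have -> : e1 = e / 4 / (2 * pi) by rewrite /e1 -mulrA -invfM; congr (_ / _); ring.
  by rewrite divfK.
have h2 : K * (32 * pi * a) <= e / 4.
  apply: (@le_trans _ _ ((K + 1) * (32 * pi * a))).
    by rewrite ler_wpM2r ?mulr_ge0 ?(ltW pi0) ?(ltW a0) // lerDl.
  have K1 : 0 < K + 1 by lra.
  have D0 : 0 < 128 * pi * (K + 1) by rewrite !mulr_gt0.
  move: ad; rewrite (ltr_pdivlMr _ _ D0) => ad.
  have -> : (K + 1) * (32 * pi * a) = a * (128 * pi * (K + 1)) / 4 by field.
  by rewrite ler_pM2r ?invr_gt0 // ltW.
have h3 := ler_wpM2l K0 M; lra.
Qed.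

End GaussianMass.

(** * Sobolev regularity implies Hölder continuity *)

Section Hoelder.
Context {R : realType}.
Notation mu := (@lebesgue_measure R).
Implicit Types (x y k : R).

Lemma cmod_i : cmod ('i : R[i]) = 1.
Proof.
have : cmod ('i : R[i]) ^+ 2 = 1 by rewrite expr2 -cmodM -expr2 sqr_i cmodN cmod_real normr1.
move/eqP; rewrite -subr_eq0 subr_sqr_1 mulf_eq0 subr_eq0 => /orP[/eqP //|/eqP h].
by have := cmod_ge0 ('i : R[i]); lra.
Qed.

Lemma eq_cintegral_ae (f g : R -> R[i]) : cmeas setT f -> cmeas setT g ->
  {ae mu, forall x, f x = g x} -> cintegral setT f = cintegral setT g.
Proof.
move=> [f1 f2] [g1 g2] [N [mN N0 hN]]; apply: complexP => /=; congr fine.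
- apply: ae_eq_integral => //; [exact/measurable_EFinP|exact/measurable_EFinP|].
  by exists N; split => // x hx; apply: hN => fg; apply: hx => _ /=; rewrite fg.
- apply: ae_eq_integral => //; [exact/measurable_EFinP|exact/measurable_EFinP|].
  by exists N; split => // x hx; apply: hN => fg; apply: hx => _ /=; rewrite fg.
Qed.

Lemma cintegrable_ae (f g : R -> R[i]) : cmeas setT f -> cmeas setT g ->
  {ae mu, forall x, f x = g x} -> cintegrable setT f -> cintegrable setT g.
Proof.
move=> [f1 f2] [g1 g2] [N [mN N0 hN]] [/integrableP[_ i1] /integrableP[_ i2]].
have T (u w : R -> R) : measurable_fun setT u -> measurable_fun setT w ->
    (forall x, f x = g x -> u x = w x) ->
    (\int[mu]_x `|(EFin \o u) x| < +oo)%E -> mu.-integrable setT (EFin \o w).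
  move=> mu_ mw uw iu; apply/integrableP; split; first exact/measurable_EFinP.
  rewrite (@ae_eq_integral _ _ _ mu setT (fun x => `|(EFin \o u) x|%E)) //.
  - by apply: measurableT_comp => //; exact/measurable_EFinP.
  - by apply: measurableT_comp => //; exact/measurable_EFinP.
  - by exists N; split => // x hx; apply: hN => fg; apply: hx => _ /=; rewrite (uw x fg).
by split; [apply: T f1 g1 _ i1|apply: T f2 g2 _ i2] => x ->.
Qed.

(** Interpolation between the trivial bound 2 and the Lipschitz bound $d=|k||x-y|$: the smaller of
    them is at most $2d^\theta$. *)
Lemma exp_dist_le (th x y k : R) : 0 < th < 1 ->
  `|cos (x * k) - cos (y * k)| <= 2 * (`|k| `^ th * `|x - y| `^ th) /\
  `|sin (x * k) - sin (y * k)| <= 2 * (`|k| `^ th * `|x - y| `^ th).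
Proof.
move=> /andP[t0 t1]; rewrite -powRM //; set d := `|k| * `|x - y|.
have d0 : 0 <= d by rewrite mulr_ge0.
have key (m : R) : m <= 2 -> m <= d -> m <= 2 * d `^ th.
  move=> m2 md; have [d1|d1] := leP 1 d.
    apply: le_trans m2 _; rewrite -[leLHS]mulr1 ler_wpM2l //.
    have -> : 1 = 1 `^ th :> R by rewrite powR1.
    by apply: ge0_ler_powR; rewrite ?nnegrE // ltW.
  apply: le_trans md _; have [->|dn] := eqVneq d 0; first by rewrite mulr_ge0 // powR_ge0.
  have dp : 0 < d <= 1 by rewrite lt_neqAle eq_sym dn d0 /= ltW.
  have := ger1_powR dp (ltW t1); have := powR_ge0 d th; lra.
have lip (f f' : R -> R) : (forall z : R, is_derive z (1 : R) f (f' z)) -> (forall z, `|f' z| <= 1) ->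
    `|f (x * k) - f (y * k)| <= d.
  move=> df f1.
  have W u w : u < w -> `|f w - f u| <= w - u.
    move=> uw; have [z _ ->] := @is_derive_MVT _ f f' (u - 1) u w (fun z _ => df z) ltac:(lra) uw.
    by rewrite normrM (ger0_norm (_ : 0 <= w - u)) ?subr_ge0 ?(ltW uw) // ler_piMl ?subr_ge0 ?(ltW uw).
  have -> : d = `|x * k - y * k| by rewrite /d -mulrBl normrM mulrC.
  have [h|h|->] := ltgtP (x * k) (y * k); last by rewrite !subrr normr0.
  - rewrite distrC [leRHS]distrC; apply: le_trans (W _ _ h) (ler_norm _).
  - apply: le_trans (W _ _ h) (ler_norm _).
split; apply: key.
- apply: le_trans (ler_normB _ _) _; have := norm_cos_le1 (x * k); have := norm_cos_le1 (y * k); lra.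
- apply: (lip (@cos R) (fun z => - sin z)) => z; rewrite ?normrN; exact: norm_sin_le1.
- apply: le_trans (ler_normB _ _) _; have := norm_sin_le1 (x * k); have := norm_sin_le1 (y * k); lra.
- apply: (lip (@sin R) (fun z => cos z)) => z; exact: norm_cos_le1.
Qed.

(** With $h=1+k^2$, write $h^{\theta/2}=h^{(1+\theta/2)/2}\,h^{-(1-\theta/2)/2}$ and bound the
    product by squares. The Sobolev norm controls the first factor together with $|g|$, and the
    square of the second is integrable because $1-\theta/2>1/2$. *)
Lemma integrable_sobolev (g : R -> R[i]) (th : R) : 0 < th < 1 -> cmeas setT g ->
  (\int[mu]_k ((1 + k ^+ 2) `^ (1 + th / 2) * cmod (g k) ^+ 2)%:E < +oo)%E ->
  mu.-integrable setT (EFin \o (fun k => cmod (g k) * `|k| `^ th)) /\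
  mu.-integrable setT (EFin \o (fun k => cmod (g k) ^+ 2)).
Proof.
move=> /andP[t0 t1] mg hg.
have mh (r : R) : measurable_fun setT (fun k : R => (1 + k ^+ 2) `^ r).
  apply: (@measurableT_comp _ _ _ _ _ _ (fun y => y `^ r)); first exact: measurable_powR.
  by apply: measurable_funD => //; exact: measurable_funX.
have mc := cmeas_cmod measurableT mg.
have h1 k : 1 <= 1 + k ^+ 2 by rewrite lerDl sqr_ge0.
have i1 : mu.-integrable setT (EFin \o (fun k => (1 + k ^+ 2) `^ (1 + th / 2) * cmod (g k) ^+ 2)).
  apply/integrableP; split.
    by apply/measurable_EFinP; apply: measurable_funM; [exact: mh|exact: measurable_funX].
  rewrite [X in (X < _)%E](_ : _ = \int[mu]_k ((1 + k ^+ 2) `^ (1 + th / 2) * cmod (g k) ^+ 2)%:E)%E //.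
  by apply: eq_integral => k _ /=; rewrite ger0_norm // mulr_ge0 ?powR_ge0 ?sqr_ge0.
have e1 : 1 / 2 < 1 - th / 2 :> R by lra.
have i2 := integrable_japanese e1.
split.
- have i3 := integrableD measurableT i1 i2.
  apply: le_integrable i3 => //.
    apply/measurable_EFinP; apply: measurable_funM => //.
    apply: (@measurableT_comp _ _ _ _ _ _ (fun y => y `^ th)); first exact: measurable_powR.
    exact: normr_measurable.
  move=> k _ /=; rewrite lee_fin ger0_norm ?mulr_ge0 ?cmod_ge0 ?powR_ge0 //.
  apply: le_trans (ler_norm _).
  set h := 1 + k ^+ 2; set G := cmod (g k).
  have hp : 0 < h by apply: lt_le_trans (h1 k).
  have kh : `|k| `^ th <= h `^ (th / 2).
    have -> : `|k| `^ th = (k ^+ 2) `^ (th / 2).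
      rewrite -[k ^+ 2]real_normK ?num_real // -powR_mulrn // -powRrM; congr (_ `^ _).
      by field.
    by apply: ge0_ler_powR; rewrite ?nnegrE ?sqr_ge0 ?(ltW hp) ?divr_ge0 ?(ltW t0) // /h lerDr.
  apply: le_trans (ler_wpM2l (cmod_ge0 _) kh) _; rewrite -/G.
  pose A := h `^ ((1 + th / 2) / 2); pose B := h `^ (- (1 - th / 2) / 2).
  have -> : h `^ (1 + th / 2) = A ^+ 2 by rewrite -powR_mulrn ?powR_ge0 // -powRrM; congr (_ `^ _); field.
  have -> : h `^ (- (1 - th / 2)) = B ^+ 2 by rewrite -powR_mulrn ?powR_ge0 // -powRrM; congr (_ `^ _); field.
  have -> : h `^ (th / 2) = A * B.
    by rewrite -powRD; [congr (_ `^ _); field|apply/implyP => _; rewrite gt_eqF].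
  have A0 : 0 <= A by exact: powR_ge0.
  have B0 : 0 <= B by exact: powR_ge0.
  have := sqr_ge0 (G * A - B); have := sqr_ge0 (G * A); have := sqr_ge0 B; nra.
- apply: le_integrable i1 => //.
    by apply/measurable_EFinP; exact: measurable_funX.
  move=> k _ /=; rewrite lee_fin ger0_norm ?sqr_ge0 //; apply: le_trans (ler_norm _).
  rewrite ler_peMl ?sqr_ge0 //; apply: (@le_trans _ _ ((1 + k ^+ 2) `^ 0)); first by rewrite powRr0.
  by apply: ler_powR => //; lra.
Qed.

(* Testing the Fourier transform of [p] against [e^{-a k^2} e^{i x k}] gives a Gaussian average of
   [p] at [x], and [|e^{i x k} - e^{i y k}| <= 4 (|k| |x - y|)^th]. *)
Lemma inHs_hoelder (p p1 : R -> R[i]) (B th : R) : 0 < th < 1 -> cmeas setT p ->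
  (forall x, cmod (p x) <= B) -> {ae mu, forall x, p x = p1 x} -> inHs (1 + th / 2) p1 ->
  exists2 C : R, 0 <= C & forall x y, ccont p x -> ccont p y -> cmod (p x - p y) <= C * `|x - y| `^ th.
Proof.
move=> th01 mp pB pp1 [[mp1 _] [g [mg hf hg]]].
have [i1 i2] := integrable_sobolev th01 mg hg.
pose G := \int[mu]_k (cmod (g k) * `|k| `^ th).
have G0 : 0 <= G by apply: Rintegral_ge0 => k _; rewrite mulr_ge0 ?cmod_ge0 ?powR_ge0.
have pi0 := @pi_gt0 R.
(* This is $e^{-ak^2}e^{ixk}$, written as a combination of the two real Schwartz functions on which
   the transform identity can be tested. *)
pose w a x k : R[i] := (gaussian a k * cos (x * k))%:C + 'i * (gaussian a k * sin (x * k))%:C.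
have mE (f : R -> R) : (forall x : R, {for x, continuous f}) -> cmeas setT (fun k => (f k)%:C).
  by move=> cf; apply: cmeas_real; exact: continuous_measurable_fun.
have ccE a x k : {for k, continuous (fun k => gaussian a k * cos (x * k))}.
  by apply: continuous_mul; [exact: gaussian_cont|exact: cosM_cont].
have csE a x k : {for k, continuous (fun k => gaussian a k * sin (x * k))}.
  by apply: continuous_mul; [exact: gaussian_cont|exact: sinM_cont].
have ig (f : R -> R) a : 0 < a -> (forall k : R, {for k, continuous f}) -> (forall k, `|f k| <= 1) ->
    cintegrable setT (fun k => g k * (gaussian a k * f k)%:C).
  move=> a0 cf f1.
  (* Integrability of $g$ against a Gaussian follows from $|g|e^{-ak^2}\le|g|^2+e^{-2ak^2}$. *)
  have a20 : 0 < 2 * a by rewrite mulr_gt0.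
  have [j2 _] := gaussian_mass 0 a20.
  have j3 := integrableD measurableT i2 j2.
  apply: cintegrable_dom j3 _ => //.
    apply: cmeasM => //; apply: mE => k; apply: continuous_mul => //; exact: gaussian_cont.
  move=> k _; rewrite cmodM cmod_real normrM (gtr0_norm (gaussian_gt0 _ _)) subr0.
  have -> : gaussian (2 * a) k = gaussian a k ^+ 2.
    by rewrite expr2 /gaussian -expRD; congr expR; ring.
  have := f1 k; have := gaussian_gt0 a k; have := cmod_ge0 (g k); have := normr_ge0 (f k).
  move: `|f k| (gaussian a k) (cmod (g k)) => f0 E0 g0 h1 h2 h3 h4.
  have : g0 * (E0 * f0) <= g0 * E0 by rewrite ler_wpM2l // ler_piMr // ltW.
  have := sqr_ge0 (g0 - E0); nra.
have key a x : 0 < a -> cintegral setT (fun z => p z * (gaussian_cos a (z - x))%:C) =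
    cintegral setT (fun k => g k * w a x k).
  move=> a0.
  have iN z := integrable_gaussian_cos z a0.
  have NE z : (gaussian_cos a (z - x))%:C = fourier (fun k => gaussian a k * cos (x * k)) z +
      'i * fourier (fun k => gaussian a k * sin (x * k)) z.
    rewrite fourier_gaussian_cos // fourier_gaussian_sin // mulrA mulrN -expr2 sqr_i opprK mul1r.
    by rewrite -rmorphD; congr (_%:C); field.
  have ipN (s z : R) : cintegrable setT (fun y => p1 y * (s * gaussian_cos a (y - z))%:C).
    have iB := integrableZl (mu := mu) measurableT (B * `|s|) (iN z).
    have mm : cmeas setT (fun y => (s * gaussian_cos a (y - z))%:C).
      apply: cmeas_real; apply: measurable_funM => //.
      by have /integrableP[/measurable_EFinP] := iN z.
    have ip : cintegrable setT (fun y => p y * (s * gaussian_cos a (y - z))%:C).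
      apply: cintegrable_dom iB _ => //; first exact: cmeasM.
      move=> y _; rewrite cmodM cmod_real normrM (ger0_norm (gaussian_cos_ge0 _ a0)) -mulrA.
      by apply: ler_wpM2r => //; rewrite mulr_ge0 // gaussian_cos_ge0.
    apply: cintegrable_ae ip; [exact: cmeasM|exact: cmeasM|].
    have [N [mN N0 hN]] := pp1; exists N; split => // y hy; apply: hN => E; apply: hy.
    by rewrite /= E.
  have E1 y : p1 y * fourier (fun k => gaussian a k * cos (x * k)) y =
      p1 y * (2^-1 * gaussian_cos a (y - x))%:C + p1 y * (2^-1 * gaussian_cos a (y - - x))%:C.
    by rewrite fourier_gaussian_cos // -mulrDr -rmorphD -mulrDr opprK.
  have E2 y : p1 y * fourier (fun k => gaussian a k * sin (x * k)) y =
      - 'i * (p1 y * (2^-1 * gaussian_cos a (y - x))%:C - p1 y * (2^-1 * gaussian_cos a (y - - x))%:C).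
    by rewrite fourier_gaussian_sin // mulrCA -mulrBr -rmorphB -mulrBr opprK.
  have J1 : cintegrable setT (fun y => p1 y * fourier (fun k => gaussian a k * cos (x * k)) y).
    by apply: (eq_cintegrable _ _ (cintegrableD measurableT (ipN 2^-1 x) (ipN 2^-1 (- x)))) => [|y _]; [exact: measurableT|rewrite E1].
  have J2 : cintegrable setT (fun y => p1 y * fourier (fun k => gaussian a k * sin (x * k)) y).
    by apply: (eq_cintegrable _ _ (cintegrableZ (- 'i) measurableT (cintegrableB measurableT (ipN 2^-1 x) (ipN 2^-1 (- x))))) => [|y _]; [exact: measurableT|rewrite E2].
  have -> : cintegral setT (fun z => p z * (gaussian_cos a (z - x))%:C) =
      cintegral setT (fun z => p1 z * (gaussian_cos a (z - x))%:C).
    have mm : cmeas setT (fun z => (gaussian_cos a (z - x))%:C).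
      by apply: cmeas_real; have /integrableP[/measurable_EFinP] := iN x.
    apply: eq_cintegral_ae; [exact: cmeasM|exact: cmeasM|].
    have [N [mN N0 hN]] := pp1; exists N; split => // z hz; apply: hN => E; apply: hz.
    by rewrite /= E.
  transitivity (cintegral setT (fun z => p1 z * fourier (fun k => gaussian a k * cos (x * k)) z) +
      'i * cintegral setT (fun z => p1 z * fourier (fun k => gaussian a k * sin (x * k)) z)).
    rewrite -cintegralZ // -cintegralD //; last exact: cintegrableZ.
    by apply: eq_cintegral => z _; rewrite NE mulrDr mulrCA.
  rewrite (hf _ (schwartz_gaussian_cos x a0)) (hf _ (schwartz_gaussian_sin x a0)).
  have I1 := ig _ a a0 (@cosM_cont _ x) (fun k => norm_cos_le1 (x * k)).
  have I2 := ig _ a a0 (@sinM_cont _ x) (fun k => norm_sin_le1 (x * k)).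
  rewrite -cintegralZ // -cintegralD //; last exact: cintegrableZ.
  by apply: eq_cintegral => k _; rewrite /w mulrDr mulrCA.
have gw a x : 0 < a -> cintegrable setT (fun k => g k * w a x k).
  move=> a0; have I1 := ig _ a a0 (@cosM_cont _ x) (fun k => norm_cos_le1 (x * k)).
  have I2 := ig _ a a0 (@sinM_cont _ x) (fun k => norm_sin_le1 (x * k)).
  apply: eq_cintegrable (cintegrableD measurableT I1 (cintegrableZ 'i measurableT I2)) => //.
  by move=> k _; rewrite /w mulrDr mulrCA.
have diff a x y : 0 < a -> cmod (cintegral setT (fun k => g k * w a x k) - cintegral setT (fun k => g k * w a y k))
    <= 8 * G * `|x - y| `^ th.
  move=> a0; rewrite -cintegralB; [|by []|exact: gw|exact: gw].
  have iG := integrableZl (mu := mu) measurableT (4 * `|x - y| `^ th) i1.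
  apply: (@le_trans _ _ (2 * \int[mu]_k (4 * `|x - y| `^ th * (cmod (g k) * `|k| `^ th)))).
    apply: cmod_cintegral_le => //.
      by have /cintegrable_cmeas := cintegrableB measurableT (gw a x a0) (gw a y a0).
    move=> k _; rewrite -mulrBr cmodM mulrCA ler_wpM2l ?cmod_ge0 //.
    have [h1 h2] := exp_dist_le x y k th01.
    have E1 : gaussian a k <= 1 by rewrite /gaussian expR_le1 mulNr oppr_le0 mulr_ge0 ?sqr_ge0 ?(ltW a0).
    have E0 := gaussian_gt0 a k.
    have wE : w a x k - w a y k = (gaussian a k * (cos (x * k) - cos (y * k)))%:C
        + 'i * (gaussian a k * (sin (x * k) - sin (y * k)))%:C.
      by rewrite /w !mulrBr !rmorphB; ring.
    rewrite wE; apply: le_trans (cmodD _ _) _; rewrite cmodM cmod_i mul1r !cmod_real.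
    rewrite !normrM (gtr0_norm E0); move: h1 h2 E0 E1; move: (normr_ge0 (cos (x * k) - cos (y * k))) (normr_ge0 (sin (x * k) - sin (y * k))).
    move: `|cos _ - _| `|sin _ - _| (gaussian a k) => X Y E X0 Y0 h1 h2 E0 E1; nra.
  rewrite RintegralZl // -/G; lra.
exists (8 * G / (2 * pi)); first by rewrite divr_ge0 ?mulr_ge0 // ltW.
move=> x y cx cy; rewrite mulrAC ler_pdivlMr ?mulr_gt0 //.
apply/ler_addgt0Pr => e e0; have e2 : 0 < e / 2 by rewrite divr_gt0.
have [d1 d10 hd1] := gaussian_approx mp pB cx e2.
have [d2 d20 hd2] := gaussian_approx mp pB cy e2.
pose a := Num.min d1 d2 / 2.
have a0 : 0 < a by rewrite divr_gt0 // lt_min d10.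
have [ad1 ad2] : Num.min d1 d2 <= d1 /\ Num.min d1 d2 <= d2 by rewrite !ge_min !lexx orbT.
have m0 : 0 < Num.min d1 d2 by rewrite lt_min d10.
have [a1 a2] : a < d1 /\ a < d2 by rewrite /a; clear - ad1 ad2 m0; split; lra.
have := hd1 a; rewrite a0 a1 key // => /(_ isT) H1.
have := hd2 a; rewrite a0 a2 key // => /(_ isT) H2.
have H3 := diff a x y a0.
have -> : cmod (p x - p y) * (2 * pi) = cmod ((2 * pi)%:C * p x - (2 * pi)%:C * p y).
  by rewrite -mulrBr cmodM cmod_real ger0_norm ?mulr_ge0 ?(ltW pi0) // mulrC.
move: H1 H2 H3; set I1 := cintegral _ _; set I2 := cintegral _ (fun k => g k * w a y k) => H1 H2 H3.
have -> : (2 * pi)%:C * p x - (2 * pi)%:C * p y =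
  (I1 - I2) - (I1 - (2 * pi)%:C * p x) + (I2 - (2 * pi)%:C * p y) by ring.
apply: le_trans (cmodD _ _) _; apply: le_trans (lerD (cmodB _ _) (lexx _)) _.
clearbody I1 I2; clear - H1 H2 H3; lra.
Qed.

End Hoelder.

(** * Eigenvalues with an eigenfunction in A *)

Section Necessity.
Context {R : realType}.
Notation mu := (@lebesgue_measure R).
Implicit Types (v f : R -> R[i]) (x y th : R).

Lemma cderiv_lipschitz f f' (K : R) x y : (forall z, 0 < z -> cderiv f z (f' z)) ->
  0 < x < y -> (forall z, x < z < y -> cmod (f' z) <= K) -> cmod (f y - f x) <= 2 * K * (y - x).
Proof.
move=> df /andP[x0 xy] hK.
have W (g g' : R -> R) : (forall z : R, 0 < z -> is_derive z (1 : R) g (g' z)) ->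
    (forall z, `|g' z| <= cmod (f' z)) -> `|g y - g x| <= K * (y - x).
  move=> dg gf; have [z zxy ->] := is_derive_MVT dg x0 xy.
  rewrite normrM (ger0_norm (_ : 0 <= y - x)) ?subr_ge0 ?(ltW xy) // ler_wpM2r ?subr_ge0 ?(ltW xy) //.
  exact: le_trans (gf z) (hK z zxy).
apply: le_trans (cmod_le_ReIm _) _; rewrite !ReImE -mulrA mulr_natl mulr2n; apply: lerD.
- apply: (W (fun z => Re (f z)) (fun z => Re (f' z))) => z; [by move/df => []|exact: Re_le_cmod].
- apply: (W (fun z => Im (f z)) (fun z => Im (f' z))) => z; [by move/df => []|exact: Im_le_cmod].
Qed.

Lemma onem_exp_le x : 1 - expR (- x) <= x.
Proof. by have := expR_ge1Dx (- x); lra. Qed.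

Lemma onem_exp_ge x : 0 <= x <= 1 -> x <= 2 * (1 - expR (- x)).
Proof.
move=> /andP[x0 x1]; have h := expR_ge1Dx x; have e0 := expR_gt0 (- x).
have E : expR (- x) * expR x = 1 by rewrite -expRD addNr expR0.
have := ler_wpM2l (ltW e0) h; nra.
Qed.

Section HoelderAtOrigin.
Variables (b : R) (la k : R[i]) (v : R -> R[i]).
Hypotheses (hv : inX v) (ode : half_ode b la k v).

(** The numerator of [hv1] with [v x] replaced by its limit at 0, so that $(1-e^{-x})v'$ is a
    bounded factor times $v(x)-v(0^+)$ plus this remainder. *)
Let rest x := (la + ((2 - b) * expR (- x))%:C) * limr0 v
  - (3 - 3 * b / 2)%:C * ((expR x)%:C * Jh v x)
  - (b / 2)%:C * ((expR (- x))%:C * Kh v x)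
  - k * (expR (- x))%:C.

Let expN_le1 x : 0 <= x -> 0 <= expR (- x) <= 1.
Proof. by move=> x0; rewrite expR_ge0 expR_le1 oppr_le0. Qed.

(** The remainder tends to 0 by the matching condition at the origin, and its derivative is bounded
    on $(0,1)$. *)
Let rest_le : exists2 K : R, 0 <= K & forall x, 0 < x <= 1 -> cmod (rest x) <= K * x.
Proof.
have [B B0 hB] := inX_bound hv; have mv := inX_cmeas hv.
have cv x : 0 < x -> ccont v x by exact: inX_cont_pos.
pose rest' x := (((2 - b) * - expR (- x))%:C * limr0 v
  - (3 - 3 * b / 2)%:C * ((expR x)%:C * Jh v x - (expR (- x))%:C * v x))
  - (b / 2)%:C * (- ((expR (- x))%:C * Kh v x) + (expR (- x))%:C * v x)
  - k * (- expR (- x))%:C.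
have dL x : 0 < x -> cderiv rest x (rest' x).
  move=> x0.
  have dr : cderiv (fun y => ((2 - b) * expR (- y))%:C) x ((2 - b) * - expR (- x))%:C.
    apply: cderiv_real.
    by apply: is_derive_eq (is_deriveM (is_derive_cst (2 - b) x 1) (is_derive_expN x)) _;
      rewrite /GRing.scale /= mulr0 addr0.
  have d1 := cderivM (cderivD (cderiv_cst la x) dr) (cderiv_cst (limr0 v) x).
  have d2 := cderivM (cderiv_cst (3 - 3 * b / 2)%:C x) (cderiv_eJh mv hB cv x0).
  have d3 := cderivM (cderiv_cst (b / 2)%:C x) (cderiv_eKh mv hB cv x0).
  have d4 := cderivM (cderiv_cst k x) (cderiv_real (is_derive_expN x)).
  apply: cderiv_eq (cderivB (cderivB (cderivB d1 d2) d3) d4) _.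
  by rewrite /rest' !mul0r !mulr0 !add0r !addr0.
have lL : ccvg (0 : R)^'+ rest 0.
  rewrite -(half_ode_at0 mv hB (inX_limr0 hv) ode).
  have lr : ccvg (0 : R)^'+ (fun x => ((2 - b) * expR (- x))%:C) ((2 - b) * 1)%:C.
    by apply: ccvg_real; apply: cvgMr; exact: cvg_expN0.
  have l1 : ccvg (0 : R)^'+ (fun x => (la + ((2 - b) * expR (- x))%:C) * limr0 v) ((la + ((2 - b) * 1)%:C) * limr0 v).
    by apply: ccvgM (ccvg_cst _) => //; apply: ccvgD => //; exact: ccvg_cst.
  have l2 : ccvg (0 : R)^'+ (fun x => (3 - 3 * b / 2)%:C * ((expR x)%:C * Jh v x)) ((3 - 3 * b / 2)%:C * Jh v 0).
    by apply: ccvgM (ccvg_cst _) _; exact: (eJh_lim0 mv hB).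
  have l3 : ccvg (0 : R)^'+ (fun x => (b / 2)%:C * ((expR (- x))%:C * Kh v x)) ((b / 2)%:C * 0).
    by apply: ccvgM (ccvg_cst _) _; exact: (eKh_lim0 mv hB).
  have l4 : ccvg (0 : R)^'+ (fun x => k * (expR (- x))%:C) (k * (1 : R)%:C).
    by apply: ccvgM (ccvg_cst _) _; apply: ccvg_real; exact: cvg_expN0.
  by apply: ccvg_eq (ccvgB (ccvgB (ccvgB l1 l2) l3) l4) _; rewrite !mulr1 mulr0 subr0.
pose K := `|2 - b| * cmod (limr0 v) + `|3 - 3 * b / 2| * (2 * B) + `|b / 2| * (3 * B) + cmod k.
have K0 : 0 <= K by rewrite !addr_ge0 ?mulr_ge0 ?cmod_ge0.
have hK z : 0 < z < 1 -> cmod (rest' z) <= K.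
  move=> /andP[z0 z1]; have /andP[e0 e1] := expN_le1 (ltW z0).
  have J : cmod ((expR z)%:C * Jh v z) <= B.
    by apply: le_trans (eJh_le mv hB (ltW z0)) _; rewrite ler_piMr.
  have Kz : cmod ((expR (- z))%:C * Kh v z) <= 2 * B.
    apply: le_trans (eKh_le mv hB (ltW z0)) _; rewrite ler_piMr ?mulr_ge0 //; nra.
  have ev : cmod ((expR (- z))%:C * v z) <= B.
    by rewrite cmodM cmod_real ger0_norm //; have := hB z; have := cmod_ge0 (v z); nra.
  apply: le_trans (cmodB _ _) _; apply: lerD; last first.
    rewrite cmodM cmod_real normrN ger0_norm //; have := cmod_ge0 k; nra.
  apply: le_trans (cmodB _ _) _; apply: lerD; last first.
    rewrite cmodM cmod_real ler_wpM2l //; by apply: le_trans (cmodD _ _) _; rewrite cmodN; lra.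
  apply: le_trans (cmodB _ _) _; apply: lerD.
    rewrite cmodM cmod_real normrM normrN (ger0_norm e0) ler_wpM2r ?cmod_ge0 //.
    by rewrite ler_piMr.
  rewrite cmodM cmod_real ler_wpM2l //; by apply: le_trans (cmodB _ _) _; lra.
exists (2 * K); first by rewrite mulr_ge0.
move=> x /andP[x0 x1].
apply: (@cmod_lim_le _ (0 : R)^'+ _ (fun y => rest x - rest y)).
  by apply: ccvg_eq (ccvgB (ccvg_cst _) lL) _; rewrite subr0.
near=> y; have y0 : 0 < y by near: y; exact: nbhs_right_gt.
have yx : y < x by near: y; exact: nbhs_right_lt.
apply: (@le_trans _ _ (2 * K * (x - y))).
  apply: cderiv_lipschitz dL _ _; first by rewrite y0.
  by move=> z /andP[yz zx]; apply: hK; rewrite (lt_trans y0 yz) (lt_le_trans zx x1).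
by rewrite ler_wpM2l ?mulr_ge0 //; lra.
Unshelve. all: by end_near. Qed.

(** Let $d=1-e^{-x}$. The modulus of $d\,^2(v-v'')$ is comparable to
    $|M|d^{\,2+\mathrm{Re}\,\lambda-b}$ near 0, while Hölder continuity of exponent $\theta$ makes
    $dv'$, then $d\,^2v''$, of order $d\,^\theta$. This forces $M=0$ once
    $\theta>2+\mathrm{Re}\,\lambda-b$, which some $\theta<1$ satisfies when
    $\mathrm{Re}\,\lambda<b-1$. *)
Lemma hoelder_no_momentum : Re la < b - 1 ->
  (forall th, 0 < th < 1 -> exists2 C : R, 0 <= C &
     forall x, 0 < x <= 1 -> cmod (v x - limr0 v) <= C * x `^ th) ->
  no_momentum b la k v.
Proof.
move=> lab hh; have [B B0 hB] := inX_bound hv; have mv := inX_cmeas hv.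
have cv x : 0 < x -> ccont v x by exact: inX_cont_pos.
have [M hM] := momentum_mexp mv hB cv ode.
suff M0 : M = 0.
  by move=> x x0; have /eqP := hM x x0; rewrite M0 mul0r subr_eq0 => /eqP.
(* The midpoint of $2+\mathrm{Re}\,\lambda-b$ and 1 when the former is positive, and $1/2$
   otherwise. *)
have [th th01 hth] : exists2 th, 0 < th < 1 & 0 < th - 2 + b - Re la.
  have [h|h] := leP (2 + Re la - b) 0; first by exists (1 / 2) => //; lra.
  by exists ((1 + (2 + Re la - b)) / 2); [apply/andP; split|]; lra.
have [C C0 hC] := hh th th01; have /andP[t0 t1] := th01.
have [K K0 hK] := rest_le.
pose d x := 1 - expR (- x).
have d01 x : 0 < x -> 0 < d x <= 1.
  by move=> x0; rewrite onem_exp_gt0 //= /d lerBlDr lerDl expR_ge0.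
have xd x : 0 < x <= 1 -> x `^ th <= 2 * d x `^ th.
  move=> /andP[x0 x1]; have /andP[d0 d1] := d01 x x0.
  apply: (@le_trans _ _ ((2 * d x) `^ th)).
    apply: ge0_ler_powR; rewrite ?nnegrE ?mulr_ge0 ?(ltW x0) ?(ltW d0) ?(ltW t0) //.
    by apply: onem_exp_ge; rewrite (ltW x0).
  rewrite powRM ?(ltW d0) // ler_wpM2r ?powR_ge0 //.
  by have := ler_powR (ler1n R 2) (ltW t1); rewrite powRr1.
have dd x : 0 < x -> d x <= d x `^ th.
  by move=> /d01 h; have := ger1_powR h (ltW t1).
pose C1 := (cmod la + `|2 - b|) * (C * 2) + K * 2.
have C10 : 0 <= C1 by rewrite addr_ge0 ?mulr_ge0 ?addr_ge0 ?cmod_ge0.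
have h1 x : 0 < x <= 1 -> cmod ((d x)%:C * hv1 b la k v x) <= C1 * d x `^ th.
  move=> x01; have /andP[x0 x1] := x01; have /andP[e0 e1] := expN_le1 (ltW x0).
  have /andP[d0 d1] := d01 x x0.
  have -> : (d x)%:C * hv1 b la k v x = (la + ((2 - b) * expR (- x))%:C) * (v x - limr0 v) + rest x.
    have E : (d x)%:C * ((d x)^-1)%:C = 1 :> R[i] by rewrite -rmorphM mulfV ?gt_eqF.
    rewrite /hv1 mulrA E mul1r /rest; move: (la + _) (_ * (_ * Jh v x)) (_ * (_ * Kh v x)) (k * _) => X1 X2 X3 X4.
    ring.
  apply: le_trans (cmodD _ _) _; rewrite /C1 [leRHS]mulrDl; apply: lerD.
    rewrite cmodM -mulrA; apply: ler_pM; rewrite ?cmod_ge0 //.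
      apply: le_trans (cmodD _ _) _; rewrite lerD2l cmod_real normrM (ger0_norm e0).
      by rewrite ler_piMr.
    by rewrite -mulrA; apply: le_trans (hC x x01) _; rewrite ler_wpM2l // xd.
  apply: le_trans (hK x x01) _; rewrite -mulrA ler_wpM2l //.
  apply: le_trans (onem_exp_ge _) _; first by rewrite (ltW x0).
  by rewrite ler_wpM2l // dd.
clearbody C1.
pose C2 := (cmod la + `|1 - b|) * C1 + `|1 - b| * B + `|3 - 3 * b / 2| * B + `|b / 2| * (2 * B) + cmod k.
have C20 : 0 <= C2 by rewrite !addr_ge0 ?mulr_ge0 ?addr_ge0 ?cmod_ge0.
have h2 x : 0 < x <= 1 -> cmod (((d x) ^+ 2)%:C * hv2 b la k v x) <= C2 * d x `^ th.
  move=> x01; have /andP[x0 x1] := x01; have /andP[e0 e1] := expN_le1 (ltW x0).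
  have /andP[d0 d1] := d01 x x0.
  have J : cmod ((expR x)%:C * Jh v x) <= B.
    by apply: le_trans (eJh_le mv hB (ltW x0)) _; rewrite ler_piMr.
  have Kx : cmod ((expR (- x))%:C * Kh v x) <= 2 * B.
    apply: le_trans (eKh_le mv hB (ltW x0)) _; rewrite ler_piMr ?mulr_ge0 //; nra.
  have -> : ((d x) ^+ 2)%:C * hv2 b la k v x =
      (la + ((1 - b) * expR (- x))%:C) * ((d x)%:C * hv1 b la k v x)
      + (d x)%:C * (((1 - b) * expR (- x))%:C * v x)
      - (d x)%:C * ((3 - 3 * b / 2)%:C * ((expR x)%:C * Jh v x))
      + (d x)%:C * ((b / 2)%:C * ((expR (- x))%:C * Kh v x))
      + (d x)%:C * (k * (expR (- x))%:C).
    have E : ((d x) ^+ 2)%:C * ((d x)^-1)%:C = (d x)%:C :> R[i].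
      by rewrite -rmorphM; congr (_%:C); rewrite expr2 mulfK ?gt_eqF.
    rewrite /hv2 mulrA E; move: (la + _) (_ * v x) (_ * (_ * Jh v x)) (_ * (_ * Kh v x)) (k * _) (hv1 _ _ _ _ _) => X1 X2 X3 X4 X5 X6.
    ring.
  have sm (z : R[i]) (Z : R) : cmod z <= Z -> cmod ((d x)%:C * z) <= Z * d x `^ th.
    move=> hz; rewrite cmodM cmod_real gtr0_norm // mulrC.
    by apply: ler_pM; rewrite ?cmod_ge0 ?(ltW d0) // dd.
  rewrite /C2 !(mulrDl _ _ (d x `^ th)).
  apply: le_trans (cmodD _ _) _; apply: lerD; last first.
    by apply: sm; rewrite cmodM cmod_real ger0_norm // ler_piMr ?cmod_ge0.
  apply: le_trans (cmodD _ _) _; apply: lerD; last first.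
    by apply: sm; rewrite cmodM cmod_real ler_wpM2l.
  apply: le_trans (cmodB _ _) _; apply: lerD; last first.
    by apply: sm; rewrite cmodM cmod_real ler_wpM2l.
  apply: le_trans (cmodD _ _) _; apply: lerD; last first.
    apply: sm; rewrite cmodM cmod_real normrM (ger0_norm e0) -mulrA ler_wpM2l //.
    by have := hB x; have := cmod_ge0 (v x); nra.
  rewrite cmodM -mulrA; apply: ler_pM; rewrite ?cmod_ge0 //; last exact: h1.
  apply: le_trans (cmodD _ _) _; rewrite lerD2l cmod_real normrM (ger0_norm e0).
  by rewrite ler_piMr.
pose C3 := (B + C2) * expR `|Re la|.
pose p := th - 2 + b - Re la.
have h3 x : 0 < x <= 1 -> cmod M <= C3 * d x `^ p.
  move=> x01; have /andP[x0 x1] := x01; have /andP[d0 d1] := d01 x x0.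
  have h : cmod M * (d x ^+ 2 * cmod (mexp b la x)) <= (B + C2) * d x `^ th.
    have -> : cmod M * (d x ^+ 2 * cmod (mexp b la x)) = cmod (((d x) ^+ 2)%:C * (v x - hv2 b la k v x)).
      by rewrite hM // !cmodM cmod_real ger0_norm ?sqr_ge0 // mulrCA.
    rewrite mulrBr; apply: le_trans (cmodB _ _) _; rewrite mulrDl; apply: lerD; last exact: h2.
    rewrite cmodM cmod_real ger0_norm ?sqr_ge0 // mulrC; apply: ler_pM; rewrite ?cmod_ge0 ?sqr_ge0 //.
    by apply: le_trans (dd x x0); rewrite expr2 ler_piMr // ltW.
  have E : d x ^+ 2 * cmod (mexp b la x) = expR (Re la * x) * (d x `^ th / d x `^ p).
    rewrite cmod_mexp -/(d x) -powR_mulrn ?(ltW d0) // /powR gt_eqF // -expRN -!expRD; congr expR.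
    rewrite /p; ring.
  have q0 : 0 < d x `^ p by rewrite powR_gt0.
  have r0 : 0 < d x `^ th by rewrite powR_gt0.
  have u0 : expR (- `|Re la|) <= expR (Re la * x).
    rewrite ler_expR; have := ler_norm (Re la); have := ler_norm (- Re la); rewrite normrN; nra.
  have {h} : cmod M * (expR (- `|Re la|) * (d x `^ th / d x `^ p)) <= (B + C2) * d x `^ th.
    by apply: le_trans h; rewrite E ler_wpM2l ?cmod_ge0 // ler_wpM2r // divr_ge0 // ltW.
  rewrite expRN.
  have -> : cmod M * ((expR `|Re la|)^-1 * (d x `^ th / d x `^ p)) =
     (cmod M / (expR `|Re la| * d x `^ p)) * d x `^ th.
    by rewrite invfM; ring.
  by rewrite ler_pM2r // ler_pdivrMr ?mulr_gt0 ?expR_gt0 // mulrA.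
apply: cmod_eq0; apply/eqP; rewrite eq_le cmod_ge0 andbT.
apply/ler_addgt0Pr => e e0; rewrite add0r.
have C30 : 0 <= C3 by rewrite mulr_ge0 ?expR_ge0 // addr_ge0.
(* Since [d x <= x], the power [p] of [d x] is then at most [e / (C3 + 1)]. *)
pose x := Num.min 1 (expR (ln (e / (C3 + 1)) / p)).
have e1 : 0 < e / (C3 + 1) by rewrite divr_gt0 // ltr_wpDl.
have x01 : 0 < x <= 1 by rewrite lt_min ltr01 expR_gt0 ge_min lexx.
have /andP[x0 _] := x01; have /andP[d0 _] := d01 x x0.
apply: le_trans (h3 x x01) _.
have : d x `^ p <= e / (C3 + 1).
  have dx : d x <= expR (ln (e / (C3 + 1)) / p).
    by apply: le_trans (onem_exp_le _) _; rewrite /x ge_min lexx orbT.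
  rewrite /powR gt_eqF // -[leRHS]lnK ?posrE // ler_expR.
  rewrite mulrC -ler_pdivlMr // -ler_expR lnK ?posrE //.
rewrite ler_pdivlMr ?ltr_wpDl // => h4; have := powR_ge0 (d x) p; nra.
Qed.

End HoelderAtOrigin.

(** Off 0, $v-u_0'$ is a continuous representative of [p1], so the Hölder bound holds between any
    two nonzero points. On each side $u_0'$ is Lipschitz, and the second point is sent to 0. *)
Lemma setA_hoelder0 (c : R) v th : 0 < c -> inX v -> setA c v -> 0 < th < 1 ->
  exists2 C : R, 0 <= C & forall x, 0 < x <= 1 ->
    cmod (v x - limr0 v) <= C * x `^ th /\ cmod (v (- x) - liml0 v) <= C * x `^ th.
Proof.
move=> c0 hv [p1 [hp1 hvp]] th01; have /andP[t0 t1] := th01.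
have [B B0 hB] := inX_bound hv; have mv := inX_cmeas hv.
pose p x := v x - (du0 c x)%:C.
have mp : cmeas setT p.
  apply: cmeasB => //; apply: cmeas_real; apply: measurable_funM.
    by apply: measurable_funM => //; exact: measurable_sg.
  apply: (@measurableT_comp _ _ _ _ _ _ expR); first exact: measurable_expR.
  by apply: measurableT_comp => //; exact: normr_measurable.
have pB x : cmod (p x) <= B + c.
  apply: le_trans (cmodB _ _) _; apply: lerD => //; rewrite cmod_real /du0 !normrM normrN (gtr0_norm c0).
  rewrite -mulrA ler_piMr ?(ltW c0) // (ger0_norm (expR_ge0 _)).
  have : expR (- `|x|) <= 1 by rewrite expR_le1 oppr_le0.
  have : `|Num.sg x| <= 1 by rewrite normr_sg; case: eqVneq.
  have := expR_ge0 (- `|x|); have := normr_ge0 (Num.sg x); nra.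
have pp : {ae mu, forall x, p x = p1 x}.
  have [N [mN N0 hN]] := hvp; exists N; split => // x hx; apply: hN => /= E; apply: hx.
  by rewrite /= /p E addrAC subrr add0r.
have [C C0 hC] := inHs_hoelder th01 mp pB pp (hp1 (1 + th / 2) ltac:(lra)).
have dpos (x : R) : 0 < x -> du0 c x = - c * expR (- x).
  by move=> x0; rewrite /du0 gtr0_sg // mulr1 gtr0_norm.
have dneg (x : R) : x < 0 -> du0 c x = c * expR x.
  by move=> x0; rewrite /du0 ltr0_sg // mulrN1 opprK ltr0_norm // opprK.
have dc (x : R) : x != 0 -> {for x, continuous (du0 c)}.
  have cE (q r : R) : {for x, continuous (fun y : R => q * expR (r * y))}.
    apply: continuous_mul; first exact: cst_continuous.
    apply: (@continuous_comp _ _ _ (fun y : R => r * y) expR); last exact: continuous_expR.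
    by apply: continuous_mul; [exact: cst_continuous|exact: cvg_id].
  move=> x0; have [x1|x1|E] := ltgtP x 0; last by rewrite E eqxx in x0.
  - move: (cE c 1); rewrite /prop_for /continuous_at dneg // mul1r; apply: cvg_trans; apply: near_eq_cvg.
    by near=> y; rewrite mul1r dneg //; near: y; exact: lt_nbhsl.
  - move: (cE (- c) (-1)); rewrite /prop_for /continuous_at dpos // mulN1r; apply: cvg_trans; apply: near_eq_cvg.
    by near=> y; rewrite mulN1r dpos //; near: y; exact: lt_nbhsr.
have pc x : x != 0 -> ccont p x.
  by move=> x0; apply: ccontB; [exact: inX_cont|apply: ccont_real; exact: dc].
have ex (x y : R) : 0 < y < x -> x <= 1 -> `|expR (- x) - expR (- y)| <= x `^ th /\ `|x - y| `^ th <= x `^ th.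
  move=> /andP[y0 yx] x1; have x0 := lt_trans y0 yx; split; last first.
    apply: ge0_ler_powR; rewrite ?nnegrE ?(ltW t0) ?(ltW x0) //.
    by rewrite gtr0_norm ?subr_gt0 // lerBlDr lerDl ltW.
  have x01 : 0 < x <= 1 by rewrite x0.
  apply: le_trans (ger1_powR x01 (ltW t1)); rewrite distrC ger0_norm; last by rewrite subr_ge0 ler_expR lerN2 ltW.
  have -> : expR (- y) - expR (- x) = expR (- y) * (1 - expR (- (x - y))).
    by rewrite mulrBr mulr1 -expRD; congr (_ - expR _); ring.
  have := onem_exp_le (x - y); have xy : 0 < x - y by rewrite subr_gt0.
  have := onem_exp_gt0 xy; have := expR_gt0 (- y).
  have : expR (- y) <= 1 by rewrite expR_le1 oppr_le0 ltW.
  move: (expR _) (1 - _) => E1 E2; nra.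
exists (C + c); first by rewrite addr_ge0 // ltW.
move=> x x01; have /andP[x0 x1] := x01; split.
- apply: (@cmod_lim_le _ (0 : R)^'+ _ (fun y => v x - v y)).
    by apply: ccvgB (ccvg_cst _) _; exact: inX_limr0.
  near=> y; have y0 : 0 < y by near: y; exact: nbhs_right_gt.
  have yx : y < x by near: y; exact: nbhs_right_lt.
  have /ex/(_ x1)[e1 e2] : 0 < y < x by rewrite y0.
  have -> : v x - v y = (p x - p y) + (- c * (expR (- x) - expR (- y)))%:C.
    by rewrite mulrBr -!dpos // rmorphB /p; ring.
  apply: le_trans (cmodD _ _) _; rewrite mulrDl; apply: lerD.
    by apply: le_trans (hC x y _ _) _; [apply: pc; rewrite gt_eqF|apply: pc; rewrite gt_eqF|rewrite ler_wpM2l].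
  by rewrite cmod_real normrM normrN (gtr0_norm c0) ler_wpM2l // ltW.
- apply: (@cmod_lim_le _ (0 : R)^'+ _ (fun y => v (- x) - v (- y))).
    have [hr r1 _] := inX_opp hv; apply: ccvgB (ccvg_cst _) _.
    by rewrite -r1; exact: (inX_limr0 hr).
  near=> y; have y0 : 0 < y by near: y; exact: nbhs_right_gt.
  have yx : y < x by near: y; exact: nbhs_right_lt.
  have /ex/(_ x1)[e1 e2] : 0 < y < x by rewrite y0.
  have -> : v (- x) - v (- y) = (p (- x) - p (- y)) + (c * (expR (- x) - expR (- y)))%:C.
    by rewrite mulrBr -!dneg ?oppr_lt0 // rmorphB /p; ring.
  apply: le_trans (cmodD _ _) _; rewrite mulrDl; apply: lerD.
    apply: le_trans (hC (- x) (- y) _ _) _; [apply: pc; rewrite oppr_eq0 gt_eqF //|apply: pc; rewrite oppr_eq0 gt_eqF //|].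
    by rewrite opprK addrC distrC ler_wpM2l // distrC.
  by rewrite cmod_real normrM (gtr0_norm c0) ler_wpM2l // ltW.
Unshelve. all: by end_near. Qed.

(** Hölder regularity is called upon only on a half-line whose parameter has negative real part; on
    the others decay already excludes momentum. *)
Lemma eigenvalue_in_A b c (lambda : R[i]) v : 0 < c -> Lw_eigenfunction b c lambda v -> setA c v ->
  lambda = 0 \/ 0 < `|Re lambda| <= c * (1 - b).
Proof.
move=> c0 he hA; have [hv hr o1 o2] := eigenfunction_halves c0 he.1.
have [->|[_ /andP[l0 _]]] := eigenvalue_band c0 he; [by left|].
have [h|h] := leP `|Re lambda| (c * (1 - b)); [by right; rewrite l0|left].
set la := lambda / c%:C in o1 o2.
have Rl : Re lambda = c * Re la by rewrite /la Re_divc mulrC divfK // gt_eqF.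
have h' : 1 - b < `|Re la| by move: h; rewrite Rl normrM (gtr0_norm c0) ltr_pM2l.
have [_ r1 _] := inX_opp hv.
apply: (no_momentum_eigenvalue c0 he); rewrite -/la.
- have [l1|l1] := leP 0 (Re la); first by apply: half_ode_no_momentum => //; left.
  apply: hoelder_no_momentum => //; first by move: h'; rewrite ltr0_norm //; lra.
  move=> th th01; have [C C0 hC] := setA_hoelder0 c0 hv hA th01.
  by exists C => // x /hC[].
- have [l1|l1] := leP (Re la) 0; first by apply: half_ode_no_momentum => //; left; rewrite cReN oppr_ge0.
  apply: hoelder_no_momentum => //; first by move: h'; rewrite gtr0_norm // cReN; lra.
  move=> th th01; have [C C0 hC] := setA_hoelder0 c0 hv hA th01.
  by exists C => // x /hC[_]; rewrite r1.
Qed.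

End Necessity.

(** * The jump at the origin *)

Section HalfLineIntegrals.
Context {R : realType}.
Notation mu := (@lebesgue_measure R).
Implicit Types (a x : R).

Lemma Rintegral_oy_derivative (G g : R -> R) (a l r : R) :
  (forall x : R, a < x -> is_derive x (1 : R) G (g x)) ->
  (forall x : R, a < x -> {for x, continuous g}) -> mu.-integrable `]a, +oo[ (EFin \o g) ->
  G x @[x --> a^'+] --> l -> G x @[x --> +oo] --> r -> \int[mu]_(x in `]a, +oo[) g x = r - l.
Proof.
move=> dG cg ig Gl Gr.
(* The index [n.+2] keeps [u n < w n] already for [n = 0]. *)
pose u n : R := a + n.+2%:R^-1; pose w n : R := a + n.+1%:R.
pose A n := `[u n, w n]%classic : set R.
have ua n : a < u n by rewrite /u ltrDl invr_gt0 ltr0n.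
have uw n : u n < w n.
  rewrite /u /w ltrD2l; apply: (@lt_le_trans _ _ 1); last by rewrite ler1n.
  by rewrite invf_lt1 ?ltr0n // ltr1n.
have h1 : \int[mu]_(x in A n) g x @[n --> \oo] --> \int[mu]_(x in `]a, +oo[) g x.
  have mA n : measurable (A n) by exact: measurable_itv.
  have AD n : A n `<=` `]a, +oo[%classic.
    by move=> x; rewrite /A /= !in_itv /= andbT => /andP[h _]; exact: lt_le_trans h.
  apply: (cvg_Rintegral_expanding (measurable_itv _) mA AD _ ig) => x; rewrite /= in_itv /= andbT => ax.
  near=> n; rewrite /A /= in_itv /=; apply/andP; split.
    rewrite /u -lerBrDl -[leRHS]invrK lef_pV2 ?posrE ?ltr0n ?invr_gt0 ?subr_gt0 //.
    apply: (@le_trans _ _ n%:R); last by rewrite ler_nat -addn2 leq_addr.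
    by near: n; exact: nbhs_infty_ger.
  rewrite /w -lerBlDl; apply: (@le_trans _ _ n%:R); last by rewrite ler_nat.
  by near: n; exact: nbhs_infty_ger.
have cn : (n.+1%:R : R) @[n --> \oo] --> +oo.
  by rewrite (cvg_shiftS (fun n => n%:R : R)); exact: cvgr_idn.
have cw : w n @[n --> \oo] --> +oo.
  apply/cvgryPge => M; near=> n; rewrite /w -lerBlDl.
  by near: n; move/cvgryPge : cn; exact.
have cu : u n @[n --> \oo] --> a.
  rewrite -[X in _ --> X]addr0; apply: cvgD; first exact: cvg_cst.
  by rewrite (cvg_shiftS (fun n => n.+1%:R^-1 : R)); exact: cvg_harmonic.
have h2 : \int[mu]_(x in A n) g x @[n --> \oo] --> r - l.
  have E n : \int[mu]_(x in A n) g x = G (w n) - G (u n).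
    have up x : u n <= x <= w n -> a < x by move=> /andP[h _]; exact: lt_le_trans h.
    by rewrite (@FTC2_closed _ G g _ _ (uw n)) // => x /up; [exact: dG|exact: cg].
  have -> : (fun n => \int[mu]_(x in A n) g x) = (fun n => G (w n) - G (u n)) by apply/funext.
  apply: cvgB; first exact: cvg_comp cw Gr.
  by move/cvg_at_rightP : Gl; apply; split.
exact: (cvg_unique _ h1 h2).
Unshelve. all: by end_near. Qed.

Lemma cintegral_oy_derivative (H h : R -> R[i]) (a : R) (l r : R[i]) :
  (forall x, a < x -> cderiv H x (h x)) -> (forall x, a < x -> ccont h x) ->
  cintegrable `]a, +oo[ h -> ccvg a^'+ H l -> ccvg (+oo : set_system R) H r ->
  cintegral `]a, +oo[ h = r - l.
Proof.
move=> dH ch [i1 i2] [l1 l2] [r1 r2]; apply: complexP; rewrite !ReImE /=.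
- apply: (Rintegral_oy_derivative _ _ i1 l1 r1) => x ax; [by have [] := dH x ax|by have [] := ch x ax].
- apply: (Rintegral_oy_derivative _ _ i2 l2 r2) => x ax; [by have [] := dH x ax|by have [] := ch x ax].
Qed.

Lemma Rintegral_tail_decreasing (G g : R -> R) (a : R) :
  (forall x : R, a <= x -> is_derive x (1 : R) G (- g x)) ->
  (forall x : R, a <= x -> {for x, continuous g}) -> (forall x : R, a <= x -> 0 <= g x) ->
  G x @[x --> +oo] --> (0 : R) ->
  mu.-integrable `]a, +oo[ (EFin \o g) /\ \int[mu]_(x in `]a, +oo[) g x = G a.
Proof.
move=> dG cg g0 G0.
have E : (\int[mu]_(x in `[a, +oo[) (g x)%:E = (- 0 - - G a)%:E)%E.
  rewrite EFinB; apply: (@ge0_continuous_FTC2y _ _ (fun x => - G x) a (- 0)).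
  - by move=> x ax; exact: g0.
  - by apply: continuous_in_subspaceT => x; rewrite inE /= in_itv /= andbT; exact: cg.
  - exact: cvgN.
  - move=> x ax; have h := dG x (ltW ax).
    by have [] := is_deriveN h.
  - by apply: cvg_at_right_filter; apply: cvgN; exact: is_derive_cont (dG a (lexx _)).
  - move=> x; rewrite in_itv /= andbT => ax; rewrite derive1E.
    have h := dG x (ltW ax); have h2 : is_derive x (1 : R) (fun y => - G y) (g x).
      by apply: is_derive_eq (is_deriveN h) _; rewrite opprK.
    by rewrite derive_val.
have mg : measurable_fun `]a, +oo[ g.
  apply: open_continuous_measurable_fun; first exact: interval_open.
  by move=> x; rewrite inE /= in_itv /= andbT => ax; apply: cg; exact: ltW.
have E2 : (\int[mu]_(x in `]a, +oo[) (g x)%:E = (G a)%:E)%E.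
  rewrite integral_itv_obnd_cbnd; last exact/measurable_EFinP.
  by rewrite E; congr (_%:E); ring.
split; last by rewrite /Rintegral E2.
apply/integrableP; split; first exact/measurable_EFinP.
rewrite [X in (X < _)%E](_ : _ = (G a)%:E) ?ltry // -E2.
by apply: eq_integral => x; rewrite inE /= in_itv /= andbT => ax; rewrite ger0_norm ?g0 // ltW.
Qed.

End HalfLineIntegrals.

(** * Concentration of powers at a strict maximum *)

Section Concentration.
Context {R : realType}.
Notation mu := (@lebesgue_measure R).

Lemma bernoulli_ge (r : R) n : 0 <= r -> 1 + n%:R * r <= (1 + r) ^+ n.
Proof.
move=> r0; elim: n => [|n IH]; first by rewrite mul0r addr0 expr0.
rewrite exprS -natr1; have r1 : 0 <= 1 + r by rewrite addr_ge0.
apply: le_trans (ler_wpM2l r1 IH); have : 0 <= n%:R * r * r by rewrite !mulr_ge0.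
lra.
Qed.

(* The powers of [phi] concentrate at the strict maximum [x0]. *)
Lemma concentration_neq0 (D : set R) (f phi : R -> R) (x0 : R) : measurable D ->
  nbhs x0 D -> mu.-integrable D (EFin \o f) -> {for x0, continuous f} -> 0 < f x0 ->
  {for x0, continuous phi} -> (forall x, D x -> 0 <= phi x) -> 0 < phi x0 ->
  (forall d, 0 < d -> exists2 q, q < phi x0 & forall x, D x -> d <= `|x - x0| -> phi x <= q) ->
  (forall n, mu.-integrable D (EFin \o (fun x => phi x ^+ n * f x))) ->
  exists n, \int[mu]_(x in D) (phi x ^+ n * f x) != 0.
Proof.
move=> mD nD fi cf f0 cphi phi0 p0 hmax fni.
apply: contrapT => /forallNP H.
have {}H n : \int[mu]_(x in D) (phi x ^+ n * f x) = 0.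
  by apply/eqP; apply: contrapT => /negP; exact: H.
pose e := f x0 / 2; have e0 : 0 < e by rewrite divr_gt0.
have [d /= d0 hd] : exists2 d, 0 < d & forall x, `|x0 - x| < d -> e < f x.
  have /nbhs_ballP[d d0 hd] : \forall x \near x0, e < f x.
    by apply: (cvgr_gt _ cf); rewrite /e; lra.
  by exists d.
have [q1 q1p hq1] := hmax d d0.
(* The second entry makes [q] positive, since [phi] will be divided by it. *)
pose q := Num.max q1 (phi x0 / 2).
have qp : q < phi x0 by rewrite gt_max q1p /=; lra.
have q0 : 0 < q by rewrite lt_max divr_gt0 // orbT.
have hq x : D x -> d <= `|x - x0| -> phi x <= q.
  by move=> Dx dx; rewrite le_max hq1.
(* [(1 + r) * q] is the midpoint of [q] and [phi x0], so [phi / q] exceeds [1 + r] near [x0]. *)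
pose r := ((q + phi x0) / 2) / q - 1.
have r0 : 0 < r by rewrite subr_gt0 ltr_pdivlMr // mul1r; lra.
have [d1 /= d10 hd1] : exists2 d1, 0 < d1 &
    forall x, `|x0 - x| < d1 -> D x /\ (1 + r) * q < phi x.
  have h : \forall x \near x0, (1 + r) * q < phi x.
    apply: (cvgr_gt _ cphi); rewrite /r addrC subrK divfK ?gt_eqF //; lra.
  have /nbhs_ballP[d1 d10 hd1] : \forall x \near x0, D x /\ (1 + r) * q < phi x.
    by near=> x; split; near: x.
  by exists d1.
pose del := Num.min d d1; have del0 : 0 < del by rewrite lt_min d0.
pose B := `]x0 - del, x0 + del[%classic : set R.
have BP x : B x <-> `|x0 - x| < del.
  by rewrite /B /= in_itv /= distrC -ltr_distl.
have BD : B `<=` D.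
  by move=> x /BP; rewrite lt_min => /andP[_ /hd1[]].
have mB : measurable B by exact: measurable_itv.
have iB : mu.-integrable D (EFin \o (fun x => \1_B x)).
  apply: (integrableS measurableT) => //; apply: integrable_indic_itv.
have EB : \int[mu]_(x in D) \1_B x = 2 * del.
  have mB2 : mu B = (2 * del)%:E.
    rewrite /B lebesgue_measure_itv /= lte_fin ifT; last by lra.
    by rewrite -EFinB; congr (_%:E); ring.
  have E1 : (\int[mu]_(x in D) (\1_B x)%:E = mu (B `&` D))%E by exact: integral_indic.
  by rewrite /Rintegral E1 (setIidl BD) mB2.
have ia := integrable_norm fi.
pose I := \int[mu]_(x in D) `|f x|.
(* After division by [q ^+ n] the integrand exceeds [e * (1 + n%:R * r)] on [B] by Bernoulli's
   inequality. Elsewhere it is at least $-|f|$: either [f] is positive or [phi / q <= 1]. As its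
   integral is 0, this bounds [n]. *)
have key n : e * (1 + n%:R * r) * (2 * del) <= I.
  have := H n => /(congr1 (fun z => q ^- n * z)); rewrite mulr0 -RintegralZl // => E.
  have i1 := integrableZl (mu := mu) mD (q ^- n) (fni n).
  have i2 := integrableZl (mu := mu) mD (e * (1 + n%:R * r)) iB.
  rewrite -EB -RintegralZl // -subr_le0 -RintegralB // -[leRHS]E.
  apply: le_Rintegral => //; first exact: integrableB i2 ia.
  move=> x Dx; have pq0 : 0 <= phi x / q by rewrite divr_ge0 ?phi0 // ltW.
  have -> : q ^- n * (phi x ^+ n * f x) = (phi x / q) ^+ n * f x by rewrite expr_div_n; ring.
  rewrite lerBlDr indicE; case: (boolP (x \in B)) => [|nB] /=.
    rewrite inE => /BP; rewrite lt_min => /andP[xd xd1]; rewrite mulr1.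
    have fe := hd x xd; have [_ px] := hd1 x xd1.
    have : 1 + n%:R * r <= (phi x / q) ^+ n.
      apply: le_trans (bernoulli_ge n (ltW r0)) _; apply: lerXn2r; rewrite ?nnegrE //.
        by rewrite addr_ge0 // ltW.
      by rewrite ler_pdivlMr // ltW.
    have : 0 <= n%:R * r by rewrite mulr_ge0 // ltW.
    have := normr_ge0 (f x); move: (_ ^+ n) (n%:R * r) => X Y; clear - fe e0; nra.
  rewrite mulr0; have [dx|dx] := leP d `|x - x0|.
    have : (phi x / q) ^+ n <= 1.
      by rewrite exprn_ile1 // ler_pdivrMr // mul1r hq.
    have : 0 <= (phi x / q) ^+ n by exact: exprn_ge0.
    have := ler_norm (- f x); rewrite normrN; have := normr_ge0 (f x); move: (_ ^+ n) => X; clear; nra.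
  rewrite distrC in dx; have fe := hd x dx.
  by rewrite addr_ge0 // mulr_ge0 ?exprn_ge0 // ltW // (lt_trans e0).
have K0 : 0 < e * r * (2 * del) by rewrite !mulr_gt0.
have [n hn] : exists n : nat, I / (e * r * (2 * del)) < n%:R.
  by exists (Num.bound (I / (e * r * (2 * del)))); apply: le_lt_trans (archi_boundP _); rewrite ?ler_norm // divr_ge0 ?(ltW K0) // Rintegral_ge0.
move: hn; rewrite ltr_pdivrMr // => hn; have := key n.
have : 0 <= e * (2 * del) by rewrite !mulr_ge0 // ltW.
clear - hn; lra.
Unshelve. all: by end_near. Qed.

End Concentration.

(** * Non-vanishing of a complex Beta integral *)

Section BetaIntegral.
Context {R : realType}.
Notation mu := (@lebesgue_measure R).
Implicit Types (p q x : R).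

(** With $t=1-e^{-x}$ the moment is $\int_0^1t^{p-\lambda-b}(1-t)^{q+\lambda-1}\,dt$, the Beta
    function at $(p+1-\lambda-b,\;q+\lambda)$. *)
Definition beta_kernel b (la : R[i]) p q x := (epow q p x)%:C * mexp b (- la) x.

Definition beta_moment b (la : R[i]) p q := cintegral `]0, +oo[ (beta_kernel b la p q).

Variables (b : R) (la : R[i]).
Hypotheses (la0 : 0 < Re la) (lab : Re la + b <= 1).

Local Notation m := (mexp b (- la)).
Local Notation em := (beta_kernel b la).
Local Notation A := (beta_moment b la).

Let cmod_em p q x : cmod (em p q x) = epow (q + Re la) (p - Re la - b) x.
Proof.
by rewrite /beta_kernel cmodM cmod_real (ger0_norm (epow_ge0 _ _ _)) cmod_mexp_epow epowM cReN opprK addrA.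
Qed.

Let em_cont p q x : 0 < x -> ccont (em p q) x.
Proof.
move=> x0; apply: ccontM; last exact: cderiv_cont (cderiv_mexp _ _ x0).
by apply: ccont_real; exact: is_derive_cont (is_derive_epow q p x0).
Qed.

Let em_Re p q x : Re (em p q x) = epow q p x * Re (m x).
Proof. by rewrite /beta_kernel cReM /= mul0r subr0. Qed.

Let em_Im p q x : Im (em p q x) = epow q p x * Im (m x).
Proof. by rewrite /beta_kernel cImM /= mul0r addr0. Qed.

Lemma beta_kernel_integrable p q : 1 <= p -> 1 <= q -> cintegrable `]0, +oo[ (em p q).
Proof.
move=> p1 q1; have i1 : mu.-integrable `]0, +oo[ (EFin \o (fun x => expR (-1 * x))).
  apply: integrableS (integrable_tail_expM 0 ltr01) => //.
  by move=> x /=; rewrite !in_itv /= !andbT; exact: ltW.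
apply: cintegrable_dom i1 _ => //.
  by apply: ccont_cmeas => [|x]; [exact: interval_open|rewrite inE /= in_itv /= andbT; exact: em_cont].
move=> x; rewrite /= in_itv /= andbT => x0.
have := la0; have := lab => h1 h2; rewrite cmod_em mulN1r -epow10; apply: epow_le => //; lra.
Qed.

Let em_deriv p q x : 0 < x -> cderiv (em p q) x
  ((epow q (p - 1) x * ((p - b) * expR (- x) - q * (1 - expR (- x))))%:C * m x
   - la * em (p - 1) q x).
Proof.
move=> x0; have d0 := onem_exp_gt0 x0.
apply: cderiv_eq (cderivM (cderiv_real (is_derive_epow q p x0)) (cderiv_mexp b (- la) x0)) _.
rewrite -(@epow_onem _ q (p - 1) p x x0); last by ring.
rewrite /beta_kernel ; set D := 1 - expR (- x) in d0 *; set E := epow q (p - 1) x.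
have Dn : D != 0 by rewrite gt_eqF.
have -> : E * D * (p * (expR (- x) / D) - q) = E * (p * expR (- x) - q * D) by field.
have -> : (E * D)%:C * ((D^-1)%:C * (- la - (b * expR (- x))%:C) * m x) = E%:C * (- la - (b * expR (- x))%:C) * m x.
  by rewrite !mulrA -rmorphM mulfK.
move: D E (expR (- x)) (m x) {d0 Dn} => D E e M; rewrite !realcE; ring.
Qed.

(** The integral of a derivative whose boundary terms vanish: the kernel has modulus of order
    $x^{p-\mathrm{Re}\,\lambda-b}$ at 0, a positive power as $\mathrm{Re}\,\lambda+b\le1$ and
    $p\ge2$, and it decays exponentially. *)
Let em_moment p q : 2 <= p -> 1 <= q ->
  cintegral `]0, +oo[ (fun x => (epow q (p - 1) x * ((p - b) * expR (- x) - q * (1 - expR (- x))))%:C * m x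
   - la * em (p - 1) q x) = 0.
Proof.
move=> p2 q1; have lim0 (F : set_system R) (FF : Filter F) :
    epow (q + Re la) (p - Re la - b) x @[x --> F] --> (0 : R) -> ccvg F (em p q) 0.
  by apply: ccvg0_le; near=> x; rewrite cmod_em.
rewrite -[RHS](subrr (0 : R[i])); apply: (@cintegral_oy_derivative _ (em p q) _ 0 0 0).
- exact: em_deriv.
- move=> x x0; apply: ccontB.
    apply: ccontM; last exact: cderiv_cont (cderiv_mexp _ _ x0).
    apply: ccont_real; apply: continuous_mul; first exact: is_derive_cont (is_derive_epow q (p - 1) x0).
    have ce : {for x, continuous (fun y : R => expR (- y))} by exact: is_derive_cont (is_derive_expN x).
    apply: cvgB; first by apply: cvgMr; exact: ce.
    by apply: cvgMr; apply: cvgB; [exact: cvg_cst|exact: ce].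
  by apply: ccontM; [exact: ccont_cst|exact: em_cont].
- have i1 := beta_kernel_integrable (p := p - 1) (q := q) ltac:(lra) q1.
  have i2 := beta_kernel_integrable (p := p) (q := q) ltac:(lra) q1.
  have := cintegrableB (measurable_itv _) (cintegrableZ ((p - b)%:C - la) (measurable_itv _) i1) (cintegrableZ (p - b + q)%:C (measurable_itv _) i2).
  apply: eq_cintegrable; first exact: measurable_itv.
  move=> x; rewrite inE /= in_itv /= andbT => x0.
  rewrite /beta_kernel -(@epow_onem _ q (p - 1) p x x0); last by ring.
  move: (expR (- x)) (m x) (epow _ _ _) => e M E; rewrite !realcE; ring.
- by apply: lim0; apply: cvg_epow_at0; have := la0; have := lab; lra.
- by apply: lim0; apply: cvg_epow_pinfty; have := la0; lra.
Unshelve. all: by end_near. Qed.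

(** [em_moment] reads $(p-b-\lambda)A(p-1,q)=(p-b+q)A(p,q)$, and here as in [moment_q], where it
    reads $(p-b+q)A(p-1,q+1)=(q+\lambda)A(p-1,q)$, raising an index divides only by the positive
    number $p-b+q$. *)
Let moment_p p q : 2 <= p -> 1 <= q -> A (p - 1) q = 0 -> A p q = 0.
Proof.
have pq0 : 2 <= p -> 1 <= q -> p - b + q != 0 by have := la0; have := lab; move=> *; apply/eqP; lra.
move=> p2 q1 A0; have {}pq0 := pq0 p2 q1; have := em_moment p2 q1.
have i1 := beta_kernel_integrable (p := p - 1) (q := q) ltac:(lra) q1.
have i2 := beta_kernel_integrable (p := p) (q := q) ltac:(lra) q1.
have -> : cintegral `]0, +oo[ (fun x => (epow q (p - 1) x * ((p - b) * expR (- x) - q * (1 - expR (- x))))%:C * m x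
   - la * em (p - 1) q x) = cintegral `]0, +oo[ (fun x => ((p - b)%:C - la) * em (p - 1) q x - (p - b + q)%:C * em p q x).
  apply: eq_cintegral => x; rewrite inE /= in_itv /= andbT => x0.
  rewrite /beta_kernel -(@epow_onem _ q (p - 1) p x x0); last by ring.
  move: (expR (- x)) (m x) (epow _ _ _) => e M E; rewrite !realcE; ring.
rewrite cintegralB; [|exact: measurable_itv|by apply: cintegrableZ; first exact: measurable_itv|by apply: cintegrableZ; first exact: measurable_itv].
rewrite !cintegralZ; [|exact: measurable_itv|exact: i2|exact: measurable_itv|exact: i1].
rewrite -!/(A _ _) A0 mulr0 sub0r => /eqP; rewrite oppr_eq0 mulf_eq0 => /orP[|/eqP h]; last exact: h.
rewrite -realc0 (inj_eq (@complexI _)) (negbTE pq0); discriminate.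
Qed.

Let moment_q p q : 2 <= p -> 1 <= q -> A (p - 1) q = 0 -> A (p - 1) (q + 1) = 0.
Proof.
have pq0 : 2 <= p -> 1 <= q -> p - b + q != 0 by have := la0; have := lab; move=> *; apply/eqP; lra.
move=> p2 q1 A0; have {}pq0 := pq0 p2 q1; have := em_moment p2 q1.
have i1 := beta_kernel_integrable (p := p - 1) (q := q) ltac:(lra) q1.
have i2 := beta_kernel_integrable (p := p - 1) (q := q + 1) ltac:(lra) ltac:(lra).
have -> : cintegral `]0, +oo[ (fun x => (epow q (p - 1) x * ((p - b) * expR (- x) - q * (1 - expR (- x))))%:C * m x
   - la * em (p - 1) q x) = cintegral `]0, +oo[ (fun x => (p - b + q)%:C * em (p - 1) (q + 1) x - (q%:C + la) * em (p - 1) q x).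
  apply: eq_cintegral => x; rewrite inE /= in_itv /= andbT => x0.
  rewrite /beta_kernel -(@expN_epow _ q (q + 1) (p - 1) x) //.
  move: (expR (- x)) (m x) (epow _ _ _) => e M E; rewrite !realcE; ring.
rewrite cintegralB; [|exact: measurable_itv|by apply: cintegrableZ; first exact: measurable_itv|by apply: cintegrableZ; first exact: measurable_itv].
rewrite !cintegralZ; [|exact: measurable_itv|exact: i1|exact: measurable_itv|exact: i2].
rewrite -!/(A _ _) A0 mulr0 subr0 => /eqP; rewrite mulf_eq0 => /orP[|/eqP h]; last exact: h.
rewrite -realc0 (inj_eq (@complexI _)) (negbTE pq0); discriminate.
Qed.

(* The substitution [t = 1 - e^-x] turns this into [B(2 - la - b, 1 + la)]; if it vanished, the
   recursion for the Beta integral would annihilate all the moments of [t (1 - t)]. *)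
Lemma mexp_moment_neq0 : cintegral `]0, +oo[ (fun x => (epow 1 1 x)%:C * mexp b (- la) x) != 0.
Proof.
apply/eqP => A11.
have AS n : A n.+1%:R n.+1%:R = 0.
  elim: n => [|n IH]; first exact: A11.
  have n1 : 1 <= n.+1%:R :> R by rewrite ler1n.
  have s1 : A n.+2%:R n.+1%:R = 0.
    apply: moment_p; [by rewrite -[n.+2%:R]natr1; lra|exact: n1|].
    by rewrite -[in A _ _]natr1 addrK; exact: IH.
  have -> : A n.+2%:R n.+2%:R = A (n.+2%:R + 1 - 1) (n.+1%:R + 1) by rewrite addrK natr1.
  by apply: moment_q; [rewrite -[n.+2%:R]natr1; lra|exact: n1|rewrite addrK; exact: s1].
(* The maximum of $4e^{-x}(1-e^{-x})$ is at $e^{-x}=1/2$. Pairing the kernel with its value [z0]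
   there gives a real function [f] with $f(x_0)=|z_0|^2>0$. *)
pose x0 : R := ln 2; have [z0 z0E] : exists z, z = em 1 1 x0 by exists (em 1 1 x0).
have x00 : 0 < x0 by rewrite ln_gt0 // ltr1n.
have ex0 : expR (- x0) = 2^-1 by rewrite expRN lnK // posrE.
pose f x := Re z0 * Re (em 1 1 x) + Im z0 * Im (em 1 1 x).
pose phi x := 4 * (expR (- x) * (1 - expR (- x))) : R.
have iF n : cintegrable `]0, +oo[ (em n.+1%:R n.+1%:R) by apply: beta_kernel_integrable; rewrite ler1n.
have phiE n x : 0 < x -> phi x ^+ n * f x = 4 ^+ n * (Re z0 * Re (em n.+1%:R n.+1%:R x) + Im z0 * Im (em n.+1%:R n.+1%:R x)).
  move=> xp; have EE : epow n.+1%:R n.+1%:R x = (expR (- x) * (1 - expR (- x))) ^+ n * epow 1 1 x.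
    elim: n => [|n IH]; first by rewrite expr0 mul1r.
    rewrite exprS -mulrA -IH -(epow01 xp) -(epow10 x) !epowM addr0 add0r.
    by rewrite -[n.+2%:R]natr1 addrC.
  rewrite /f /phi !em_Re !em_Im EE exprMn; move: (Re z0) (Im z0) => X Y.
  by move: (_ ^+ n) (4 ^+ n) (epow _ _ _) (Re _) (Im _) => Z W E1 M1 M2; ring.
have if_ n : mu.-integrable `]0, +oo[ (EFin \o (fun x => 4 ^+ n * (Re z0 * Re (em n.+1%:R n.+1%:R x) + Im z0 * Im (em n.+1%:R n.+1%:R x)))).
  have [j1 j2] := iF n.
  have k1 := integrableZl (mu := mu) (measurable_itv _) (Re z0) j1.
  have k2 := integrableZl (mu := mu) (measurable_itv _) (Im z0) j2.
  have k3 := integrableD (mu := mu) (measurable_itv _) k1 k2.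
  have k4 := integrableZl (mu := mu) (measurable_itv _) (4 ^+ n) k3.
  by apply: eq_integrable k4; first exact: measurable_itv.
have int_n n : mu.-integrable `]0, +oo[ (EFin \o (fun x => phi x ^+ n * f x)).
  apply: eq_integrable (if_ n); first exact: measurable_itv.
  by move=> x; rewrite inE /= in_itv /= andbT => xp; rewrite phiE.
have F0 : z0 != 0.
  rewrite z0E; apply/eqP => /(congr1 cmod); rewrite cmod0 cmod_em => /eqP; rewrite gt_eqF //; exact: epow_gt0.
have [n] : exists n, \int[mu]_(x in `]0, +oo[) (phi x ^+ n * f x) != 0.
  apply: (@concentration_neq0 _ _ f phi x0).
  - exact: measurable_itv.
  - by have := lt_nbhsr x00; apply: filterS => x /=; rewrite in_itv /= andbT.
  - by have := int_n 0%N; apply: eq_integrable => // x _ /=; rewrite expr0 mul1r.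
  - have [c1 c2] := em_cont 1 1 x00.
    by apply: cvgD; apply: cvgMr.
  - have : 0 < cmod z0 ^+ 2 by rewrite exprn_gt0 // cmod_gt0.
    by rewrite cmod_sqr /f -z0E !expr2.
  - have ce : {for x0, continuous (fun y : R => expR (- y))} by exact: is_derive_cont (is_derive_expN x0).
    have c1 : {for x0, continuous (fun y : R => 1 - expR (- y))} by exact: is_derive_cont (is_derive_onem_exp x0).
    by apply: cvgMr; exact: (continuous_mul ce c1).
  - move=> x; rewrite /= in_itv /= andbT => xp.
    by rewrite !mulr_ge0 ?expR_ge0 // ltW // onem_exp_gt0.
  - by rewrite /phi ex0; lra.
  - move=> d d0; have r0 := onem_exp_gt0 d0; exists (1 - (1 - expR (- d)) ^+ 2).
      by rewrite /phi ex0; have := exprn_gt0 2 r0; lra.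
    (* With $t=e^{-x}$, $1-4t(1-t)=(1-2t)^2$ and $2t=e^{-(x-x_0)}$. At distance at least [d] from
       [x0] this is at least $(1-e^{-d})^2$, on the left because $e^d-1\ge1-e^{-d}$. *)
    move=> x _ dx; have -> : phi x = 1 - (1 - expR (- (x - x0))) ^+ 2.
      have -> : expR (- (x - x0)) = 2 * expR (- x) by rewrite opprB expRD lnK ?posrE.
      by rewrite /phi; ring.
    rewrite lerD2l lerN2 -[leRHS]real_normK ?num_real // ler_pXn2r ?nnegrE ?(ltW r0) //.
    have [h|h] := leP 0 (x - x0).
      rewrite ger0_norm // in dx; rewrite ger0_norm; last by rewrite subr_ge0 expR_le1 oppr_le0.
      by rewrite lerD2l lerN2 ler_expR lerN2.
    rewrite ltr0_norm // in dx; rewrite distrC; apply: le_trans (ler_norm _).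
    have := expR_ge1Dx (- d); have := expR_ge1Dx (- (x - x0)); lra.
  - exact: int_n.
have E : \int[mu]_(x in `]0, +oo[) (phi x ^+ n * f x) = \int[mu]_(x in `]0, +oo[) (4 ^+ n * (Re z0 * Re (em n.+1%:R n.+1%:R x) + Im z0 * Im (em n.+1%:R n.+1%:R x))).
  by apply: eq_Rintegral => x; rewrite inE /= in_itv /= andbT => xp; rewrite phiE.
have [j1 j2] := iF n; have := AS n => AE.
have ReA : \int[mu]_(x in `]0, +oo[) Re (em n.+1%:R n.+1%:R x) = 0 by rewrite -[LHS]/(Re (A n.+1%:R n.+1%:R)) AE.
have ImA : \int[mu]_(x in `]0, +oo[) Im (em n.+1%:R n.+1%:R x) = 0 by rewrite -[LHS]/(Im (A n.+1%:R n.+1%:R)) AE.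
have k1 := integrableZl (mu := mu) (measurable_itv _) (Re z0) j1.
have k2 := integrableZl (mu := mu) (measurable_itv _) (Im z0) j2.
have k3 := integrableD (mu := mu) (measurable_itv _) k1 k2.
rewrite E RintegralZl; [|exact: measurable_itv|exact: k3].
rewrite RintegralD; [|exact: measurable_itv|exact: k1|exact: k2].
rewrite RintegralZl; [|exact: measurable_itv|exact: j1].
rewrite RintegralZl; [|exact: measurable_itv|exact: j2].
rewrite ReA ImA.
by rewrite !mulr0 addr0 mulr0 eqxx.
Qed.

End BetaIntegral.

(** * Regularity of the constructed eigenfunctions *)

Section Oscillation.
Context {R : realType}.
Notation mu := (@lebesgue_measure R).
Implicit Types (x k t : R) (f : R -> R[i]).

Definition osc t : R[i] := cos t -i* sin t.

Lemma cmod_osc t : cmod (osc t) = 1.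
Proof. by rewrite cmodE /= sqrrN cos2Dsin2 sqrtr1. Qed.

Lemma osc0 : osc 0 = 1.
Proof. by apply: complexP; rewrite /= ?cos0 ?sin0 ?oppr0. Qed.

(** The multiplier $-ik$ by which differentiation acts on [osc (k * x)], that is on $e^{-ikx}$. *)
Definition wave k : R[i] := 0 +i* (- k).

Lemma cmod_wave k : cmod (wave k) = `|k|.
Proof. by rewrite cmodE /= expr0n add0r sqrrN sqrtr_sqr. Qed.

Lemma cderiv_osc k x : cderiv (fun y => osc (k * y)) x (wave k * osc (k * x)).
Proof.
split; rewrite ReImE /=.
- by apply: is_derive_eq (is_derive_cosM k x) _; ring.
- by apply: is_derive_eq (is_deriveN (is_derive_sinM k x)) _; ring.
Qed.

Lemma osc_cont k x : ccont (fun y => osc (k * y)) x.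
Proof. exact: cderiv_cont (cderiv_osc k x). Qed.

Lemma oscM_cintegrable (D : set R) f k : measurable D -> cmeas D f ->
  mu.-integrable D (EFin \o (fun x => cmod (f x))) -> cintegrable D (fun x => f x * osc (k * x)).
Proof.
move=> mD mf fi; apply: (cintegrable_dom mD _ fi).
  apply: cmeasM => //; split; apply: measurable_funTS; apply: continuous_measurable_fun => x.
  - by have [] := osc_cont k x.
  - by have [] := osc_cont k x.
by move=> x _; rewrite cmodM cmod_osc mulr1.
Qed.

Definition half_fourier f k := cintegral `]0, +oo[ (fun x => f x * osc (k * x)).

Lemma half_fourier_exp k : half_fourier (fun x => (expR (- x))%:C) k = (1 - wave k)^-1.
Proof.
have w1 : 1 - wave k != 0.
  by apply/eqP => /(congr1 (@complex.Re R)) /=; rewrite !subr0 => /eqP; rewrite oner_eq0.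
pose H x := (expR (- x))%:C * osc (k * x).
have dH x : cderiv H x ((wave k - 1) * H x).
  apply: cderiv_eq (cderivM (cderiv_real (is_derive_expN x)) (cderiv_osc k x)) _.
  by rewrite /H; move: (expR _) (osc _) (wave k) => e z w; rewrite !realcE; ring.
have mE : measurable_fun setT (fun x : R => expR (- x)).
  by apply: continuous_measurable_fun => x; exact: is_derive_cont (is_derive_expN x).
have i0 : mu.-integrable `]0, +oo[ (EFin \o (fun x => cmod (expR (- x))%:C)).
  have i1 : mu.-integrable `]0, +oo[ (EFin \o (fun x => expR (-1 * x))).
    apply: integrableS (integrable_tail_expM 0 ltr01) => //.
    by move=> x /=; rewrite !in_itv /= !andbT; exact: ltW.
  apply: eq_integrable i1 => // x _ /=.
  by rewrite cmod_real ger0_norm ?expR_ge0 // mulN1r.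
have iH : cintegrable `]0, +oo[ H.
  by apply: oscM_cintegrable => //; apply: cmeas_real; exact: measurable_funTS.
have cH x : ccont H x by exact: cderiv_cont (dH x).
have E : cintegral `]0, +oo[ (fun x => (wave k - 1) * H x) = 0 - 1.
  apply: (@cintegral_oy_derivative _ H).
  - by move=> x _; exact: dH.
  - by move=> x _; apply: ccontM; [exact: ccont_cst|exact: cH].
  - by apply: cintegrableZ; first exact: measurable_itv.
  - have -> : 1 = H 0 by rewrite /H oppr0 expR0 mulr0 osc0 mulr1.
    by have [c1 c2] := cH 0; split; apply: cvg_at_right_filter.
  - apply: ccvg0_le (@cvg_expN_pinfty R); near=> x.
    by rewrite /H cmodM cmod_osc mulr1 cmod_real ger0_norm ?expR_ge0.
rewrite cintegralZ in E; [|exact: measurable_itv|exact: iH].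
rewrite /half_fourier -/H; apply: (mulfI w1); rewrite mulfV //.
by move: E => /(congr1 -%R); rewrite sub0r opprK -mulNr opprB.
Unshelve. all: by end_near. Qed.

Lemma epow0E p x : epow 0 p x = expR (p * ln (1 - expR (- x))).
Proof. by rewrite epowE oppr0 mul0r expR0 mulr1. Qed.

Lemma onem_exp_ge_half x : 0 < x <= 1 -> x / 2 <= 1 - expR (- x).
Proof. by move=> /andP[x0 x1]; rewrite ler_pdivrMr // mulrC onem_exp_ge // ltW. Qed.

Section HalfLineDecay.
Variables (s eta C : R) (f f1 f2 : R -> R[i]).
Hypotheses (s0 : 0 < s) (eta01 : 0 < eta < 1) (C0 : 0 <= C).
Hypotheses (df : forall x, 0 < x -> cderiv f x (f1 x))
           (df1 : forall x, 0 < x -> cderiv f1 x (f2 x))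
           (cf2 : forall x, 0 < x -> ccont f2 x).
Hypothesis fC : forall x, 0 < x -> [/\ cmod (f x) <= C * epow s (1 - eta) x,
  cmod (f1 x) <= C * epow s (- eta) x & cmod (f2 x) <= C * epow s (- 1 - eta) x].

Let K := (Num.min eta s)^-1.

Let K0 : 0 < K.
Proof. by case/andP: eta01 => e0 _; rewrite invr_gt0 lt_min e0. Qed.

(** The function [epow s (- eta)] decreases to 0 at infinity, and minus its derivative is at least
    $\min(\eta,s)$ times the integrand. *)
Let tail_epow a : 0 < a -> mu.-integrable `]a, +oo[ (EFin \o epow s (- 1 - eta)) /\
  \int[mu]_(x in `]a, +oo[) epow s (- 1 - eta) x <= K * epow s (- eta) a.
Proof.
move=> a0; have /andP[e0 e1] := eta01; pose k := Num.min eta s.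
have k0 : 0 < k by rewrite lt_min e0.
have [ke ks] : k <= eta /\ k <= s by rewrite /k !ge_min !lexx orbT.
pose g x := epow s (- eta) x * (eta * (expR (- x) / (1 - expR (- x))) + s).
have dG (x : R) : a <= x -> is_derive x (1 : R) (epow s (- eta)) (- g x).
  move=> ax; apply: is_derive_eq (is_derive_epow s (- eta) (lt_le_trans a0 ax)) _.
  by rewrite /g; ring.
have gE (x : R) : 0 < x -> g x = epow s (- 1 - eta) x * (eta * expR (- x) + s * (1 - expR (- x))).
  move=> x0; have d0 := onem_exp_gt0 x0.
  rewrite /g -(@epow_onem _ s (- 1 - eta) (- eta) x x0); last by ring.
  by field; rewrite gt_eqF.
have pg (x : R) : 0 < x -> k * epow s (- 1 - eta) x <= g x.
  move=> x0; have d0 := onem_exp_gt0 x0; rewrite gE // mulrC ler_pM2l ?epow_gt0 //.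
  by have := expR_gt0 (- x); nra.
have cg (x : R) : a <= x -> {for x, continuous g}.
  move=> ax; have x0 := lt_le_trans a0 ax.
  apply: continuous_mul; first exact: is_derive_cont (is_derive_epow _ _ x0).
  have c1 : {for x, continuous (fun y : R => expR (- y))} by exact: is_derive_cont (is_derive_expN x).
  have c2 : {for x, continuous (fun y : R => (1 - expR (- y))^-1)} by exact: is_derive_cont (is_derive_onem_expV x0).
  have c3 := continuous_mul c1 c2.
  by apply: cvgD; [apply: cvgMr; exact: c3|exact: cvg_cst].
have g0 (x : R) : a <= x -> 0 <= g x.
  by move=> ax; apply: le_trans (pg x (lt_le_trans a0 ax)); rewrite mulr_ge0 ?epow_ge0 // ltW.
have [ig Eg] := Rintegral_tail_decreasing dG cg g0 (cvg_epow_pinfty _ s0).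
have iK := integrableZl (mu := mu) (measurable_itv _) K ig.
have pK x : `]a, +oo[%classic x -> epow s (- 1 - eta) x <= K * g x.
  rewrite /= in_itv /= andbT => ax; rewrite /K -/k mulrC ler_pdivlMr // mulrC; exact: pg (lt_trans a0 ax).
have ie : mu.-integrable `]a, +oo[ (EFin \o epow s (- 1 - eta)).
  apply: le_integrable iK => //.
    apply/measurable_EFinP; apply: open_continuous_measurable_fun; first exact: interval_open.
    move=> x; rewrite inE /= in_itv /= andbT => ax.
    exact: is_derive_cont (is_derive_epow _ _ (lt_trans a0 ax)).
  move=> x ax; rewrite /= lee_fin ger0_norm ?epow_ge0 //.
  by apply: le_trans (pK x ax) (ler_norm _).
split=> //; rewrite -Eg -RintegralZl //.
by apply: le_Rintegral.
Qed.

Let cf x : 0 < x -> ccont f x. Proof. by move=> x0; exact: cderiv_cont (df x0). Qed.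
Let cf1 x : 0 < x -> ccont f1 x. Proof. by move=> x0; exact: cderiv_cont (df1 x0). Qed.

Let tail_cintegrable (h : R -> R[i]) p k a : 0 < a -> - 1 - eta <= p ->
  (forall x, 0 < x -> ccont h x) -> (forall x, 0 < x -> cmod (h x) <= C * epow s p x) ->
  cintegrable `]a, +oo[ (fun x => h x * osc (k * x)).
Proof.
move=> a0 hp ch hC; have [ie _] := tail_epow a0.
apply: cintegrable_dom (integrableZl (mu := mu) (measurable_itv _) C ie) _ => //.
  apply: ccont_cmeas; first exact: interval_open.
  move=> x; rewrite inE /= in_itv /= andbT => ax; apply: ccontM; last exact: osc_cont.
  by apply: ch; exact: lt_trans ax.
move=> x; rewrite /= in_itv /= andbT => ax; have x0 := lt_trans a0 ax.
rewrite cmodM cmod_osc mulr1; apply: le_trans (hC x x0) _.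
by rewrite ler_wpM2l //; apply: epow_le.
Qed.

Let tail_parts (h h1 : R -> R[i]) p q k a : 0 < a -> - 1 - eta <= p -> - 1 - eta <= q ->
  (forall x, 0 < x -> cderiv h x (h1 x)) -> (forall x, 0 < x -> ccont h1 x) ->
  (forall x, 0 < x -> cmod (h x) <= C * epow s p x) ->
  (forall x, 0 < x -> cmod (h1 x) <= C * epow s q x) ->
  wave k * cintegral `]a, +oo[ (fun x => h x * osc (k * x)) =
  - (h a * osc (k * a)) - cintegral `]a, +oo[ (fun x => h1 x * osc (k * x)).
Proof.
move=> a0 hp hq dh ch1 hC h1C; have ch x : 0 < x -> ccont h x by move=> /dh; exact: cderiv_cont.
have i0 := tail_cintegrable k a0 hp ch hC; have i1 := tail_cintegrable k a0 hq ch1 h1C.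
have iw := cintegrableZ (wave k) (measurable_itv _) i0.
have E : cintegral `]a, +oo[ (fun x => h1 x * osc (k * x) + wave k * (h x * osc (k * x))) = 0 - h a * osc (k * a).
  apply: (@cintegral_oy_derivative _ (fun x => h x * osc (k * x))).
  - move=> x ax; apply: cderiv_eq (cderivM (dh x (lt_trans a0 ax)) (cderiv_osc k x)) _.
    by rewrite [h x * _]mulrCA.
  - move=> x ax; have x0 := lt_trans a0 ax; apply: ccontD.
      by apply: ccontM; [exact: ch1|exact: osc_cont].
    by apply: ccontM; [exact: ccont_cst|apply: ccontM; [exact: ch|exact: osc_cont]].
  - exact: cintegrableD (measurable_itv _) i1 iw.
  - have [c1 c2] := ccontM (ch a a0) (osc_cont k a); split; exact: cvg_at_right_filter.
  - have lG : C * epow s p x @[x --> +oo] --> (0 : R).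
      by rewrite -(mulr0 C); apply: cvgMr; exact: cvg_epow_pinfty.
    apply: ccvg0_le lG; near=> x; rewrite cmodM cmod_osc mulr1; apply: hC.
    by near: x; apply: nbhs_pinfty_gt; exact: num_real.
rewrite cintegralD in E; [|exact: measurable_itv|exact: i1|exact: iw].
rewrite cintegralZ in E; [|exact: measurable_itv|exact: i0].
by move: E; move: (cintegral _ _) (cintegral _ _) => X Y /(canRL (addKr _)) ->; rewrite sub0r addrC.
Unshelve. all: by end_near. Qed.

(** The second derivative need not be integrable at the origin, so the integral is cut at $r=1/|k|$.
    On [(0, r]] the integrand is $O(|k|^{\eta-1})$ over a length $1/|k|$. Beyond [r], two
    integrations by parts leave boundary terms and a tail of [f2] which, up to the powers of $1/|k|$
    gained, are $O(|k|^\eta)$ at worst. *)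
Lemma half_fourier_decay : exists2 M : R, 0 <= M &
  forall k, 1 <= `|k| -> cmod (half_fourier f k) <= M * (`|k| `^ eta / `|k| ^+ 2).
Proof.
have /andP[e0 e1] := eta01.
exists (C * (8 + 4 * K)); first by rewrite mulr_ge0 // addr_ge0 // mulr_ge0 // ltW.
move=> k k1; have k0 : 0 < `|k| by apply: lt_le_trans k1.
pose r := `|k|^-1; pose X := `|k| `^ eta.
have X0 : 0 <= X by exact: powR_ge0.
have r0 : 0 < r by rewrite invr_gt0.
have r1 : r <= 1 by rewrite invf_le1.
have dr : 0 < 1 - expR (- r) by exact: onem_exp_gt0.
have Er : epow 0 (- eta) r <= 2 * X.
  rewrite epow0E.
  apply: (@le_trans _ _ (expR (eta * ln (2 * `|k|)))).
    rewrite ler_expR mulNr -mulrN ler_wpM2l ?(ltW e0) // -lnV ?posrE // ler_ln ?posrE ?invr_gt0 ?mulr_gt0 //.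
    rewrite -[leRHS]invrK lef_pV2 ?posrE ?invr_gt0 ?mulr_gt0 // invfM mulrC.
    by apply: onem_exp_ge_half; rewrite r0.
  rewrite lnM ?posrE // mulrDr expRD -/(2 * X) /X /powR gt_eqF // ler_wpM2r ?expR_ge0 //.
  rewrite -[leRHS](@lnK _ 2) ?posrE // ler_expR -[leRHS]mul1r ler_wpM2r ?ln_ge0 ?ler1n //.
  exact: ltW.
have E2 p x : 0 < x -> epow s p x <= epow 0 p x by move=> x0; apply: epow_le => //; exact: ltW.
have E1 x : 0 < x <= r -> epow s (1 - eta) x <= 2 * X / `|k|.
  move=> /andP[x0 xr]; apply: le_trans (E2 _ _ x0) _.
  apply: (@le_trans _ _ (epow 0 (1 - eta) r)).
    have h1 : 0 <= 1 - eta by lra.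
    rewrite !epow0E ler_expR; apply: (ler_wpM2l h1).
    by rewrite ler_ln ?posrE ?onem_exp_gt0 // lerD2l lerN2 ler_expR lerN2.
  rewrite -(@epow_onem _ 0 (- eta) (1 - eta) r r0); last by ring.
  apply: ler_pM; rewrite ?epow_ge0 ?(ltW dr) //; exact: onem_exp_le.
have F0 x : 0 < x -> cmod (f x) <= C * epow s (1 - eta) x by move=> /fC[].
have F1 x : 0 < x -> cmod (f1 x) <= C * epow s (- eta) x by move=> /fC[].
have F2 x : 0 < x -> cmod (f2 x) <= C * epow s (- 1 - eta) x by move=> /fC[].
have q1 : - 1 - eta <= - eta by lra.
have q0 : - 1 - eta <= 1 - eta by lra.
have T2 : cmod (cintegral `]r, +oo[ (fun x => f2 x * osc (k * x))) <= C * (4 * K * X).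
  have [ie Ie] := tail_epow r0.
  have iC := integrableZl (mu := mu) (measurable_itv _) C ie.
  apply: (@le_trans _ _ (2 * \int[mu]_(x in `]r, +oo[) (C * epow s (- 1 - eta) x))).
    apply: cmod_cintegral_le iC _ => //.
      exact: cintegrable_cmeas (tail_cintegrable k r0 (lexx _) cf2 F2).
    move=> x; rewrite /= in_itv /= andbT => rx; rewrite cmodM cmod_osc mulr1; apply: F2; exact: lt_trans rx.
  rewrite RintegralZl // mulrCA ler_wpM2l //.
  have := ler_wpM2l (ltW K0) (le_trans (E2 (- eta) r r0) Er); lra.
have T1 : cmod (cintegral `]r, +oo[ (fun x => f1 x * osc (k * x))) <= C * (2 * X + 4 * K * X) / `|k|.
  rewrite ler_pdivlMr // mulrC -cmod_wave -cmodM.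
  rewrite (tail_parts k r0 q1 (lexx _) df1 cf2 F1 F2) -opprD cmodN.
  apply: le_trans (cmodD _ _) _; rewrite mulrDr; apply: lerD => //.
  rewrite cmodM cmod_osc mulr1; apply: le_trans (F1 r r0) _; rewrite ler_wpM2l //.
  exact: le_trans (E2 _ _ r0) Er.
have T0 : cmod (cintegral `]r, +oo[ (fun x => f x * osc (k * x))) <= C * (4 * X + 4 * K * X) / `|k| ^+ 2.
  rewrite expr2 invfM mulrA ler_pdivlMr // mulrC -cmod_wave -cmodM.
  rewrite (tail_parts k r0 q0 q1 df cf1 F0 F1) -opprD cmodN.
  apply: le_trans (cmodD _ _) _.
  have -> : C * (4 * X + 4 * K * X) / cmod (wave k) = C * (2 * X / cmod (wave k)) + C * (2 * X + 4 * K * X) / cmod (wave k) by ring.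
  rewrite cmod_wave; apply: lerD => //.
  rewrite cmodM cmod_osc mulr1; apply: le_trans (F0 r r0) _; rewrite ler_wpM2l //.
  by apply: E1; rewrite r0 lexx.
have iC : mu.-integrable `]0, r] (EFin \o (fun=> C * (2 * X / `|k|))).
  by apply: integrableS (integrable_cst_itv 0 r _) => //; exact: subset_itv_oc_cc.
have ifr : cintegrable `]0, r] (fun x => f x * osc (k * x)).
  apply: cintegrable_dom iC _ => //.
    apply: (@cmeasS _ _ `]0, +oo[%classic) => //.
      by move=> x /=; rewrite !in_itv /= => /andP[->].
    apply: ccont_cmeas; first exact: interval_open.
    by move=> x; rewrite inE /= in_itv /= andbT => x0; apply: ccontM; [exact: cf|exact: osc_cont].
  move=> x; rewrite /= in_itv /= => x0r; have /andP[x0 xr] := x0r.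
  rewrite cmodM cmod_osc mulr1; apply: le_trans (F0 x x0) _; rewrite ler_wpM2l //; exact: E1.
have S0 : cmod (cintegral `]0, r] (fun x => f x * osc (k * x))) <= C * (4 * X) / `|k| ^+ 2.
  apply: (@le_trans _ _ (2 * \int[mu]_(x in `]0, r]) (C * (2 * X / `|k|)))).
    apply: cmod_cintegral_le iC _ => //; first exact: cintegrable_cmeas ifr.
    move=> x; rewrite /= in_itv /= => x0r; have /andP[x0 xr] := x0r.
    rewrite cmodM cmod_osc mulr1; apply: le_trans (F0 x x0) _; rewrite ler_wpM2l //; exact: E1.
  have -> : \int[mu]_(x in `]0, r]) (C * (2 * X / `|k|)) = C * (2 * X / `|k|) * r.
    rewrite Rintegral_cst; [|exact: measurable_itv]; congr (_ * _).
    have mr : mu `]0, r]%classic = r%:E by rewrite lebesgue_measure_itv /= lte_fin r0 oppr0 adde0.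
    have h : fine (mu `]0, r]%classic) = r by rewrite mr.
    exact: h.
  by rewrite /r expr2 invfM; lra.
have U : `]0, +oo[%classic = `]0, r]%classic `|` `]r, +oo[%classic :> set R.
  by rewrite -itv_bndbnd_setU // bnd_simp ltW.
have -> : half_fourier f k = cintegral `]0, r] (fun x => f x * osc (k * x)) + cintegral `]r, +oo[ (fun x => f x * osc (k * x)).
  rewrite /half_fourier U cintegral_setU //.
    apply/disj_setPRL => x /=; rewrite !in_itv /= andbT => rx; apply/negP; rewrite negb_and -ltNge rx orbT //.
  have [a1 a2] := ifr; have [b1 b2] := tail_cintegrable k r0 q0 cf F0.
  by split; apply: integrable_setU.
apply: le_trans (cmodD _ _) _; apply: le_trans (lerD S0 T0) _.
rewrite -/X; lra.
Qed.

End HalfLineDecay.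

End Oscillation.

(** * Pointwise and distributional Fourier transforms *)

Section FourierFubini.
Context {R : realType}.
Notation mu := (@lebesgue_measure R).
Implicit Types (x k : R).

(** Fubini's theorem for the product of [q], [psi] and the bounded kernel; cosine and sine are the
    kernels to which it is applied, after the transform is split into real integrals. *)
Lemma Rfubini_kernel (q psi K : R -> R) : mu.-integrable setT (EFin \o q) ->
  mu.-integrable setT (EFin \o psi) -> (forall x : R, {for x, continuous K}) ->
  (forall x, `|K x| <= 1) ->
  mu.-integrable setT (EFin \o (fun x => q x * \int[mu]_k (psi k * K (x * k)))) /\
      \int[mu]_x (q x * \int[mu]_k (psi k * K (x * k))) =
      \int[mu]_k ((\int[mu]_x (q x * K (k * x))) * psi k).
Proof.
move=> iq ip cK K1.
have mK : measurable_fun setT K by exact: continuous_measurable_fun.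
have mq : measurable_fun setT q by have /integrableP[/measurable_EFinP] := iq.
have mp : measurable_fun setT psi by have /integrableP[/measurable_EFinP] := ip.
pose f (z : measurableTypeR R * measurableTypeR R) := (q z.1 * (psi z.2 * K (z.1 * z.2)))%:E.
have mf : measurable_fun setT f.
  apply/measurable_EFinP; apply: measurable_funM; first exact: (measurableT_comp mq measurable_fst).
  apply: measurable_funM; first exact: (measurableT_comp mp measurable_snd).
  apply: (measurableT_comp mK); apply: measurable_funM; [exact: measurable_fst|exact: measurable_snd].
have iM (h : R -> R) x : mu.-integrable setT (EFin \o h) -> mu.-integrable setT (EFin \o (fun k => h k * K (x * k))).
  move=> ih; have mh : measurable_fun setT h by have /integrableP[/measurable_EFinP] := ih.
  apply: le_integrable ih => //.
    apply/measurable_EFinP; apply: measurable_funM => //; apply: (measurableT_comp mK).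
    exact: measurable_funM.
  by move=> k _; rewrite /= lee_fin normrM ler_piMr.
have im : (mu \x mu)%E.-integrable setT f.
  apply/(@integrable12ltyP _ _ _ _ _ mu mu f mf).
  pose M := \int[mu]_k `|psi k|.
  have ia := integrable_norm ip.
  have h1 x : (\int[mu]_y `|f (x, y)| <= (`|q x| * M)%:E)%E.
    have -> : (`|q x| * M)%:E = (\int[mu]_y (`|q x| * `|psi y|)%:E)%E.
      rewrite EFinM /M /Rintegral fineK; last by apply: integrable_fin_num.
      by rewrite -integralZl.
    apply: ge0_le_integral => //.
    - by apply/measurable_EFinP; apply: measurableT_comp => //;
        have /measurable_EFinP := measurable_fun_pair2 x mf.
    - by apply/measurable_EFinP; apply: measurable_funM => //; exact: measurableT_comp.
    - by move=> y _; rewrite /f /= lee_fin !normrM mulrA ler_piMr // mulr_ge0.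
  have iqM := integrableZl (mu := mu) measurableT M (integrable_norm iq).
  apply: (@le_lt_trans _ _ (\int[mu]_x (M * `|q x|)%:E)%E); last first.
    by have h := integrable_fin_num measurableT iqM; rewrite ltey_eq h.
  apply: ge0_le_integral => //.
  - by move=> x _; exact: integral_ge0.
  - have maf : measurable_fun setT (fun z => `|f z|%E) by exact: measurableT_comp.
    by apply: (@measurable_fun_fubini_tonelli_F _ _ _ _ _ mu (fun z => `|f z|%E)).
  - by have /integrableP[] := iqM.
  - by move=> x _; rewrite mulrC; exact: h1.
have EF x : (\int[mu]_y f (x, y))%E = (q x * \int[mu]_k (psi k * K (x * k)))%:E.
  rewrite EFinM /Rintegral fineK; last by apply: integrable_fin_num => //; exact: iM.
  by rewrite -integralZl //; exact: iM.
have EG k : (\int[mu]_x f (x, k))%E = ((\int[mu]_x (q x * K (k * x))) * psi k)%:E.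
  rewrite mulrC EFinM /Rintegral fineK; last by apply: integrable_fin_num => //; exact: iM.
  rewrite -integralZl //; last exact: iM.
  by apply: eq_integral => x _; rewrite /f /= -EFinM; congr (_%:E); rewrite [x * k]mulrC; ring.
split.
- by have := integrable_fubini_F im; apply: eq_integrable => // x _; rewrite /fubini_F EF.
- rewrite /Rintegral; congr fine; transitivity (\int[mu]_x \int[mu]_y f (x, y))%E.
    by apply: eq_integral => x _; rewrite EF.
  by rewrite (Fubini im); apply: eq_integral => k _; rewrite EG.
Qed.

Lemma schwartz_integrable (psi : R -> R) : schwartz psi -> mu.-integrable setT (EFin \o psi).
Proof.
move=> [sp dp]; have [M0 h0] := dp 0%N 0%N; have [M2 h2] := dp 2%N 0%N.
have e1 : 1 / 2 < 1 :> R by lra.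
have i := integrableZl (mu := mu) measurableT (M0 + M2) (integrable_japanese e1).
apply: le_integrable i => //.
  apply/measurable_EFinP; apply: continuous_measurable_fun => x.
  by have := @smooth_cont R psi 0%N x sp; rewrite derive1n0.
move=> x _; rewrite /= lee_fin; apply: le_trans (ler_norm _).
have p0 : 0 < 1 + x ^+ 2 by have := sqr_ge0 x; lra.
rewrite powRN powRr1 ?(ltW p0) // ler_pdivlMr //.
have := h0 x; have := h2 x; rewrite derive1n0 expr0 mul1r real_normK ?num_real // => a1 a2.
lra.
Qed.

Definition fourier_integral (p : R -> R[i]) k := cintegral setT (fun x => p x * osc (k * x)).

Lemma fourier_integralE (p : R -> R[i]) k : cintegrable setT p ->
  fourier_integral p k =
  (\int[mu]_x (Re (p x) * cos (k * x)) + \int[mu]_x (Im (p x) * sin (k * x)))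
  +i* (\int[mu]_x (Im (p x) * cos (k * x)) - \int[mu]_x (Re (p x) * sin (k * x))).
Proof.
move=> [ir ii].
have iM (h K : R -> R) : mu.-integrable setT (EFin \o h) -> (forall x : R, {for x, continuous K}) ->
    (forall x, `|K x| <= 1) -> mu.-integrable setT (EFin \o (fun x => h x * K x)).
  move=> ih cK K1; have mh : measurable_fun setT h by have /integrableP[/measurable_EFinP] := ih.
  apply: le_integrable ih => //.
    by apply/measurable_EFinP; apply: measurable_funM => //; exact: continuous_measurable_fun.
  by move=> x _; rewrite /= lee_fin normrM ler_piMr.
have c1 h ih := iM h _ ih (@cosM_cont R k) (fun x => norm_cos_le1 (k * x)).
have s1 h ih := iM h _ ih (@sinM_cont R k) (fun x => norm_sin_le1 (k * x)).
apply: complexP => /=.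
- rewrite -RintegralD; [|exact: measurableT|exact: c1|exact: s1].
  by apply: eq_Rintegral => x _; rewrite cReM /=; ring.
- rewrite -RintegralB; [|exact: measurableT|exact: c1|exact: s1].
  by apply: eq_Rintegral => x _; rewrite cImM /=; ring.
Qed.

Lemma fourierE (psi : R -> R) x : mu.-integrable setT (EFin \o psi) ->
  fourier psi x = (\int[mu]_k (psi k * cos (x * k))) -i* (\int[mu]_k (psi k * sin (x * k))).
Proof.
move=> ip; have ipc : cintegrable setT (fun k => (psi k)%:C) by exact: cintegrable_real.
rewrite -[LHS]/(fourier_integral (fun k => (psi k)%:C) x) fourier_integralE //.
have z (K : R -> R) : \int[mu]_k (Im (psi k)%:C * K k) = 0.
  by under eq_Rintegral do rewrite /= mul0r; rewrite /Rintegral integral0.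
by rewrite !z addr0 add0r.
Qed.

(** The multiplication formula, part by part: for an integrable function the pointwise transform is
    the distributional one. *)
Lemma fourier_integral_transform (p : R -> R[i]) : cintegrable setT p ->
  cmeasurable (fourier_integral p) /\ is_fourier_transform p (fourier_integral p).
Proof.
move=> ip; have [ir ii] := ip.
have cc (x : R) : {for x, continuous (@cos R)} by exact: continuous_cos.
have cs (x : R) : {for x, continuous (@sin R)} by exact: continuous_sin.
pose g1 k := \int[mu]_x (Re (p x) * cos (k * x)).
pose g2 k := \int[mu]_x (Im (p x) * sin (k * x)).
pose g3 k := \int[mu]_x (Im (p x) * cos (k * x)).
pose g4 k := \int[mu]_x (Re (p x) * sin (k * x)).
have gE : fourier_integral p = fun k => (g1 k + g2 k) +i* (g3 k - g4 k).
  by apply/funext => k; rewrite fourier_integralE.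
have mg (q K : R -> R) : mu.-integrable setT (EFin \o q) -> (forall x : R, {for x, continuous K}) ->
    (forall x, `|K x| <= 1) -> measurable_fun setT (fun k => \int[mu]_x (q x * K (k * x))).
  (* Fubini yields the measurability of this partial integral multiplied by an integrable weight. A
     Gaussian weight, which never vanishes, can be divided out. *)
  move=> iq cK K1; have [iE _] := @gaussian_mass R 1 0 ltr01.
  have iE' : mu.-integrable setT (EFin \o (fun x => gaussian 1 x)).
    by apply: eq_integrable iE => // x _ /=; rewrite subr0.
  have [/integrableP[/measurable_EFinP m _] _] := Rfubini_kernel iE' iq cK K1.
  have mV : measurable_fun setT (fun x : R => (gaussian 1 x)^-1).
    apply: continuous_measurable_fun => x; apply: cvgV; first by rewrite gt_eqF // gaussian_gt0.
    exact: gaussian_cont.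
  have := measurable_funM mV m; apply: eq_measurable_fun => x _.
  by rewrite /= mulrA mulVf ?mul1r // gt_eqF // gaussian_gt0.
split.
  rewrite gE; split => /=.
  - by apply: measurable_funD; apply: mg => // x; [exact: norm_cos_le1|exact: norm_sin_le1].
  - by apply: measurable_funB; apply: mg => // x; [exact: norm_cos_le1|exact: norm_sin_le1].
move=> psi /schwartz_integrable ips.
have F q K iq cK K1 := @Rfubini_kernel q psi K iq ips cK K1.
have G (q K : R -> R) (iq : mu.-integrable setT (EFin \o q)) (cK : forall x : R, {for x, continuous K})
    (K1 : forall x, `|K x| <= 1) : mu.-integrable setT (EFin \o (fun k => (\int[mu]_x (q x * K (k * x))) * psi k)).
  have [i _] := @Rfubini_kernel psi q K ips iq cK K1.
  by apply: eq_integrable i => // k _; rewrite /= mulrC.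
have [a1 b1] := F _ _ ir cc (@norm_cos_le1 R); have [a2 b2] := F _ _ ii cs (@norm_sin_le1 R).
have [a3 b3] := F _ _ ii cc (@norm_cos_le1 R); have [a4 b4] := F _ _ ir cs (@norm_sin_le1 R).
have d1 := G _ _ ir cc (@norm_cos_le1 R); have d2 := G _ _ ii cs (@norm_sin_le1 R).
have d3 := G _ _ ii cc (@norm_cos_le1 R); have d4 := G _ _ ir cs (@norm_sin_le1 R).
rewrite gE; apply: complexP.
- transitivity (\int[mu]_x (Re (p x) * \int[mu]_k (psi k * cos (x * k)) + Im (p x) * \int[mu]_k (psi k * sin (x * k)))).
    by apply: eq_Rintegral => x _; rewrite fourierE // cReM /=; ring.
  rewrite RintegralD; [|exact: measurableT|exact: a1|exact: a2].
  rewrite b1 b2 -RintegralD; [|exact: measurableT|exact: d1|exact: d2].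
  by apply: eq_Rintegral => k _; rewrite cReM /= /g1 /g2; ring.
- transitivity (\int[mu]_x (Im (p x) * \int[mu]_k (psi k * cos (x * k)) - Re (p x) * \int[mu]_k (psi k * sin (x * k)))).
    by apply: eq_Rintegral => x _; rewrite fourierE // cImM /=; ring.
  rewrite RintegralB; [|exact: measurableT|exact: a3|exact: a4].
  rewrite b3 b4 -RintegralB; [|exact: measurableT|exact: d3|exact: d4].
  by apply: eq_Rintegral => k _; rewrite cImM /= /g3 /g4; ring.
Qed.

(** For $|k|\ge1$ the squared transform weighted by $(1+k^2)^s$ is $O((1+k^2)^{-(2-\eta-s)})$,
    integrable when $\eta<3/2-s$; [eta] is at most half that margin. Low frequencies are covered by
    the uniform bound of the transform. *)
Lemma inHs_of_decay (p : R -> R[i]) : inL2 p -> cintegrable setT p ->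
  (forall eta, 0 < eta < 1 -> exists2 C : R, 0 <= C &
     forall k, 1 <= `|k| -> cmod (fourier_integral p k) <= C * (`|k| `^ eta / `|k| ^+ 2)) ->
  forall s, s < 3 / 2 -> inHs s p.
Proof.
move=> hp ip hd s s32; have [mg hf] := fourier_integral_transform ip.
split; first exact: hp.
exists (fourier_integral p); split; [exact: mg|exact: hf|].
pose eta := Num.min (1 / 2) ((3 / 2 - s) / 2).
have eta01 : 0 < eta < 1 by rewrite lt_min gt_min divr_gt0 //=; apply/andP; split; [|apply/orP; left]; lra.
have etas : eta <= (3 / 2 - s) / 2 by rewrite ge_min lexx orbT.
have [C C0 hC] := hd eta eta01; have /andP[e0 e1] := eta01.
have ic := cintegrable_cmod measurableT ip.
pose M := 2 * \int[mu]_x cmod (p x).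
have M0 : 0 <= M by rewrite mulr_ge0 // Rintegral_ge0 // => x _; exact: cmod_ge0.
have hM k : cmod (fourier_integral p k) <= M.
  have mm := cintegrable_cmeas (oscM_cintegrable k measurableT (cintegrable_cmeas ip) ic).
  apply: cmod_cintegral_le ic _ => //.
  by move=> x _; rewrite cmodM cmod_osc mulr1.
pose e := 2 - eta - s; have e12 : 1 / 2 < e by rewrite /e; lra.
pose K := 4 * (C ^+ 2 + M ^+ 2).
have iJ := integrableZl (mu := mu) measurableT K (integrable_japanese e12).
have mP : measurable_fun setT (fun k : R => (1 + k ^+ 2) `^ s * cmod (fourier_integral p k) ^+ 2).
  apply: measurable_funM.
    apply: (@measurableT_comp _ _ _ _ _ _ (fun y => y `^ s)); first exact: measurable_powR.
    by apply: measurable_funD => //; exact: measurable_funX.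
  by apply: measurable_funX; exact: cmeas_cmod.
have key k : (1 + k ^+ 2) `^ s * cmod (fourier_integral p k) ^+ 2 <= K * (1 + k ^+ 2) `^ (- e).
  set h := 1 + k ^+ 2; have h1 : 1 <= h by rewrite lerDl sqr_ge0.
  have h0 : 0 < h by apply: lt_le_trans h1.
  have hs : 0 < h `^ s by rewrite powR_gt0.
  have he : h `^ (- e) = h `^ s * h `^ (eta - 2).
    by rewrite -powRD; [congr (_ `^ _); rewrite /e; ring|apply/implyP => _; rewrite gt_eqF].
  rewrite he [K * (h `^ s * _)]mulrCA; apply: ler_wpM2l; first exact: ltW.
  have ->: h `^ (eta - 2) = h `^ eta / h ^+ 2.
    rewrite powRD; last by apply/implyP => _; rewrite gt_eqF.
    by rewrite powRN -[2]/(2%:R) powR_mulrn // ltW.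
  have he0 : 1 <= h `^ eta.
    by have := ler_powR h1 (ltW e0); rewrite powRr0.
  rewrite mulrA ler_pdivlMr ?exprn_gt0 //.
  have [k1|k1] := leP 1 `|k|.
    have kk : `|k| ^+ 2 = k ^+ 2 by rewrite real_normK ?num_real.
    have k2 : 1 <= k ^+ 2 by rewrite -kk exprn_ege1.
    have hk : h <= 2 * k ^+ 2 by rewrite /h; lra.
    have kp : 0 < `|k| by apply: lt_le_trans k1.
    have Y0 : 0 <= `|k| `^ eta by exact: powR_ge0.
    have Yh : (`|k| `^ eta) ^+ 2 <= h `^ eta.
      rewrite expr2 -powRM // -expr2 kk; apply: ge0_ler_powR; rewrite ?nnegrE ?(ltW e0) ?sqr_ge0 ?(ltW h0) //.
      by rewrite /h lerDr.
    have := hC k k1; rewrite kk mulrA ler_pdivlMr; last by apply: lt_le_trans k2.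
    set g := cmod _; have g0 : 0 <= g by exact: cmod_ge0.
    move=> gk; have g2 : (g * k ^+ 2) ^+ 2 <= (C * `|k| `^ eta) ^+ 2.
      by apply: lerXn2r gk; rewrite nnegrE; [exact: mulr_ge0 g0 (sqr_ge0 _)|exact: mulr_ge0].
    have hh : h ^+ 2 <= 4 * (k ^+ 2) ^+ 2.
      have := ltW h0; have := sqr_ge0 k; clear - hk; move: (k ^+ 2) hk => z hk z0 hp0; nra.
    have G2 : g ^+ 2 * h ^+ 2 <= 4 * (C ^+ 2 * h `^ eta).
      apply: (@le_trans _ _ (g ^+ 2 * (4 * (k ^+ 2) ^+ 2))); first by rewrite ler_wpM2l ?sqr_ge0.
      rewrite !exprMn in g2; have := ler_wpM2l (sqr_ge0 C) Yh; clear - g2; lra.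
    apply: le_trans G2 _; have := mulr_ge0 (sqr_ge0 M) (powR_ge0 h eta); rewrite /K; clear; lra.
  have h2 : h <= 2.
    have : `|k| ^+ 2 <= 1 by rewrite exprn_ile1 // ltW.
    by rewrite real_normK ?num_real // /h; lra.
  have hh : h ^+ 2 <= 4 by rewrite expr2; have := ler_pM (ltW h0) (ltW h0) h2 h2; lra.
  have gM : cmod (fourier_integral p k) ^+ 2 <= M ^+ 2 by rewrite ler_pXn2r ?nnegrE ?cmod_ge0 ?hM.
  apply: (@le_trans _ _ (M ^+ 2 * 4)); first by apply: ler_pM; rewrite ?sqr_ge0.
  have := sqr_ge0 C; have := sqr_ge0 M; rewrite /K; move: (h `^ eta) he0 (M ^+ 2) (C ^+ 2) => z z1 X Y X0 Y0; clear - z1 X0 Y0; nra.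
apply: (@le_lt_trans _ _ (\int[mu]_k (K * (1 + k ^+ 2) `^ (- e))%:E)%E).
  apply: ge0_le_integral => //.
  - by move=> k _; rewrite lee_fin mulr_ge0 ?powR_ge0 ?sqr_ge0.
  - exact/measurable_EFinP.
  - by have /integrableP[] := iJ.
  - by move=> k _; rewrite lee_fin.
by have h := integrable_fin_num measurableT iJ; rewrite ltey_eq h.
Qed.

End FourierFubini.

(** * Fourier decay of the constructed eigenfunctions *)

Section EigenfunctionsInA.
Context {R : realType}.
Notation mu := (@lebesgue_measure R).
Implicit Types (v : R -> R[i]) (z : R[i]) (x k : R).

Lemma inXZ z v : inX v -> [/\ inX (fun x => z * v x),
  limr0 (fun x => z * v x) = z * limr0 v & liml0 (fun x => z * v x) = z * liml0 v].
Proof.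
move=> [/inL2P[mv iv] /inCdP[[M hM] v1 v2 v3]].
have [h1 h2 h3] : [/\ inCd (fun x => z * v x),
  limr0 (fun x => z * v x) = z * limr0 v & liml0 (fun x => z * v x) = z * liml0 v].
  apply: inCdI.
  - by exists (cmod z * M) => x x0; rewrite cmodM ler_wpM2l ?cmod_ge0 // hM.
  - by move=> x x0; apply: ccontM; [exact: ccont_cst|exact: v1].
  - by apply: ccvgM v2; exact: ccvg_cst.
  - by apply: ccvgM v3; exact: ccvg_cst.
split; [split; [|exact: h1]|exact: h2|exact: h3].
apply/inL2P; split; first by apply: cmeasM => //; exact: cmeas_cst.
have := integrableZl (mu := mu) measurableT (cmod z ^+ 2) iv.
by apply: eq_integrable => // x _; rewrite /= cmodM exprMn.
Qed.

Lemma JhZ z v x : inX v -> Jh (fun y => z * v y) x = z * Jh v x.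
Proof.
move=> hv; have [B B0 hB] := inX_bound hv.
have h2 : 0 < (2 : R) by [].
have i := @cintegrable_tail _ _ B 2 x (inX_cmeas hv) (fun y _ => hB y) h2.
rewrite /Jh -cintegralZ; [|exact: measurable_itv|exact: i].
by apply: eq_cintegral => y _; rewrite mulrCA.
Qed.

Lemma KhZ z v x : inX v -> Kh (fun y => z * v y) x = z * Kh v x.
Proof.
move=> hv; have [B B0 hB] := inX_bound hv.
have i := @cintegrable_Kh _ _ B x (inX_cmeas hv) hB.
by rewrite /Kh -cintegralZ; [|exact: measurable_itv|exact: i].
Qed.

Lemma couplingZ b z v : inX v -> coupling b (fun x => z * v x) = z * coupling b v.
Proof.
move=> hv; have [_ r1 r2] := inXZ z hv; have [ho _ _] := inX_opp hv.
rewrite /coupling r1 r2 (JhZ z 0 ho); move: (Jh _ _) (limr0 v) (liml0 v) (3 - b)%:C (3 - _)%:C => J l1 l2 a1 a2.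
by rewrite -mulrDr; ring.
Qed.

Lemma half_odeZ b (la ka : R[i]) z v : inX v -> half_ode b la ka v ->
  half_ode b la (z * ka) (fun x => z * v x).
Proof.
move=> hv ode x x0.
apply: cderiv_near (cderiv_eq (cderivZ z (ode x x0)) _); first by apply: filterE => y; rewrite mulrCA.
rewrite /hrhs (JhZ z x hv) (KhZ z x hv).
move: (Jh _ _) (Kh _ _) (v x) (la + _)%R (expR x)%:C (expR (- x))%:C (3 - _)%:C (b / 2)%:C => J K w a e1 e2 a1 a2.
ring.
Qed.

Lemma Lw_eigenfunctionZ b c (lambda : R[i]) z v : 0 < c -> z != 0 ->
  Lw_eigenfunction b c lambda v -> Lw_eigenfunction b c lambda (fun x => z * v x).
Proof.
move=> c0 z0 [hG hn]; have [hv hr o1 o2] := eigenfunction_halves c0 hG.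
have [hz _ _] := inXZ z hv; have [hlz _ _] := inXZ lambda hz; split.
  apply: half_ode_Lw_graph c0 hz hlz _ _.
  - by rewrite (couplingZ b z hv); exact: half_odeZ.
  - by rewrite (couplingZ b z hr); exact: half_odeZ.
move=> [N [mN N0 hN]]; apply: hn; exists N; split => // x hx; apply: hN => zv; apply: hx.
by move/eqP: zv; rewrite mulf_eq0 (negbTE z0) => /eqP.
Qed.

Lemma fourier_integral_halves (p : R -> R[i]) k : cintegrable setT p ->
  fourier_integral p k = half_fourier p k + half_fourier (fun x => p (- x)) (- k).
Proof.
move=> ip; pose h x := p x * osc (k * x).
have mp := cintegrable_cmeas ip.
have ih : cintegrable setT h.
  by apply: oscM_cintegrable => //; exact: cintegrable_cmod.
have mh := cintegrable_cmeas ih.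
have U : [set: R] = `]-oo, 0]%classic `|` `]0, +oo[%classic.
  by apply/seteqP; split => // x _ /=; rewrite !in_itv /= andbT; case: (leP x 0) => h0; [left|right].
have iho : cintegrable setT (fun x => h (- x)).
  have := cintegrable_opp measurableT mh ih.
  by have -> : [set x : R | [set: R] (- x)] = setT by apply/seteqP.
have iho0 : cintegrable `[0, +oo[ (fun x => h (- x)) by apply: cintegrableS iho.
have iho1 : cintegrable `]0, +oo[ (fun x => h (- x)) by apply: cintegrableS iho.
rewrite /fourier_integral -/h {1}U cintegral_setU //; last 2 first.
- by apply/disj_setPRL => x /=; rewrite !in_itv /= andbT ltNge => /negP.
- by rewrite -U.
rewrite addrC; congr (_ + _).
have -> : cintegral `]-oo, 0] h = cintegral `]-oo, (- 0)] (fun x => h (- - x)).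
  by rewrite oppr0; apply: eq_cintegral => x _; rewrite opprK.
rewrite (cintegral_oppy (f := fun x => h (- x))) //; last exact: cmeas_opp.
rewrite -cintegral_obnd_cbnd //.
by apply: eq_cintegral => x _; rewrite /h mulrN mulNr.
Qed.

Section Perturbation.
Variables (s : R) (A a1 a2 : R[i]) (y y1 y2 p : R -> R[i]).
Hypotheses (s01 : 0 < s < 1).
Hypotheses (dy : forall x, 0 < x -> cderiv y x (y1 x))
           (dy1 : forall x, 0 < x -> cderiv y1 x (y2 x))
           (cy2 : forall x, 0 < x -> ccont y2 x).
Hypothesis yC : forall eta, 0 < eta < 1 -> exists2 C : R, 0 <= C & forall x, 0 < x ->
  [/\ cmod (y x) <= C * epow s (1 - eta) x,
  cmod (y1 x) <= C * epow s (- eta) x & cmod (y2 x) <= C * epow s (- 1 - eta) x].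
Hypothesis hp : inX p.
Hypothesis pr : forall x, 0 < x -> p x = A * (expR (- x))%:C + a1 * y x.
Hypothesis pl : forall x, 0 < x -> p (- x) = A * (expR (- x))%:C + a2 * y x.

Let y_le : exists2 C : R, 0 <= C & forall x, 0 < x -> cmod (y x) <= C * expR (- s * x).
Proof.
have h : 0 < (1 / 2 : R) < 1 by apply/andP; split; lra.
have [C C0 hC] := yC h; exists C => // x x0; have [h1 _ _] := hC x x0.
apply: le_trans h1 _; rewrite ler_wpM2l //.
have -> : expR (- s * x) = epow s 0 x by rewrite epowE mul0r expR0 mul1r.
by apply: epow_le => //; lra.
Qed.

Let p_le : exists2 C : R, 0 <= C & forall x, cmod (p x) <= C * expR (- s * `|x|).
Proof.
have [C C0 hC] := y_le; have /andP[s0 s1] := s01.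
pose D := cmod A + (cmod a1 + cmod a2) * C + cmod (p 0).
have D0 : 0 <= D by rewrite !addr_ge0 ?mulr_ge0 ?addr_ge0 ?cmod_ge0.
exists D => // x.
have key (a : R[i]) (t : R) : 0 < t -> cmod a <= cmod a1 + cmod a2 ->
    cmod (A * (expR (- t))%:C + a * y t) <= D * expR (- s * t).
  move=> t0 ha; have e0 := expR_gt0 (- s * t).
  apply: (@le_trans _ _ (cmod A * expR (- s * t) + (cmod a1 + cmod a2) * (C * expR (- s * t)))).
    apply: le_trans (cmodD _ _) _; apply: lerD.
      rewrite cmodM cmod_real ger0_norm ?expR_ge0 // ler_wpM2l ?cmod_ge0 // ler_expR.
      by rewrite mulNr lerN2 ler_piMl // ltW.
    by rewrite cmodM; apply: ler_pM; rewrite ?cmod_ge0 ?hC.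
  rewrite mulrA -mulrDl ler_wpM2r ?(ltW e0) // lerDl; exact: cmod_ge0.
have [x0|x0|->] := ltgtP x 0.
- have nx : 0 < - x by rewrite oppr_gt0.
  have := key a2 _ nx; rewrite -pl // opprK ltr0_norm //; apply.
  by rewrite lerDr cmod_ge0.
- by rewrite gtr0_norm // pr //; apply: key => //; rewrite lerDl cmod_ge0.
- rewrite normr0 mulr0 expR0 mulr1 lerDr !addr_ge0 ?mulr_ge0 ?addr_ge0 ?cmod_ge0 //.
Qed.

Let cintegrable_p : cintegrable setT p.
Proof.
have [C C0 hC] := p_le; have /andP[s0 _] := s01.
have i := integrableZl (mu := mu) measurableT C (integrable_exp_abs s0).
by apply: cintegrable_dom i _ => //; exact: inX_cmeas.
Qed.

Let half_sum (q : R -> R[i]) (a : R[i]) k :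
  (forall x, 0 < x -> q x = A * (expR (- x))%:C + a * y x) ->
  half_fourier q k = A * (1 - wave k)^-1 + a * half_fourier y k.
Proof.
move=> hq; have [C C0 hC] := y_le; have /andP[s0 s1] := s01.
have mE : cmeas `]0, +oo[ (fun x : R => (expR (- x))%:C).
  apply: cmeas_real; apply: measurable_funTS; apply: continuous_measurable_fun => x.
  exact: is_derive_cont (is_derive_expN x).
have tl t : 0 < t -> mu.-integrable `]0, +oo[ (EFin \o (fun x => expR (- t * x))).
  move=> t0; apply: integrableS (integrable_tail_expM 0 t0) => //.
  by move=> x /=; rewrite !in_itv /= !andbT; exact: ltW.
have my : cmeas `]0, +oo[ y.
  apply: ccont_cmeas; first exact: interval_open.
  by move=> x; rewrite inE /= in_itv /= andbT => x0; exact: cderiv_cont (dy x0).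
have i1 : cintegrable `]0, +oo[ (fun x => (expR (- x))%:C * osc (k * x)).
  apply: oscM_cintegrable => //; apply: eq_integrable (tl 1 ltr01) => // x _.
  by rewrite /= cmod_real ger0_norm ?expR_ge0 // mulN1r.
have i2 : cintegrable `]0, +oo[ (fun x => y x * osc (k * x)).
  apply: oscM_cintegrable => //.
  have ic := integrableZl (mu := mu) (measurable_itv _) C (tl s s0).
  have mc := cmeas_cmod (measurable_itv _) my.
  apply: le_integrable ic => //; first exact/measurable_EFinP.
  move=> x; rewrite /= in_itv /= andbT => x0; rewrite lee_fin ger0_norm ?cmod_ge0 //.
  exact: le_trans (hC x x0) (ler_norm _).
have j1 := cintegrableZ A (measurable_itv _) i1; have j2 := cintegrableZ a (measurable_itv _) i2.
have -> : half_fourier q k = cintegral `]0, +oo[ (fun x => A * ((expR (- x))%:C * osc (k * x)) + a * (y x * osc (k * x))).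
  by apply: eq_cintegral => x; rewrite inE /= in_itv /= andbT => x0; rewrite hq // mulrDl !mulrA.
rewrite cintegralD; [|exact: measurable_itv|exact: j1|exact: j2].
rewrite cintegralZ; [|exact: measurable_itv|exact: i1].
rewrite cintegralZ; [|exact: measurable_itv|exact: i2].
by rewrite -half_fourier_exp.
Qed.

Let peakon_fourier k : (1 - wave k)^-1 + (1 - wave (- k))^-1 = (2 / (1 + k ^+ 2))%:C.
Proof.
have p0 : 0 < 1 + k ^+ 2 by have := sqr_ge0 k; lra.
have w2 : (1 - wave k) * (1 - wave (- k)) = (1 + k ^+ 2)%:C.
  by apply: complexP; rewrite !ReImE /=; ring.
have ws : (1 - wave k) + (1 - wave (- k)) = (2 : R)%:C.
  by apply: complexP; rewrite !ReImE /=; ring.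
have pn : (1 + k ^+ 2)%:C != 0 :> R[i] by rewrite -realc0 (inj_eq (@complexI _)) gt_eqF.
have /andP[n1 n2] : (1 - wave k != 0) && (1 - wave (- k) != 0).
  by rewrite -negb_or -mulf_eq0 w2.
rewrite rmorphM fmorphV /= -ws -w2.
move: n1 n2; move: (1 - wave k) (1 - wave (- k)) => u w n1 n2.
by field; apply/andP.
Qed.

(** The common coefficient [A] on both sides expresses the continuity of [p] at the origin. Each
    one-sided exponential has a transform of order $1/|k|$ only, but with equal coefficients they
    add up to $2A/(1+k^2)$; the terms in [y] vanish at 0 and decay by [half_fourier_decay]. *)
Lemma inHs_perturbation t : t < 3 / 2 -> inHs t p.
Proof.
apply: inHs_of_decay; [by case: hp|exact: cintegrable_p|].
move=> eta eta01; have [C C0 hC] := yC eta01; have /andP[e0 e1] := eta01; have /andP[s0 s1] := s01.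
have [M M0 hM] := half_fourier_decay s0 eta01 C0 dy dy1 cy2 hC.
exists (2 * cmod A + (cmod a1 + cmod a2) * M).
  by rewrite addr_ge0 ?mulr_ge0 ?addr_ge0 ?cmod_ge0.
move=> k k1; rewrite (fourier_integral_halves k cintegrable_p) (half_sum k pr) (half_sum (- k) pl).
have -> : A * (1 - wave k)^-1 + a1 * half_fourier y k + (A * (1 - wave (- k))^-1 + a2 * half_fourier y (- k)) =
  A * ((1 - wave k)^-1 + (1 - wave (- k))^-1) + (a1 * half_fourier y k + a2 * half_fourier y (- k)) by ring.
rewrite peakon_fourier; have hk := hM k k1.
have hnk := hM (- k); rewrite normrN in hnk; have {}hnk := hnk k1.
have k0 : 0 < `|k| by apply: lt_le_trans k1.
set Q := `|k| `^ eta / `|k| ^+ 2 in hk hnk *.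
rewrite [leRHS](mulrDl _ _ Q); apply: le_trans (cmodD _ _) _; apply: lerD.
  have p0 : 0 < 1 + k ^+ 2 by have := sqr_ge0 k; lra.
  have K2 : 0 < `|k| ^+ 2 by rewrite exprn_gt0.
  have h : 2 / (1 + k ^+ 2) <= 2 * Q.
    rewrite ler_wpM2l //; apply: (@le_trans _ _ (1 / `|k| ^+ 2)).
      by rewrite div1r lef_pV2 ?posrE // real_normK ?num_real // lerDr.
    rewrite ler_pM2r ?invr_gt0 //.
    by have := ler_powR k1 (ltW e0); rewrite powRr0.
  rewrite cmodM cmod_real ger0_norm; last by rewrite divr_ge0 // ltW.
  by have := ler_wpM2l (cmod_ge0 A) h; lra.
apply: le_trans (cmodD _ _) _; rewrite !cmodM.
by have := lerD (ler_wpM2l (cmod_ge0 a1) hk) (ler_wpM2l (cmod_ge0 a2) hnk); lra.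
Qed.

End Perturbation.

(** Green's identity with $g=e^{-x}(1-e^{-x})$, for which $g-g''=3e^{-2x}$: from $y''=y-m$ one gets
    $3\int e^{-2x}y=\int gm$, the Beta integral shown not to vanish. As $g(0)=0$, the boundary term
    in $y'$ disappears although $y'$ may be unbounded. *)
Lemma particular_mass_neq0 b (la : R[i]) (s C : R) (y y1 : R -> R[i]) : 0 < Re la -> Re la + b <= 1 ->
  0 < s -> 0 <= C ->
  (forall x, 0 < x -> cderiv y x (y1 x)) ->
  (forall x, 0 < x -> cderiv y1 x (y x - mexp b (- la) x)) ->
  (forall x, 0 < x -> cmod (y x) <= C * epow s (1 / 2) x /\ cmod (y1 x) <= C * epow s (- (1 / 2)) x) ->
  Jh (glue_halves y (fun=> 0)) 0 != 0.
Proof.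
move=> l0 lb s0 C0 dy dy1 hC.
pose g x : R := expR (- x) * (1 - expR (- x)).
pose g1 x : R := 2 * expR (- 2 * x) - expR (- x).
have eM x : expR (- 2 * x) = expR (- x) * expR (- x) by rewrite -expRD; congr expR; ring.
have gE x : 0 < x -> g x = epow 1 1 x.
  by move=> x0; rewrite /g -(epow01 x0) -(epow10 x) epowM addr0 add0r.
have dg x : is_derive x (1 : R) g (g1 x).
  apply: is_derive_eq (is_deriveM (is_derive_expN x) (is_derive_onem_exp x)) _.
  by rewrite /GRing.scale /= /g1 eM; ring.
have dg1 x : is_derive x (1 : R) g1 (expR (- x) - 4 * expR (- 2 * x)).
  have d1 : is_derive x (1 : R) (fun y : R => 2 * expR (- 2 * y)) (- 4 * expR (- 2 * x)).
    by apply: is_derive_eq (is_deriveM (is_derive_cst (2 : R) x (1 : R)) (is_derive_expM (- 2) x)) _;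
      rewrite /GRing.scale /=; ring.
  by apply: is_derive_eq (is_deriveB d1 (is_derive_expN x)) _; ring.
pose m := mexp b (- la).
pose H x := (g x)%:C * y1 x - (g1 x)%:C * y x.
pose h x := 3%:R * ((expR (- 2 * x))%:C * y x) - beta_kernel b la 1 1 x.
have dH x : 0 < x -> cderiv H x (h x).
  move=> x0; apply: cderiv_eq (cderivB (cderivM (cderiv_real (dg x)) (dy1 x x0)) (cderivM (cderiv_real (dg1 x)) (dy x x0))) _.
  rewrite /h /beta_kernel -gE // /g eM.
  move: (expR (- x)) (mexp _ _ _) (y x) (y1 x) (g1 x) => e M u u1 G1; rewrite !realcE; ring.
have cy x : 0 < x -> ccont y x by move=> x0; exact: cderiv_cont (dy x x0).
have iy : cintegrable `]0, +oo[ (fun x => (expR (- 2 * x))%:C * y x).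
  have i2 : mu.-integrable `]0, +oo[ (EFin \o (fun x => expR (- 2 * x))).
    apply: integrableS (integrable_tail_expM 0 (ltr0Sn R 1)) => //.
    by move=> x /=; rewrite !in_itv /= !andbT; exact: ltW.
  apply: cintegrable_dom (integrableZl (mu := mu) (measurable_itv _) C i2) _ => //.
    apply: ccont_cmeas; first exact: interval_open.
    move=> x; rewrite inE /= in_itv /= andbT => x0; apply: ccontM; last exact: cy.
    by apply: ccont_real; exact: continuous_expM.
  move=> x; rewrite /= in_itv /= andbT => x0; have [h1 _] := hC x x0.
  rewrite cmodM cmod_real ger0_norm ?expR_ge0 // mulrC ler_wpM2r ?expR_ge0 //.
  apply: le_trans h1 _; rewrite ler_piMr //; apply: (@le_trans _ _ (epow 0 0 x)); last by rewrite epow00.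
  by apply: epow_le => //; lra.
have im : cintegrable `]0, +oo[ (beta_kernel b la 1 1) by apply: beta_kernel_integrable.
have i3 := cintegrableZ 3%:R (measurable_itv _) iy.
have HC x : 0 < x -> cmod (H x) <= (4 * C) * epow s (1 / 2) x.
  move=> x0; have [h1 h2] := hC x x0; have d0 := onem_exp_gt0 x0.
  have e0 := expR_gt0 (- x); have e1 : expR (- x) <= 1 by rewrite expR_le1 oppr_le0 ltW.
  apply: le_trans (cmodB _ _) _.
  have -> : 4 * C * epow s (1 / 2) x = C * epow s (1 / 2) x + 3 * (C * epow s (1 / 2) x) by ring.
  rewrite !cmodM !cmod_real; apply: lerD.
    rewrite ger0_norm; last by rewrite /g mulr_ge0 // ltW.
    apply: le_trans (ler_wpM2l _ h2) _; first by rewrite /g mulr_ge0 // ltW.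
    rewrite gE // mulrCA ler_wpM2l // epowM; apply: epow_le => //; lra.
  apply: ler_pM; rewrite ?cmod_ge0 //; rewrite /g1 eM.
  apply: le_trans (ler_normB _ _) _; rewrite !ger0_norm ?mulr_ge0 ?(ltW e0) //; nra.
have lim (F : set_system R) (FF : Filter F) : (\forall x \near F, 0 < x) ->
    epow s (1 / 2) x @[x --> F] --> (0 : R) -> ccvg F H 0.
  move=> F0 lF; have lG : (4 * C) * epow s (1 / 2) x @[x --> F] --> (0 : R).
    by rewrite -(mulr0 (4 * C)); apply: cvgMr.
  by apply: ccvg0_le lG; near=> x; apply: HC; near: x.
have E : cintegral `]0, +oo[ h = 0 - 0.
  apply: (@cintegral_oy_derivative _ H).
  - exact: dH.
  - move=> x x0; apply: ccontB.
      apply: ccontM; first exact: ccont_cst.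
      by apply: ccontM; [apply: ccont_real; exact: continuous_expM|exact: cy].
    apply: ccontM; last exact: cderiv_cont (cderiv_mexp _ _ x0).
    by apply: ccont_real; exact: is_derive_cont (is_derive_epow 1 1 x0).
  - exact: cintegrableB (measurable_itv _) i3 im.
  - by apply: lim; [exact: nbhs_right_gt|apply: cvg_epow_at0; lra].
  - by apply: lim; [apply: nbhs_pinfty_gt; exact: num_real|exact: cvg_epow_pinfty].
rewrite subrr /h cintegralB in E; [|exact: measurable_itv|exact: i3|exact: im].
rewrite cintegralZ in E; [|exact: measurable_itv|exact: iy].
have JE : Jh (glue_halves y (fun=> 0)) 0 = cintegral `]0, +oo[ (fun x => (expR (- 2 * x))%:C * y x).
  have iJ : cintegrable `]0, +oo[ (fun x => (expR (- 2 * x))%:C * glue_halves y (fun=> 0) x).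
    apply: eq_cintegrable iy => //.
    by move=> x; rewrite inE /= in_itv /= andbT => x0; rewrite glue_pos.
  rewrite /Jh -cintegral_obnd_cbnd //; apply: eq_cintegral => x; rewrite inE /= in_itv /= andbT => x0.
  by rewrite glue_pos.
apply/eqP => J0; rewrite JE in J0; rewrite J0 mulr0 sub0r in E.
have := mexp_moment_neq0 l0 lb.
by move/eqP: E; rewrite oppr_eq0 => ->.
Unshelve. all: by end_near. Qed.

End EigenfunctionsInA.

(** * The point spectrum with eigenfunctions in A *)

Section SpectrumInA.
Context {R : realType}.
Notation mu := (@lebesgue_measure R).
Implicit Types (v : R -> R[i]) (z : R[i]) (x k : R).

Lemma setA_intro (c : R) (v p : R -> R[i]) : (forall s : R, s < 3 / 2 -> inHs s p) ->
  (forall x, v x = (du0 c x)%:C + p x) -> setA c v.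
Proof. move=> hp hv; exists p; split; first exact: hp.
exists set0; split; [exact: measurable0|exact: measure0|by move=> x /= h; apply: h; exact: hv]. Qed.

Lemma du0_pos (c x : R) : 0 < x -> du0 c x = - c * expR (- x).
Proof. by move=> x0; rewrite /du0 gtr0_sg // mulr1 gtr0_norm. Qed.

Lemma du0_neg (c x : R) : 0 < x -> du0 c (- x) = c * expR (- x).
Proof.
by move=> x0; rewrite /du0 ltr0_sg ?oppr_lt0 // mulrN1 opprK normrN gtr0_norm.
Qed.

(** The constructed function has jump $2\kappa$ at the origin; the factor $-c/\kappa$ turns it into
    $-2c$, the jump of $u_0'$, and both one-sided limits of the difference equal $-c\lambda$.
    Reflection with a change of sign preserves this jump and serves the opposite eigenvalue. *)
Lemma eigenfunction_in_A_pos (b c : R) (la : R[i]) : 0 < c -> b < 1 -> 0 < Re la <= 1 - b ->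
  exists v, [/\ Lw_eigenfunction b c (c%:C * la) v, setA c v & setA c (fun x => - v (- x))].
Proof.
move=> c0 b1 /andP[l0 lb].
have l2 : 0 < Re la < 2 - b by rewrite l0 /=; lra.
have [kap [y [y1 [v [[dy dy1 yC] kapE vr vl ev]]]]] := eigenfunction_exists_pos c0 l2.
move: yC; set s := Num.min (Re la) (1 / 2) => yC.
have s0 : 0 < s by rewrite lt_min l0 divr_gt0.
have s01 : 0 < s < 1.
  by rewrite s0 /= gt_min; apply/orP; right; lra.
have sl : s <= Re la by rewrite ge_min lexx.
have kap0 : kap != 0.
  have h12 : 0 < (1 / 2 : R) < 1 by apply/andP; split; lra.
  have [C C0 hC] := yC (1 / 2) h12 ltac:(lra).
  have e12 : 1 - 1 / 2 = 1 / 2 :> R by field.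
  have J0 : Jh (glue_halves y (fun=> 0)) 0 != 0.
    apply: (@particular_mass_neq0 _ b la s C y y1) => //; first by lra.
    by move=> x /hC; rewrite e12.
  apply/eqP => k0; move: kapE; rewrite k0 mul0r => /esym/eqP.
  rewrite mulf_eq0 (negbTE J0) orbF oppr_eq0 -realc0 (inj_eq (@complexI _)) => /eqP h3.
  by lra.
pose z := - c%:C / kap.
have zk : z * kap = - c%:C by rewrite /z divfK.
have z0 : z != 0.
  by rewrite mulf_neq0 ?invr_eq0 // oppr_eq0 -realc0 (inj_eq (@complexI _)) gt_eqF.
pose w x := z * v x.
have ew : Lw_eigenfunction b c (c%:C * la) w by exact: Lw_eigenfunctionZ.
have wr x : 0 < x -> w x = - c%:C * (la + 1) * (expR (- x))%:C.
  by move=> x0; rewrite /w vr // !mulrA zk.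
have wl x : 0 < x -> w (- x) = - c%:C * (la - 1) * (expR (- x))%:C + z * y x.
  by move=> x0; rewrite /w vl // mulrDr !mulrA zk.
have [[hw _ _] _] := ew.
have [[hd _ _] _] := @eigenfunction_du0 R b c c0.
pose y2 x := y x - mexp b (- la) x.
have cy2 x : 0 < x -> ccont y2 x.
  by move=> x0; apply: ccontB; [exact: cderiv_cont (dy x x0)|exact: cderiv_cont (cderiv_mexp _ _ x0)].
(* Here $\mathrm{Re}\,\lambda+b\le1$ makes every [eta] in $(0,1)$ admissible, which is the
   arbitrarily small loss required by [inHs_perturbation]. *)
have yC2 eta : 0 < eta < 1 -> exists2 C : R, 0 <= C & forall x, 0 < x ->
    [/\ cmod (y x) <= C * epow s (1 - eta) x,
    cmod (y1 x) <= C * epow s (- eta) x & cmod (y2 x) <= C * epow s (- 1 - eta) x].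
  move=> eta01; have /andP[e0 e1] := eta01.
  have [C C0 hC] := yC eta eta01 ltac:(lra).
  exists (C + 1); first by rewrite addr_ge0.
  move=> x x0; have [h1 h2] := hC x x0; split.
  - by apply: le_trans h1 _; rewrite ler_wpM2r ?epow_ge0 // lerDl.
  - by apply: le_trans h2 _; rewrite ler_wpM2r ?epow_ge0 // lerDl.
  - apply: le_trans (cmodB _ _) _; rewrite mulrDl mul1r; apply: lerD.
      by apply: le_trans h1 _; rewrite ler_wpM2l //; apply: epow_le => //; lra.
    by rewrite cmod_mexp_epow cReN opprK; apply: epow_le => //; lra.
have P := inHs_perturbation s01 dy dy1 cy2 yC2.
exists w; split; first exact: ew.
- pose p x := w x - (du0 c x)%:C.
  have [hp _ _] := inXB hw hd.
  apply: (@setA_intro c w p); last by move=> x; rewrite /p addrC subrK.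
  apply: (P (- c%:C * la) 0 z p hp) => x x0; rewrite /p.
  - by rewrite wr // du0_pos // !realcE; ring.
  - by rewrite wl // du0_neg // !realcE; ring.
- pose p x := - w (- x) - (du0 c x)%:C.
  have [ho _ _] := inX_opp hw; have [hn _ _] := inXZ (-1) ho.
  have {}hn : inX (fun x => - w (- x)).
    by have -> : (fun x => - w (- x)) = (fun x => -1 * w (- x)) by apply/funext => x; rewrite mulN1r.
  have [hp _ _] := inXB hn hd.
  apply: (@setA_intro c _ p); last by move=> x; rewrite /p addrC subrK.
  apply: (P (c%:C * la) (- z) 0 p hp) => x x0; rewrite /p.
  - by rewrite wl // du0_pos // !realcE; ring.
  - by rewrite opprK wr // du0_neg // !realcE; ring.
Qed.

Lemma inHs0 (s : R) : s < 3 / 2 -> inHs s (fun=> 0 : R[i]).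
Proof.
have i0 : mu.-integrable setT (EFin \o (fun=> 0 : R)) by exact: integrable0.
apply: inHs_of_decay.
- apply/inL2P; split; first exact: cmeas_cst.
  by apply: eq_integrable i0 => // x _; rewrite /= cmod0 expr0n.
- exact: (cintegrable_real i0 measurableT).
move=> eta _; exists 0 => // k _; rewrite mul0r.
have -> : fourier_integral (fun=> 0 : R[i]) k = 0.
  rewrite /fourier_integral (_ : (fun x => 0 * osc (k * x)) = fun=> 0); last by apply/funext => x; rewrite mul0r.
  by apply: complexP; rewrite /= /Rintegral integral0.
by rewrite cmod0.
Qed.

Lemma Lw_point_spectrum_in_AE (b c : R) : 0 < c -> b < 1 -> Lw_point_spectrum_in_A b c =
  [set lambda : R[i] | lambda = 0 \/ 0 < `|Re lambda| <= c * (1 - b)].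
Proof.
move=> c0 b1; apply/seteqP; split => lambda /=; first by move=> [v [ev hA]]; exact: eigenvalue_in_A ev hA.
case=> [->|hl].
  exists (fun x => (du0 c x)%:C); split; first exact: eigenfunction_du0.
  by apply: (@setA_intro c _ (fun=> 0)) => [s|x]; [exact: inHs0|rewrite addr0].
have cn : (c%:C : R[i]) != 0 by rewrite -realc0 (inj_eq (@complexI _)) gt_eqF.
have pos (l : R[i]) : 0 < Re l <= c * (1 - b) ->
    exists v, [/\ Lw_eigenfunction b c l v, setA c v & setA c (fun x => - v (- x))].
  move=> /andP[h1 h2]; have [|v] := @eigenfunction_in_A_pos b c (l / c%:C) c0 b1.
    by rewrite Re_divc divr_gt0 //= ler_pdivrMr // mulrC.
  by rewrite mulrC divfK // => hv; exists v.
have [l0|l0] := leP 0 (Re lambda).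
  have [|v [ev hA _]] := pos lambda; first by rewrite ger0_norm in hl.
  by exists v.
have [|v [ev _ hA]] := pos (- lambda); first by rewrite cReN; rewrite ltr0_norm in hl.
exists (fun x => - v (- x)); split; last exact: hA.
have n1 : (-1 : R[i]) != 0 by rewrite oppr_eq0 oner_eq0.
have := Lw_eigenfunctionZ c0 n1 (Lw_eigenfunction_opp c0 ev); rewrite opprK.
by have -> : (fun x => -1 * v (- x)) = (fun x => - v (- x)) by apply/funext => x; rewrite mulN1r.
Qed.

End SpectrumInA.

Theorem theorem2p1 (R : realType) (b c : R) (hc : 0 < c) :
  [/\ closed_graph (Lw_graph b c),
      Lw_point_spectrum b c =
        [set lambda : R[i] | lambda = 0 \/
           (b < 2 /\ 0 < `|complex.Re lambda| < c * (2 - b))] &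
      b < 1 ->
      Lw_point_spectrum_in_A b c =
        [set lambda : R[i] | lambda = 0 \/
           0 < `|complex.Re lambda| <= c * (1 - b)]].
Proof.
split; first exact: closed_graph_Lw.
- exact: Lw_point_spectrumE.
- by move=> b1; exact: Lw_point_spectrum_in_AE.
Qed.
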